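(* Let $r\in\mathbb{N}$ and $m\in\mathbb{N}_0$ with $m\ge r-1$. Let $a\in(l_0(\mathbb{Z}))^{r\times r}$ be such that $1$ is a simple eigenvalue of $\widehat{a}(0)$ and $2^k$ is not an eigenvalue of $\widehat{a}(0)$ for every $k\in\mathbb{N}$. Let $\upsilon_a\in(l_0(\mathbb{Z}))^{1\times r}$ be an order $r$ matching filter of $a$ such that the first nonzero entry of $\widehat{\upsilon_a}(0)$ is $1$. Let $\phi$ be a vector of compactly supported distributions satisfying $\widehat{\phi}(2\xi)=\widehat{a}(\xi)\widehat{\phi}(\xi)$ and $\widehat{\upsilon_a}(0)\widehat{\phi}(0)=1$. (1) If the Hermite subdivision scheme of order $r$ with mask $a$ is convergent with limiting functions in $C^m(\mathbb{R})$, then $\operatorname{sm}_\infty(a)>0$, $\operatorname{sm}_\infty(\phi)>m$, and the matching filter $\upsilon_a$ must satisfy $$\widehat{\upsilon_a}(\xi)=[1+O(|\xi|),\,i\xi+O(|\xi|^2),\,\ldots,\,(i\xi)^{r-1}+O(|\xi|^r)],\quad\xi\to0.\qquad( * )$$ (2) If $\operatorname{sm}_\infty(a)>r-1$, $\operatorname{sm}_\infty(\phi)>m$ and the matching filter $\upsilon_a$ satisfies $( * )$, then the Hermite subdivision scheme of order $r$ with mask $a$ is convergent with limiting functions in $C^m(\mathbb{R})$.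
   Context: Notation. $\mathbb{N}_0=\mathbb{N}\cup\{0\}$. $(l(\mathbb{Z}))^{s\times r}$ is the space of all sequences $\mathbb{Z}\to\mathbb{C}^{s\times r}$, and $(l_0(\mathbb{Z}))^{s\times r}$ its subspace of finitely supported sequences; $(l_0(\mathbb{Z}))^r:=(l_0(\mathbb{Z}))^{r\times1}$; $\|\cdot\|_{(l_\infty(\mathbb{Z}))^r}$ is the sup norm. $\boldsymbol{\delta}$ is the Dirac sequence ($\boldsymbol{\delta}(0)=1$, $\boldsymbol{\delta}(k)=0$ for $k\neq0$); $I_r$ is the identity matrix; $e_\ell$ is the $\ell$-th unit coordinate column vector in $\mathbb{R}^r$. Convolution: $[u*v](j)=\sum_{k}u(j-k)v(k)$. Symbol: $\widehat{u}(\xi):=\sum_{k\in\mathbb{Z}}u(k)e^{-ik\xi}$. Fourier transform: $\widehat{f}(\xi)=\int_{\mathbb{R}}f(x)e^{-ix\xi}dx$, extended to tempered distributions. $\widehat f(\xi)=\widehat g(\xi)+O(|\xi|^{k})$, $\xi\to0$, means $\widehat f^{(j)}(0)=\widehat g^{(j)}(0)$ for $j=0,\dots,k-1$. Subdivision operator: $(\mathcal{S}_av)(j):=2\sum_{k\in\mathbb{Z}}v(k)a(j-2k)$ for $v\in(l(\mathbb{Z}))^{s\times r}$, $j\in\mathbb{Z}$. Matching filter: $\upsilon_a\in(l_0(\mathbb{Z}))^{1\times r}$ is an order $k$ matching filter of $a$ if $\widehat{\upsilon_a}(0)\neq0$ and $\widehat{\upsilon_a}(2\xi)\widehat{a}(\xi)=\widehat{\upsilon_a}(\xi)+O(|\xi|^{k})$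 as $\xi\to0$. Hermite subdivision scheme: for $m\ge r-1$, the Hermite subdivision scheme of order $r$ with mask $a$ is convergent with limiting functions in $C^m(\mathbb{R})$ if for any $w_0\in(l(\mathbb{Z}))^{1\times r}$ there exists a scalar function $\eta\in C^m(\mathbb{R})$ ($m$ times continuously differentiable) such that for every constant $K>0$, $\lim_{n\to\infty}\sup_{k\in\mathbb{Z}\cap[-2^nK,2^nK]}|(\mathcal{S}_a^nw_0)(k)2^{(\ell-1)n}e_\ell-\eta^{(\ell-1)}(2^{-n}k)|=0$ for $\ell=1,\ldots,r$. Quantity $\operatorname{sm}_\infty(a)$: $a$ has order $k$ sum rules with a matching filter $v\in(l_0(\mathbb{Z}))^{1\times r}$ if $\widehat{v}(0)\neq0$, $\widehat{v}(2\xi)\widehat{a}(\xi)=\widehat{v}(\xi)+O(|\xi|^{k})$ and $\widehat{v}(2\xi)\widehat{a}(\xi+\pi)=O(|\xi|^{k})$ as $\xi\to0$. Let $\operatorname{sr}(a)$ be the largest $k\in\mathbb{N}_0$ such that $a$ has order $k$ sum rules with some matching filter, and let $v$ be such a filter for $k=\operatorname{sr}(a)$. With $\mathscr{V}_{j-1,v}:=\{u\in(l_0(\mathbb{Z}))^r:\widehat{v}(\xi)\widehat{u}(\xi)=O(|\xi|^{j}),\ \xi\to0\}$ (so $\mathscr{V}_{-1,v}=(l_0(\mathbb{Z}))^r$), put $\rho_j(a,v)_\infty:=\sup\{\limsup_{n\to\infty}\|(\mathcal{S}_a^n(\boldsymbol{\delta}I_r))*u\|_{(l_\infty(\mathbb{Z}))^r}^{1/n}:u\in\mathscr{V}_{j-1,v}\}$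 and $\operatorname{sm}_\infty(a):=-\log_2\rho_{\operatorname{sr}(a)}(a,v)_\infty$ (the value does not depend on the choice of $v$). Smoothness exponent of a function: for $f\in L_\infty(\mathbb{R})$, $\operatorname{sm}_\infty(f)$ is the supremum of $n+\tau$ with $n\in\mathbb{N}_0$, $0\le\tau<1$ such that $f\in W^n_\infty(\mathbb{R})$ (i.e. $f,\dots,f^{(n-1)}$ are absolutely continuous functions in $L_\infty(\mathbb{R})$ and $f^{(n)}\in L_\infty(\mathbb{R})$) and $f^{(n)}\in\operatorname{Lip}(\tau,L_\infty)$, meaning there is $C>0$ with $\|f^{(n)}-f^{(n)}(\cdot-t)\|_{L_\infty(\mathbb{R})}\le C|t|^\tau$ for all $t\in\mathbb{R}$. For a vector $\phi=[\phi_1,\dots,\phi_r]^{\mathsf T}$, $\operatorname{sm}_\infty(\phi):=\min_\ell\operatorname{sm}_\infty(\phi_\ell)$; the condition $\operatorname{sm}_\infty(\phi)>m$ includes that every entry of $\phi$ is in $L_\infty(\mathbb{R})$. *)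

(* Defs.v *)
From HB Require Import structures.
From mathcomp Require Import all_boot all_order all_algebra.
From mathcomp Require Import all_classical all_reals all_analysis.
From mathcomp Require Export complex.

Set Implicit Arguments.
Unset Strict Implicit.
Unset Printing Implicit Defensive.

Import Order.TTheory GRing.Theory Num.Theory.
Import numFieldNormedType.Exports.
Import Normc.

Local Open Scope classical_set_scope.
Local Open Scope ring_scope.
Local Open Scope complex_scope.

(** * Complex-valued functions of a real variable *)

(* [R[i]] carries no topology over [R], so continuity, derivatives,
   measurability and integrals of a function [R -> R[i]] are taken on its real
   and imaginary parts. *)

Definition re_fun (T : Type) (R : rcfType) (f : T -> R[i]) : T -> R :=
  fun x => complex.Re (f x).

Definition im_fun (T : Type) (R : rcfType) (f : T -> R[i]) : T -> R :=
  fun x => complex.Im (f x).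

Definition cderivn (R : realType) (n : nat) (f : R -> R[i]) : R -> R[i] :=
  fun x => derive1n n (re_fun f) x +i* derive1n n (im_fun f) x.

Definition cderivable (R : realType) (f : R -> R[i]) (x : R) : Prop :=
  derivable (re_fun f) x 1 /\ derivable (im_fun f) x 1.

Definition ccontinuous (R : realType) (f : R -> R[i]) : Prop :=
  continuous (re_fun f) /\ continuous (im_fun f).

Definition cont_diff (R : realType) (m : nat) (f : R -> R[i]) : Prop :=
  (forall k, (k < m)%N -> forall x, cderivable (cderivn k f) x) /\
  (forall k, (k <= m)%N -> ccontinuous (cderivn k f)).

Definition smooth (R : realType) (f : R -> R[i]) : Prop :=
  forall m, cont_diff m f.

Definition expi (R : realType) (t : R) : R[i] := cos t +i* sin t.

(* [mxeqO k F G] is F(xi) = G(xi) + O(|xi|^k) as xi -> 0, in the sense that the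
   derivatives of orders 0, ..., k-1 at 0 agree. *)
Definition ceqO (R : realType) (k : nat) (f g : R -> R[i]) : Prop :=
  forall j, (j < k)%N -> cderivn j f 0 = cderivn j g 0.

Definition mxeqO (R : realType) (k s r : nat)
    (F G : R -> 'M[R[i]]_(s, r)) : Prop :=
  forall p q, ceqO k (fun xi => F xi p q) (fun xi => G xi p q).

(** * Matrix sequences *)

(* An element of (l(Z))^{s x r} is a function [int -> 'M[R[i]]_(s, r)].  In the
   sums over [int] below only finitely many terms are nonzero as soon as one of
   the sequences involved is finitely supported. *)

Definition finitely_supported (R : realType) (s r : nat)
    (u : int -> 'M[R[i]]_(s, r)) : Prop :=
  finite_set [set k | u k != 0].

Definition symbol (R : realType) (s r : nat) (u : int -> 'M[R[i]]_(s, r))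
    (xi : R) : 'M[R[i]]_(s, r) :=
  \sum_(k \in [set: int]) expi (- (k%:~R * xi)) *: u k.

Definition convolution (R : realType) (s r q : nat)
    (u : int -> 'M[R[i]]_(s, r)) (v : int -> 'M[R[i]]_(r, q)) (j : int) :
    'M[R[i]]_(s, q) :=
  \sum_(k \in [set: int]) u (j - k) *m v k.

Definition dirac_mx (R : realType) (r : nat) (k : int) : 'M[R[i]]_r :=
  if k == 0 then 1%:M else 0.

Definition subdivision (R : realType) (s r : nat) (a : int -> 'M[R[i]]_r)
    (v : int -> 'M[R[i]]_(s, r)) (j : int) : 'M[R[i]]_(s, r) :=
  2 *: \sum_(k \in [set: int]) v k *m a (j - 2 * k).

Definition supnorm (R : realType) (r : nat) (u : int -> 'cV[R[i]]_r) : \bar R :=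
  ereal_sup [set (normc (u p.1 p.2 0))%:E | p in [set: int * 'I_r]].

Definition simple_eigenvalue (R : realType) (r : nat) (A : 'M[R[i]]_r)
    (z : R[i]) : Prop :=
  eigenvalue A z /\ mup z (char_poly A) = 1%N.

(** * Matching filters and sum rules *)

Definition matching_filter (R : realType) (r k : nat) (a : int -> 'M[R[i]]_r)
    (v : int -> 'rV[R[i]]_r) : Prop :=
  [/\ finitely_supported v, symbol v 0 <> 0 &
      mxeqO k (fun xi => symbol v (2 * xi) *m symbol a xi) (symbol v)].

Definition sum_rules (R : realType) (r k : nat) (a : int -> 'M[R[i]]_r)
    (v : int -> 'rV[R[i]]_r) : Prop :=
  matching_filter k a v /\
  mxeqO k (fun xi => symbol v (2 * xi) *m symbol a (xi + pi)) (fun=> 0).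

(* If no largest order exists, [sr a] takes the default value 0. *)
Definition sr (R : realType) (r : nat) (a : int -> 'M[R[i]]_r) : nat :=
  xget 0%N [set k | (exists v, sum_rules k a v) /\
                    forall k', (exists v, sum_rules k' a v) -> (k' <= k)%N].

(* A filter attaining [sr a], selected by the choice operator. *)
Definition sr_filter (R : realType) (r : nat) (a : int -> 'M[R[i]]_r) :
    int -> 'rV[R[i]]_r :=
  xget (fun=> 0) [set v | sum_rules (sr a) a v].

(* The space V_{j-1,v}: the index [j] is the order of vanishing. *)
Definition vanishing_space (R : realType) (r : nat) (v : int -> 'rV[R[i]]_r)
    (j : nat) : set (int -> 'cV[R[i]]_r) :=
  [set u | finitely_supported u /\
           mxeqO j (fun xi => symbol v xi *m symbol u xi) (fun=> 0)].

Definition rho_infty (R : realType) (r j : nat) (a : int -> 'M[R[i]]_r)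
    (v : int -> 'rV[R[i]]_r) : \bar R :=
  ereal_sup
    [set limn_esup (fun n : nat =>
           poweR (supnorm (convolution (iter n (subdivision a) (@dirac_mx R r))
                                       u))
                 n%:R^-1)
    | u in vanishing_space v j].

(* Extended-valued: equal to +oo when rho is 0. *)
Definition sm_mask (R : realType) (r : nat) (a : int -> 'M[R[i]]_r) : \bar R :=
  (- (lne (rho_infty (sr a) a (sr_filter a)) * ((ln 2)^-1)%:E))%E.

(** * Hermite subdivision schemes *)

(* The index [l : 'I_r] starts at 0, so it plays the role of l-1. *)
Definition hermite_convergent (R : realType) (r m : nat)
    (a : int -> 'M[R[i]]_r) : Prop :=
  forall w0 : int -> 'rV[R[i]]_r, exists eta : R -> R[i],
    cont_diff m eta /\
    forall K : R, 0 < K -> forall l : 'I_r,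
      (fun n : nat =>
         ereal_sup [set (normc (iter n (subdivision a) w0 k 0 l * 2 ^+ (l * n)
                                - cderivn l eta (2 ^- n * k%:~R)))%:E
                   | k in [set k : int | `|k%:~R| <= 2 ^+ n * K]])
        @ \oo --> 0%E.

(** * Compactly supported distributions *)

(* A compactly supported distribution is a continuous linear form on the space
   of smooth functions; only its values on smooth functions are meaningful. *)
Record cs_distribution (R : realType) := CsDistribution {
  pairing :> (R -> R[i]) -> R[i];
  pairing_linear : forall (c : R[i]) (f g : R -> R[i]), smooth f -> smooth g ->
    pairing (fun x => c * f x + g x) = c * pairing f + pairing g;
  pairing_continuous : exists (C K : R) (N : nat), forall f : R -> R[i],
    smooth f -> forall M : R,
    (forall j x, (j <= N)%N -> `|x| <= K -> normc (cderivn j f x) <= M) ->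
    normc (pairing f) <= C * M }.

(* The Fourier transform of a compactly supported distribution is the function
   xi |-> <phi, exp(-i xi .)>. *)
Definition fourier (R : realType) (r : nat) (phi : 'I_r -> cs_distribution R)
    (xi : R) : 'cV[R[i]]_r :=
  \col_l phi l (fun x => expi (- (x * xi))).

(** * Smoothness exponents of functions and distributions *)

Definition Linfty_norm (R : realType) (f : R -> R[i]) : \bar R :=
  Lnorm (@lebesgue_measure R) +oo%E (fun x => (normc (f x))%:E).

Definition in_Linfty (R : realType) (f : R -> R[i]) : Prop :=
  [/\ measurable_fun setT (re_fun f), measurable_fun setT (im_fun f) &
      (Linfty_norm f < +oo)%E].

Definition absolutely_continuous (R : realType) (f : R -> R[i]) : Prop :=
  forall e : R, 0 < e -> exists2 d : R, 0 < d &
    forall (n : nat) (x y : 'I_n -> R),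
      (forall i, x i <= y i) ->
      trivIset setT (fun i => `]x i, y i[%classic) ->
      \sum_i (y i - x i) < d ->
      \sum_i normc (f (y i) - f (x i)) < e.

(* [sobolev_derivs n f g]: the function [f] (up to equality a.e.) belongs to
   W^n_infty(R) and [g j] is its derivative of order j for j = 0, ..., n; the
   last one, [g n], is an a.e. derivative. *)
Definition sobolev_derivs (R : realType) (n : nat) (f : R -> R[i])
    (g : nat -> R -> R[i]) : Prop :=
  [/\ {ae @lebesgue_measure R, forall x, f x = g 0%N x},
      forall j, (j <= n)%N -> in_Linfty (g j),
      forall j, (j < n)%N -> absolutely_continuous (g j) &
      forall j, (j < n)%N -> {ae @lebesgue_measure R, forall x,
        cderivable (g j) x /\ cderivn 1 (g j) x = g j.+1 x}].

Definition lipschitz_Linfty (R : realType) (tau : R) (f : R -> R[i]) : Prop :=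
  exists2 C : R, 0 < C & forall t : R,
    (Linfty_norm (fun x => f x - f (x - t))%R <= (C * `|t| `^ tau)%:E)%E.

Definition sm_fun (R : realType) (f : R -> R[i]) : \bar R :=
  ereal_sup [set s | exists (n : nat) (tau : R) (g : nat -> R -> R[i]),
    [/\ 0 <= tau < 1, sobolev_derivs n f g, lipschitz_Linfty tau (g n) &
        s = (n%:R + tau)%:E]].

Definition cRintegral (R : realType) (f : R -> R[i]) : R[i] :=
  Rintegral (@lebesgue_measure R) setT (re_fun f)
    +i* Rintegral (@lebesgue_measure R) setT (im_fun f).

Definition represented_by (R : realType) (T : cs_distribution R)
    (f : R -> R[i]) : Prop :=
  forall g : R -> R[i], smooth g ->
    (exists K : R, forall x, K < `|x| -> g x = 0) ->
    T g = cRintegral (fun x => f x * g x).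

(* sm_infty(phi) > m, which includes that every entry of phi is (represented by)
   an L_infty function. *)
Definition sm_gt (R : realType) (r : nat) (phi : 'I_r -> cs_distribution R)
    (m : nat) : Prop :=
  exists f : 'I_r -> R -> R[i],
    (forall l, in_Linfty (f l) /\ represented_by (phi l) (f l)) /\
    (m%:R%:E < \big[Order.min/+oo]_(l < r) sm_fun (f l))%E.

(* Main.v *)
(* Everything is read on moments: with [mom f w] the sum of the f(k) w(k), the
   matching filter and the sum rules say how S_a acts on the polynomial moments of
   degree < k of a row sequence v, and a column sequence u lies in V_(j-1,v) iff
   v * u annihilates the polynomials of degree < j.

   (1) Start a convergent scheme at ups, with limit E.  The moments of S_a^n ups are
   2^n times those of ups, so 2^((l-p) n) times the p-th moment of the l-th entry of
   ups is close to a Riemann sum of x^p E^(l): that moment must be 0 for p < l, and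
   for p = l it is (-1)^l l! times the integral of E, which is 1.  Starting at the delta
   sequences gives compactly supported C^m functions eta_i, refined by the mask.  As
   the l-th column of S_a^n (delta I_r) is O(2^(-l n)), only the first component
   survives in the limit, and a vector sequence u with v^(0) u^(0) = 0 gives a cascade
   tending to 0; compactness in a finite-dimensional space invariant under the
   transition operators turns this into exponential decay, whence sm(a) > 0.  The same
   argument for the differences of the m-th derivatives makes them Hoelder continuous,
   and eta represents phi because both have the same moments, 2^k being no eigenvalue
   of a^(0).

   (2) Conversely, sm(phi) > m gives C^m representatives F of phi.  For a polynomial p
   of degree < k = sr a, the function x |-> sum_q mom (p(. + q)) v F(x + q) differs from
   a multiple of p(-x) by a 1-periodic function h with h(x/2) = 2^(-deg p) h(x), by
   induction on deg p; so h = 0 and F reproduces polynomials.  Because sm(a) > r-1, the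
   moments of v of order < r are proportional to those of ups.  So the l-th derivatives
   of F at the integers minus delta e_l vanish to order min(l+1, k) against v; their
   cascade is therefore o(2^(-l n)), which is the required convergence
   for delta data, and locality handles arbitrary initial data. *)

Require Import Defs.
From HB Require Import structures.
From mathcomp Require Import all_boot all_order all_algebra.
From mathcomp Require Import all_classical all_reals all_analysis.
From mathcomp Require Import complex.
From mathcomp Require Import zify ring lra.

Set Implicit Arguments.
Unset Strict Implicit.
Unset Printing Implicit Defensive.

Import Order.TTheory GRing.Theory Num.Theory.
Import numFieldNormedType.Exports.

Local Open Scope classical_set_scope.
Local Open Scope ring_scope.
Local Open Scope complex_scope.

(** * Finitely supported sums over the integers *)

(** In (1) the exponent [sm_mask] is computed from [sr_filter a], a filter picked by choice and a
    priori unrelated to [ups], and [sr a] is a maximum only if the orders of sum rules are bounded.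
    Both points are settled for arbitrary filters: the support of the mask bounds the order,
    convergence forces order at least 1, and any filter of order 1 then has at 0 a multiple of the
    first unit row as symbol. Since rho is a supremum over sequences of arbitrary support, the decay
    rate must not depend on the sequence; the transition operators contract every support into one
    window fixed by the mask, so a single finite-dimensional space decides the rate. In (2) k =
    [sr a] is never compared with r: moments are used below both bounds, and a sequence vanishing to
    order k already decays faster than 2^(-(r-1) n). Analytically, integrals of continuous functions
    are read on primitives, and the C^m representatives rest on a mean value inequality for
    absolutely continuous functions with an a.e. bounded derivative, obtained by covering the
    exceptional null set by a small open set. *)

Definition zbnd (V : zmodType) (M : nat) (F : int -> V) :=
  forall k : int, (M < `|k|)%N -> F k = 0.

Definition zr (M : nat) : seq int := [seq i%:Z - M%:Z | i <- iota 0 (2 * M).+1].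

Lemma zr_uniq M : uniq (zr M).
Proof. by rewrite map_inj_uniq ?iota_uniq // => i j /addIr []. Qed.

Lemma mem_zr M (k : int) : (k \in zr M) = (`|k| <= M)%N.
Proof.
apply/mapP/idP => [ [ i ]|h]; first by rewrite mem_iota => ? ->; lia.
exists (absz (k + M%:Z)); last by lia.
by rewrite mem_iota; lia.
Qed.

Lemma size_zr M : size (zr M) = (2 * M).+1.
Proof. by rewrite size_map size_iota. Qed.

(* Sums over the integers, sealed behind a constant so that unification does not
   look into the finitely supported big operator. *)
Definition zsum (V : zmodType) (F : int -> V) : V := \sum_(k \in [set: int]) F k.
Notation "\zsum_ ( k ) F" := (zsum (fun k : int => F))
  (at level 41, k name, F at level 41, format "\zsum_ ( k )  F").

Section ZSum.
Variable V : zmodType.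
Implicit Types F G : int -> V.

Lemma zsumE M F : zbnd M F ->
  \zsum_(k) F k = \sum_(k <- zr M) F k.
Proof.
move=> bF; rewrite /zsum (fsbig_seq _ _ (zr_uniq M)); symmetry; apply: fsbig_widen => //.
by move=> k [_ /=]; rewrite mem_zr => /negP; rewrite -ltnNge => /bF.
Qed.

Lemma zbnd_widen M M' F : (M <= M')%N -> zbnd M F -> zbnd M' F.
Proof. by move=> le bF k lt; apply: bF; exact: leq_ltn_trans lt. Qed.

Lemma finite_set_zbnd F : finite_set [set k | F k != 0] -> exists M, zbnd M F.
Proof.
move=> /finite_seqP [s sP]; exists (\max_(k <- s) `|k|)%N => k lt.
apply/eqP; apply: contraTT lt => Fk0; rewrite -leqNgt.
have ks : k \in s by have : [set k | F k != 0] k by []; rewrite sP.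
by rewrite (big_rem k ks) /= leq_maxl.
Qed.

Lemma zbnd_finite_set M F : zbnd M F -> finite_set [set k | F k != 0].
Proof.
move=> bF; apply: (@sub_finite_set _ _ [set` zr M]) => [k /= Fk0|]; last exact: finite_seq.
by rewrite mem_zr leqNgt; apply: contra Fk0 => /bF/eqP.
Qed.

Lemma eq_zsum F G : (forall k, F k = G k) ->
  \zsum_(k) F k = \zsum_(k) G k.
Proof. by move=> FG; congr zsum; apply/funext. Qed.

Lemma zsum0 F : (forall k, F k = 0) -> \zsum_(k) F k = 0.
Proof. by move=> F0; rewrite /zsum fsbig1. Qed.

Lemma zsum1 (k0 : int) F : (forall k, k != k0 -> F k = 0) ->
  \zsum_(k) F k = F k0.
Proof.
move=> F0; rewrite (@zsumE `|k0| F); last by move=> k lt; apply: F0; lia.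
rewrite (bigD1_seq k0) ?zr_uniq ?mem_zr //= big1 ?addr0 // => k /F0 //.
Qed.

Lemma zsumD M F G : zbnd M F -> zbnd M G ->
  \zsum_(k) (F k + G k) =
  \zsum_(k) F k + \zsum_(k) G k.
Proof.
move=> bF bG; rewrite !(@zsumE M) // ?big_split // => k lt.
by rewrite bF // bG // addr0.
Qed.

Lemma zsum_reindex (h : int -> int) F : injective h ->
  (forall k, F k != 0 -> exists j, k = h j) ->
  \zsum_(k) F k = \zsum_(k) F (h k).
Proof.
move=> hi hs.
rewrite /zsum -(fsbig_image [set: int] h F); last by move=> x y _ _ /hi.
symmetry; apply: fsbig_widen => // k [_ nk] /=.
apply/eqP; apply: contrapT => /negP F0; apply: nk.
by have [j ->] := hs _ F0; exists j.
Qed.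

Lemma zsum_shift (a : int) F :
  \zsum_(k) F k = \zsum_(k) F (k + a).
Proof.
by apply: zsum_reindex => [|k _]; [exact: addIr | exists (k - a); rewrite subrK].
Qed.

Lemma zsum_sub (a : int) F :
  \zsum_(k) F k = \zsum_(k) F (a - k).
Proof.
apply: zsum_reindex => [x y /addrI /oppr_inj//|k _].
by exists (a - k); lia.
Qed.

Lemma zsum_exch M M' (F : int -> int -> V) :
  (forall i j, F i j != 0 -> (`|i| <= M)%N /\ (`|j| <= M')%N) ->
  \zsum_(i) \zsum_(j) F i j =
  \zsum_(j) \zsum_(i) F i j.
Proof.
move=> hF.
have hi i j : (M < `|i|)%N -> F i j = 0.
  by move=> lt; apply/eqP; apply: contraTT lt => /hF[]; lia.
have hj i j : (M' < `|j|)%N -> F i j = 0.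
  by move=> lt; apply/eqP; apply: contraTT lt => /hF[]; lia.
rewrite (@zsumE M); last by move=> i lt; apply: zsum0 => j; exact: hi.
rewrite [RHS](@zsumE M'); last by move=> j lt; apply: zsum0 => i; exact: hj.
transitivity (\sum_(i <- zr M) \sum_(j <- zr M') F i j).
  by apply: eq_bigr => i _; apply: zsumE => j /hj.
rewrite exchange_big /=.
by apply: eq_bigr => j _; symmetry; apply: zsumE => i /hi.
Qed.

Lemma zsum_even M F : zbnd M F ->
  \zsum_(s) (if (s %% 2 == 0)%Z then F s else 0) =
  \zsum_(j) F (2 * j).
Proof.
move=> bF; rewrite (@zsum_reindex (fun j => 2 * j)).
- by apply: eq_zsum => k; rewrite mulrC modzMl.
- by move=> x y; lia.
- move=> k; case: ifP => [h _|]; last by rewrite eqxx.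
  by exists (k %/ 2)%Z; lia.
Qed.

End ZSum.

Lemma raddf_zsum (U V : zmodType) (f : {additive U -> V}) M (F : int -> U) :
  zbnd M F ->
  f (\zsum_(k) F k) = \zsum_(k) f (F k).
Proof.
move=> bF; rewrite (zsumE bF) raddf_sum (@zsumE _ M) // => k /bF ->.
exact: raddf0.
Qed.

(** * Matrix-valued sums and the entrywise norm *)

Section ZMat.
Variable R : realType.
Local Notation C := R[i].

Lemma zsumZ M s r (c : C) (F : int -> 'M[C]_(s, r)) : zbnd M F ->
  c *: (\zsum_(k) F k) = \zsum_(k) (c *: F k).
Proof. by move=> bF; exact: (raddf_zsum (GRing.scale c) bF). Qed.

Lemma zsum_mull M s r q (B : 'M[C]_(q, s)) (F : int -> 'M[C]_(s, r)) : zbnd M F ->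
  B *m (\zsum_(k) F k) = \zsum_(k) (B *m F k).
Proof. by move=> bF; exact: (raddf_zsum (mulmx B) bF). Qed.

Lemma zsum_mulr M s r q (B : 'M[C]_(r, q)) (F : int -> 'M[C]_(s, r)) : zbnd M F ->
  (\zsum_(k) F k) *m B = \zsum_(k) (F k *m B).
Proof. by move=> bF; exact: (raddf_zsum (mulmxr B) bF). Qed.

Lemma zsum_entry M s r (F : int -> 'M[C]_(s, r)) i j : zbnd M F ->
  (\zsum_(k) F k) i j = \zsum_(k) F k i j.
Proof.
move=> bF; rewrite (zsumE bF) summxE (@zsumE _ M) // => k /bF ->.
by rewrite mxE.
Qed.

(** The entrywise l^1 norm: real-valued, submultiplicative and dominating every entry; constants
    depending on r are absorbed wherever it is used. *)
Definition mnorm s r (A : 'M[C]_(s, r)) : R := \sum_i \sum_j Normc.normc (A i j).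

Lemma mnorm_ge0 s r (A : 'M[C]_(s, r)) : 0 <= mnorm A.
Proof. by do 2!(apply: sumr_ge0 => ? _); case: (A _ _) => x y /=; exact: sqrtr_ge0. Qed.

Lemma normc_ge0 (z : C) : 0 <= Normc.normc z.
Proof. by case: z => x y; exact: sqrtr_ge0. Qed.

Lemma normcD (x y : C) : Normc.normc (x + y) <= Normc.normc x + Normc.normc y.
Proof. exact: le_normcD. Qed.

Lemma normcB (x y : C) : Normc.normc (x - y) = Normc.normc (y - x).
Proof. by rewrite -normcN opprB. Qed.

Lemma normc_sum I (s : seq I) (P : pred I) (F : I -> C) :
  Normc.normc (\sum_(i <- s | P i) F i) <= \sum_(i <- s | P i) Normc.normc (F i).
Proof.
elim/big_rec2: _ => [|i y x _ h]; first by rewrite Normc.normc0.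
by apply: le_trans (normcD _ _) _; rewrite lerD2l.
Qed.

Lemma mnorm0 s r : mnorm (0 : 'M[C]_(s, r)) = 0.
Proof.
by rewrite /mnorm big1 // => i _; rewrite big1 // => j _; rewrite mxE Normc.normc0.
Qed.

Lemma normc_le_mnorm s r (A : 'M[C]_(s, r)) i j : Normc.normc (A i j) <= mnorm A.
Proof.
rewrite /mnorm (bigD1 i) //= (bigD1 j) //= -addrA lerDl addr_ge0 //.
  by apply: sumr_ge0 => k _; exact: normc_ge0.
by do 2!(apply: sumr_ge0 => ? _); exact: normc_ge0.
Qed.

Lemma mnormD s r (A B : 'M[C]_(s, r)) : mnorm (A + B) <= mnorm A + mnorm B.
Proof.
rewrite /mnorm -big_split; apply: ler_sum => i _.
by rewrite -big_split; apply: ler_sum => j _; rewrite mxE; exact: normcD.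
Qed.

Lemma mnormZ s r (c : C) (A : 'M[C]_(s, r)) : mnorm (c *: A) = Normc.normc c * mnorm A.
Proof.
rewrite /mnorm mulr_sumr; apply: eq_bigr => i _; rewrite mulr_sumr.
by apply: eq_bigr => j _; rewrite mxE Normc.normcM.
Qed.

Lemma mnormN s r (A : 'M[C]_(s, r)) : mnorm (- A) = mnorm A.
Proof. by do 2!(apply: eq_bigr => ? _); rewrite mxE normcN. Qed.

Lemma mnormB s r (A B : 'M[C]_(s, r)) : mnorm (A - B) <= mnorm A + mnorm B.
Proof. by rewrite -(mnormN B); exact: mnormD. Qed.

Lemma mnorm_sum s r I (t : seq I) (P : pred I) (F : I -> 'M[C]_(s, r)) :
  mnorm (\sum_(i <- t | P i) F i) <= \sum_(i <- t | P i) mnorm (F i).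
Proof.
elim/big_rec2: _ => [|i y x _ h]; first by rewrite mnorm0.
by apply: le_trans (mnormD _ _) _; rewrite lerD2l.
Qed.

Lemma mnormM s r q (A : 'M[C]_(s, r)) (B : 'M[C]_(r, q)) :
  mnorm (A *m B) <= mnorm A * mnorm B.
Proof.
rewrite {1 2}/mnorm mulr_suml; apply: ler_sum => i _.
apply: (@le_trans _ _ (\sum_k \sum_j Normc.normc (A i j) * Normc.normc (B j k))).
  apply: ler_sum => k _; rewrite mxE; apply: le_trans (normc_sum _ _ _) _.
  by apply: ler_sum => j _; rewrite Normc.normcM.
rewrite exchange_big /= mulr_suml; apply: ler_sum => j _; rewrite -mulr_sumr.
apply: ler_wpM2l; first exact: normc_ge0.
rewrite /mnorm (bigD1 j) //= lerDl; apply: sumr_ge0 => ? _.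
by apply: sumr_ge0 => ? _; exact: normc_ge0.
Qed.

Lemma mnorm_le_entries s r (A : 'M[C]_(s, r)) e :
  (forall i j, Normc.normc (A i j) <= e) -> mnorm A <= (s * r)%:R * e.
Proof.
move=> h; apply: (@le_trans _ _ (\sum_(i < s) \sum_(j < r) e)).
  by do 2!(apply: ler_sum => ? _).
under eq_bigr do rewrite sumr_const card_ord.
by rewrite sumr_const card_ord -mulrnA mulr_natl mulnC.
Qed.

Lemma normc_real (x : R) : Normc.normc (x%:C) = `|x|.
Proof. by rewrite /= expr0n addr0 sqrtr_sqr. Qed.

Lemma normc_nat n : Normc.normc (n%:R : C) = n%:R.
Proof. by rewrite -(rmorph_nat (real_complex R)) normc_real normr_nat. Qed.

Lemma normcX (x : C) n : Normc.normc (x ^+ n) = Normc.normc x ^+ n.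
Proof. by elim: n => [|n IH]; rewrite ?Normc.normc1 // !exprS Normc.normcM IH. Qed.

Lemma Re_normc (z : C) : `|complex.Re z| <= Normc.normc z.
Proof.
case: z => x y /=; rewrite -sqrtr_sqr ler_wsqrtr // lerDl; exact: sqr_ge0.
Qed.

Lemma Im_normc (z : C) : `|complex.Im z| <= Normc.normc z.
Proof.
case: z => x y /=; rewrite -sqrtr_sqr ler_wsqrtr // lerDr; exact: sqr_ge0.
Qed.

Lemma normc_ReIm (z : C) : Normc.normc z <= `|complex.Re z| + `|complex.Im z|.
Proof.
case: z => x y /=; rewrite -[leRHS]ger0_norm ?addr_ge0 // -sqrtr_sqr ler_wsqrtr //.
by rewrite sqrrD !real_normK ?num_real // lerD2r lerDl mulrn_wge0 // mulr_ge0.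
Qed.

End ZMat.

(** * Iterated subdivision and moments *)

Section Subdivision.
Variable R : realType.
Local Notation C := R[i].

Lemma convolutionE s r q (b : int -> 'M[C]_(s, r)) (u : int -> 'M[C]_(r, q)) j :
  convolution b u j = \zsum_(k) (b (j - k) *m u k).
Proof. by []. Qed.

Lemma subdivision_zsum s r (a : int -> 'M[C]_r) (v : int -> 'M[C]_(s, r)) j :
  subdivision a v j = 2 *: \zsum_(k) (v k *m a (j - 2 * k)).
Proof. by []. Qed.

Lemma symbolE s r (u : int -> 'M[C]_(s, r)) xi :
  symbol u xi = \zsum_(k) (expi (- (k%:~R * xi)) *: u k).
Proof. by []. Qed.

Lemma scaler_neq0 (s q : nat) (c : C) (A : 'M[C]_(s, q)) : c *: A != 0 -> A != 0.
Proof. by apply: contraNneq => ->; rewrite scaler0. Qed.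

Lemma scaleMr (s q t : nat) (c : C) (A : 'M[C]_(s, q)) (B : 'M[C]_(q, t)) :
  A *m (c *: B) = c *: (A *m B).
Proof. by rewrite -scalemxAr. Qed.

Lemma scaleMl (s q t : nat) (c : C) (A : 'M[C]_(s, q)) (B : 'M[C]_(q, t)) :
  (c *: A) *m B = c *: (A *m B).
Proof. by rewrite -scalemxAl. Qed.

Lemma mulmx_neq0 (s q t : nat) (A : 'M[C]_(s, q)) (B : 'M[C]_(q, t)) :
  A *m B != 0 -> A != 0 /\ B != 0.
Proof.
by move=> h; split; apply: contraNneq h => ->; rewrite ?mul0mx ?mulmx0.
Qed.

Lemma zbnd_neq0 (V : zmodType) M (F : int -> V) k : zbnd M F -> F k != 0 -> (`|k| <= M)%N.
Proof. by move=> bF; rewrite leqNgt; apply: contra => /bF/eqP. Qed.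

Lemma fsuppP s q (u : int -> 'M[C]_(s, q)) : finitely_supported u -> exists M, zbnd M u.
Proof. exact: finite_set_zbnd. Qed.

Lemma fsupp_zbnd M s q (u : int -> 'M[C]_(s, q)) : zbnd M u -> finitely_supported u.
Proof. by move=> h; exact: zbnd_finite_set h. Qed.

Definition mom s q (f : {poly C}) (w : int -> 'M[C]_(s, q)) : 'M[C]_(s, q) :=
  \zsum_(k) f.[k%:~R] *: w k.

Lemma zbndZ M s q (g : int -> C) (w : int -> 'M[C]_(s, q)) :
  zbnd M w -> zbnd M (fun k => g k *: w k).
Proof. by move=> bw k /bw ->; rewrite scaler0. Qed.

Lemma momD M s q f g (w : int -> 'M[C]_(s, q)) : zbnd M w ->
  mom (f + g) w = mom f w + mom g w.
Proof.
move=> bw; rewrite /mom -(zsumD (M := M)); try exact: zbndZ.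
by apply: eq_zsum => k; rewrite hornerD scalerDl.
Qed.

Lemma momZ M s q c f (w : int -> 'M[C]_(s, q)) : zbnd M w ->
  mom (c *: f) w = c *: mom f w.
Proof.
move=> bw; rewrite /mom (zsumZ (M := M)); last exact: zbndZ.
by apply: eq_zsum => k; rewrite hornerZ scalerA.
Qed.

Lemma mom0 s q (w : int -> 'M[C]_(s, q)) : mom 0 w = 0.
Proof. by apply: zsum0 => k; rewrite horner0 scale0r. Qed.

Lemma mom_sum M s q I (t : seq I) (F : I -> {poly C}) (w : int -> 'M[C]_(s, q)) :
  zbnd M w -> mom (\sum_(x <- t) F x) w = \sum_(x <- t) mom (F x) w.
Proof.
move=> bw; elim: t => [|x t IH]; first by rewrite !big_nil mom0.
by rewrite !big_cons (momD _ _ bw) IH.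
Qed.

Lemma momDr M s q f (w w' : int -> 'M[C]_(s, q)) : zbnd M w -> zbnd M w' ->
  mom f (fun k => w k + w' k) = mom f w + mom f w'.
Proof.
move=> bw bw'; rewrite /mom -(zsumD (M := M)); try exact: zbndZ.
by apply: eq_zsum => k; rewrite scalerDr.
Qed.

Lemma momZr M s q c f (w : int -> 'M[C]_(s, q)) : zbnd M w ->
  mom f (fun k => c *: w k) = c *: mom f w.
Proof.
move=> bw; rewrite /mom (zsumZ (M := M)); last exact: zbndZ.
by apply: eq_zsum => k; rewrite !scalerA mulrC.
Qed.

Lemma mom_monom M s q k (w w' : int -> 'M[C]_(s, q)) : zbnd M w -> zbnd M w' ->
  (forall p, (p < k)%N -> mom 'X^p w = mom 'X^p w') ->
  forall f : {poly C}, (size f <= k)%N -> mom f w = mom f w'.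
Proof.
move=> bw bw' h f szf; rewrite -[f]coefK poly_def !(mom_sum _ _ bw) !(mom_sum _ _ bw').
rewrite !big_seq; apply: eq_bigr => /= i _.
by rewrite (momZ _ _ bw) (momZ _ _ bw') h //; exact: leq_trans (ltn_ord i) szf.
Qed.

Variables (r : nat) (a : int -> 'M[C]_r) (N : nat).
Hypothesis aN : zbnd N a.

Definition A n := iter n (subdivision a) (@dirac_mx R r).

Lemma zbnd_subdivision s M (v : int -> 'M[C]_(s, r)) :
  zbnd M v -> zbnd (2 * M + N) (subdivision a v).
Proof.
move=> bv k lt; rewrite subdivision_zsum zsum0 ?scaler0 // => j.
have [/bv->|le] := ltnP M `|j|; first by rewrite mul0mx.
by rewrite aN ?mulmx0 //; lia.
Qed.

Lemma A_zbnd n : zbnd (N * (2 ^ n - 1)) (A n).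
Proof.
elim: n => [|n IH]; first by move=> k; rewrite muln0 /A /= /dirac_mx absz_gt0; case: eqP.
apply: (zbnd_widen _ (zbnd_subdivision IH)).
by have := expn_gt0 2 n; rewrite expnS; nia.
Qed.

Lemma A_zbnd' n : zbnd (N * 2 ^ n) (A n).
Proof. by apply: (zbnd_widen _ (@A_zbnd n)); rewrite leq_mul // leq_subr. Qed.

Lemma subdivisionE s (v : int -> 'M[C]_(s, r)) j :
  subdivision a v j = \zsum_(k) 2 *: (v k *m a (j - 2 * k)).
Proof.
rewrite subdivision_zsum (@zsumZ R (`|j| + N)) // => k lt.
by rewrite aN ?mulmx0 //; lia.
Qed.

Lemma two_le (n : nat) (l : int) : (absz l <= absz (2 ^+ n * l)%R)%N.
Proof. by rewrite abszM leq_pmull // absz_gt0 expf_neq0. Qed.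

Lemma two_expz n : absz ((2 : int) ^+ n)%R = (2 ^ n)%N.
Proof. by rewrite abszX. Qed.

(** By linearity, and because a shift of the data by k becomes a shift by 2^n k after n steps, every
    output is a superposition of the responses [A n] to delta data. *)
Lemma iter_subdivision s (w : int -> 'M[C]_(s, r)) n i :
  iter n (subdivision a) w i = \zsum_(k) w k *m A n (i - 2 ^+ n * k).
Proof.
elim: n i => [|n IH] i.
  rewrite (@zsum1 _ i) => [|k ki]; rewrite expr0 mul1r /A /= /dirac_mx.
    by rewrite subrr eqxx mulmx1.
  by rewrite subr_eq0 eq_sym (negbTE ki) mulmx0.
have bl k : zbnd (`|k| + N * 2 ^ n) (fun l => w l *m A n (k - 2 ^+ n * l)).
  move=> l lt; rewrite A_zbnd' ?mulmx0 //.
  by have := two_le n l; lia.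
rewrite iterS subdivisionE.
transitivity (\zsum_(k) \zsum_(l)
   2 *: (w l *m A n (k - 2 ^+ n * l) *m a (i - 2 * k))).
  apply: eq_zsum => k; rewrite IH (zsum_mulr _ (bl k)) (@zsumZ R (`|k| + N * 2 ^ n)) //.
  by move=> l /bl ->; rewrite mul0mx.
rewrite (@zsum_exch _ (`|i| + N) (`|i| + N + N * 2 ^ n)) => [|k l /scaler_neq0 /mulmx_neq0[h1 h2]].
  apply: eq_zsum => l; rewrite /A iterS subdivisionE (@zsum_mull R (absz (i - 2 ^+ n.+1 * l)%R + N)).
    rewrite [LHS](zsum_shift (2 ^+ n * l)); apply: eq_zsum => k.
    rewrite addrK scaleMr mulmxA; congr (_ *: (_ *m a _)).
    by rewrite exprS; ring.
  by move=> k lt; rewrite (aN (k := i - _ - _)) ?mulmx0 ?scaler0 //; lia.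
have := zbnd_neq0 aN h2.
have : (w l *m A n (k - 2 ^+ n * l)) != 0 by [].
by move=> /(zbnd_neq0 (bl k)); lia.
Qed.

Lemma A_add n m i :
  A (n + m) i = \zsum_(k) A n k *m A m (i - 2 ^+ m * k).
Proof. by rewrite /A addnC iterD iter_subdivision. Qed.

Lemma A_1 i : A 1 i = 2 *: a i.
Proof.
rewrite /A /= subdivisionE (@zsum1 _ 0) => [|k /negbTE k0].
  by rewrite /dirac_mx eqxx mul1mx mulr0 subr0.
by rewrite /dirac_mx k0 mul0mx scaler0.
Qed.

Lemma convolutionC s q (b : int -> 'M[C]_(s, r)) (u : int -> 'M[C]_(r, q)) j :
  convolution b u j = \zsum_(k) b k *m u (j - k).
Proof.
rewrite convolutionE [LHS](zsum_sub j); by apply: eq_zsum => k; rewrite subKr.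
Qed.

Lemma convolution_scale s q M (b : int -> 'M[C]_(s, r)) (u w : int -> 'M[C]_(r, q)) c j :
  zbnd M u -> zbnd M w ->
  convolution b (fun k => u k + c *: w k) j = convolution b u j + c *: convolution b w j.
Proof.
move=> uM wM; rewrite !convolutionE.
rewrite (zsumE (M := M)); last by move=> k lt; rewrite uM // wM // scaler0 addr0 mulmx0.
rewrite (zsumE (M := M)); last by move=> k lt; rewrite uM // mulmx0.
rewrite (zsumE (M := M)); last by move=> k lt; rewrite wM // mulmx0.
rewrite scaler_sumr -big_split; apply: eq_bigr => k _.
by rewrite mulmxDr scaleMr.
Qed.

Section Conv.
Variables (q M : nat) (u : int -> 'M[C]_(r, q)).
Hypothesis uM : zbnd M u.

Lemma convolution_zbnd s (P : nat) (b : int -> 'M[C]_(s, r)) :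
  zbnd P b -> zbnd (P + M) (convolution b u).
Proof.
move=> bP j lt; apply: zsum0 => k.
have [/uM->|le] := ltnP M `|k|; first by rewrite mulmx0.
by rewrite bP ?mul0mx //; lia.
Qed.

(** Restricted to the coset e + 2^m Z, n + m steps of the cascade are n steps applied to another
    sequence, obtained from u by m steps and sampling on that coset. All decay estimates iterate
    this identity. *)
Lemma convolution_A_add n m j e :
  convolution (A (n + m)) u (2 ^+ m * j + e) =
  convolution (A n) (fun j => convolution (A m) u (2 ^+ m * j + e)) j.
Proof.
rewrite convolutionC.
transitivity (\zsum_(i) \zsum_(k)
   A n k *m A m (i - 2 ^+ m * k) *m u (2 ^+ m * j + e - i)).
  apply: eq_zsum => i; rewrite A_add (@zsum_mulr R (N * 2 ^ n)) // => k lt.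
  by rewrite A_zbnd' ?mul0mx.
rewrite (@zsum_exch _ (N * 2 ^ m + 2 ^ m * (N * 2 ^ n)) (N * 2 ^ n)); last first.
  move=> i k /mulmx_neq0[/mulmx_neq0[/(zbnd_neq0 (A_zbnd' (n := n))) h1]].
  move=> /(zbnd_neq0 (A_zbnd' (n := m))) h2 _; split => //.
  have : (absz (2 ^+ m * k)%R <= 2 ^ m * (N * 2 ^ n))%N.
    by rewrite abszM two_expz leq_mul.
  lia.
rewrite [RHS]convolutionC; apply: eq_zsum => k.
rewrite [LHS](zsum_shift (2 ^+ m * k)).
have e1 i : i + 2 ^+ m * k - 2 ^+ m * k = i by rewrite addrK.
have e2 i : 2 ^+ m * j + e - (i + 2 ^+ m * k) = 2 ^+ m * (j - k) + e - i by ring.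
transitivity (\zsum_(i) A n k *m (A m i *m u (2 ^+ m * (j - k) + e - i))).
  by apply: eq_zsum => i; rewrite e1 e2 -mulmxA.
rewrite -(@zsum_mull R (N * 2 ^ m)) => [|i lt]; last by rewrite A_zbnd' ?mul0mx.
by rewrite convolutionC.
Qed.

End Conv.

(** Writing the output index as 2k + i moves the dilation from the sequence into the polynomial, so
    that moments are transported by affine substitutions. *)
Lemma mom_subdivision M s (w : int -> 'M[C]_(s, r)) f : zbnd M w ->
  mom f (subdivision a w) =
  2 *: \zsum_(i) mom (f \Po (2 *: 'X + (i%:~R)%:P)) w *m a i.
Proof.
move=> wM.
have b1 i : zbnd M (fun k => f.[(2 * k + i)%:~R] *: w k) by exact: zbndZ.
transitivity (\zsum_(s) \zsum_(k)
   f.[s%:~R] *: (2 *: (w k *m a (s - 2 * k)))).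
  apply: eq_zsum => t; rewrite subdivisionE (@zsumZ R M) // => k /wM ->.
  by rewrite mul0mx scaler0.
rewrite (@zsum_exch _ (2 * M + N) M); last first.
  move=> t k /scaler_neq0/scaler_neq0/mulmx_neq0[/(zbnd_neq0 wM) ? /(zbnd_neq0 aN) ?].
  lia.
transitivity (\zsum_(k) \zsum_(i)
   f.[(2 * k + i)%:~R] *: (2 *: (w k *m a i))).
  apply: eq_zsum => k; rewrite [LHS](zsum_shift (2 * k)); apply: eq_zsum => i.
  by rewrite (addrK (2 * k) i) (addrC i).
rewrite (@zsum_exch _ M N); last first.
  by move=> k i /scaler_neq0/scaler_neq0/mulmx_neq0[/(zbnd_neq0 wM) ? /(zbnd_neq0 aN) ?].
rewrite (@zsumZ R N) => [|i /aN ->]; last by rewrite mulmx0.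
apply: eq_zsum => i; rewrite /mom (@zsum_mulr R M) => [|k /wM->]; last by rewrite scaler0.
rewrite (@zsumZ R M) => [|k /wM->]; last by rewrite scaler0 mul0mx.
apply: eq_zsum => k; rewrite horner_comp hornerD hornerZ hornerX hornerC.
rewrite scaleMl !scalerA mulrC; congr (_ *: _); congr (_ * f.[_]).
by rewrite rmorphD rmorphM.
Qed.

Lemma size_comp_aff (f : {poly C}) (c d : C) k :
  (size f <= k)%N -> (size (f \Po (c *: 'X + d%:P)) <= k)%N.
Proof.
move=> szf; have [->|f0] := eqVneq f 0; first by rewrite comp_poly0 size_poly0.
apply: leq_trans (size_comp_poly_leq _ _) _.
have h : (size (c *: 'X + d%:P)%R <= 2)%N.
  rewrite (leq_trans (size_polyD _ _)) // geq_max.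
  by rewrite (leq_trans (size_scale_leq _ _)) ?size_polyX //= (leq_trans (size_polyC_leq1 _)).
apply: (@leq_trans ((size f).-1 * 1).+1); last by rewrite muln1 prednK // size_poly_gt0.
by rewrite ltnS leq_mul // -ltnS; case: size h.
Qed.

(** The moment form of the matching condition of order k; the factor 2 is the one in
    [subdivision]. *)
Definition matched k (v : int -> 'rV[C]_r) :=
  forall f : {poly C}, (size f <= k)%N -> mom f (subdivision a v) = 2 *: mom f v.

(** The affine substitutions of [mom_subdivision] do not raise the degree, so the induction
    hypothesis applies to each substituted polynomial. *)
Lemma mom_iter k M (v : int -> 'rV[C]_r) n (f : {poly C}) : zbnd M v -> matched k v -> (size f <= k)%N ->
  mom f (iter n (subdivision a) v) = 2 ^+ n *: mom f v.
Proof.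
move=> vM hv; elim: n f => [|n IH] f szf; first by rewrite expr0 scale1r.
have [M' bM'] : exists M', zbnd M' (iter n (subdivision a) v).
  elim: n {IH} => [|n [M' bM']]; first by exists M.
  by exists (2 * M' + N)%N; exact: zbnd_subdivision.
rewrite iterS (mom_subdivision _ bM') exprSr -scalerA -hv // (mom_subdivision _ vM).
rewrite !scalerA mulrC -scalerA; congr (_ *: _).
rewrite (@zsumZ R N) => [|i /aN->]; last by rewrite mulmx0.
by apply: eq_zsum => i; rewrite IH ?size_comp_aff // scaleMl.
Qed.

(* The moment form of the sum rules of order k: every coset of 2Z carries the
   same moments. *)
Definition sum_ruled k (v : int -> 'rV[C]_r) :=
  forall (e : int) (f : {poly C}), (size f <= k)%N ->
   \zsum_(i) f.[(2 * i + e)%:~R] *: subdivision a v (2 * i + e) = mom f v.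

Definition pairmom s q (f : {poly C}) (v : int -> 'M[C]_(s, r)) (u : int -> 'M[C]_(r, q)) :=
  mom f (convolution v u).

Lemma pairmomE s q f Mv Mu (v : int -> 'M[C]_(s, r)) (u : int -> 'M[C]_(r, q)) :
  zbnd Mv v -> zbnd Mu u ->
  pairmom f v u = \zsum_(i) mom (f \Po ('X + (i%:~R)%:P)) v *m u i.
Proof.
move=> bv bu; rewrite /pairmom /mom.
transitivity (\zsum_(x) \zsum_(i)
   f.[x%:~R] *: (v (x - i) *m u i)).
  apply: eq_zsum => x; rewrite (@zsumZ R Mu) // => i /bu ->; rewrite mulmx0 //.
rewrite (@zsum_exch _ (Mv + Mu) Mu); last first.
  by move=> x i /scaler_neq0/mulmx_neq0[/(zbnd_neq0 bv) ? /(zbnd_neq0 bu) ?]; lia.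
apply: eq_zsum => i; rewrite (@zsum_mulr R Mv) => [|k /bv->]; last by rewrite scaler0.
rewrite [LHS](zsum_shift i); apply: eq_zsum => t.
rewrite addrK scaleMl horner_comp hornerD hornerX hornerC.
by congr (f.[_] *: _); rewrite rmorphD.
Qed.

(** The transition operators: [e] selects the coset of 2^m Z on which m steps of the cascade are
    sampled. *)
Definition Tm m e q (u : int -> 'M[C]_(r, q)) (j : int) : 'M[C]_(r, q) :=
  convolution (A m) u (2 ^+ m * j + e).

(** Replacing i by i - t collects the terms into [subdivision a v] on the coset of e. There i is
    half of (2 i + e) - e, whence the substitution by (X - e) / 2 in the sum rule. *)
Lemma sum_ruled_coset k Mv (v : int -> 'rV[C]_r) (vM : zbnd Mv v) (e : int) (f : {poly C}) :
  sum_ruled k v -> (size f <= k)%N ->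
  \zsum_(i) \zsum_(t)
     f.[(t + i)%:~R] *: (v t *m (2 *: a (2 * i + e))) =
  mom (f \Po (2^-1 *: 'X + (- e%:~R / 2)%:P)) v.
Proof.
move=> hv szf; rewrite -(hv e) ?size_comp_aff //.
rewrite (@zsum_exch _ (N + `|e|) Mv); last first.
  move=> i t /scaler_neq0/mulmx_neq0[/(zbnd_neq0 vM) ? /scaler_neq0/(zbnd_neq0 aN) ?].
  by lia.
transitivity (\zsum_(t) \zsum_(i)
     f.[i%:~R] *: (v t *m (2 *: a (2 * i + e - 2 * t)))).
  apply: eq_zsum => t; rewrite [LHS](zsum_shift (- t)); apply: eq_zsum => i.
  have -> : t + (i - t) = i by ring.
  by have -> : 2 * (i - t) + e = 2 * i + e - 2 * t by ring.
rewrite (@zsum_exch _ Mv (N + `|e| + 2 * Mv)); last first.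
  move=> t i /scaler_neq0/mulmx_neq0[/(zbnd_neq0 vM) ? /scaler_neq0/(zbnd_neq0 aN) ?].
  by lia.
apply: eq_zsum => i; rewrite subdivisionE (@zsumZ R Mv) => [|t /vM->]; last first.
  by rewrite mul0mx scaler0.
apply: eq_zsum => t; rewrite -scaleMr; congr (_ *: _).
rewrite horner_comp hornerD hornerZ hornerX hornerC; congr f.[_].
by rewrite rmorphD rmorphM /= -[2%:~R]/(2%:R : C); field.
Qed.

(** Dually to the sum rules, a transition operator acts on the pairing by the contraction (X - e) /
    2. In degree p its leading factor is 2^(-p) for every e, which is what later allows one order of
    vanishing to be gained. *)
Lemma pairmom_T k Mv Mu (v : int -> 'rV[C]_r) (u : int -> 'cV[C]_r) e (f : {poly C}) :
  zbnd Mv v -> zbnd Mu u -> sum_ruled k v -> (size f <= k)%N ->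
  pairmom f v (Tm 1 e u) = pairmom (f \Po (2^-1 *: 'X + (- e%:~R / 2)%:P)) v u.
Proof.
move=> vM uM hv szf.
have bT : zbnd (N * 2 ^ 1 + Mu + `|e|) (Tm 1 e u).
  move=> j lt; rewrite /Tm (convolution_zbnd uM (A_zbnd' (n := 1))) //.
  by have := two_le 1 j; lia.
rewrite (pairmomE _ vM bT) (pairmomE _ vM uM).
transitivity (\zsum_(i) \zsum_(q)
  \zsum_(t) (f.[(t + i)%:~R] *: (v t *m (2 *: a (2 * i + e - q)) *m u q))).
  apply: eq_zsum => i; rewrite /Tm convolutionE (@zsum_mull R Mu) => [|q /uM->]; last first.
    by rewrite mulmx0.
  apply: eq_zsum => q; rewrite /mom (@zsum_mulr R Mv) => [|t /vM->]; last by rewrite scaler0.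
  apply: eq_zsum => t; rewrite A_1 expr1 mulmxA !scaleMl; congr (_ *: _).
  by rewrite horner_comp hornerD hornerX hornerC rmorphD.
rewrite (@zsum_exch _ (N + `|e| + Mu) Mu); last first.
  move=> i q; have [/uM h|le] := ltnP Mu `|q|.
    by rewrite zsum0 ?eqxx // => t; rewrite h mulmx0 scaler0.
  have [lt|] := ltnP N (absz (2 * i + e - q)%R); last by lia.
  by rewrite zsum0 ?eqxx // => t; rewrite aN // scaler0 mulmx0 mul0mx scaler0.
apply: eq_zsum => q.
have := sum_ruled_coset vM (e - q) hv szf => h.
transitivity ((\zsum_(i) \zsum_(t)
     f.[(t + i)%:~R] *: (v t *m (2 *: a (2 * i + (e - q))))) *m u q).
  rewrite (@zsum_mulr R (N + absz (e - q)%R)) => [|i lt]; last first.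
    by apply: zsum0 => t; rewrite aN ?scaler0 ?mulmx0 ?scaler0 //; lia.
  apply: eq_zsum => i; rewrite (@zsum_mulr R Mv) => [|t /vM->]; last first.
    by rewrite mul0mx scaler0.
  by apply: eq_zsum => t; rewrite scaleMl addrA.
rewrite h; congr (mom _ v *m u q); rewrite -comp_polyA; congr (f \Po _).
rewrite comp_polyD comp_polyZ comp_polyX comp_polyC scalerDr -addrA; congr (_ + _).
rewrite -mul_polyC -!polyCM -polyCD; congr (_%:P).
by rewrite rmorphB /=; field.
Qed.

(** The convolution of v with the samples of f. Under the sum rules these sequences form a space
    that subdivision maps to itself, by dilating f. *)
Definition polyconv (f : {poly C}) (v : int -> 'rV[C]_r) (i : int) :=
  \zsum_(t) f.[(i - t)%:~R] *: v t.

Lemma subdivision_polyconv k Mv (v : int -> 'rV[C]_r) (f : {poly C}) : zbnd Mv v -> sum_ruled k v -> (size f <= k)%N ->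
  subdivision a (polyconv f v) =1 polyconv (f \Po (2^-1 *: 'X)) v.
Proof.
move=> vM hv szf i; rewrite subdivisionE.
(* Reflection: [polyconv] evaluates f at i - t, whereas [sum_ruled_coset] evaluates at t + i. *)
pose g := f \Po (-1 *: 'X + 0%:P).
have := sum_ruled_coset vM i hv (size_comp_aff (-1) 0 szf); rewrite -/g => h.
transitivity (\zsum_(i0) \zsum_(t)
     g.[(t + i0)%:~R] *: (v t *m (2 *: a (2 * i0 + i)))).
  rewrite [RHS](zsum_sub 0); apply: eq_zsum => j; rewrite sub0r /polyconv.
  rewrite (@zsum_mulr R Mv) => [|t /vM->]; last by rewrite scaler0.
  rewrite (@zsumZ R Mv) => [|t /vM->]; last by rewrite scaler0 mul0mx.
  apply: eq_zsum => t; rewrite scaleMl scaleMr !scalerA.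
  have -> : 2 * - j + i = i - 2 * j by ring.
  congr (_ *: _); rewrite mulrC; congr (_ * _).
  rewrite horner_comp hornerD hornerZ hornerX hornerC addr0 mulN1r -rmorphN; congr (f.[_%:~R]).
  by ring.
rewrite h /polyconv /mom; apply: eq_zsum => t; congr (_ *: _).
rewrite /g !horner_comp !(hornerD, hornerZ, hornerX, hornerC).
by congr f.[_]; rewrite rmorphB /=; field.
Qed.

End Subdivision.

(** * Derivatives of complex-valued functions *)

Section Calculus.
Variable R : realType.
Local Notation C := R[i].

Definition is_cderive (f : R -> C) (x : R) (d : C) : Prop :=
  is_derive x 1 (re_fun f) (complex.Re d) /\ is_derive x 1 (im_fun f) (complex.Im d).

Lemma cReD (z w : C) : complex.Re (z + w) = complex.Re z + complex.Re w.
Proof. by case: z w => [? ?] [? ?]. Qed.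
Lemma cImD (z w : C) : complex.Im (z + w) = complex.Im z + complex.Im w.
Proof. by case: z w => [? ?] [? ?]. Qed.
Lemma cReM (z w : C) : complex.Re (z * w) =
  complex.Re z * complex.Re w - complex.Im z * complex.Im w.
Proof. by case: z w => [? ?] [? ?]. Qed.
Lemma cImM (z w : C) : complex.Im (z * w) =
  complex.Re z * complex.Im w + complex.Im z * complex.Re w.
Proof. by case: z w => [? ?] [? ?]. Qed.
Lemma cReB (z w : C) : complex.Re (z - w) = complex.Re z - complex.Re w.
Proof. by case: z w => [? ?] [? ?]. Qed.
Lemma cImB (z w : C) : complex.Im (z - w) = complex.Im z - complex.Im w.
Proof. by case: z w => [? ?] [? ?]. Qed.
Lemma cReIm_eq (z w : C) : complex.Re z = complex.Re w -> complex.Im z = complex.Im w -> z = w.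
Proof. by case: z w => [? ?] [? ?] /= -> ->. Qed.

Lemma is_derive_eqf (f g : R -> R) (x d e : R) :
  is_derive x 1 f d -> f =1 g -> d = e -> is_derive x 1 g e.
Proof. by move=> h /funext <- <-. Qed.

Lemma is_cderive_eq (f g : R -> C) x d e :
  is_cderive f x d -> f =1 g -> d = e -> is_cderive g x e.
Proof. by move=> h /funext <- <-. Qed.

Lemma is_cderive_cst (c : C) x : is_cderive (fun=> c) x 0.
Proof.
by split; [apply: (is_derive_eqf (is_derive_cst (complex.Re c) x 1))
          |apply: (is_derive_eqf (is_derive_cst (complex.Im c) x 1))].
Qed.

Lemma is_cderiveD f g x d e : is_cderive f x d -> is_cderive g x e ->
  is_cderive (fun y => f y + g y) x (d + e).
Proof.
move=> [f1 f2] [g1 g2]; split; [apply: (is_derive_eqf (is_deriveD f1 g1))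
  |apply: (is_derive_eqf (is_deriveD f2 g2))] => [y||y|];
 by rewrite /re_fun /im_fun ?cReD ?cImD.
Qed.

Lemma is_cderiveM f g x d e : is_cderive f x d -> is_cderive g x e ->
  is_cderive (fun y => f y * g y) x (f x * e + d * g x).
Proof.
move=> [f1 f2] [g1 g2]; split.
- apply: (is_derive_eqf (is_deriveB (is_deriveM f1 g1) (is_deriveM f2 g2))) => [y|].
    by rewrite /re_fun cReM.
  rewrite /re_fun /im_fun cReD !cReM; rewrite /GRing.scale /=; ring.
- apply: (is_derive_eqf (is_deriveD (is_deriveM f1 g2) (is_deriveM f2 g1))) => [y|].
    by rewrite /im_fun cImM.
  rewrite /re_fun /im_fun cImD !cImM; rewrite /GRing.scale /=; ring.
Qed.

Lemma is_cderiveZ c f x d : is_cderive f x d -> is_cderive (fun y => c * f y) x (c * d).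
Proof.
move=> h; apply: is_cderive_eq (is_cderiveM (is_cderive_cst c x) h) _ _ => //.
by rewrite mul0r addr0.
Qed.

Lemma is_cderive_sum I (s : seq I) (f : I -> R -> C) x d :
  (forall i, is_cderive (f i) x (d i)) ->
  is_cderive (fun y => \sum_(i <- s) f i y) x (\sum_(i <- s) d i).
Proof.
move=> h; elim: s => [|i s IH].
  by apply: is_cderive_eq (is_cderive_cst 0 x) _ _ => [y|]; rewrite big_nil.
by apply: is_cderive_eq (is_cderiveD (h i) IH) _ _ => [y|]; rewrite big_cons.
Qed.

Lemma is_derive_aff (s t x : R) : is_derive x 1 (fun y => s * y + t) s.
Proof.
apply: (@is_derive_eqf (fun y => s *: y + cst t y) _ _ (s *: 1 + 0)) => //.
by rewrite addr0 /GRing.scale /= mulr1.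
Qed.

Lemma is_derive_comp_aff (f : R -> R) (s t x d : R) : is_derive (s * x + t) 1 f d ->
  is_derive x 1 (fun y => f (s * y + t)) (s * d).
Proof.
move=> h; apply: (@is_derive_eqf (f \o (fun y => s * y + t)) _ _ (d * s)).
- by apply: is_derive1_comp => //; exact: is_derive_aff.
- by [].
- exact: mulrC.
Qed.

Lemma is_cderive_aff f (s t x : R) d : is_cderive f (s * x + t) d ->
  is_cderive (fun y => f (s * y + t)) x (s%:C * d).
Proof.
move=> [f1 f2]; split.
  apply: (is_derive_eqf (is_derive_comp_aff f1)) => //.
  by rewrite cReM /= mul0r subr0.
apply: (is_derive_eqf (is_derive_comp_aff f2)) => //.
by rewrite cImM /= mul0r addr0.
Qed.

Lemma is_cderive_expi (c x : R) :
  is_cderive (fun y => expi (c * y)) x ((0 +i* c) * expi (c * x)).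
Proof.
split.
  apply: (is_derive_eqf (is_derive_comp_aff (is_derive_cos (c * x + 0)))) => [y|] /=;
   by rewrite /re_fun /= addr0 ?cReM //=; ring.
apply: (is_derive_eqf (is_derive_comp_aff (is_derive_sin (c * x + 0)))) => [y|] /=;
 by rewrite /im_fun /= addr0 ?cImM //=; ring.
Qed.

Lemma is_cderive_id x : is_cderive (fun y : R => y%:C) x 1.
Proof.
by split; [apply: (is_derive_eqf (is_derive_id x 1))|apply: (is_derive_eqf (is_derive_cst 0 x 1))].
Qed.

Lemma is_cderive_poly (p : {poly C}) x :
  is_cderive (fun y => p.[y%:C]) x (p^`().[x%:C]).
Proof.
elim/poly_ind: p => [|p c IH].
  by apply: is_cderive_eq (is_cderive_cst 0 x) _ _ => [y|]; rewrite ?deriv0 horner0.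
apply: is_cderive_eq
  (is_cderiveD (is_cderiveM IH (is_cderive_id x)) (is_cderive_cst c x)) _ _ => [y|].
  by rewrite hornerMXaddC.
by rewrite derivMXaddC hornerD hornerMX mulr1 addr0.
Qed.

Lemma is_cderive_unique f (x : R) d e : is_cderive f x d -> is_cderive f x e -> d = e.
Proof.
move=> [[_ f1] [_ f2]] [[_ g1] [_ g2]].
by apply: cReIm_eq; rewrite -?f1 -?f2.
Qed.

Lemma derive1n1E (g : R -> R) (x : R) : derive1n 1 g x = 'D_1 g x.
Proof. exact: derive1E. Qed.

Lemma is_cderiveP (f : R -> C) (x : R) : cderivable f x -> is_cderive f x (cderivn 1 f x).
Proof.
move=> [h1 h2].
split.
have e := derive1n1E (re_fun f) x.
have d := derivableP h1.
rewrite -e in d.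
exact: d.
have d := derivableP h2.
have e : complex.Im (cderivn 1 f x) = 'D_1 (im_fun f) x by exact: derive1n1E.
rewrite e.
exact: d.
Qed.

Lemma is_cderive_derivable (f : R -> C) (x : R) d : is_cderive f x d -> cderivable f x /\ cderivn 1 f x = d.
Proof.
move=> [[h1 e1] [h2 e2]].
split.
split.
exact: h1.
exact: h2.
apply: cReIm_eq.
rewrite -e1.
exact: derive1n1E.
rewrite -e2.
exact: derive1n1E.
Qed.

Lemma cderivnS n (f : R -> C) : cderivn n.+1 f = cderivn 1 (cderivn n f).
Proof. by apply/funext => x; rewrite /cderivn /=. Qed.

Lemma cderivn0 (f : R -> C) : cderivn 0 f = f.
Proof. by apply/funext => x; rewrite /cderivn /= /re_fun /im_fun; case: (f x). Qed.

(** A tower of successive derivatives given in advance. Towers are combined by the rules of calculus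
    without ever computing [cderivn], which is recovered by uniqueness in [derivs_cderivn]. *)
Definition derivs (m : nat) (D : nat -> R -> C) :=
  forall n, (n < m)%N -> forall x, is_cderive (D n) x (D n.+1 x).

Lemma derivs_cderivn m D : derivs m D -> forall n, (n <= m)%N -> cderivn n (D 0%N) = D n.
Proof.
move=> h; elim=> [_|n IH lt]; first exact: cderivn0.
rewrite cderivnS (IH (ltnW lt)); apply/funext => x.
exact: (is_cderive_derivable (h n lt x)).2.
Qed.

Lemma is_cderive_continuous f x d : is_cderive f x d ->
  {for x, continuous (re_fun f)} /\ {for x, continuous (im_fun f)}.
Proof.
move=> [[h1 _] [h2 _]].
by split; apply: differentiable_continuous; [move/derivable1_diffP: h1|move/derivable1_diffP: h2].
Qed.

Lemma cont_diff_derivs m f : cont_diff m f -> derivs m (fun n => cderivn n f).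
Proof. by move=> [h _] n lt x; rewrite cderivnS; apply: is_cderiveP; exact: h. Qed.

Lemma derivs_cont_diff m D : derivs m D -> ccontinuous (D m) -> cont_diff m (D 0%N).
Proof.
move=> h c; split=> k lt.
  by move=> x; rewrite (derivs_cderivn h (ltnW lt)); have [] := is_cderive_derivable (h k lt x).
rewrite (derivs_cderivn h lt); move: lt; rewrite leq_eqVlt => /orP[/eqP->//|lt].
by split=> x; have [] := is_cderive_continuous (h k lt x).
Qed.

Lemma derivs_smooth D : (forall m, derivs m D) -> smooth (D 0%N).
Proof.
move=> h m; apply: derivs_cont_diff => //.
by split=> x; have [] := is_cderive_continuous (h m.+1 m (leqnn _) x).
Qed.

Lemma smooth_derivs f : smooth f -> forall m, derivs m (fun n => cderivn n f).
Proof. by move=> h m; exact: cont_diff_derivs. Qed.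

Lemma derivs_all_cderivn D : (forall m, derivs m D) -> forall n, cderivn n (D 0%N) = D n.
Proof. by move=> h n; exact: (derivs_cderivn (h n)). Qed.

Lemma derivsD m D E : derivs m D -> derivs m E -> derivs m (fun n x => D n x + E n x).
Proof. by move=> hD hE n lt x; apply: is_cderiveD; [exact: hD|exact: hE]. Qed.

Lemma derivsZ m c D : derivs m D -> derivs m (fun n x => c * D n x).
Proof. by move=> hD n lt x; apply: is_cderiveZ; exact: hD. Qed.

Lemma derivs_sum m I (s : seq I) (D : I -> nat -> R -> C) :
  (forall i, derivs m (D i)) -> derivs m (fun n x => \sum_(i <- s) D i n x).
Proof. by move=> hD n lt x; apply: is_cderive_sum => i; exact: hD. Qed.

Lemma derivs_aff m s t D : derivs m D ->
  derivs m (fun n x => s%:C ^+ n * D n (s * x + t)).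
Proof.
move=> hD n lt x; rewrite exprSr -mulrA; apply: is_cderiveZ.
by apply: is_cderive_aff; exact: hD.
Qed.

Lemma derivs_expi m c : derivs m (fun n x => (0 +i* c) ^+ n * expi (c * x)).
Proof.
by move=> n lt x; rewrite exprSr -mulrA; apply: is_cderiveZ; exact: is_cderive_expi.
Qed.

Lemma derivs_poly m p : derivs m (fun n x => (derivn n p).[x%:C]).
Proof. by move=> n lt x; rewrite derivnS; exact: is_cderive_poly. Qed.

Lemma expi0 : expi (0 : R) = 1.
Proof. by rewrite /expi cos0 sin0. Qed.

Lemma expiD (x y : R) : expi (x + y) = expi x * expi y.
Proof.
by apply: cReIm_eq; rewrite ?cReM ?cImM /= ?cosD ?sinD //; ring.
Qed.

Lemma mean_value (f : R -> R) (f' : R -> R) (a b : R) : a <= b ->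
  (forall x : R, is_derive x 1 f (f' x)) ->
  exists2 c, a <= c <= b & f b - f a = f' c * (b - a).
Proof.
move=> ab df.
have [x xab ->] : exists2 x, x \in `[a, b] & f b - f a = f' x * (b - a).
  apply: MVT_segment => //.
  by apply: derivable_within_continuous => x _; have [h _] := df x; exact: h.
by exists x => //; rewrite in_itv in xab.
Qed.

(** The mean value theorem fails for complex values and is applied to the real and imaginary parts
    separately; this is the origin of the factor 2 in many later constants. *)
Lemma normc_increment (f : R -> C) f' (a b M : R) :
  (forall x, is_cderive f x (f' x)) ->
  (forall x, Num.min a b <= x <= Num.max a b -> Normc.normc (f' x) <= M) ->
  Normc.normc (f b - f a) <= 2 * M * `|b - a|.
Proof.
wlog ab : a b / a <= b => [H|] df hM.
  have [/H|/ltW ba] := leP a b; first by apply.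
  rewrite normcB distrC; apply: H => // x hx; apply: hM.
  by rewrite minC maxC.
rewrite (min_idPl ab) (max_idPr ab) in hM.
apply: le_trans (normc_ReIm _) _; rewrite cReB cImB.
rewrite -mulrA mulr_natl mulr2n [`|b - a|]ger0_norm ?subr_ge0 //; apply: lerD.
  have [c cab e] := mean_value ab (fun x => (df x).1).
  move: e; rewrite /re_fun => ->; rewrite normrM [`|b - a|]ger0_norm ?subr_ge0 //.
  by rewrite ler_wpM2r ?subr_ge0 //; apply: le_trans (Re_normc _) (hM _ cab).
have [c cab e] := mean_value ab (fun x => (df x).2).
move: e; rewrite /im_fun => ->; rewrite normrM [`|b - a|]ger0_norm ?subr_ge0 //.
by rewrite ler_wpM2r ?subr_ge0 //; apply: le_trans (Im_normc _) (hM _ cab).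
Qed.

Lemma normc_expi (x : R) : Normc.normc (expi x) = 1.
Proof. by rewrite /= cos2Dsin2 sqrtr1. Qed.

(** * Taylor coefficients of symbols *)

(** Each derivative of exp(-i k xi) brings down a factor -i k, where -i is written [0 -i* 1]. *)
Lemma symbol_derivn s q M (w : int -> 'M[C]_(s, q)) (bw : zbnd M w) p i j :
  cderivn p (fun xi => symbol w xi i j) 0 = (0 -i* 1) ^+ p * mom 'X^p w i j.
Proof.
pose D n x := \sum_(k <- zr M) (w k i j * ((0 +i* - k%:~R) ^+ n * expi (- k%:~R * x))).
have dD m : derivs m D.
  by apply: derivs_sum => k; apply: derivsZ; exact: derivs_expi.
have -> : (fun xi => symbol w xi i j) = D 0%N.
  apply/funext => x; rewrite symbolE (zsumE (zbndZ _ bw)) summxE; apply: eq_bigr => k _.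
  by rewrite mxE expr0 mul1r mulrC mulNr.
rewrite derivs_all_cderivn // /D /mom (zsumE (zbndZ _ bw)) summxE mulr_sumr.
apply: eq_bigr => k _; rewrite mxE mulr0 expi0 mulr1 hornerXn mulrA -exprMn mulrC.
congr (_ ^+ _ * _); apply: cReIm_eq; rewrite ?cReM ?cImM /=.
  by rewrite -(rmorph_int (real_complex R)) /=; ring.
by rewrite -(rmorph_int (real_complex R)) /=; ring.
Qed.

Lemma mI_neq0 p : (0 -i* 1 : C) ^+ p != 0.
Proof. by rewrite expf_neq0 // eq_complex /= oppr_eq0 oner_eq0 andbF. Qed.

Lemma mxeqO_mom M s q k (w w' : int -> 'M[C]_(s, q)) : zbnd M w -> zbnd M w' ->
  mxeqO k (symbol w) (symbol w') <->
  forall f : {poly C}, (size f <= k)%N -> mom f w = mom f w'.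
Proof.
move=> bw bw'; split=> [h|h i j p lt].
  apply: (mom_monom bw bw') => p lt; apply/matrixP => i j.
  have := h i j p lt; rewrite (symbol_derivn bw) (symbol_derivn bw').
  by move=> e; apply: (mulfI (mI_neq0 p)); exact: e.
by rewrite (symbol_derivn bw) (symbol_derivn bw') h // size_polyXn.
Qed.

Lemma symbol0 s q : symbol (fun=> 0 : 'M[C]_(s, q)) = fun=> 0.
Proof. by apply/funext => x; apply: zsum0 => k; rewrite scaler0. Qed.

Lemma mom_0 s q f : mom f (fun=> 0 : 'M[C]_(s, q)) = 0.
Proof. by apply: zsum0 => k; rewrite scaler0. Qed.

Lemma symbol_convolution M M' s q t (v : int -> 'M[C]_(s, q)) (u : int -> 'M[C]_(q, t)) x :
  zbnd M v -> zbnd M' u -> symbol (convolution v u) x = symbol v x *m symbol u x.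
Proof.
move=> bv bu; rewrite !symbolE.
transitivity (\zsum_(j) \zsum_(k)
   expi (- (j%:~R * x)) *: (v (j - k) *m u k)).
  apply: eq_zsum => j; rewrite (@zsumZ R M') // => k /bu ->; exact: mulmx0.
rewrite (@zsum_exch _ (M + M') M'); last first.
  by move=> i j /scaler_neq0/mulmx_neq0[/(zbnd_neq0 bv) ? /(zbnd_neq0 bu) ?]; lia.
rewrite (zsum_mull _ (zbndZ _ bu)); apply: eq_zsum => k.
rewrite (zsum_mulr _ (zbndZ _ bv)) [LHS](zsum_shift k); apply: eq_zsum => j.
rewrite addrK scaleMl scaleMr scalerA; congr (_ *: _).
by rewrite -expiD; congr expi; rewrite rmorphD /=; ring.
Qed.

Lemma symbol_subdivision M N r s (a : int -> 'M[C]_r) (v : int -> 'M[C]_(s, r)) x :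
  zbnd N a -> zbnd M v -> symbol (subdivision a v) x = 2 *: (symbol v (2 * x) *m symbol a x).
Proof.
move=> ba bv; rewrite !symbolE.
transitivity (\zsum_(j) \zsum_(k)
   expi (- (j%:~R * x)) *: (2 *: (v k *m a (j - 2 * k)))).
  apply: eq_zsum => j; rewrite (subdivisionE ba) (@zsumZ R M) // => k /bv ->.
  by rewrite mul0mx scaler0.
rewrite (@zsum_exch _ (2 * M + N) M); last first.
  move=> i j /scaler_neq0/scaler_neq0/mulmx_neq0[/(zbnd_neq0 bv) ? /(zbnd_neq0 ba) ?].
  lia.
rewrite (zsum_mulr _ (zbndZ _ bv)) (@zsumZ R M) => [|k /bv->]; last by rewrite scaler0 mul0mx.
apply: eq_zsum => k; rewrite (zsum_mull _ (zbndZ _ ba)) (@zsumZ R N) => [|j /ba->]; last first.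
  by rewrite scaler0 mulmx0.
rewrite [LHS](zsum_shift (2 * k)); apply: eq_zsum => j.
rewrite addrK scaleMl scaleMr !scalerA; congr (_ *: _).
rewrite mulrC -mulrA -expiD; congr (_ * expi _); rewrite rmorphD rmorphM /=; ring.
Qed.

End Calculus.

(** * Integrals of compactly supported functions *)

Section Integrals.
Variable R : realType.
Local Notation C := R[i].
Local Notation mu := (@lebesgue_measure R).

(* Cousin's lemma: a local property that is additive over adjacent intervals is
   global. *)
Lemma cousin (P : R -> R -> Prop) (a b : R) : a <= b ->
  (forall x y z, x <= y <= z -> P x y -> P y z -> P x z) ->
  (forall t, a <= t <= b -> exists2 d : R, 0 < d &
     forall x y, a <= x -> x <= t <= y -> y <= b -> t - d < x -> y < t + d -> P x y) ->
  P a b.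
Proof.
move=> ab Padd Ploc.
pose S := [set x | a <= x <= b /\ P a x].
have Sa : S a.
  split; first by rewrite lexx.
  have [|d d0 h] := Ploc a; first by rewrite lexx ab.
  by apply: h; rewrite ?lexx //; lra.
have hS : has_sup S by split; [exists a | exists b => x [/andP[]]].
set s := sup S.
have sa : a <= s by exact: sup_upper_bound.
have sb : s <= b by apply: sup_le_ub; [exists a | move=> x [/andP[]]].
have [|d d0 h] := Ploc s; first by rewrite sa sb.
have [x [/andP[ax xb] Pax] sx] := sup_adherent d0 hS.
have xs : x <= s by apply: sup_upper_bound => //; split => //; rewrite ax xb.
pose y := Num.min b (s + d / 2).
have sy : s <= y by rewrite /y le_min sb /=; lra.
have yb : y <= b by rewrite /y ge_min lexx.
have ysd : y <= s + d / 2 by rewrite /y ge_min lexx orbT.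
have Pxy : P x y by apply: h => //; [rewrite xs sy | lra].
have Pay : P a y by apply: (Padd a x y) => //; rewrite ax (le_trans xs sy).
have : y <= s by apply: sup_upper_bound => //; split => //; rewrite (le_trans sa sy) yb.
rewrite {1}/y ge_min => /orP[bs|]; last by lra.
by have -> : b = y by apply/le_anti; rewrite yb (le_trans bs sy).
Qed.

Lemma cont_eps (f : R -> R) (x : R) : {for x, continuous f} <->
  forall e : R, 0 < e -> exists2 d : R, 0 < d & forall y, `|y - x| < d -> `|f y - f x| < e.
Proof.
split=> [cf e e0|h].
  move/cvgrPdist_lt: cf => /(_ e e0) /nbhs_ballP [d /= d0 H]; exists d => // y yx.
  by rewrite distrC; apply: H; rewrite /ball /= distrC.
apply/cvgrPdist_lt => e e0; have [d d0 H] := h e e0.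
apply/nbhs_ballP; exists d => //= y; rewrite /ball /= => yx.
by rewrite distrC; apply: H; rewrite distrC.
Qed.

Lemma ccont_eps (f : R -> C) : ccontinuous f -> forall (x e : R), 0 < e ->
  exists2 d : R, 0 < d & forall y, `|y - x| < d -> Normc.normc (f y - f x) < e.
Proof.
move=> [c1 c2] x e e0; have e2 : 0 < e / 2 by lra.
have [d1 d10 h1] := (cont_eps _ _).1 (c1 x) _ e2.
have [d2 d20 h2] := (cont_eps _ _).1 (c2 x) _ e2.
exists (Num.min d1 d2) => [|y]; first by rewrite lt_min d10 d20.
rewrite lt_min => /andP[/h1 k1 /h2 k2]; apply: le_lt_trans (normc_ReIm _) _.
by rewrite cReB cImB; move: k1 k2; rewrite /re_fun /im_fun; lra.
Qed.

Lemma eps_ccont (f : R -> C) : (forall (x e : R), 0 < e ->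
  exists2 d : R, 0 < d & forall y, `|y - x| < d -> Normc.normc (f y - f x) < e) -> ccontinuous f.
Proof.
move=> h; split=> x; apply/cont_eps => e e0; have [d d0 H] := h x e e0.
  exists d => // y /H k; apply: le_lt_trans k; rewrite /re_fun -cReB; exact: Re_normc.
exists d => // y /H k; apply: le_lt_trans k; rewrite /im_fun -cImB; exact: Im_normc.
Qed.

(** Only s is confined to the interval while t ranges over the whole line; this makes the property
    additive over adjacent intervals, as [cousin] requires, with the minimum of the two radii. *)
Lemma unif_cont_segment (f : R -> C) (a b e : R) : a <= b -> ccontinuous f -> 0 < e ->
  exists2 d : R, 0 < d & forall s t, a <= s <= b -> `|s - t| < d -> Normc.normc (f s - f t) <= e.
Proof.
move=> ab /ccont_eps cf e0.
apply: (@cousin (fun x y => exists2 d : R, 0 < d & forall s t, x <= s <= y ->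
  `|s - t| < d -> Normc.normc (f s - f t) <= e) a b ab) => [x y z _ [d1 d10 h1] [d2 d20 h2]|t _].
  exists (Num.min d1 d2) => [|s t /andP[xs sz]]; first by rewrite lt_min d10 d20.
  rewrite lt_min => /andP[k1 k2]; have [sy|/ltW ys] := leP s y.
    by apply: h1; rewrite ?xs ?sy.
  by apply: h2; rewrite ?ys ?sz.
have e2 : 0 < e / 2 by lra.
have [d d0 h] := cf t _ e2; exists (d / 2) => [|x y _ xty _ xd yd]; first lra.
exists (d / 2) => [|s u sxy su]; first lra.
have k1 : `|s - t| < d / 2 by rewrite ltr_norml; lra.
have k2 : `|u - t| < d by move: su k1; rewrite !ltr_norml; lra.
have k3 : `|s - t| < d by apply: (lt_trans k1); lra.
have -> : f s - f u = (f s - f t) + (f t - f u) by ring.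
apply: le_trans (normcD _ _) _; rewrite (normcB (f t)).
by have := h _ k2; have := h _ k3; lra.
Qed.

Lemma bounded_segment (f : R -> C) (a b : R) : a <= b -> ccontinuous f ->
  exists2 B, 0 <= B & forall s, a <= s <= b -> Normc.normc (f s) <= B.
Proof.
move=> ab /ccont_eps cf.
apply: (@cousin (fun x y => exists2 B, 0 <= B & forall s, x <= s <= y ->
  Normc.normc (f s) <= B) a b ab) => [x y z _ [B1 B10 h1] [B2 B20 h2]|t _].
  exists (B1 + B2) => [|s /andP[xs sz]]; first lra.
  have [sy|/ltW ys] := leP s y.
    by have := h1 s; rewrite xs sy => /(_ isT); lra.
  by have := h2 s; rewrite ys sz => /(_ isT); lra.
have [d d0 h] := cf t 1 ltr01; exists d => // x y _ xty _ xd yd.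
exists (1 + Normc.normc (f t)) => [|s sxy]; first by have := normc_ge0 (f t); lra.
have -> : f s = (f s - f t) + f t by ring.
have k : `|s - t| < d by rewrite ltr_norml; lra.
apply: le_trans (normcD _ _) _.
by have := h _ k; lra.
Qed.

Definition csupp (L : R) (f : R -> C) := forall x, L < `|x| -> f x = 0.

Lemma csupp_bounded L f : 0 <= L -> csupp L f -> ccontinuous f ->
  exists2 B, 0 <= B & forall s, Normc.normc (f s) <= B.
Proof.
move=> L0 sf cf; have [|B B0 h] := @bounded_segment f (- L) L _ cf; first lra.
exists B => // s; have [sL|/sf ->] := leP `|s| L; last by rewrite Normc.normc0.
by apply: h; rewrite -ler_norml.
Qed.

Lemma csupp_unif L f : 0 <= L -> csupp L f -> ccontinuous f -> forall e : R, 0 < e ->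
  exists2 d : R, 0 < d & forall s t, `|s - t| < d -> Normc.normc (f s - f t) <= e.
Proof.
move=> L0 sf cf e e0; have [|d d0 h] := @unif_cont_segment f (- L) L e _ cf e0; first lra.
exists d => // s t st; have [sL|Ls] := leP `|s| L.
  by apply: h; rewrite // -ler_norml.
have [tL|Lt] := leP `|t| L.
  by rewrite normcB; apply: h; rewrite // ?(distrC t) // -ler_norml.
by rewrite (sf s) // (sf t) // subrr Normc.normc0 ltW.
Qed.

Section Real.
Variables (g : R -> R) (L : R).
Hypothesis (L0 : 0 < L) (cg : continuous g) (sg : forall x, L < `|x| -> g x = 0).

Lemma restrict_supp (A : set R) : `[- L, L] `<=` A -> g \_ A = g.
Proof.
move=> LA; apply/funext => x; rewrite patchE; case: ifPn => // /negP xA.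
apply/esym/sg; rewrite ltNge; apply/negP => xL; apply: xA; rewrite inE; apply: LA.
by rewrite /= in_itv /= -ler_norml.
Qed.

Lemma supp_integrable : mu.-integrable setT (EFin \o g).
Proof.
have h : mu.-integrable `[- L, L] (EFin \o g).
  by apply: continuous_compact_integrable; [exact: segment_compact | exact: continuous_subspaceT].
have mI : measurable (`[- L, L]%classic : set (measurableTypeR R)) by exact: measurable_itv.
move/(integrable_mkcond _ mI): h; rewrite restrict_EFin restrict_supp //.
Qed.

Lemma Rintegral_primitive (G : R -> R) : (forall x : R, is_derive x 1 G (g x)) ->
  Rintegral mu setT g = G L - G (- L).
Proof.
move=> dG; have LL : - L < L by rewrite gtrN.
have cG : continuous G.
  by move=> x; apply: differentiable_continuous; apply/derivable1_diffP; have [h _] := dG x; exact: h.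
rewrite -{1}(@restrict_supp `[- L, L]%classic) // -Rintegral_mkcond /Rintegral.
rewrite (@continuous_FTC2 _ g G) //.
- exact: continuous_subspaceT.
- split.
  + by move=> x _; have [h _] := dG x; exact: h.
  + by apply: cvg_at_right_filter; exact: cG.
  + by apply: cvg_at_left_filter; exact: cG.
- by move=> x _; rewrite derive1E; have [_ h] := dG x; exact: h.
Qed.

Lemma primitive_ex : exists G : R -> R, forall x : R, is_derive x 1 G (g x).
Proof.
exists (fun x => Rintegral mu [set` Interval -oo%O (BRight x)] g) => x.
have cgx : {for x, continuous g} by exact: cg.
have [|||h1 h2] := @continuous_FTC1 R g -oo%O x (x + 1) _ _ _ cgx.
- by rewrite ltrDl.
- apply: (@integrableS _ _ _ _ setT) => //; exact: supp_integrable.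
- exact: ltNyr.
by split; [exact: h1|rewrite -derive1E; exact: h2].
Qed.

End Real.

(** The interface to integration: from here on, linearity, change of variables and bounds for
    continuous functions of bounded support are read on a primitive. *)
Lemma cRintegral_primitive (L : R) f F : 0 < L -> ccontinuous f -> csupp L f ->
  (forall x, is_cderive F x (f x)) -> cRintegral f = F L - F (- L).
Proof.
move=> L0 [c1 c2] sf dF; apply: cReIm_eq; rewrite ?cReB ?cImB /=.
  apply: (@Rintegral_primitive (re_fun f) L L0 c1 _ (re_fun F)) => x; first by rewrite /re_fun => /sf ->.
  exact: (dF x).1.
apply: (@Rintegral_primitive (im_fun f) L L0 c2 _ (im_fun F)) => x; first by rewrite /im_fun => /sf ->.
exact: (dF x).2.
Qed.

Lemma cprimitive_ex (L : R) f : 0 < L -> ccontinuous f -> csupp L f ->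
  exists F, forall x, is_cderive F x (f x).
Proof.
move=> L0 [c1 c2] sf.
have [|G1 h1] := primitive_ex (g := re_fun f) (L := L) c1; first by move=> x /sf; rewrite /re_fun => ->.
have [|G2 h2] := primitive_ex (g := im_fun f) (L := L) c2; first by move=> x /sf; rewrite /im_fun => ->.
by exists (fun x => G1 x +i* G2 x) => x; split; [exact: h1 | exact: h2].
Qed.

Lemma csupp_widen (L L' : R) f : L <= L' -> csupp L f -> csupp L' f.
Proof. by move=> LL sf x xL; apply: sf; exact: le_lt_trans xL. Qed.

Lemma ccontinuousD f g : ccontinuous f -> ccontinuous g -> ccontinuous (fun x : R => f x + g x : C).
Proof.
move=> /ccont_eps cf /ccont_eps cg; apply: eps_ccont => x e e0; have e2 : 0 < e / 2 by lra.
have [d1 d10 h1] := cf x _ e2; have [d2 d20 h2] := cg x _ e2.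
exists (Num.min d1 d2) => [|y]; first by rewrite lt_min d10 d20.
rewrite lt_min => /andP[/h1 k1 /h2 k2].
have -> : f y + g y - (f x + g x) = (f y - f x) + (g y - g x) by ring.
by apply: le_lt_trans (normcD _ _) _; lra.
Qed.

Lemma ccontinuousM f g : ccontinuous f -> ccontinuous g -> ccontinuous (fun x : R => f x * g x : C).
Proof.
move=> [f1 f2] [g1 g2].
have e1 : re_fun (fun x => f x * g x) =
    (fun y => re_fun f y * re_fun g y - im_fun f y * im_fun g y).
  by apply/funext => y; exact: cReM.
have e2 : im_fun (fun x => f x * g x) =
    (fun y => re_fun f y * im_fun g y + im_fun f y * re_fun g y).
  by apply/funext => y; exact: cImM.
split=> x; rewrite ?e1 ?e2.
  by apply: (@continuousB _ _ _ (fun y => re_fun f y * re_fun g y)); apply: continuousM;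
    [exact: f1|exact: g1|exact: f2|exact: g2].
by apply: (@continuousD _ _ _ (fun y => re_fun f y * im_fun g y)); apply: continuousM;
    [exact: f1|exact: g2|exact: f2|exact: g1].
Qed.

Lemma ccontinuous_cst (c : C) : ccontinuous (fun _ : R => c).
Proof. by split; apply: cst_continuous. Qed.

Lemma ccontinuousZ (c : C) f : ccontinuous f -> ccontinuous (fun x : R => c * f x).
Proof. by move=> cf; apply: ccontinuousM => //; exact: ccontinuous_cst. Qed.

Lemma ccontinuous_sum I (s : seq I) (f : I -> R -> C) : (forall i, ccontinuous (f i)) ->
  ccontinuous (fun x => \sum_(i <- s) f i x).
Proof.
move=> h; elim: s => [|i s IH].
  by under eq_fun do rewrite big_nil; exact: ccontinuous_cst.
by under eq_fun do rewrite big_cons; exact: ccontinuousD.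
Qed.

Lemma ccontinuous_aff (s t : R) f : ccontinuous f -> ccontinuous (fun x : R => f (s * x + t) : C).
Proof.
move=> [c1 c2]; have ca : continuous (fun x : R => s * x + t).
  move=> x; apply: differentiable_continuous; apply/derivable1_diffP.
  have [h _] := is_derive_aff s t x; exact: h.
split=> x.
  exact: (@continuous_comp _ _ _ (fun y => s * y + t) (re_fun f) x (ca x) (c1 _)).
exact: (@continuous_comp _ _ _ (fun y => s * y + t) (im_fun f) x (ca x) (c2 _)).
Qed.

Lemma cRintegralD (L : R) f g : 0 < L -> ccontinuous f -> ccontinuous g -> csupp L f -> csupp L g ->
  cRintegral (fun x => f x + g x) = cRintegral f + cRintegral g.
Proof.
move=> L0 cf cg sf sg.
have [F hF] := cprimitive_ex L0 cf sf; have [G hG] := cprimitive_ex L0 cg sg.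
rewrite (cRintegral_primitive L0 cf sf hF) (cRintegral_primitive L0 cg sg hG).
rewrite (@cRintegral_primitive L _ (fun x => F x + G x)) //; first by ring.
- exact: ccontinuousD.
- by move=> x xL; rewrite sf // sg // addr0.
- by move=> x; apply: is_cderiveD.
Qed.

Lemma cRintegralZ (L : R) c f : 0 < L -> ccontinuous f -> csupp L f ->
  cRintegral (fun x => c * f x) = c * cRintegral f.
Proof.
move=> L0 cf sf; have [F hF] := cprimitive_ex L0 cf sf.
rewrite (cRintegral_primitive L0 cf sf hF) (@cRintegral_primitive L _ (fun x => c * F x)) //.
- by ring.
- exact: ccontinuousZ.
- by move=> x xL; rewrite sf // mulr0.
- by move=> x; apply: is_cderiveZ.
Qed.

Lemma cRintegral_0 : cRintegral (fun _ : R => 0 : C) = 0.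
Proof.
rewrite (@cRintegral_primitive 1 _ (fun _ => 0)) ?subrr //; first exact: ccontinuous_cst.
by move=> x; exact: is_cderive_cst.
Qed.

Lemma cRintegral_sum (L : R) I (s : seq I) (f : I -> R -> C) : 0 < L ->
  (forall i, ccontinuous (f i)) -> (forall i, csupp L (f i)) ->
  cRintegral (fun x => \sum_(i <- s) f i x) = \sum_(i <- s) cRintegral (f i).
Proof.
move=> L0 cf sf; elim: s => [|i s IH].
  rewrite big_nil -[RHS]cRintegral_0; congr cRintegral; apply/funext => x; exact: big_nil.
rewrite big_cons -IH -(cRintegralD L0) //.
- by congr cRintegral; apply/funext => x; exact: big_cons.
- exact: ccontinuous_sum.
- by move=> x xL; rewrite big1 // => j _; exact: sf.
Qed.

Lemma cRintegral_deriv (L : R) F f : 0 < L -> ccontinuous f -> csupp L F ->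
  (forall x, is_cderive F x (f x)) -> csupp L f -> cRintegral f = 0.
Proof.
move=> L0 cf sF dF sf; have L1 : 0 < L + 1 by lra.
have LL : L <= L + 1 by lra.
rewrite (cRintegral_primitive L1 cf (csupp_widen LL sf) dF).
by rewrite !sF ?subrr // ?normrN gtr0_norm //; lra.
Qed.

(** Continuity extends the vanishing to the boundary points, which are approached by points slightly
    further out. *)
Lemma csupp_closed (L : R) f : 0 < L -> ccontinuous f -> csupp L f ->
  forall x, L <= `|x| -> f x = 0.
Proof.
move=> L0 cf sf x Lx; apply/Normc.eq0_normc/le_anti; rewrite normc_ge0 andbT.
apply/ler_addgt0Pl => e e0; rewrite addr0.
have [d d0 h] := ccont_eps cf x e0.
have x0 : 0 < `|x| by lra.
pose y := x * (1 + d / (2 * `|x|)).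
have p : 0 < d / (2 * `|x|) by rewrite divr_gt0 //; lra.
have fy : f y = 0.
  apply: sf; rewrite /y normrM [`|1 + _|]gtr0_norm; last by lra.
  by rewrite (le_lt_trans Lx) // ltr_pMr //; lra.
have := h y; rewrite fy sub0r normcN => H; apply/ltW/H.
have -> : y - x = x * (d / (2 * `|x|)) by rewrite /y; ring.
rewrite normrM (gtr0_norm p).
have -> : `|x| * (d / (2 * `|x|)) = d / 2 by field; rewrite gt_eqF.
by lra.
Qed.

Lemma primitive_const (F f : R -> C) (x y : R) : (forall z, is_cderive F z (f z)) ->
  (forall z, Num.min x y <= z <= Num.max x y -> f z = 0) -> F x = F y.
Proof.
move=> dF f0; apply/esym/eqP; rewrite -subr_eq0; apply/eqP/Normc.eq0_normc/le_anti.
rewrite normc_ge0 andbT.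
apply: le_trans (@normc_increment R F f x y 0 dF _) _; last by rewrite mulr0 mul0r.
by move=> z /f0 ->; rewrite Normc.normc0.
Qed.

(* Change of variables; since both sides are primitives evaluated outside the
   support, no measure theory is needed. *)
Lemma cRintegral_aff (L s t : R) f : 0 < L -> 0 < s -> ccontinuous f -> csupp L f ->
  cRintegral (fun x => f (s * x + t)) = (s^-1)%:C * cRintegral f.
Proof.
move=> L0 s0 cf sf; have [F hF] := cprimitive_ex L0 cf sf.
pose L' := (L + `|t|) / s.
have h1 : 0 < L' by rewrite divr_gt0 // ltr_wpDr.
have hs : csupp L' (fun x => f (s * x + t)).
  move=> x; rewrite /L' ltr_pdivrMr // => h; apply: sf.
  have : `|x * s| <= `|s * x + t| + `|t|.
    by rewrite mulrC -{1}[s * x](addrK t); exact: ler_normB.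
  by rewrite normrM (gtr0_norm s0); lra.
rewrite (cRintegral_primitive L0 cf sf hF).
rewrite (@cRintegral_primitive L' _ (fun x => (s^-1)%:C * F (s * x + t)) h1 _ hs); last first.
- move=> x; have -> : f (s * x + t) = (s^-1)%:C * (s%:C * f (s * x + t)).
    by rewrite mulrA -rmorphM /= mulVf ?gt_eqF // mul1r.
  by apply: is_cderiveZ; apply: is_cderive_aff.
- exact: ccontinuous_aff.
have f0 := csupp_closed L0 cf sf.
rewrite -mulrBr; congr (_ * (_ - _)); apply: (primitive_const hF) => z hz; apply: f0.
  have e : s * L' + t = L + (`|t| + t) by rewrite /L'; field; rewrite gt_eqF.
  have ht : 0 <= `|t| + t by have := ler_norm (- t); rewrite normrN; lra.
  move: hz; rewrite minC (min_idPl _) ?e ?lerDl // => /andP[h _].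
  by rewrite (le_trans h) // ler_norm.
have e : s * - L' + t = - (L + (`|t| - t)) by rewrite /L'; field; rewrite gt_eqF.
have ht : 0 <= `|t| - t by have := ler_norm t; lra.
move: hz; rewrite (max_idPr _) ?e ?lerN2 ?lerDl // => /andP[_ h].
rewrite -normrN (le_trans _ (ler_norm (- z))) //; lra.
Qed.

(** The constant 4 L is the length 2 L of the interval times the factor 2 of [normc_increment]. *)
Lemma cRintegral_bound (L B : R) f : 0 < L -> ccontinuous f -> csupp L f ->
  (forall x, `|x| <= L -> Normc.normc (f x) <= B) -> Normc.normc (cRintegral f) <= 4 * L * B.
Proof.
move=> L0 cf sf hB; have [F hF] := cprimitive_ex L0 cf sf.
rewrite (cRintegral_primitive L0 cf sf hF).
have LL : - L <= L by lra.
apply: le_trans (@normc_increment R F f (- L) L B hF _) _.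
  by rewrite (min_idPl LL) (max_idPr LL) => x; rewrite -ler_norml => /hB.
by rewrite opprK [`|_|]gtr0_norm //; [nra | lra].
Qed.

End Integrals.

(** * Riemann sums and polynomial approximation *)

Section Riemann.
Variable R : realType.
Local Notation C := R[i].

Lemma pow2_small (d : R) : 0 < d -> exists n0, forall n, (n0 <= n)%N -> 2 ^- n < d.
Proof.
move=> d0; exists (Num.bound d^-1) => n le.
have h : d^-1 < (Num.bound d^-1)%:R by apply: archi_boundP; rewrite invr_ge0 ltW.
have h2 : ((Num.bound d^-1)%:R : R) <= 2 ^+ n.
  rewrite -natrX ler_nat (leq_trans le) //; apply: ltnW; exact: ltn_expl.
by rewrite invf_plt ?posrE ?exprn_gt0 //; apply: lt_le_trans h2.
Qed.

Lemma telescope_iota (V : zmodType) (h : nat -> V) n :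
  \sum_(j <- iota 0 n) (h j.+1 - h j) = h n - h 0%N.
Proof.
elim: n => [|n IH]; first by rewrite big_nil subrr.
by rewrite -{1}[n.+1]addn1 iotaD big_cat IH /= big_seq1 add0n addrC addrA subrK.
Qed.

Lemma riemann (L : R) (f : R -> C) : 0 < L -> ccontinuous f -> csupp L f ->
  forall e : R, 0 < e -> exists n0, forall n, (n0 <= n)%N ->
  Normc.normc (\zsum_(k) ((2 ^- n)%:C * f (2 ^- n * k%:~R)) - cRintegral f) <= e.
Proof.
move=> L0 cf sf e e0.
(* An integer radius makes both ends of the interval grid points at every level n. *)
pose P := (Num.bound L).+1.
have LP : L <= P%:R.
  by apply: ltW; apply: lt_trans (archi_boundP (ltW L0)) _; rewrite ltr_nat.
have P0 : (0 : R) < P%:R by rewrite ltr0n.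
have sfP : csupp P%:R f by exact: csupp_widen sf.
have [F hF] := cprimitive_ex P0 cf sfP.
(* There are 2 P / h cells, and on each the error is at most 2 h times the oscillation of f, by
   [normc_increment] applied to F(y) - f(x_j) y; an oscillation of e / (4 P) gives e in total. *)
have w0 : 0 < e / (4 * P%:R) by rewrite divr_gt0 ?mulr_gt0.
have [d d0 hd] := csupp_unif (ltW P0) sfP cf w0.
have [n0 hn0] := pow2_small d0; exists n0 => n /hn0 nd.
pose h : R := 2 ^- n; have h0 : 0 < h by rewrite invr_gt0 exprn_gt0.
pose K := (P * 2 ^ n)%N.
pose x (j : nat) : R := h * (j%:R - K%:R).
have hK : h * K%:R = P%:R.
  by rewrite /h /K natrM natrX mulrC -mulrA mulfV ?mulr1 // expf_neq0.
have xS j : x j.+1 = x j + h by rewrite /x -[j.+1]addn1 natrD; ring.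
have fend j : (2 * K <= j)%N -> f (x j) = 0.
  move=> le; apply: (csupp_closed P0 cf sfP); rewrite -hK /x normrM (gtr0_norm h0).
  rewrite ler_pM2l // (le_trans _ (ler_norm _)) // -natrB ?ler_nat; lia.
have zb : zbnd K (fun k : int => h%:C * f (h * k%:~R)).
  move=> k lt; rewrite (csupp_closed P0 cf sfP) ?mulr0 //.
  by rewrite -hK normrM (gtr0_norm h0) ler_pM2l // -intr_norm -abszE -[K%:R]/(K%:~R) ler_int ltW // ltz_nat.
rewrite (zsumE zb) /zr big_map -addn1 iotaD big_cat /= big_seq1.
have e2 (j : nat) : h * (j%:Z - K%:Z)%:~R = x j by rewrite /x rmorphB.
rewrite e2 add0n fend // mulr0 addr0.
under eq_bigr do rewrite e2.
have eI : cRintegral f = \sum_(j <- iota 0 (2 * K)) (F (x j.+1) - F (x j)).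
  rewrite telescope_iota (cRintegral_primitive P0 cf sfP hF) -hK /x; congr (F _ - F _).
    by rewrite natrM; ring.
  by ring.
rewrite eI -sumrB; apply: le_trans (normc_sum _ _ _) _.
apply: (@le_trans _ _ (\sum_(j <- iota 0 (2 * K)) (2 * (e / (4 * P%:R)) * h))).
  apply: ler_sum => j _; rewrite normcB xS.
  have dG y : is_cderive (fun y => F y + (- f (x j)) * y%:C) y (f y - f (x j)).
    have hh := is_cderiveZ (- f (x j)) (is_cderive_id y); rewrite mulr1 in hh.
    exact: (is_cderiveD (hF y) hh).
  have := @normc_increment R _ _ (x j) (x j + h) (e / (4 * P%:R)) dG.
  have -> : F (x j + h) + - f (x j) * (x j + h)%:C - (F (x j) + - f (x j) * (x j)%:C) =
      F (x j + h) - F (x j) - h%:C * f (x j) by rewrite rmorphD; ring.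
  rewrite [`|_ - _|](_ : _ = h); last by rewrite addrAC subrr add0r gtr0_norm.
  have xh : x j <= x j + h by rewrite lerDl ltW.
  rewrite (min_idPl xh) (max_idPr xh); apply => y hy.
  by apply: hd; rewrite ltr_norml; move: nd; rewrite -/h; lra.
rewrite big_const_seq count_predT size_iota iter_addr_0 -[leLHS]mulr_natl natrM.
have -> : 2 * K%:R * (2 * (e / (4 * P%:R)) * h) = (h * K%:R) * (e / P%:R).
  by field; rewrite gt_eqF.
by rewrite hK mulrCA mulfV ?gt_eqF // mulr1.
Qed.

End Riemann.

(** * Weierstrass approximation together with derivatives *)

Section Bernstein.

(** The Bernstein polynomial with coefficients f 0, ..., f n, in de Casteljau form. Its value at x
    is the mean of f under the binomial law of parameters n and x, and the facts about it below are
    inductions on n. *)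
Fixpoint bern (T : comNzRingType) (n : nat) (f : nat -> T) : {poly T} :=
  if n is m.+1 then 'X * bern m (fun k => f k.+1) + (1 - 'X) * bern m f else (f 0%N)%:P.

Variable R : realType.
Local Notation C := R[i].

Lemma bernS (T : comNzRingType) n (f : nat -> T) x :
  (bern n.+1 f).[x] = x * (bern n (fun k => f k.+1)).[x] + (1 - x) * (bern n f).[x].
Proof. by rewrite /= !(hornerD, hornerM, hornerN, hornerX, hornerC). Qed.

Lemma bern_cst (T : comNzRingType) n (c x : T) : (bern n (fun=> c)).[x] = c.
Proof. by elim: n => [|n IH]; [exact: hornerC|rewrite bernS IH; ring]. Qed.

Lemma bern_sub (T : comNzRingType) n (f g : nat -> T) (x : T) :
  (bern n f).[x] - (bern n g).[x] = (bern n (fun k => f k - g k)).[x].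
Proof.
elim: n f g => [|n IH] f g; first by rewrite /= !hornerC.
by rewrite !bernS -!IH; ring.
Qed.

Lemma bern_lin n (a b : R) (f : nat -> R) (x : R) :
  (bern n (fun k => a + b * f k)).[x] = a + b * (bern n f).[x].
Proof.
elim: n f => [|n IH] f; first by rewrite /= !hornerC.
by rewrite !bernS (IH (fun k => f k.+1)) IH; ring.
Qed.

Lemma bern_le n (f g : nat -> R) (x : R) : 0 <= x <= 1 ->
  (forall k, (k <= n)%N -> f k <= g k) -> (bern n f).[x] <= (bern n g).[x].
Proof.
move=> /andP[x0 x1]; elim: n f g => [|n IH] f g h; first by rewrite /= !hornerC h.
rewrite !bernS; apply: lerD; apply: ler_wpM2l => //; first by apply: IH => k hk; exact: h.
  lra.
by apply: IH => k hk; apply: h; exact: leqW.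
Qed.

Lemma bern_normc n (f : nat -> C) (x : R) : 0 <= x <= 1 ->
  Normc.normc (bern n f).[x%:C] <= (bern n (fun k => Normc.normc (f k))).[x].
Proof.
move=> /andP[x0 x1]; elim: n f => [|n IH] f; first by rewrite /= !hornerC.
rewrite !bernS; apply: le_trans (normcD _ _) _; apply: lerD; rewrite Normc.normcM.
  by rewrite normc_real ger0_norm // ler_wpM2l.
rewrite -(rmorph1 (real_complex R)) -rmorphB normc_real ger0_norm; last by lra.
by rewrite ler_wpM2l //; lra.
Qed.

(** The variance n x (1 - x) of the binomial law plus the squared bias. The centre c is arbitrary
    because the recursion shifts it by 1. *)
Lemma bern_variance n (c x : R) :
  (bern n (fun k => (k%:R - c) ^+ 2)).[x] = n%:R * x * (1 - x) + (n%:R * x - c) ^+ 2.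
Proof.
elim: n c => [|n IH] c; first by rewrite /= hornerC; ring.
have -> : (bern n.+1 (fun k => (k%:R - c) ^+ 2)).[x] =
    x * (bern n (fun k => (k%:R - (c - 1)) ^+ 2)).[x] + (1 - x) * (bern n (fun k => (k%:R - c) ^+ 2)).[x].
  rewrite bernS; congr (_ * (bern n _).[_] + _); apply/funext => k.
  by rewrite -[k.+1]addn1 natrD; ring.
by rewrite !IH -[n.+1]addn1 natrD; ring.
Qed.

Lemma bernstein (g : R -> C) (e : R) : ccontinuous g -> 0 < e ->
  exists p : {poly C}, forall x, 0 <= x <= 1 -> Normc.normc (g x - p.[x%:C]) <= e.
Proof.
move=> cg e0; have e2 : 0 < e / 2 by lra.
have [d d0 hd] := unif_cont_segment (ler01 : 0 <= 1 :> R) cg e2.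
have [B B0 hB] := bounded_segment (ler01 : 0 <= 1 :> R) cg.
(* Chebyshev's argument: where the sample point is at distance at least d from x, the trivial bound
   2 B is at most b times the squared distance. The mean of this term is at most b / n, and n is
   taken so large that this is at most e / 2. *)
pose b : R := 2 * B / d ^+ 2.
have d2 : 0 < d ^+ 2 by rewrite exprn_gt0.
have b0 : 0 <= b by rewrite divr_ge0 ?mulr_ge0 // ltW.
pose n := (Num.bound (2 * b / e)).+1.
have n0 : (0 : R) < n%:R by rewrite ltr0n.
have nb : 2 * b / e < n%:R.
  apply: lt_trans (archi_boundP _) _; last by rewrite ltr_nat.
  by apply: divr_ge0; [exact: mulr_ge0 | exact: ltW].
exists (bern n (fun k => g (k%:R / n%:R))) => x x01.
rewrite normcB -{1}(bern_cst n (g x) x%:C) bern_sub.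
apply: le_trans (bern_normc _ _ x01) _.
apply: (@le_trans _ _ (bern n (fun k => e / 2 + b / n%:R ^+ 2 * (k%:R - n%:R * x) ^+ 2)).[x]).
  apply: bern_le => // k kn.
  have hk : 0 <= (k%:R / n%:R : R) <= 1.
    by rewrite divr_ge0 //= ler_pdivrMr // mul1r ler_nat.
  have -> : b / n%:R ^+ 2 * (k%:R - n%:R * x) ^+ 2 = b * (k%:R / n%:R - x) ^+ 2.
    by field; rewrite gt_eqF.
  set s := k%:R / n%:R in hk *.
  have [lt|ge] := ltP `|s - x| d.
    apply: le_trans (hd _ _ hk lt) _; rewrite lerDl; apply: mulr_ge0 => //; exact: sqr_ge0.
  apply: (@le_trans _ _ (2 * B)).
    apply: le_trans (normcD _ _) _; rewrite normcN.
    by have := hB _ hk; have := hB _ x01; lra.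
  have : d ^+ 2 <= (s - x) ^+ 2 by rewrite -[leRHS]real_normK ?num_real // lerXn2r ?nnegrE // ltW.
  move=> /(ler_wpM2l b0); rewrite {1}/b mulfVK ?gt_eqF //.
  by move=> h; apply: le_trans h _; rewrite lerDr ltW.
rewrite bern_lin bern_variance subrr expr0n addr0.
have -> : b / n%:R ^+ 2 * (n%:R * x * (1 - x)) = (b / n%:R) * (x * (1 - x)).
  by field; rewrite gt_eqF.
have h1 : x * (1 - x) <= 1 by move: x01; nra.
have h2 : b / n%:R <= e / 2.
  by move: nb; rewrite ler_pdivrMr // ltr_pdivrMr // => h; lra.
have h3 : 0 <= b / n%:R by apply: divr_ge0 => //; exact: ltW.
have : b / n%:R * (x * (1 - x)) <= b / n%:R * 1 by rewrite ler_wpM2l.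
lra.
Qed.

Lemma weierstrass (g : R -> C) (K e : R) : ccontinuous g -> 0 < K -> 0 < e ->
  exists p : {poly C}, forall x, `|x| <= K -> Normc.normc (g x - p.[x%:C]) <= e.
Proof.
move=> cg K0 e0.
have [p hp] := bernstein (ccontinuous_aff (2 * K) (- K) cg) e0.
exists (p \Po (((2 * K)^-1)%:C *: 'X + (2^-1)%:C%:P)) => x; rewrite ler_norml => xK.
pose t := (2 * K)^-1 * x + 2^-1.
have t01 : 0 <= t <= 1.
  have -> : t = (x + K) / (2 * K) by rewrite /t; field; rewrite gt_eqF.
  by rewrite divr_ge0 ?ler_pdivrMr //=; lra.
have := hp t t01; rewrite horner_comp hornerD hornerZ hornerX hornerC -rmorphM -rmorphD.
have -> : 2 * K * t - K = x by rewrite /t; field; rewrite gt_eqF.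
by [].
Qed.

Definition primpoly (c : C) (q : {poly C}) : {poly C} :=
  \poly_(j < (size q).+1) (if j is k.+1 then q`_k / k.+1%:R else c).

Lemma primpoly_deriv c q : (primpoly c q)^`() = q.
Proof.
apply/polyP => k; rewrite coef_deriv coef_poly ltnS; case: ltnP => h.
  by rewrite -[LHS]mulr_natr mulfVK // pnatr_eq0.
by rewrite mul0rn nth_default.
Qed.

Lemma primpoly0 c q : (primpoly c q).[0] = c.
Proof. by rewrite horner_coef0 coef_poly. Qed.

(* Simultaneous approximation of the derivatives: approximate the last one and
   integrate. *)
Lemma weierstrass_derivs (K : R) N (D : nat -> R -> C) (e : R) : 0 < K -> 0 < e ->
  derivs N D -> ccontinuous (D N) ->
  exists p : {poly C}, forall n x, (n <= N)%N -> `|x| <= K ->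
    Normc.normc (D n x - (derivn n p).[x%:C]) <= e.
Proof.
move=> K0; elim: N D e => [|N IH] D e e0 dD cD.
  have [p hp] := weierstrass cD K0 e0; exists p => n x; rewrite leqn0 => /eqP-> xK.
  exact: hp.
(* Integrating the error of the derivatives over a length of at most K costs 2 K, by
   [normc_increment]. *)
pose e' := Num.min e (e / (2 * K)).
have e'0 : 0 < e' by rewrite lt_min e0 divr_gt0 // mulr_gt0.
have [q hq] := IH (fun n => D n.+1) e' e'0 (fun n lt => dD n.+1 lt) cD.
exists (primpoly (D 0%N 0) q) => -[|n] x le xK; last first.
  by rewrite derivSn primpoly_deriv (le_trans (hq n x le xK)) // ge_min lexx.
have dG y : is_cderive (fun y => D 0%N y + -1 * (primpoly (D 0%N 0) q).[y%:C]) y (D 1%N y - q.[y%:C]).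
  have hp := is_cderive_poly (primpoly (D 0%N 0) q) y; rewrite primpoly_deriv in hp.
  by have := is_cderiveD (dD 0%N (ltn0Sn N) y) (is_cderiveZ (-1) hp); rewrite mulN1r.
have := @normc_increment R _ _ 0 x e' dG; rewrite primpoly0 !mulN1r subrr !subr0 => h.
rewrite derivn0 (le_trans (h _)) => // [y hy|].
  apply: hq => //; move: xK hy; rewrite !ler_norml => /andP[x1 x2].
  by rewrite ge_min le_max => /andP[/orP[] ? /orP[] ?]; lra.
have h1 : e' <= e / (2 * K) by rewrite ge_min lexx orbT.
apply: (@le_trans _ _ (2 * (e / (2 * K)) * K)).
  by apply: ler_pM => //; [rewrite mulr_ge0 // ltW | rewrite ler_wpM2l].
by have -> : 2 * (e / (2 * K)) * K = e by field; rewrite gt_eqF.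
Qed.

End Bernstein.

(** * Compactly supported distributions *)

Section Distributions.
Variable R : realType.
Local Notation C := R[i].

Definition distr_bound (D : (R -> C) -> C) (B K : R) (N : nat) :=
  forall f : R -> C, smooth f -> forall M : R,
  (forall j x, (j <= N)%N -> `|x| <= K -> Normc.normc (cderivn j f x) <= M) ->
  Normc.normc (D f) <= B * M.

(* Continuous linear forms on smooth functions, with the constants normalized. *)
Definition distr (D : (R -> C) -> C) :=
  (forall (c : C) (f g : R -> C), smooth f -> smooth g ->
     D (fun x => c * f x + g x) = c * D f + D g) /\
  exists (B K : R) (N : nat), [/\ 0 <= B, 1 <= K & distr_bound D B K N].

Lemma distr_bound_widen D B K N B' K' N' : B <= B' -> K <= K' -> (N <= N')%N -> 0 <= K' ->
  distr_bound D B K N -> distr_bound D B' K' N'.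
Proof.
move=> BB KK NN K0 h f sf M hM.
have M0 : 0 <= M.
  by apply: le_trans (hM 0%N 0 _ _) => //; [exact: normc_ge0 | rewrite normr0].
apply: le_trans (h f sf M _) _; last by rewrite ler_wpM2r.
move=> j x jN xK; apply: hM; [exact: leq_trans NN | exact: le_trans KK].
Qed.

Lemma distr_cs (phi : cs_distribution R) : distr phi.
Proof.
split; first exact: pairing_linear.
have [B [K [N h]]] := pairing_continuous phi.
exists (Num.max B 0), (Num.max K 1), N; split; rewrite ?le_max ?lexx ?orbT //.
apply: (distr_bound_widen _ _ _ _ h); rewrite ?le_max ?lexx ?ler01 ?orbT //.
Qed.

Lemma derivs_smooth_eq (D : nat -> R -> C) f : (forall m, derivs m D) -> D 0%N =1 f ->
  smooth f /\ forall n, cderivn n f = D n.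
Proof.
move=> dD /funext <-; split; first exact: derivs_smooth.
exact: derivs_all_cderivn.
Qed.

Lemma smooth_cst (c : C) : smooth (fun _ : R => c).
Proof.
apply: (@derivs_smooth R (fun n _ => if n is 0%N then c else 0)).
by move=> m n lt x; case: n lt => [|n] _; exact: is_cderive_cst.
Qed.

Lemma derivs_lin m (c : C) (D E : nat -> R -> C) : derivs m D -> derivs m E ->
  derivs m (fun n x => c * D n x + E n x).
Proof. by move=> dD dE; apply: derivsD => //; exact: derivsZ. Qed.

Lemma smooth_lin (c : C) f g : smooth f -> smooth g -> smooth (fun x : R => c * f x + g x).
Proof.
move=> sf sg.
have [||h _] := @derivs_smooth_eq (fun n x => c * cderivn n f x + cderivn n g x) (fun x => c * f x + g x).
- by move=> m; apply: derivs_lin; exact: smooth_derivs.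
- by move=> x; rewrite !cderivn0.
exact: h.
Qed.

Lemma smoothZ (c : C) f : smooth f -> smooth (fun x : R => c * f x).
Proof.
move=> sf; have := smooth_lin c sf (smooth_cst 0).
by under eq_fun do rewrite addr0.
Qed.

Lemma smoothD f g : smooth f -> smooth g -> smooth (fun x : R => f x + g x : C).
Proof. by move=> sf sg; have := smooth_lin 1 sf sg; under eq_fun do rewrite mul1r. Qed.

Lemma smooth_sum I (s : seq I) (f : I -> R -> C) : (forall i, smooth (f i)) ->
  smooth (fun x => \sum_(i <- s) f i x).
Proof.
move=> h; elim: s => [|i s IH].
  by have := smooth_cst 0; congr smooth; apply/funext => x; rewrite big_nil.
by have := smoothD (h i) IH; congr smooth; apply/funext => x; rewrite big_cons.
Qed.

Lemma smooth_aff_cderivn (s t : R) f : smooth f -> smooth (fun x : R => f (s * x + t) : C) /\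
  forall n, cderivn n (fun x => f (s * x + t)) = fun x => s%:C ^+ n * cderivn n f (s * x + t).
Proof.
move=> sf; apply: derivs_smooth_eq => [m|x]; last by rewrite expr0 mul1r cderivn0.
exact: (derivs_aff s t (@smooth_derivs R f sf m)).
Qed.

Lemma smooth_aff (s t : R) f : smooth f -> smooth (fun x : R => f (s * x + t) : C).
Proof. by move=> /(smooth_aff_cderivn s t)[]. Qed.

Lemma cderivn_aff n (s t : R) (f : R -> C) : smooth f ->
  cderivn n (fun x => f (s * x + t)) = fun x => s%:C ^+ n * cderivn n f (s * x + t).
Proof. by move=> /(smooth_aff_cderivn s t)[]. Qed.

Lemma smooth_poly (p : {poly C}) : smooth (fun x : R => p.[x%:C]).
Proof. by apply: (@derivs_smooth R (fun n x => (derivn n p).[x%:C])) => m; exact: derivs_poly. Qed.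

Lemma smooth_mono p : smooth (fun x : R => x%:C ^+ p).
Proof. by have := smooth_poly 'X^p; under eq_fun do rewrite hornerXn. Qed.

Lemma smooth_expi (c : R) : smooth (fun x : R => expi (c * x)).
Proof.
by apply: (derivs_smooth_eq (fun m => @derivs_expi R m c) _).1 => x; rewrite expr0 mul1r.
Qed.

Section Linear.
Variable D : (R -> C) -> C.
Hypothesis dD : distr D.

Lemma distr0 : D (fun=> 0) = 0.
Proof.
have [lin _] := dD; have := lin 1 _ _ (smooth_cst 0) (smooth_cst 0).
under eq_fun do rewrite mulr0 addr0.
by rewrite mul1r => /esym/eqP; rewrite -subr_eq0 addrK => /eqP.
Qed.

Lemma distrZ c f : smooth f -> D (fun x => c * f x) = c * D f.
Proof.
move=> sf; have [lin _] := dD; have := lin c _ _ sf (smooth_cst 0).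
by under eq_fun do rewrite addr0; rewrite distr0 addr0.
Qed.

Lemma distrD f g : smooth f -> smooth g -> D (fun x => f x + g x) = D f + D g.
Proof.
move=> sf sg; have [lin _] := dD; have := lin 1 _ _ sf sg.
by under eq_fun do rewrite mul1r; rewrite mul1r.
Qed.

Lemma distr_lsum I (s : seq I) (f : I -> R -> C) : (forall i, smooth (f i)) ->
  D (fun x => \sum_(i <- s) f i x) = \sum_(i <- s) D (f i).
Proof.
move=> h; elim: s => [|i s IH].
  by rewrite big_nil -[RHS]distr0; congr D; apply/funext => x; rewrite big_nil.
rewrite big_cons -IH -distrD //; last exact: smooth_sum.
by congr D; apply/funext => x; rewrite big_cons.
Qed.

Lemma distr_poly (p : {poly C}) :
  D (fun x => p.[x%:C]) = \sum_(i < size p) p`_i * D (fun x => x%:C ^+ i).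
Proof.
transitivity (D (fun x => \sum_(i < size p) p`_i * x%:C ^+ i)).
  by congr D; apply/funext => x; rewrite horner_coef.
rewrite distr_lsum => [|i]; last by apply: smoothZ; exact: smooth_mono.
by apply: eq_bigr => i _; rewrite distrZ //; exact: smooth_mono.
Qed.

End Linear.

(* Polynomials are dense, so a compactly supported distribution is determined by
   its moments. *)
Lemma distr_moments D : distr D -> (forall p, D (fun x => x%:C ^+ p) = 0) ->
  forall g, smooth g -> D g = 0.
Proof.
move=> dD hD g sg; have [lin [B [K [N [B0 K1 hB]]]]] := dD.
have K0 : 0 < K by lra.
apply/Normc.eq0_normc/le_anti; rewrite normc_ge0 andbT; apply/ler_addgt0Pl => e e0; rewrite addr0.
have e1 : 0 < e / (B + 1) by rewrite divr_gt0 // ltr_wpDl.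
have [p hp] := weierstrass_derivs K0 e1 (@smooth_derivs R g sg N) ((sg N).2 N (leqnn N)).
have -> : D g = D (fun x => -1 * p.[x%:C] + g x).
  by rewrite lin ?(distr_poly dD) ?big1 ?mulr0 ?add0r // => [i _|]; [rewrite hD mulr0|exact: smooth_poly].
apply: (@le_trans _ _ (B * (e / (B + 1)))).
  apply: hB; first by apply: smooth_lin => //; exact: smooth_poly.
  move=> j x jN xK.
  have [||_ ->] := @derivs_smooth_eq (fun j x => -1 * (derivn j p).[x%:C] + cderivn j g x)
     (fun x => -1 * p.[x%:C] + g x).
  - by move=> m; apply: derivs_lin; [exact: derivs_poly|exact: smooth_derivs].
  - by move=> y; rewrite cderivn0.
  by have := hp j x jN xK; rewrite mulN1r addrC.
have -> : B * (e / (B + 1)) = e * (B / (B + 1)) by ring.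
by rewrite -[leRHS]mulr1 ler_wpM2l ?(ltW e0) // ler_pdivrMr ?mul1r; lra.
Qed.

Lemma distrB D E : distr D -> distr E -> distr (fun f => D f - E f).
Proof.
move=> [lD [B [K [N [B0 K1 hB]]]]] [lE [B' [K' [N' [B0' K1' hB']]]]]; split.
  by move=> c f g sf sg; rewrite lD // lE //; ring.
exists (B + B'), (Num.max K K'), (maxn N N'); split; first exact: addr_ge0.
  by rewrite le_max K1.
have K0 : 0 <= Num.max K K' by rewrite le_max (le_trans ler01 K1).
move=> f sf M hM; apply: le_trans (normcD _ _) _; rewrite normcN mulrDl; apply: lerD.
  have := distr_bound_widen (lexx B) (_ : K <= Num.max K K') (leq_maxl N N') K0 hB.
  by apply => //; rewrite le_max lexx.
have := distr_bound_widen (lexx B') (_ : K' <= Num.max K K') (leq_maxr N N') K0 hB'.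
by apply => //; rewrite le_max lexx orbT.
Qed.

Lemma distr_scale c D : distr D -> distr (fun f => c * D f).
Proof.
move=> [lD [B [K [N [B0 K1 hB]]]]]; split.
  by move=> c' f g sf sg; rewrite lD //; ring.
exists (Normc.normc c * B), K, N; split => //; first by rewrite mulr_ge0 // normc_ge0.
by move=> f sf M hM; rewrite Normc.normcM -mulrA ler_wpM2l ?normc_ge0 // hB.
Qed.

Lemma distr_zero : distr (fun=> 0).
Proof.
split; first by move=> *; rewrite mulr0 addr0.
exists 0, 1, 0%N; split => //.
by move=> f sf M hM; rewrite mul0r Normc.normc0.
Qed.

Lemma distr_sum I (s : seq I) (D : I -> (R -> C) -> C) : (forall i, distr (D i)) ->
  distr (fun f => \sum_(i <- s) D i f).
Proof.
move=> h; elim: s => [|i s IH].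
  by have := distr_zero; congr distr; apply/funext => f; rewrite big_nil.
have := distrB (h i) (distr_scale (-1) IH); congr distr; apply/funext => f.
by rewrite big_cons mulN1r opprK.
Qed.

Lemma distr_aff (s t : R) D : distr D -> distr (fun f => D (fun x => f (s * x + t))).
Proof.
move=> [lD [B [K [N [B0 K1 hB]]]]]; split.
  by move=> c f g sf sg; rewrite lD //; exact: smooth_aff.
pose S := (`|s| + 1) ^+ N.
have S1 : 1 <= `|s| + 1 by rewrite lerDr.
have S0 : 0 <= S by rewrite exprn_ge0 // (le_trans ler01).
exists (B * S), (`|s| * K + `|t| + 1), N; split; first exact: mulr_ge0.
  by rewrite lerDr addr_ge0 // mulr_ge0 // (le_trans ler01).
move=> f sf M hM; rewrite -mulrA; apply: hB; first exact: smooth_aff.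
have M0 : 0 <= M.
  apply: le_trans (hM 0%N 0 _ _) => //; first exact: normc_ge0.
  by rewrite normr0 !addr_ge0 // mulr_ge0 // (le_trans ler01).
move=> j x jN xK; rewrite cderivn_aff // Normc.normcM normcX normc_real; apply: ler_pM.
- exact: exprn_ge0.
- exact: normc_ge0.
- apply: (@le_trans _ _ ((`|s| + 1) ^+ j)).
    by rewrite lerXn2r ?nnegrE ?lerDl // (le_trans ler01).
  by rewrite ler_weXn2l.
- apply: hM => //; apply: le_trans (ler_normD _ _) _; rewrite normrM.
  by have := ler_wpM2l (normr_ge0 s) xK; lra.
Qed.

Lemma smooth_continuous (g : R -> C) : smooth g -> ccontinuous g.
Proof. by move=> sg; have := (sg 0%N).2 0%N (leqnn _); rewrite cderivn0. Qed.

Lemma distr_integral (L : R) (f : R -> C) : 1 <= L -> ccontinuous f -> csupp L f ->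
  distr (fun g => cRintegral (fun x => f x * g x)).
Proof.
move=> L1 cf sf; have L0 : 0 < L by lra.
have c g : smooth g -> ccontinuous (fun x => f x * g x).
  by move=> sg; apply: ccontinuousM => //; exact: smooth_continuous.
have s (g : R -> C) : csupp L (fun x => f x * g x) by move=> x /sf ->; rewrite mul0r.
split.
  move=> k g h sg sh; rewrite -(cRintegralZ k L0) //; last exact: c.
  rewrite -(cRintegralD L0) //; try exact: c.
  - by congr cRintegral; apply/funext => x; ring.
  - by apply: ccontinuousZ; exact: c.
  - by move=> x xL; rewrite sf // mul0r mulr0.
have [B B0 hB] := csupp_bounded (ltW L0) sf cf.
exists (4 * L * B), L, 0%N; split => //; first by rewrite !mulr_ge0 // ltW.
move=> g sg M hM; rewrite -mulrA; apply: cRintegral_bound => //; first exact: c.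
move=> x xL; rewrite Normc.normcM; apply: ler_pM; rewrite ?normc_ge0 //.
by have := hM 0%N x (leqnn _) xL; rewrite cderivn0.
Qed.

Let mi : C := 0 -i* 1.

(** The Taylor polynomial of exp(-i t) of degree less than p; [erem] is the corresponding
    remainder. *)
Definition etay (p : nat) : {poly C} := \sum_(q < p) (mi ^+ q / q`!%:R) *: 'X^q.

Lemma etayS p : etay p.+1 = etay p + (mi ^+ p / p`!%:R) *: 'X^p.
Proof. by rewrite /etay big_ord_recr. Qed.

Lemma etay_deriv p : (etay p.+1)^`() = mi *: etay p.
Proof.
elim: p => [|p IH]; first by rewrite etayS /etay big_ord0 add0r expr0 alg_polyC derivC scaler0.
rewrite etayS derivD IH (etayS p) scalerDr; congr (_ + _).
rewrite derivZ derivXn /= -scalerMnr scalerMnl scalerA; congr (_ *: _).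
rewrite -[LHS]mulr_natr factS natrM exprS; field.
by rewrite -(natrD _ 1) !pnatr_eq0 -lt0n fact_gt0.
Qed.

Definition erem (p : nat) (t : R) : C := expi (- t) - (etay p).[t%:C].

(** Differentiation lowers the order of the remainder by one. At order 0 the remainder is the
    exponential itself, and the formula persists because the predecessor of 0 is 0. *)
Lemma erem_deriv p t : is_cderive (erem p) t (mi * erem p.-1 t).
Proof.
have h1 := is_cderive_expi (-1) t.
have e1 : (0 +i* -1 : C) = mi by [].
have h2 := is_cderiveZ (-1) (is_cderive_poly (etay p) t).
apply: is_cderive_eq (is_cderiveD h1 h2) _ _ => [y|].
  by rewrite /erem !mulN1r.
rewrite /erem mulrBr !mulN1r e1; congr (_ - _).
case: p {h2} => [|p]; last by rewrite etay_deriv hornerZ.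
by rewrite /etay big_ord0 deriv0 !horner0 mulr0.
Qed.

Lemma etay0 p : (etay p.+1).[0] = 1.
Proof.
elim: p => [|p IH]; first by rewrite etayS /etay big_ord0 add0r expr0 fact0 alg_polyC hornerC mul1r invr1.
by rewrite etayS hornerD IH hornerZ hornerXn expr0n mulr0 addr0.
Qed.

(** Each integration contributes 2 |t|; the sharp constant 1 / p! is not sought, since only the
    power of t matters for isolating a moment. *)
Lemma erem_bound p t : Normc.normc (erem p t) <= (2 * `|t|) ^+ p.
Proof.
elim: p t => [|p IH] t.
  by rewrite /erem /etay big_ord0 horner0 subr0 normc_expi expr0.
have e0 : erem p.+1 0 = 0 by rewrite /erem oppr0 expi0 etay0 subrr.
have := @normc_increment R (erem p.+1) _ 0 t ((2 * `|t|) ^+ p) (erem_deriv p.+1).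
rewrite e0 !subr0 => h; rewrite exprS mulrAC; apply: h => x hx.
rewrite Normc.normcM [Normc.normc mi](_ : _ = 1); last first.
  by rewrite /= sqrrN expr0n expr1n add0r sqrtr1.
rewrite mul1r (le_trans (IH x)) //= lerXn2r ?nnegrE ?mulr_ge0 // ler_wpM2l //.
move: hx; rewrite ge_min le_max => /andP[/orP[] h1 /orP[] h2]; rewrite ler_norml;
 have := ler_norm t; have := ler_norm (- t); rewrite normrN; lra.
Qed.

Lemma derivs_erem m p (s : R) : derivs m (fun n x => (s%:C ^+ n * (mi ^+ n * erem (p - n) (s * x + 0)))).
Proof.
apply: (@derivs_aff R m s 0 (fun n x => mi ^+ n * erem (p - n) x)) => n lt x.
by rewrite exprSr -mulrA subnS; apply: is_cderiveZ; exact: erem_deriv.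
Qed.

(* Vanishing of the Fourier transform forces all moments to vanish: divide the
   Taylor remainder of the exponential by the power of the frequency. *)
Lemma distr_fourier D : distr D -> (forall xi : R, D (fun x => expi (- (x * xi))) = 0) ->
  forall p, D (fun x => x%:C ^+ p) = 0.
Proof.
move=> dD hD p; have [lin [B [K [N [B0 K1 hB]]]]] := dD.
have [n] := ubnP p; elim: n p => // n IH p; rewrite ltnS => pn.
have IHp q : (q < p)%N -> D (fun x => x%:C ^+ q) = 0 by move=> qp; apply: IH; exact: leq_trans pn.
pose c : C := mi ^+ p / p`!%:R.
have c0 : c != 0.
  by rewrite mulf_neq0 ?mI_neq0 // invr_neq0 // pnatr_eq0 -lt0n fact_gt0.
suff h : Normc.normc c * Normc.normc (D (fun x => x%:C ^+ p)) <= 0.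
  apply/Normc.eq0_normc/le_anti; rewrite normc_ge0 andbT.
  have cp : 0 < Normc.normc c.
    by rewrite lt_neqAle normc_ge0 andbT eq_sym; apply: contra c0 => /eqP/Normc.eq0_normc ->.
  by move: h; rewrite pmulr_rle0.
apply/ler_addgt0Pl => e e0; rewrite addr0.
pose Q := B * (2 * K) ^+ p.+1.
have Q0 : 0 <= Q by rewrite mulr_ge0 // exprn_ge0 //; lra.
(* The frequency at which the transform is tested. Since D vanishes on exp(-i s x) and on lower
   powers, D of the remainder is -c s^p D(x^p); it is at most s^(p+1) Q, and division by s^p leaves
   s Q, which is at most e. *)
pose s := Num.min 1 (e / (Q + 1)).
have s0 : 0 < s by rewrite lt_min ltr01 divr_gt0 // ltr_wpDl.
have s1 : s <= 1 by rewrite ge_min lexx.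
have se : s * (Q + 1) <= e by rewrite -ler_pdivlMr ?ltr_wpDl // ge_min lexx orbT.
have De : D (erem p.+1 \o (fun x => s * x + 0)) = - (c * s%:C ^+ p * D (fun x => x%:C ^+ p)).
  transitivity (D (fun x => 1 * expi (- (x * s)) +
       \sum_(q < p.+1) (- (mi ^+ q / q`!%:R) * s%:C ^+ q) * x%:C ^+ q)).
    congr D; apply/funext => x /=; rewrite /erem addr0 mulrC mul1r /etay horner_sum -sumrN.
    congr (_ + _); apply: eq_bigr => q _; rewrite hornerZ hornerXn rmorphM exprMn; ring.
  rewrite lin; last first.
  - by apply: smooth_sum => q; apply: smoothZ; exact: smooth_mono.
  - by have := smooth_expi (- s); congr smooth; apply/funext => x; rewrite mulNr mulrC.
  rewrite hD mulr0 add0r (distr_lsum dD) => [|q]; last by apply: smoothZ; exact: smooth_mono.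
  rewrite big_ord_recr /= big1 ?add0r => [|q _].
    by rewrite (distrZ dD) ?mulNr //; exact: smooth_mono.
  by rewrite (distrZ dD) ?IHp ?mulr0 //; exact: smooth_mono.
have [||hsm hder] := @derivs_smooth_eq
    (fun n x => (s%:C ^+ n * (mi ^+ n * erem (p.+1 - n) (s * x + 0))))
    (erem p.+1 \o (fun x => s * x + 0)).
- by move=> m'; exact: derivs_erem.
- by move=> x; rewrite !expr0 !mul1r subn0.
have hb : Normc.normc (D (erem p.+1 \o (fun x => s * x + 0))) <= B * (s ^+ p.+1 * (2 * K) ^+ p.+1).
  apply: hB => // j x jN xK.
  rewrite hder.
  rewrite !Normc.normcM !normcX normc_real gtr0_norm //.
  rewrite [Normc.normc mi](_ : _ = 1); last by rewrite /= sqrrN expr0n expr1n add0r sqrtr1.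
  rewrite expr1n mul1r addr0.
  have b1 := erem_bound (p.+1 - j) (s * x).
  have b2 : (2 * `|s * x|) ^+ (p.+1 - j) <= (s * (2 * K)) ^+ (p.+1 - j).
    rewrite lerXn2r ?nnegrE ?mulr_ge0 ?(ltW s0) //; try lra.
    by rewrite normrM (gtr0_norm s0) mulrCA ler_wpM2l ?(ltW s0) // ler_wpM2l.
  have sj : 0 <= s ^+ j by rewrite exprn_ge0 // ltW.
  apply: le_trans (ler_wpM2l sj (le_trans b1 b2)) _; rewrite exprMn mulrA -exprD.
  apply: ler_pM; rewrite ?exprn_ge0 ?(ltW s0) //; try lra.
    by rewrite ler_wiXn2l ?(ltW s0) // -leq_subLR.
  by rewrite ler_weXn2l ?leq_subr //; lra.
clearbody c; move: hb; rewrite De normcN !Normc.normcM normcX normc_real gtr0_norm // exprS.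
have sp : 0 < s ^+ p by rewrite exprn_gt0.
have -> : B * (s * s ^+ p * (2 * K) ^+ p.+1) = s ^+ p * (s * Q) by rewrite /Q; ring.
rewrite mulrAC [_ * s ^+ p]mulrC ler_pM2l // => h; apply: le_trans h _.
by apply: le_trans se; rewrite mulrDr lerDl mulr1 ltW.
Qed.

End Distributions.

(** * From pointwise to exponential decay *)

Section FiniteDim.
Variable R : realType.
Local Notation C := R[i].

(* Pointwise smallness on a set of vectors of a finite-dimensional space is
   uniform: expand in a maximal independent family of the set. *)
Lemma finite_dim_uniform (d : nat) (J : Type) (P : 'rV[C]_d -> Prop)
    (q : nat -> J -> 'rV[C]_d -> R) :
  (forall n j m (al : 'I_m -> C) (w : 'I_m -> 'rV[C]_d),
     q n j (\sum_i al i *: w i) <= \sum_i Normc.normc (al i) * q n j (w i)) ->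
  (forall v, P v -> forall e : R, 0 < e -> exists n0, forall n, (n0 <= n)%N ->
     forall j, q n j v <= e) ->
  forall kappa : R, 0 < kappa -> exists n0, forall n, (n0 <= n)%N -> forall v, P v ->
     forall j, q n j v <= kappa * mnorm v.
Proof.
move=> qlin qP kappa k0.
(* The ranks of finite families in P are bounded by d. A family of maximal rank spans every vector
   of P, since adjoining a vector outside its row space would raise the rank. *)
pose Q (k : nat) := `[< exists m (B : 'M[C]_(m, d)), (forall i, P (row i B)) /\ \rank B = k >].
have Q0 : exists k, Q k.
  exists 0%N; apply/asboolP; exists 0%N, 0; split; last exact: mxrank0.
  by case.
have Qb k : Q k -> (k <= d)%N.
  by move=> /asboolP [m [B [_ <-]]]; exact: rank_leq_col.
have [k /asboolP [m [B [PB rB]]] kmax] := ex_maxnP Q0 Qb.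
have sub v : P v -> (v <= B)%MS.
  move=> Pv; apply/negPn/negP => nv.
  have rBv : (\rank B < \rank (col_mx B v))%N.
    rewrite -[(\rank B < _)%N]andTb ltn_neqAle; apply/andP; split => //; apply/andP; split.
      apply: contra nv => /eqP e.
      have sB : (B <= col_mx B v)%MS by rewrite -addsmxE addsmxSl.
      have : (col_mx B v <= B)%MS by rewrite -(geq_leqif (mxrank_leqif_sup sB)) e.
      by apply: submx_trans; rewrite -addsmxE addsmxSr.
    by apply: mxrankS; rewrite -addsmxE addsmxSl.
  have : Q (\rank (col_mx B v)).
    apply/asboolP; exists (m + 1)%N, (col_mx B v); split => // j.
    case: (split_ordP j) => j' ->; first by rewrite rowKu; exact: PB.
    by rewrite rowKd row_id.
  by move=> /kmax; rewrite leqNgt -rB rBv.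
(* The coordinates of v in the family are v times the pseudo-inverse, hence bounded by its norm
   times that of v. *)
pose e := kappa / (mnorm (pinvmx B) + 1).
have e0 : 0 < e by rewrite divr_gt0 // ltr_wpDl // mnorm_ge0.
have h j := qP _ (PB j) e e0.
pose n0 j := projT1 (cid (h j)).
exists (\max_j n0 j) => n nn v Pv j.
pose al := v *m pinvmx B.
have ev : v = \sum_t al 0 t *: row t B by rewrite -mulmx_sum_row mulmxKpV // sub.
rewrite {1}ev; apply: le_trans (qlin _ _ _ _ _) _.
apply: (@le_trans _ _ (\sum_t Normc.normc (al 0 t) * e)).
  apply: ler_sum => t _; rewrite ler_wpM2l ?normc_ge0 //.
  by apply: (projT2 (cid (h t))); apply: leq_trans nn; exact: (leq_bigmax t).
rewrite -mulr_suml.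
have -> : \sum_t Normc.normc (al 0 t) = mnorm al.
  by rewrite /mnorm big_ord1.
apply: (@le_trans _ _ (mnorm v * mnorm (pinvmx B) * e)).
  by rewrite ler_wpM2r ?(ltW e0) // mnormM.
rewrite -mulrA mulrC; apply: ler_wpM2r; first exact: mnorm_ge0.
rewrite /e mulrCA -[leRHS]mulr1 ler_wpM2l ?(ltW k0) // ler_pdivrMr ?mul1r ?lerDl //.
by rewrite ltr_wpDl // mnorm_ge0.
Qed.

End FiniteDim.

(** * Exponential decay of the cascade *)

Section Decay.
Variable R : realType.
Local Notation C := R[i].
Variables (r : nat) (a : int -> 'M[C]_r) (N : nat).
Hypothesis aN : zbnd N a.
Local Notation A := (A a).

Lemma convolution_lin M n m (al : 'I_m -> C) (u : 'I_m -> int -> 'cV[C]_r) j :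
  (forall i, zbnd M (u i)) ->
  convolution (A n) (fun k => \sum_i al i *: u i k) j =
  \sum_i al i *: convolution (A n) (u i) j.
Proof.
move=> uM; rewrite convolutionE (@zsumE _ M); last first.
  by move=> k lt; rewrite big1 ?mulmx0 // => i _; rewrite uM ?scaler0.
under [RHS]eq_bigr => i _.
  rewrite convolutionE (@zsumE _ M); last by move=> k lt; rewrite uM ?mulmx0.
  rewrite scaler_sumr; over.
rewrite exchange_big /=; apply: eq_bigr => k _; rewrite mulmx_sumr.
by apply: eq_bigr => i _; rewrite scaleMr.
Qed.

Definition znorm (M : nat) (u : int -> 'cV[C]_r) : R := \sum_(k <- zr M) mnorm (u k).

Lemma znorm_ge0 M u : 0 <= znorm M u.
Proof. by apply: sumr_ge0 => k _; exact: mnorm_ge0. Qed.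

Lemma convolution_bound_unif n : exists2 B : R, 0 <= B &
  forall M (u : int -> 'cV[C]_r) j, zbnd M u -> mnorm (convolution (A n) u j) <= B * znorm M u.
Proof.
pose S := \sum_(k <- zr (N * 2 ^ n)) mnorm (A n k).
have S0 : 0 <= S by apply: sumr_ge0 => k _; exact: mnorm_ge0.
have hS k : mnorm (A n k) <= S.
  have [lt|le] := ltnP (N * 2 ^ n) `|k|; first by rewrite (A_zbnd' aN) // mnorm0.
  rewrite /S (bigD1_seq k) ?zr_uniq ?mem_zr //= lerDl.
  by apply: sumr_ge0 => i _; exact: mnorm_ge0.
exists S => // M u j uM.
rewrite convolutionE (@zsumE _ M); last by move=> k lt; rewrite uM ?mulmx0.
apply: le_trans (mnorm_sum _ _ _) _; rewrite mulr_sumr; apply: ler_sum => k _.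
by apply: le_trans (mnormM _ _) _; rewrite ler_wpM2r ?mnorm_ge0.
Qed.

Variable c : R.
Hypothesis c0 : 0 < c.

(** The weight c is 1 when the cascade itself is studied and 2^m when it produces derivatives of
    order m. *)
Definition vanishes (u : int -> 'cV[C]_r) := forall e : R, 0 < e -> exists n0, forall n,
  (n0 <= n)%N -> forall j, c ^+ n * mnorm (convolution (A n) u j) <= e.

Lemma vanishes_Tm M m e (u : int -> 'cV[C]_r) : zbnd M u -> vanishes u -> vanishes (Tm a m e u).
Proof.
move=> uM vu eps eps0; have e1 : 0 < eps * c ^+ m by rewrite mulr_gt0 // exprn_gt0.
have [n0 h] := vu _ e1; exists n0 => n nn j.
have := h (n + m)%N (leq_trans nn (leq_addr m n)) (2 ^+ m * j + e).
rewrite (convolution_A_add aN u) exprD mulrAC.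
by rewrite ler_pM2r // exprn_gt0.
Qed.

(** Sampling on a coset halves at least the part of the support due to u, so that windows of radius
    at least 2 N + 4 are mapped into themselves. *)
Lemma zbnd_Tm M m (e : int) (u : int -> 'cV[C]_r) : (0 < m)%N -> (`|e| <= 2 ^ m)%N -> zbnd M u ->
  zbnd (N + 1 + (M + 1) %/ 2) (Tm a m e u).
Proof.
move=> m0 em uM j lt; rewrite /Tm (convolution_zbnd uM (A_zbnd' aN (n := m))) //.
have h1 : absz (2 ^+ m * j)%R = (2 ^ m * `|j|)%N by rewrite abszM two_expz.
have h2 : (2 <= 2 ^ m)%N by rewrite -{1}(expn1 2) leq_pexp2l.
have h3 : (absz (2 ^+ m * j)%R <= absz (2 ^+ m * j + e)%R + `|e|)%N by lia.
have h4 : (M < 2 * ((M + 1) %/ 2) + 1)%N by lia.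
rewrite h1 in h3; move: (2 ^ m)%N (absz (2 ^+ m * j + e)%R) `|j|%N `|e|%N ((M + 1) %/ 2)%N h2 em h3 lt h4.
move=> p x jj ee h h2 em h3 lt h4; nia.
Qed.

Section Fixed.
Variable M : nat.
Hypothesis MN : (2 * N + 4 <= M)%N.

Let d := ((2 * M).+1 * r)%N.

Definition encode (u : int -> 'cV[C]_r) : 'rV[C]_d :=
  mxvec (\matrix_(k < (2 * M).+1, i < r) u (k%:Z - M%:Z) i 0).

Definition decode (v : 'rV[C]_d) (k : int) : 'cV[C]_r :=
  if (`|k| <= M)%N then \col_i (vec_mx v : 'M[C]_((2 * M).+1, r)) (inord (absz (k + M%:Z)%R)) i else 0.

Lemma decode_zbnd v : zbnd M (decode v).
Proof. by move=> k lt; rewrite /decode leqNgt lt. Qed.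

Lemma encodeK (u : int -> 'cV[C]_r) : zbnd M u -> decode (encode u) = u.
Proof.
move=> uM; apply/funext => k; rewrite /decode /encode mxvecK.
case: leqP => [le|/uM ->//]; apply/matrixP => i j; rewrite !mxE ord1; congr (u _ _ _).
rewrite inordK; last by lia.
by lia.
Qed.

Lemma decode_sum m (al : 'I_m -> C) (w : 'I_m -> 'rV[C]_d) :
  decode (\sum_i al i *: w i) = fun k => \sum_i al i *: decode (w i) k.
Proof.
apply/funext => k; rewrite /decode; case: ifP => _; last first.
  by rewrite big1 // => i _; rewrite scaler0.
apply/matrixP => i j; rewrite mxE linear_sum summxE summxE; apply: eq_bigr => t _.
by rewrite linearZ !mxE.
Qed.

Lemma mnorm_encode u : mnorm (encode u) <= znorm M u.
Proof.
rewrite /mnorm big_ord1 /znorm /zr big_map.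
rewrite (reindex _ (curry_mxvec_bij _ _)).
pose G (k : 'I_(2 * M).+1) (i : 'I_r) := Normc.normc (u (k%:Z - M%:Z) i 0).
have -> : \sum_(p in [pred p | true]) Normc.normc (encode u ord0 (uncurry (@mxvec_index _ _) p)) =
    \sum_p G p.1 p.2.
  by apply: eq_big => [p|[k i] _] //=; rewrite /encode mxvecE mxE.
rewrite -(pair_bigA _ G) -[iota 0 _]/(index_iota 0 (2 * M).+1) big_mkord; apply: ler_sum => k _.
by rewrite /mnorm; apply: ler_sum => i _; rewrite big_ord1.
Qed.

(** The constant is chosen to halve the window norm: [znorm] sums over 2 M + 1 positions, each
    bounded by this share. *)
Lemma decay_step : exists2 n0, (0 < n0)%N & forall u : int -> 'cV[C]_r, zbnd M u -> vanishes u ->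
  forall j, c ^+ n0 * mnorm (convolution (A n0) u j) <= (2 * (2 * M).+1%:R)^-1 * znorm M u.
Proof.
pose kappa : R := (2 * (2 * M).+1%:R)^-1.
have k0 : 0 < kappa by rewrite invr_gt0 mulr_gt0 // ltr0n.
have [n jj m al w|v Pv|n0 h] := @finite_dim_uniform R d int (fun v => vanishes (decode v))
  (fun n j v => c ^+ n * mnorm (convolution (A n) (decode v) j)) _ _ _ k0.
- rewrite decode_sum (@convolution_lin M) => [|i]; last exact: decode_zbnd.
  apply: (@le_trans _ _ (c ^+ n * \sum_i mnorm (al i *: convolution (A n) (decode (w i)) jj))).
    by rewrite ler_pM2l ?exprn_gt0 // mnorm_sum.
  rewrite mulr_sumr; apply: ler_sum => i _.
  by rewrite mnormZ mulrCA.
- exact: Pv.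
exists n0.+1 => // u uM vu j; have := h n0.+1 (leqnSn _) (encode u).
rewrite encodeK // => /(_ vu j) k; apply: le_trans k _.
by rewrite ler_wpM2l ?(ltW k0) // mnorm_encode.
Qed.

Lemma divz_rem (m : nat) (k : int) : exists j e : int,
  [/\ k = 2 ^+ m * j + e & (`|e| <= 2 ^ m)%N].
Proof.
exists (k %/ 2 ^+ m)%Z, (k %% 2 ^+ m)%Z; split.
  by rewrite mulrC -divz_eq.
have p : (2 : int) ^+ m != 0 by rewrite expf_neq0.
have := modz_ge0 k p; have := ltz_mod k p; rewrite -(two_expz m); lia.
Qed.

(* Halving after n0 steps, through the invariance of the vanishing sequences under
   the transition operators. *)
Lemma exponential_decay : exists B theta : R, [/\ 0 <= B, 3 / 4 <= theta < 1 &
  forall u : int -> 'cV[C]_r, zbnd M u -> vanishes u -> forall n j,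
    c ^+ n * mnorm (convolution (A n) u j) <= B * theta ^+ n * znorm M u].
Proof.
have [n0 n00 hn0] := decay_step.
pose K : R := (2 * M).+1%:R.
have K0 : 0 < K by rewrite ltr0n.
have step (u : int -> 'cV[C]_r) e : zbnd M u -> vanishes u -> (`|e| <= 2 ^ n0)%N ->
    c ^+ n0 * znorm M (Tm a n0 e u) <= 2^-1 * znorm M u.
  move=> uM vu en; rewrite /znorm mulr_sumr.
  apply: (@le_trans _ _ (\sum_(k <- zr M) (2 * K)^-1 * znorm M u)).
    by apply: ler_sum => k _; exact: hn0.
  rewrite big_const_seq count_predT size_zr iter_addr_0 -[leLHS]mulr_natl.
  by rewrite mulrA -/K invfM mulrCA mulfV ?gt_eqF // mulr1.
have [B0 B00 hB0] : exists2 B0 : R, 0 <= B0 & forall n (u : int -> 'cV[C]_r) j, (n < n0)%N -> zbnd M u ->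
    c ^+ n * mnorm (convolution (A n) u j) <= B0 * znorm M u.
  elim: (n0) => [|n [B B_0 hB]]; first by exists 0.
  have [B' B'0 hB'] := convolution_bound_unif n.
  exists (B + c ^+ n * B') => [|k u j]; first by rewrite addr_ge0 // mulr_ge0 // exprn_ge0 // ltW.
  have z0 := znorm_ge0 M u.
  have cB : 0 <= c ^+ n * B' * znorm M u.
    by apply: mulr_ge0 => //; apply: mulr_ge0 => //; rewrite exprn_ge0 // ltW.
  rewrite ltnS leq_eqVlt mulrDl => /orP[/eqP->|kn] uM.
    have := hB' M u j uM; rewrite -(ler_pM2l (exprn_gt0 n c0)) mulrA => h.
    by apply: le_trans h _; rewrite lerDr mulr_ge0.
  by apply: le_trans (hB k u j kn uM) _; rewrite lerDl.
have main t : forall k (u : int -> 'cV[C]_r) j, (k < n0)%N -> zbnd M u -> vanishes u ->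
    c ^+ (t * n0 + k) * mnorm (convolution (A (t * n0 + k)) u j) <= B0 * 2^-1 ^+ t * znorm M u.
  elim: t => [|t IH] k u j kn uM vu; first by rewrite mul0n add0n expr0 mulr1; exact: hB0.
  have [j' [e [-> en]]] := divz_rem n0 j.
  have -> : (t.+1 * n0 + k = (t * n0 + k) + n0)%N by lia.
  rewrite (convolution_A_add aN u) exprD mulrAC.
  have TM : zbnd M (Tm a n0 e u) by apply: zbnd_widen (zbnd_Tm n00 en uM); lia.
  have := IH k _ j' kn TM (vanishes_Tm n0 e uM vu).
  rewrite -(ler_pM2r (exprn_gt0 n0 c0)) => h; apply: le_trans h _.
  rewrite exprSr mulrA -[leLHS]mulrA -[leRHS]mulrA ler_wpM2l ?mulr_ge0 ?exprn_ge0 //.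
  by rewrite mulrC; exact: step.
(* A rate with theta^n0 at least 1/2, found without extracting roots: Bernoulli's inequality gives 1
   - n0 / (2 n1). The increment 2 also ensures theta >= 3/4, which keeps the Hoelder exponent
   derived from theta below 1. *)
pose n1 := (n0 + 2)%N.
pose theta : R := 1 - (2 * n1%:R)^-1.
have n1p : (0 : R) < n1%:R by rewrite ltr0n addn_gt0 n00.
have i4 : (2 * n1%:R)^-1 <= (4^-1 : R).
  by rewrite lef_pV2 ?posrE ?mulr_gt0 // -(natrM _ 2 n1) ler_nat /n1; lia.
have i0 : 0 < (2 * n1%:R : R)^-1 by rewrite invr_gt0 mulr_gt0.
have t34 : 3 / 4 <= theta < 1.
  rewrite /theta; apply/andP; split; last by lra.
  by move: i4; lra.
have tp : 0 < theta by case/andP: t34 => h _; apply: lt_le_trans h; lra.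
have bern (k : nat) : 1 - k%:R * (2 * n1%:R)^-1 <= theta ^+ k.
  elim: k => [|k IH]; first by rewrite mul0r subr0 expr0.
  rewrite exprSr -[k.+1]addn1 natrD.
  have := ler_wpM2r (ltW tp) IH; apply: le_trans; rewrite /theta.
  have : 0 <= (k%:R : R) by rewrite ler0n.
  by move: i0; set x := (_ ^-1); nra.
have th : 2^-1 <= theta ^+ n0.
  apply: le_trans (bern n0).
  have : n0%:R * (2 * n1%:R)^-1 <= (2^-1 : R).
    rewrite ler_pdivrMr ?mulr_gt0 // mulKf // ler_nat /n1; lia.
  lra.
exists (B0 * 2), theta; split => //; first by rewrite mulr_ge0.
move=> u uM vu n j.
have := main (n %/ n0)%N (n %% n0)%N u j (ltn_pmod n n00) uM vu.
rewrite -divn_eq => h; apply: le_trans h _; rewrite ler_wpM2r ?znorm_ge0 //.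
rewrite -mulrA ler_wpM2l // {2}(divn_eq n n0) exprD.
have h1 : 2^-1 ^+ (n %/ n0) <= theta ^+ (n %/ n0 * n0).
  by rewrite mulnC exprM lerXn2r ?nnegrE // ?invr_ge0 // exprn_ge0 // ltW.
have h2 : 2^-1 <= theta ^+ (n %% n0).
  apply: le_trans th _; rewrite ler_wiXn2l ?(ltW tp) //; first by case/andP: t34 => _ /ltW.
  by apply: ltnW; exact: ltn_pmod.
have h3 : 0 <= (2^-1 : R) ^+ (n %/ n0) by rewrite exprn_ge0 // invr_ge0.
apply: le_trans h1 _; have : 0 <= theta ^+ (n %/ n0 * n0) by rewrite exprn_ge0 // ltW.
move: h2; move: (theta ^+ (n %/ n0 * n0)) (theta ^+ (n %% n0)) => y z; nra.
Qed.

End Fixed.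

End Decay.

(** * Decay rates and the smoothness of a mask *)

Section Rho.
Variable R : realType.
Local Notation C := R[i].

Lemma limn_esup_le (u : (\bar R)^nat) (x : \bar R) N :
  (forall n, (N <= n)%N -> (u n <= x)%E) -> (limn_esup u <= x)%E.
Proof.
move=> h; rewrite /limn_esup /limf_esup.
apply: (@le_trans _ _ (ereal_sup [set u n | n in [set n | (N <= n)%N]])).
  by apply: ereal_inf_lbound; exists [set n | (N <= n)%N] => //; exact: nbhs_infty_ge.
by apply: ub_ereal_sup => _ [n /= nN <-]; exact: h.
Qed.

Lemma limn_esup_lt (u : (\bar R)^nat) (x : \bar R) : (limn_esup u < x)%E ->
  exists N, forall n, (N <= n)%N -> (u n < x)%E.
Proof.
rewrite /limn_esup /limf_esup => /ereal_inf_lt [_ [V [N _ hN] <-] lt].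
exists N => n nN; apply: le_lt_trans lt; apply: ereal_sup_ubound.
by exists n => //; exact: hN.
Qed.

Lemma supnorm_le r (u : int -> 'cV[C]_r) (e : R) :
  (forall j, mnorm (u j) <= e) -> (supnorm u <= e%:E)%E.
Proof.
move=> h; apply: ub_ereal_sup => _ [[j i] _ <-]; rewrite lee_fin.
by apply: le_trans (normc_le_mnorm _ _ _) (h j).
Qed.

Lemma supnorm_lt r (u : int -> 'cV[C]_r) (e : R) : (supnorm u < e%:E)%E ->
  forall j, mnorm (u j) <= r%:R * e.
Proof.
move=> h j; rewrite -[r in r%:R]muln1; apply: mnorm_le_entries => i k; rewrite ord1 -lee_fin.
apply: le_trans (ltW h); apply: ereal_sup_ubound.
by exists (j, i).
Qed.

Lemma supnorm_ge0 r (u : int -> 'cV[C]_r) : (0 < r)%N -> (0 <= supnorm u)%E.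
Proof.
move=> r0; apply: (@le_trans _ _ (Normc.normc (u 0 (Ordinal r0) 0))%:E).
  by rewrite lee_fin normc_ge0.
by apply: ereal_sup_ubound; exists (0, Ordinal r0).
Qed.

Lemma powR_root (x : R) n : (0 < n)%N -> 0 <= x -> (x ^+ n) `^ (n%:R^-1) = x.
Proof.
by move=> n0 x0; rewrite -powR_mulrn // -powRrM mulfV ?pnatr_eq0 -?lt0n // powRr1.
Qed.

Variables (r : nat) (a : int -> 'M[C]_r) (N : nat).
Hypotheses (r0 : (0 < r)%N) (aN : zbnd N a).
Local Notation A := (A a).

Definition decays (theta : R) (u : int -> 'cV[C]_r) :=
  exists2 B : R, 0 <= B & forall n j, mnorm (convolution (A n) u j) <= B * theta ^+ n.

Lemma geom_small (t : R) : 0 <= t < 1 -> forall e : R, 0 < e ->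
  exists N, forall n, (N <= n)%N -> t ^+ n <= e.
Proof.
move=> /andP[t0 t1] e e0.
have h : `|t| < 1 by rewrite ger0_norm.
have /cvgrPdist_lt/(_ e e0) := cvg_expr h.
move=> [K _ hK]; exists K => n nK; have /= := hK n nK.
by rewrite sub0r normrN ger0_norm ?exprn_ge0 // => /ltW.
Qed.

(** The rate theta is common to all u, so the supremum stays below 1; the constants depend on u and
    are absorbed, for large n, by passing to a rate halfway between theta and 1. *)
Lemma rho_lt1 v j (theta : R) : 0 < theta < 1 ->
  (forall u, vanishing_space v j u -> decays theta u) -> (rho_infty j a v < 1)%E.
Proof.
move=> /andP[t0 t1] h; pose t' := (1 + theta) / 2.
have tt : theta < t' by rewrite /t'; lra.
have t'1 : t' < 1 by rewrite /t'; lra.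
have t'0 : 0 < t' by lra.
apply: (@le_lt_trans _ _ t'%:E); last by rewrite lte_fin.
apply: ub_ereal_sup => _ [u /h [B B0 hB] <-].
have q : 0 <= theta / t' < 1 by rewrite divr_ge0 ?(ltW t0) ?(ltW t'0) //= ltr_pdivrMr // mul1r.
have B1 : 0 < B + 1 by rewrite ltr_wpDl.
have B2 : 0 < (B + 1)^-1 by rewrite invr_gt0.
have [K hK] := geom_small q B2.
have K' n : (K <= n)%N -> B * theta ^+ n <= t' ^+ n.
  move=> nK; have := hK n nK.
  rewrite expr_div_n ler_pdivrMr ?exprn_gt0 // ler_pdivlMl // => h1.
  have : 0 <= theta ^+ n by rewrite exprn_ge0 // ltW.
  by move: h1; nra.
apply: (@limn_esup_le _ _ K.+1) => n nK.
apply: (@le_trans _ _ (poweR (t' ^+ n)%:E n%:R^-1)).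
  apply: gt0_ler_poweR; rewrite ?in_itv /= ?leey ?supnorm_ge0 ?lee_fin ?exprn_ge0 ?(ltW t'0) //.
  apply: supnorm_le => i; apply: le_trans (hB n i) (K' n _); exact: ltnW.
by rewrite poweR_EFin (powR_root (leq_ltn_trans (leq0n K) nK) (ltW t'0)).
Qed.

(** A rate strictly between rho and x turns the upper limit of roots into a bound for large n; the
    finitely many remaining steps go into the constant. *)
Lemma rho_decays v j (x : R) : 0 < x -> (rho_infty j a v < x%:E)%E ->
  exists2 theta : R, 0 < theta < x & forall u, vanishing_space v j u -> decays theta u.
Proof.
move=> x0 lt.
have [th th1 th2] : exists2 th : R, 0 < th < x & (rho_infty j a v < th%:E)%E.
  have [y h1 h2] : exists2 y : R, (rho_infty j a v < y%:E)%E & y < x.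
    case E : (rho_infty j a v) lt => [y||] //=; rewrite ?lte_fin => lt.
      by exists ((y + x) / 2); rewrite ?lte_fin; lra.
    by exists 0 => //; exact: ltNyr.
  (* The maximum with x / 2 keeps the rate positive. *)
  exists (Num.max y (x / 2)).
    by rewrite lt_max gt_max h2; apply/andP; split; [apply/orP; right|]; lra.
  by apply: lt_le_trans h1 _; rewrite lee_fin le_max lexx.
exists th => // u Vu; have /andP[t0 tx] := th1.
have lu : (limn_esup (fun n : nat =>
   poweR (supnorm (convolution (iter n (subdivision a) (@dirac_mx R r)) u)) n%:R^-1) < th%:E)%E.
  by apply: le_lt_trans th2; apply: ereal_sup_ubound; exists u.
have [K hK] := limn_esup_lt lu.
have big n : (K < n)%N -> forall j, mnorm (convolution (A n) u j) <= r%:R * th ^+ n.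
  move=> nK; have n0 : (0 < n)%N by exact: leq_ltn_trans (leq0n K) nK.
  apply: supnorm_lt; rewrite ltNge; apply/negP => le.
  have := hK n (ltnW nK); rewrite ltNge => /negP; apply.
  apply: (@le_trans _ _ (poweR (th ^+ n)%:E n%:R^-1)).
    by rewrite poweR_EFin (powR_root n0 (ltW t0)).
  apply: gt0_ler_poweR; rewrite ?in_itv /= ?leey ?supnorm_ge0 ?lee_fin ?exprn_ge0 ?(ltW t0) //.
have [Mu uM] := fsuppP Vu.1.
have small : exists2 B : R, 0 <= B & forall n j, (n <= K)%N -> mnorm (convolution (A n) u j) <= B * th ^+ n.
  elim: (K) => [|k [B B0 hB]].
    have [B' B'0 hB'] := convolution_bound_unif aN 0.
    exists (B' * znorm Mu u) => [|n i]; first by rewrite mulr_ge0 // znorm_ge0.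
    by rewrite leqn0 => /eqP->; rewrite expr0 mulr1; exact: hB'.
  have [B' B'0 hB'] := convolution_bound_unif aN k.+1.
  have tk : 0 < th ^+ k.+1 by rewrite exprn_gt0.
  have c0 : 0 <= B' * znorm Mu u / th ^+ k.+1 by rewrite divr_ge0 ?mulr_ge0 ?znorm_ge0 // ltW.
  exists (B + B' * znorm Mu u / th ^+ k.+1) => [|n i]; first exact: addr_ge0.
  rewrite leq_eqVlt ltnS mulrDl => /orP[/eqP->|nk].
    rewrite mulfVK ?gt_eqF //; apply: le_trans (hB' Mu u i uM) _.
    by rewrite lerDr mulr_ge0 // ltW.
  by apply: le_trans (hB n i nk) _; rewrite lerDl mulr_ge0 // exprn_ge0 // ltW.
have [B B0 hB] := small; exists (B + r%:R) => [|n i]; first exact: addr_ge0.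
have tn : 0 <= th ^+ n by rewrite exprn_ge0 // ltW.
rewrite mulrDl; have [nK|nK] := leqP n K.
  by apply: le_trans (hB n i nK) _; rewrite lerDl mulr_ge0.
by apply: le_trans (big n nK i) _; rewrite lerDr mulr_ge0.
Qed.

Lemma ln2_gt0 : 0 < ln (2 : R).
Proof. by apply: ln_gt0; lra. Qed.

Lemma sm_mask_gt0 : (rho_infty (sr a) a (sr_filter a) < 1)%E -> (0 < sm_mask a)%E.
Proof.
rewrite -lne_lt0 /sm_mask => h; rewrite lteNr oppe0.
have l2 : (0 < ((ln (2 : R))^-1)%:E)%E by rewrite lte_fin invr_gt0 ln2_gt0.
by rewrite muleC pmule_rlt0.
Qed.

Lemma sm_mask_rho (k : nat) : (k%:R%:E < sm_mask a)%E ->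
  (rho_infty (sr a) a (sr_filter a) < (2 ^- k)%:E)%E.
Proof.
rewrite /sm_mask => h; rewrite ltNge; apply/negP => le.
have p0 : 0 < (2 ^- k : R) by rewrite invr_gt0 exprn_gt0.
have : (lne (2 ^- k)%:E <= lne (rho_infty (sr a) a (sr_filter a)))%E.
  rewrite lee_lne ?in_itv /= ?leey ?andbT ?lee_fin ?(ltW p0) //.
  by apply: le_trans le; rewrite lee_fin ltW.
rewrite lne_EFin // lnV ?posrE ?exprn_gt0 // lnXn //.
have l2 : (0 <= ((ln (2 : R))^-1)%:E)%E by rewrite lee_fin invr_ge0 ltW ?ln2_gt0.
move=> /(lee_wpmul2r l2); rewrite -EFinM => h2.
have : (sm_mask a <= k%:R%:E)%E.
  rewrite /sm_mask leeNl; apply: le_trans h2; rewrite -EFinN lee_fin.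
  have -> : ln 2 *+ k = ln 2 * k%:R :> R by rewrite mulr_natr.
  by rewrite mulNr mulrAC mulfV ?mul1r // gt_eqF // ln2_gt0.
by rewrite leNgt /sm_mask h.
Qed.

End Rho.

(** * Sum rules in terms of moments *)

Section Parity.
Variable R : realType.
Local Notation C := R[i].

Definition parsign (k : int) : C := if (k %% 2 == 0)%Z then 1 else -1.

Lemma expi_pi (k : int) : expi (k%:~R * pi) = parsign k.
Proof.
have e1 : expi (pi : R) = -1 by rewrite /expi cospi sinpi; apply: cReIm_eq => /=; rewrite ?oppr0.
have par (j : int) : parsign (j + 1) = - parsign j.
  rewrite /parsign; case: ifP; case: ifP; rewrite ?opprK // => h1 h2; exfalso; lia.
have st (j : int) : expi ((j + 1)%:~R * pi : R) = - expi (j%:~R * pi).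
  by rewrite rmorphD /= mulrDl mul1r expiD e1 mulrN1.
elim/int_rect: k => [|n IH|n IH]; first by rewrite mul0r expi0 /parsign mod0z eqxx.
  have e : n.+1%:Z = n%:Z + 1 by lia.
  by rewrite e st IH par.
have e : - n%:Z = - n.+1%:Z + 1 by lia.
by apply: oppr_inj; rewrite -st -par -e.
Qed.

Lemma parsign_even (j : int) : parsign (2 * j) = 1.
Proof. by rewrite /parsign mulrC modzMl. Qed.

Lemma parsign_odd (j : int) : parsign (2 * j + 1) = -1.
Proof. by rewrite /parsign; case: ifP => // h; exfalso; lia. Qed.

Lemma symbol_period s q (v : int -> 'M[C]_(s, q)) x : symbol v (x + 2 * pi) = symbol v x.
Proof.
rewrite !symbolE; apply: eq_zsum => k; congr (_ *: _).
have -> : - (k%:~R * (x + 2 * pi)) = - (k%:~R * x) + (2 * - k)%:~R * pi.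
  by rewrite rmorphM rmorphN /=; ring.
by rewrite expiD expi_pi parsign_even mulr1.
Qed.

Lemma symbol_shift_pi s q (v : int -> 'M[C]_(s, q)) x :
  symbol v (x + pi) = symbol (fun k => parsign k *: v k) x.
Proof.
rewrite !symbolE; apply: eq_zsum => k; rewrite scalerA; congr (_ *: _).
have -> : - (k%:~R * (x + pi)) = - (k%:~R * x) + (- k)%:~R * pi.
  by rewrite rmorphN /=; ring.
rewrite expiD expi_pi; congr (_ * _); rewrite /parsign.
by case: ifP; case: ifP => // h1 h2; exfalso; lia.
Qed.

Lemma zsum_parity (V : zmodType) M (F : int -> V) : zbnd M F ->
  zsum F = zsum (fun j => F (2 * j)) + zsum (fun j => F (2 * j + 1)).
Proof.
move=> bF; pose F0 s := if (s %% 2 == 0)%Z then F s else 0.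
pose F1 s := if (s %% 2 == 0)%Z then 0 else F s.
have -> : zsum F = zsum (fun s => F0 s + F1 s).
  by apply: eq_zsum => s; rewrite /F0 /F1; case: ifP; rewrite ?addr0 ?add0r.
rewrite (@zsumD _ M); first last.
- by move=> k /bF h; rewrite /F1 h; case: ifP.
- by move=> k /bF h; rewrite /F0 h; case: ifP.
rewrite (zsum_even bF); congr (_ + _).
rewrite (@zsum_reindex _ (fun j => 2 * j + 1)).
- apply: eq_zsum => k; rewrite /F1; case: ifP => // h; exfalso; lia.
- by move=> x y; lia.
- move=> k; rewrite /F1; case: ifP => [_|h _]; first by rewrite eqxx.
  by exists (k %/ 2)%Z; lia.
Qed.

Lemma scalerC s q (x y : C) (z : 'M[C]_(s, q)) : x *: (y *: z) = y *: (x *: z).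
Proof. by rewrite !scalerA mulrC. Qed.

End Parity.

Arguments parsign {R} k.

Section Filter.
Variable R : realType.
Local Notation C := R[i].
Variables (r : nat) (a : int -> 'M[C]_r) (N : nat).
Hypothesis aN : zbnd N a.
Variables (k M : nat) (v : int -> 'rV[C]_r).
Hypothesis vM : zbnd M v.

Let w (s : int) : 'rV[C]_r := 2^-1 *: subdivision a v s.

Lemma half_subdivision_zbnd : zbnd (2 * M + N) w.
Proof. by move=> s lt; rewrite /w (zbnd_subdivision aN vM) ?scaler0. Qed.

Lemma half_symbol x : symbol w x = symbol v (2 * x) *m symbol a x.
Proof.
transitivity (2^-1 *: symbol (subdivision a v) x).
  rewrite !symbolE (@zsumZ _ (2 * M + N)).
    by apply: eq_zsum => s; exact: scalerC.
  by apply: zbndZ; exact: zbnd_subdivision.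
by rewrite (symbol_subdivision _ aN vM) scalerA mulVf ?scale1r // pnatr_eq0.
Qed.

Lemma matchedP : mxeqO k (fun xi => symbol v (2 * xi) *m symbol a xi) (symbol v) <->
  matched a k v.
Proof.
have -> : (fun xi => symbol v (2 * xi) *m symbol a xi) = symbol w.
  by apply/funext => x; rewrite half_symbol.
have vM' : zbnd (2 * M + N) v by apply: zbnd_widen vM; lia.
have wM := half_subdivision_zbnd.
have e f : mom f w = 2^-1 *: mom f (subdivision a v).
  by rewrite /w (momZr _ _ (zbnd_subdivision aN vM)).
split=> [/(mxeqO_mom k wM vM') h f szf|h].
  by rewrite -(h f szf) e scalerA mulfV ?scale1r // pnatr_eq0.
apply/(mxeqO_mom k wM vM') => f szf.
by rewrite e h // scalerA mulVf ?scale1r // pnatr_eq0.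
Qed.

(** Translation of xi by pi multiplies the k-th term by (-1)^k. Hence the first condition fixes the
    sum of the moments on the even and odd cosets and the second says that they coincide; together
    they give each coset the moment of v. *)
Lemma sum_ruledP : mxeqO k (fun xi => symbol v (2 * xi) *m symbol a xi) (symbol v) /\
    mxeqO k (fun xi => symbol v (2 * xi) *m symbol a (xi + pi)) (fun=> 0) <->
  sum_ruled a k v.
Proof.
rewrite matchedP.
pose w' (s : int) : 'rV[C]_r := parsign s *: w s.
have -> : (fun xi => symbol v (2 * xi) *m symbol a (xi + pi)) = symbol w'.
  apply/funext => x; apply: (@etrans _ _ (symbol w (x + pi))); last exact: symbol_shift_pi.
  by rewrite half_symbol mulrDr symbol_period.
rewrite -(symbol0 R 1 r).
have wM : zbnd (2 * M + N) w' by apply: zbndZ; exact: half_subdivision_zbnd.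
have z0 : zbnd (2 * M + N) (fun=> 0 : 'rV[C]_r) by [].
pose c e (f : {poly C}) : 'rV[C]_r :=
  \zsum_(j) (f.[(2 * j + e)%:~R] *: subdivision a v (2 * j + e)).
have e1 f : mom f (subdivision a v) = c 0 f + c 1 f.
  have b : zbnd (2 * M + N) (fun s : int => f.[s%:~R] *: subdivision a v s).
    exact: (zbndZ (fun s => f.[s%:~R]) (zbnd_subdivision aN vM)).
  apply: (etrans (zsum_parity b)); apply: f_equal2; last exact: erefl.
  by apply: eq_zsum => j; rewrite addr0.
have bc e f : zbnd (2 * M + N + `|e|) (fun j => f.[(2 * j + e)%:~R] *: subdivision a v (2 * j + e)).
  move=> j lt; rewrite (zbnd_subdivision aN vM) ?scaler0 //; lia.
have e2 f : mom f w' = 2^-1 *: (c 0 f - c 1 f).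
  have b : zbnd (2 * M + N) (fun s : int => f.[s%:~R] *: w' s) by exact: (zbndZ (fun s => f.[s%:~R]) wM).
  apply: (etrans (zsum_parity b)); rewrite scalerBr; apply: f_equal2.
    rewrite (zsumZ _ (bc 0 f)); apply: eq_zsum => j.
    by rewrite /w' /w addr0 parsign_even scale1r; exact: scalerC.
  rewrite -scaleNr (zsumZ _ (bc 1 f)); apply: eq_zsum => j.
  by rewrite /w' /w parsign_odd scaleN1r scalerN scaleNr; congr (- _); exact: scalerC.
have ce e f : c e f = c (e %% 2)%Z f.
  rewrite /c [RHS](zsum_shift (e %/ 2)%Z); apply: eq_zsum => j.
  by have -> : 2 * (j + (e %/ 2)%Z) + (e %% 2)%Z = 2 * j + e by lia.
split=> [[h1 /(mxeqO_mom k wM z0) h2] e f szf|h].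
  have h3 := h1 f szf; have := h2 f szf; rewrite mom_0 e2 => /eqP.
  rewrite scaler_eq0 invr_eq0 pnatr_eq0 /= subr_eq0 => /eqP h4.
  have h5 : c 0 f = mom f v.
    apply: (@scalerI _ _ (2 : C)); first by rewrite pnatr_eq0.
    by rewrite -h3 e1 -h4 scaler_nat mulr2n.
  rewrite -/(c e f) ce; have [->|->] : (e %% 2)%Z = 0 \/ (e %% 2)%Z = 1 by lia.
    exact: h5.
  by rewrite -h4.
have hc e (f : {poly C}) : (size f <= k)%N -> c e f = mom f v by exact: h.
split=> [f szf|]; first by rewrite e1 !hc // scaler_nat mulr2n.
apply/(mxeqO_mom k wM z0) => f szf; rewrite mom_0 e2.
by rewrite !hc // subrr scaler0.
Qed.

End Filter.

(** * Bound on the order of sum rules *)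

Section SumRuleBound.
Variable R : realType.
Local Notation C := R[i].
Variables (r : nat) (a : int -> 'M[C]_r) (N : nat).
Hypotheses (r0 : (0 < r)%N) (aN : zbnd N a).

Lemma symbol_0 M s q (v : int -> 'M[C]_(s, q)) : zbnd M v -> symbol v 0 = mom 1 v.
Proof.
move=> vM; rewrite symbolE /mom; apply: eq_zsum => k.
by rewrite mulr0 oppr0 expi0 hornerC.
Qed.

Lemma sum_rulesP k M (v : int -> 'rV[C]_r) : zbnd M v ->
  sum_rules k a v <-> symbol v 0 <> 0 /\ sum_ruled a k v.
Proof.
move=> vM; rewrite -(sum_ruledP aN k vM) /sum_rules /matching_filter; split.
  by move=> [[_ v0 h1] h2].
by move=> [v0 [h1 h2]]; split => //; split => //; exact: fsupp_zbnd vM.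
Qed.

Lemma sum_ruled_matched k M (v : int -> 'rV[C]_r) : zbnd M v -> sum_ruled a k v -> matched a k v.
Proof. by move=> vM /(sum_ruledP aN k vM)[/(matchedP aN k vM)]. Qed.

(** Order 0 asks only for a nonzero symbol at 0, which a delta filter has; thus the orders form a
    nonempty set. *)
Lemma sum_rules0 : exists v, sum_rules 0 a v.
Proof.
exists (fun k => if k == 0 then delta_mx 0 (Ordinal r0) else 0).
have vM : zbnd 0 (fun k : int => if k == 0 then delta_mx 0 (Ordinal r0) else 0 : 'rV[C]_r).
  by move=> k; case: eqP => [->|].
apply/(sum_rulesP 0 vM); split.
  rewrite (symbol_0 vM) /mom (@zsum1 _ 0) => [|k /negbTE->]; last by rewrite scaler0.
  rewrite eqxx hornerC scale1r => /matrixP/(_ 0 (Ordinal r0)); rewrite !mxE !eqxx => /eqP.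
  by rewrite oner_eq0.
by move=> e f; rewrite leqn0 size_poly_eq0 => /eqP ->; rewrite mom0; apply: zsum0 => i; rewrite horner0 scale0r.
Qed.

Section Bound.
Variables (k Mv : nat) (v : int -> 'rV[C]_r).
Hypotheses (vM : zbnd Mv v) (v0 : symbol v 0 <> 0) (vk : sum_ruled a k v).

(** Subdivision replaces f by f(x/2), which keeps the degree, while the output at x depends on
    inputs at distance at most N from x on the scale of 2 j. Beyond radius N + 1 each step therefore
    enlarges the window of zeros. *)
Lemma polyconv_vanishing n (f : {poly C}) : (size f <= k)%N ->
  (forall x : int, (`|x| <= N + 1)%N -> polyconv f v x = 0) ->
  exists g : {poly C}, [/\ (size g <= k)%N, (g == 0) = (f == 0) &
    forall x : int, (`|x| <= N + 1 + n)%N -> polyconv g v x = 0].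
Proof.
move=> szf hf; elim: n => [|n [g [szg g0 hg]]]; first by exists f; split => //; rewrite addn0.
have two0 : (2^-1 : C) != 0 by rewrite invr_eq0 pnatr_eq0.
exists (g \Po (2^-1 *: 'X)); split.
- by have := size_comp_aff (2^-1) 0 szg; rewrite addr0.
- by rewrite -g0 comp_poly2_eq0 // size_scale // size_polyX.
move=> x xn; rewrite -(subdivision_polyconv aN vM vk szg) (subdivisionE aN).
apply: zsum0 => j; have [le|lt] := leqP (absz (x - 2 * j)%R) N; last first.
  by rewrite (aN lt) mulmx0 scaler0.
by rewrite hg ?mul0mx ?scaler0 //; lia.
Qed.

(** If k exceeded the dimension of the row sequences on a window, some nonzero f of degree less than
    k would have zero samples of [polyconv f v] there. A dilate g then has zeros on a window longer
    than its degree, so an entry of [polyconv g v] is the zero polynomial; but its leading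
    coefficient is that of g times a nonzero entry of the symbol of v at 0. *)
Lemma size_sum_rules : (k <= (2 * (N + 1)).+1 * r)%N.
Proof.
rewrite leqNgt; apply/negP => lt.
set P := (2 * (N + 1)).+1 in lt.
(* Row j lists the values on the window of [polyconv] for X^j; a vector in the left kernel gives the
   coefficients of f. *)
pose L : 'M[C]_(k, P * r) := \matrix_(j < k)
  mxvec (\matrix_(t < P, i < r) polyconv 'X^j v (t%:Z - (N + 1)%:Z) 0 i).
have /rowV0Pn [w wk w0] : kermx L != 0.
  rewrite -mxrank_eq0 mxrank_ker -lt0n subn_gt0.
  by apply: leq_ltn_trans lt; exact: rank_leq_col.
pose f : {poly C} := rVpoly w.
have f0 : f != 0 by rewrite /f; apply: contra w0 => /eqP h; rewrite -(rVpolyK w) h linear0.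
have szf : (size f <= k)%N by exact: size_poly.
have fv (x : int) : (`|x| <= N + 1)%N -> polyconv f v x = 0.
  move=> hx; have /sub_kermxP/(congr1 vec_mx) := wk.
  rewrite mulmx_sum_row linear_sum linear0 => /matrixP h.
  have xP : (absz (x + (N + 1)%:Z)%R < P)%N by rewrite /P; lia.
  apply/matrixP => i i2; have := h (Ordinal xP) i2; rewrite summxE !mxE ord1 => hh.
  rewrite -[RHS]hh /polyconv (zsum_entry _ _ (zbndZ _ vM)).
  have -> : f = \sum_(j < k) w 0 j *: 'X^j.
    have -> : f = \poly_(j < k) f`_j.
      by apply/polyP => t; rewrite coef_poly; case: ltnP => // h1; rewrite nth_default // (leq_trans szf).
    by rewrite poly_def; apply: eq_bigr => j _; rewrite /f coef_rVpoly_ord.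
  rewrite (@zsumE _ Mv); last by move=> t /vM ->; rewrite scaler0 mxE.
  transitivity (\sum_(t <- zr Mv) \sum_(j < k) w 0 j * ((x - t)%:~R ^+ j * v t 0 i2)).
    apply: eq_bigr => t _; rewrite mxE horner_sum mulr_suml; apply: eq_bigr => j _.
    by rewrite hornerZ hornerXn mulrA.
  rewrite exchange_big /=; apply: eq_bigr => j _.
  rewrite linearZ mxE [vec_mx _ _ _]mxE rowK mxvecE mxE (zsum_entry _ _ (zbndZ _ vM)).
  rewrite (@zsumE _ Mv); last by move=> t /vM ->; rewrite scaler0 mxE.
  rewrite mulr_sumr; apply: eq_bigr => t _; rewrite mxE hornerXn.
  by congr (_ * (_%:~R ^+ _ * _)); rewrite /=; lia.
have [g [szg g0 hg]] := polyconv_vanishing k szf fv.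
have gn0 : g != 0 by rewrite g0.
have [i vi] : exists i, symbol v 0 0 i != 0.
  apply: contrapT => no; apply: v0; apply/matrixP => i j; rewrite ord1 mxE.
  by apply/eqP/negPn/negP => h; apply: no; exists j.
(* An entry of [polyconv g v], as a polynomial in the position; the entry i is one where the symbol
   at 0 does not vanish. *)
pose p : {poly C} := \sum_(t <- zr Mv) v t 0 i *: (g \Po ('X - (t%:~R)%:P)).
have pE (x : int) : p.[x%:~R] = polyconv g v x 0 i.
  rewrite /polyconv (zsum_entry _ _ (zbndZ _ vM)) (@zsumE _ Mv); last first.
    by move=> t /vM ->; rewrite scaler0 mxE.
  rewrite /p horner_sum; apply: eq_bigr => t _.
  by rewrite hornerZ horner_comp hornerXsubC mxE mulrC rmorphB.
have szp : (size p <= k)%N.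
  apply: (leq_trans (size_sum _ _ _)); apply/bigmax_leqP_seq => t _ _.
  apply: leq_trans (size_scale_leq _ _) _.
  by rewrite size_comp_poly2 // size_XsubC.
have p0 : p = 0.
  apply/eqP/negPn/negP => pn0.
  have := max_poly_roots pn0 (rs := [seq (t%:~R : C) | t <- zr k]).
  rewrite map_inj_uniq ?zr_uniq; last exact: intr_inj.
  rewrite size_map size_zr => h.
  have : ((2 * k).+1 < size p)%N.
    apply: h => //; apply/allP => _ /mapP[t ht ->]; rewrite /root pE hg ?mxE //.
    by move: ht; rewrite mem_zr; lia.
  lia.
(* Translating g does not change its leading coefficient, so the top coefficients add up to the mass
   of v. *)
have : p`_((size g).-1) = lead_coef g * symbol v 0 0 i.
  rewrite symbolE (zsum_entry _ _ (zbndZ _ vM)) (@zsumE _ Mv); last first.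
    by move=> t /vM ->; rewrite scaler0 mxE.
  rewrite /p coef_sum mulr_sumr; apply: eq_bigr => t _.
  rewrite coefZ mxE mulr0 oppr0 expi0 mul1r mulrC; congr (_ * _).
  have -> : (size g).-1 = (size (g \Po ('X - (t%:~R)%:P))).-1.
    by rewrite size_comp_poly2 // size_XsubC.
  rewrite -/(lead_coef _) lead_coef_comp ?size_XsubC //.
  by rewrite (monicP (monicXsubC _)) expr1n mulr1.
rewrite p0 coef0 => /esym/eqP; rewrite mulf_eq0 lead_coef_eq0 (negbTE gn0) /=.
by rewrite (negbTE vi).
Qed.

End Bound.

(** The attainable orders contain 0 and are bounded by [size_sum_rules], so [sr a] is a genuine
    maximum. *)
Lemma sr_spec : [set k | (exists v, sum_rules k a v) /\
   forall k', (exists v, sum_rules k' a v) -> (k' <= k)%N] (sr a).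
Proof.
rewrite /sr; case: xgetP => [k -> //|no].
pose Q k := `[< exists v, sum_rules k a v >].
have Q0 : exists k, Q k by exists 0%N; apply/asboolP; exact: sum_rules0.
have Qb k : Q k -> (k <= (2 * (N + 1)).+1 * r)%N.
  move=> /asboolP [v hv]; have [Mv vM] := fsuppP (let: conj (And3 h _ _) _ := hv in h).
  have [v0 vk] := (sum_rulesP k vM).1 hv.
  exact: (size_sum_rules vM v0 vk).
have [k /asboolP Qk kmax] := ex_maxnP Q0 Qb.
exfalso; apply: (no k); split => // k' hk'; apply: kmax; exact/asboolP.
Qed.

Lemma sr_filter_spec : sum_rules (sr a) a (sr_filter a).
Proof.
rewrite /sr_filter; case: xgetP => [v -> //|no].
by have [[v hv] _] := sr_spec; have := no v hv.
Qed.

End SumRuleBound.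

(** * Limits of convergent Hermite schemes *)

Section Limits.
Variable R : realType.
Local Notation C := R[i].

(** Convergence to 0 uniformly in t, for nonnegative quantities, whence the one-sided bound; plain
    sequences are indexed by [unit]. *)
Definition unif0 (T : Type) (x : nat -> T -> R) :=
  forall e : R, 0 < e -> exists n0, forall n, (n0 <= n)%N -> forall t, x n t <= e.

Lemma unif0_le T (x y : nat -> T -> R) : (forall n t, x n t <= y n t) -> unif0 y -> unif0 x.
Proof.
move=> h hy e e0; have [n0 hn] := hy e e0; exists n0 => n nn t.
by apply: le_trans (h n t) _; exact: hn.
Qed.

Lemma unif0_comp T S (g : nat -> S -> T) (x : nat -> T -> R) : unif0 x -> unif0 (fun n s => x n (g n s)).
Proof. by move=> h e e0; have [n0 hn] := h e e0; exists n0 => n nn s; exact: hn. Qed.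

Lemma unif0D T (x y : nat -> T -> R) : unif0 x -> unif0 y -> unif0 (fun n t => x n t + y n t).
Proof.
move=> hx hy e e0; have e2 : 0 < e / 2 by lra.
have [n1 h1] := hx _ e2; have [n2 h2] := hy _ e2; exists (maxn n1 n2) => n.
rewrite geq_max => /andP[k1 k2] t; have := h1 n k1 t; have := h2 n k2 t; lra.
Qed.

Lemma unif0Z T (B : R) (x : nat -> T -> R) : 0 <= B -> unif0 x -> unif0 (fun n t => B * x n t).
Proof.
move=> B0 hx e e0; have B1 : 0 < B + 1 by lra.
have [n0 h] := hx (e / (B + 1)) (divr_gt0 e0 B1); exists n0 => n nn t.
apply: (@le_trans _ _ (B * (e / (B + 1)))); first by rewrite ler_wpM2l // h.
by rewrite mulrCA -[leRHS]mulr1 ler_wpM2l ?(ltW e0) // ler_pdivrMr // mul1r; lra.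
Qed.

Lemma unif0_zero T : unif0 (fun _ (_ : T) => 0).
Proof. by move=> e e0; exists 0%N => n _ t; exact: ltW. Qed.

Lemma unif0_sum T I (s : seq I) (x : I -> nat -> T -> R) : (forall i, unif0 (x i)) ->
  unif0 (fun n t => \sum_(i <- s) x i n t).
Proof.
move=> h; elim: s => [|i s IH].
  by apply: unif0_le (@unif0_zero T) => n t; rewrite big_nil.
by apply: unif0_le (unif0D (h i) IH) => n t; rewrite big_cons.
Qed.

Lemma unif0_pow : unif0 (fun n (_ : unit) => 2 ^- n).
Proof. by move=> e e0; have [n0 h] := pow2_small e0; exists n0 => n nn _; exact: ltW (h n nn). Qed.

Lemma unif0_shift T (x : nat -> T -> R) k : unif0 x -> unif0 (fun n => x (n + k)%N).
Proof.
move=> h e e0; have [n0 hn] := h e e0; exists n0 => n nn t.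
by apply: hn; exact: leq_trans (leq_addr _ _).
Qed.

Lemma unif0_eq0 (z : C) (x : nat -> unit -> R) : unif0 x -> (forall n, Normc.normc z <= x n tt) -> z = 0.
Proof.
move=> h hz; apply/Normc.eq0_normc/le_anti; rewrite normc_ge0 andbT.
apply/ler_addgt0Pl => e e0; rewrite addr0; have [n0 hn] := h e e0.
exact: le_trans (hz n0) (hn n0 (leqnn _) tt).
Qed.

Lemma floor_sample (x : R) n : exists k : int, `|2 ^- n * k%:~R - x| <= 2 ^- n.
Proof.
have p0 : 0 < (2 ^+ n : R) by rewrite exprn_gt0.
exists (Num.floor (2 ^+ n * x)).
have h1 := floor_le (2 ^+ n * x); have h2 := floorD1_gt (2 ^+ n * x).
have -> : 2 ^- n * (Num.floor (2 ^+ n * x))%:~R - x = 2 ^- n * ((Num.floor (2 ^+ n * x))%:~R - 2 ^+ n * x).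
  by rewrite mulrBr mulKf // gt_eqF.
rewrite normrM gtr0_norm ?invr_gt0 // -[leRHS]mulr1 ler_wpM2l ?invr_ge0 ?(ltW p0) //.
by move: h1 h2; rewrite rmorphD /= ler_norml; lra.
Qed.

Lemma grid_norm (L n : nat) (k : int) : (L%:R < `|2 ^- n * k%:~R| :> R) = (L * 2 ^ n < `|k|)%N.
Proof.
have p0 : 0 < (2 ^+ n : R) by rewrite exprn_gt0.
rewrite normrM gtr0_norm ?invr_gt0 // mulrC ltr_pdivlMr // -intr_norm -abszE.
by rewrite -[(`|k|%N%:Z)%:~R]/(`|k|%N%:R : R) -natrX -natrM ltr_nat.
Qed.

Lemma grid_sample (f : R -> C) (g : nat -> int -> C) (x B : R) (k : nat -> int) :
  ccontinuous f -> 0 <= B ->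
  unif0 (fun n j => Normc.normc (g n j - f (2 ^- n * j%:~R))) ->
  (forall n, `|2 ^- n * (k n)%:~R - x| <= B * 2 ^- n) ->
  unif0 (fun n (_ : unit) => Normc.normc (g n (k n) - f x)).
Proof.
move=> cf B0 hg hk.
apply: (@unif0_le _ _ (fun n _ => Normc.normc (g n (k n) - f (2 ^- n * (k n)%:~R)) +
   Normc.normc (f (2 ^- n * (k n)%:~R) - f x))).
  move=> n _; have -> : g n (k n) - f x = (g n (k n) - f (2 ^- n * (k n)%:~R)) + (f (2 ^- n * (k n)%:~R) - f x).
    by ring.
  exact: normcD.
apply: unif0D; first exact: (unif0_comp (fun n (_ : unit) => k n) hg).
move=> e e0; have [d d0 h] := ccont_eps cf x e0.
have d1 : 0 < d / (B + 1) by rewrite divr_gt0 // ltr_wpDl.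
have [n0 hn] := pow2_small d1; exists n0 => n nn _; apply/ltW/h.
apply: le_lt_trans (hk n) _; have := hn n nn; rewrite ltr_pdivlMr ?ltr_wpDl //.
have : 0 < (2 ^- n : R) by rewrite invr_gt0 exprn_gt0.
by lra.
Qed.

Lemma csupp_deriv (L : R) (f : R -> C) x d : csupp L f -> L < `|x| -> is_cderive f x d -> d = 0.
Proof.
move=> sf Lx [h1 h2].
have nz : \forall y \near x, f y = 0.
  have d0 : 0 < `|x| - L by rewrite subr_gt0.
  apply/nbhs_ballP; exists (`|x| - L) => //= y; rewrite /ball /= => xy.
  by apply: sf; have := ler_norm (`|x| - `|y|); have := lerB_dist x y; lra.
have k1 : is_derive x 1 (re_fun f) 0.
  apply: (near_eq_is_derive _ (is_derive_cst (0 : R) x 1)).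
  by apply: filterS nz => y; rewrite /re_fun => ->.
have k2 : is_derive x 1 (im_fun f) 0.
  apply: (near_eq_is_derive _ (is_derive_cst (0 : R) x 1)).
  by apply: filterS nz => y; rewrite /im_fun => ->.
apply: cReIm_eq => /=.
  by have [_ <-] := h1; have [_ ->] := k1.
by have [_ <-] := h2; have [_ ->] := k2.
Qed.

Lemma csupp_cderivn (L : R) m (f : R -> C) : csupp L f -> cont_diff m f ->
  forall l, (l <= m)%N -> csupp L (cderivn l f).
Proof.
move=> sf cf; elim=> [|l IH] lm; first by rewrite cderivn0.
move=> x Lx; have h := cont_diff_derivs cf lm x.
exact: (csupp_deriv (IH (ltnW lm)) Lx h).
Qed.

(** The error splits into that of the Riemann sum of q f and the sum of the sampling errors; the
    latter has about 2 L 2^n terms of weight 2^(-n), so uniform convergence of the samples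
    suffices. *)
Lemma riemann_samples (L : nat) (f q : R -> C) (g : nat -> int -> C) :
  (0 < L)%N -> ccontinuous f -> csupp L%:R f -> ccontinuous q ->
  (forall n, zbnd (L * 2 ^ n) (g n)) ->
  unif0 (fun n j => Normc.normc (g n j - f (2 ^- n * j%:~R))) ->
  unif0 (fun n (_ : unit) => Normc.normc
    (\zsum_(k) ((2 ^- n)%:C * (q (2 ^- n * k%:~R) * g n k)) - cRintegral (fun x => q x * f x))).
Proof.
move=> L0 cf sf cq gb hg; have L0' : (0 : R) < L%:R by rewrite ltr0n.
have sqf : csupp L%:R (fun x => q x * f x) by move=> x /sf ->; rewrite mulr0.
have cqf : ccontinuous (fun x => q x * f x) by exact: ccontinuousM.
have LL : - L%:R <= (L%:R : R) by lra.
have [B B0 hB] := bounded_segment LL cq.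
have b2 n : zbnd (L * 2 ^ n) (fun k : int => (2 ^- n)%:C * (q (2 ^- n * k%:~R) * f (2 ^- n * k%:~R))).
  by move=> k lt; rewrite sf ?mulr0 // grid_norm.
apply: (@unif0_le _ _ (fun n t => \sum_(k <- zr (L * 2 ^ n)) (2 ^- n * (B * Normc.normc (g n k - f (2 ^- n * k%:~R)))) +
   Normc.normc (\zsum_(k) ((2 ^- n)%:C * (q (2 ^- n * k%:~R) * f (2 ^- n * k%:~R))) - cRintegral (fun x => q x * f x)))).
  move=> n _; set I := cRintegral _.
  rewrite (@zsumE _ (L * 2 ^ n)); last by move=> k /gb ->; rewrite !mulr0.
  rewrite [X in _ <= _ + Normc.normc (X - _)](@zsumE _ (L * 2 ^ n)); last exact: b2.
  set S1 := \sum_(k <- _) _; set S2 := \sum_(k <- _) ((2 ^- n)%:C * (_ * f _)).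
  have -> : S1 - I = (S1 - S2) + (S2 - I) by ring.
  apply: le_trans (normcD _ _) _; rewrite lerD2r /S1 /S2 -sumrB.
  apply: le_trans (normc_sum _ _ _) _; rewrite !big_seq; apply: ler_sum => k; rewrite mem_zr => hk.
  rewrite -mulrBr -mulrBr !Normc.normcM normc_real normfV ger0_norm ?exprn_ge0 //.
  rewrite ler_wpM2l ?invr_ge0 ?exprn_ge0 // ler_wpM2r ?normc_ge0 // hB //.
  by rewrite -ler_norml leNgt grid_norm -leqNgt.
apply: unif0D.
  (* The number of grid points times 2^(-n) is at most 2 L + 1, and B bounds the weight q. *)
  move=> e e0; have K0 : 0 < (2 * L%:R + 1) * (B + 1) by rewrite mulr_gt0; lra.
  have [n0 hn] := hg _ (divr_gt0 e0 K0); exists n0 => n nn _.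
  apply: (@le_trans _ _ (\sum_(k <- zr (L * 2 ^ n)) (2 ^- n * (B * (e / ((2 * L%:R + 1) * (B + 1))))))).
    by apply: ler_sum => k _; rewrite ler_wpM2l ?invr_ge0 ?exprn_ge0 // ler_wpM2l // hn.
  rewrite big_const_seq count_predT size_zr iter_addr_0 -[leLHS]mulr_natl.
  have p1 : 1 <= (2 ^+ n : R) by rewrite exprn_ege1 // ler1n.
  have pn : 0 < (2 ^+ n : R) by lra.
  have -> : ((2 * (L * 2 ^ n)).+1%:R : R) = 2 * L%:R * 2 ^+ n + 1.
    by rewrite -addn1 natrD !natrM natrX mulrA.
  have -> : (2 * L%:R * 2 ^+ n + 1) * (2 ^- n * (B * (e / ((2 * L%:R + 1) * (B + 1))))) =
     e * (((2 * L%:R + 2 ^- n) / (2 * L%:R + 1)) * (B / (B + 1))).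
    by field; rewrite !gt_eqF //; lra.
  rewrite -[leRHS]mulr1 ler_wpM2l ?(ltW e0) // mulr_ile1 //.
  - by rewrite divr_ge0 // ?addr_ge0 ?invr_ge0 ?mulr_ge0 ?exprn_ge0 //; lra.
  - rewrite ler_pdivrMr ?mul1r; last lra.
    by rewrite lerD2l invf_le1.
  - by rewrite ler_pdivrMr ?mul1r; lra.
by move=> e e0; have [n0 hn] := riemann L0' cqf sqf e0; exists n0 => n nn _; exact: hn.
Qed.

End Limits.

(** * Limits of finitely supported data *)

Section HermiteLimits.
Variable R : realType.
Local Notation C := R[i].
Variables (r m : nat) (a : int -> 'M[C]_r) (N : nat).
Hypotheses (r0 : (0 < r)%N) (rm : (r - 1 <= m)%N) (aN : zbnd N a).

Lemma iter_subdivision_zbnd s M (w : int -> 'M[C]_(s, r)) n : zbnd M w ->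
  zbnd ((M + N) * 2 ^ n) (iter n (subdivision a) w).
Proof.
move=> wM i lt; rewrite (iter_subdivision aN); apply: zsum0 => k.
have [/wM->|le] := ltnP M `|k|; first by rewrite mul0mx.
rewrite (A_zbnd' aN) ?mulmx0 //.
have h : (absz (2 ^+ n * k)%R <= 2 ^ n * M)%N by rewrite abszM two_expz leq_mul.
by rewrite mulnDl in lt; rewrite mulnC in h; lia.
Qed.

(** The definition gives uniformity only for |k| <= 2^n K. Finite support confines the iterates, and
    by continuity the limit, to a bounded interval; outside it both vanish, which makes the
    convergence uniform over all k. *)
Lemma hermite_limit M (w : int -> 'rV[C]_r) : hermite_convergent m a -> zbnd M w ->
  exists E : R -> C, [/\ cont_diff m E, csupp (M + N + 1)%N%:R E &
    forall l : 'I_r, unif0 (fun n k =>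
      Normc.normc (iter n (subdivision a) w k 0 l * 2 ^+ (l * n) - cderivn l E (2 ^- n * k%:~R)))].
Proof.
move=> H wM; have [E [cE hE]] := H w; exists E.
pose L : R := (M + N + 1)%N%:R.
have L0 : 0 < L by rewrite ltr0n addn1.
have conv (K : R) (l : 'I_r) : 0 < K -> forall e : R, 0 < e -> exists n0, forall n, (n0 <= n)%N ->
    forall k : int, `|k%:~R| <= 2 ^+ n * K ->
    Normc.normc (iter n (subdivision a) w k 0 l * 2 ^+ (l * n) - cderivn l E (2 ^- n * k%:~R)) <= e.
  move=> K0 e e0; have := hE K K0 l.
  move=> /(_ [set x : \bar R | (x < e%:E)%E]) [|n0 _ hn].
    by apply: open_nbhs_nbhs; split; [exact: open_ereal_lt_ereal | rewrite /= lte_fin].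
  exists n0 => n nn k hk; have /= lt := hn n nn; rewrite -lee_fin; apply: le_trans (ltW lt).
  by apply: ereal_sup_ubound; exists k.
have big n (k : int) : 2 ^+ n * L < `|k%:~R| -> ((M + N) * 2 ^ n < `|k|)%N.
  move=> lt; have : L < `|2 ^- n * k%:~R| by rewrite normrM gtr0_norm ?invr_gt0 ?exprn_gt0 // mulrC ltr_pdivlMr ?exprn_gt0 // mulrC.
  by rewrite grid_norm; apply: leq_ltn_trans; rewrite leq_mul // leq_addr.
have sE : csupp L E.
  move=> x Lx; pose K := `|x| + 1.
  have K0 : 0 < K by rewrite ltr_wpDl.
  have cE0 : ccontinuous E by have := cE.2 0%N (leq0n _); rewrite cderivn0.
  apply/Normc.eq0_normc/le_anti; rewrite normc_ge0 andbT; apply/ler_addgt0Pl => e e0; rewrite addr0.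
  have e2 : 0 < e / 2 by lra.
  have [d d0 hd] := ccont_eps cE0 x e2.
  have [n1 h1] := conv K (Ordinal r0) K0 _ e2.
  have d1 : 0 < Num.min d (Num.min 1 (`|x| - L)) by rewrite !lt_min d0 ltr01 subr_gt0.
  have [n2 h2] := pow2_small d1.
  pose n := maxn n1 n2.
  have := h2 n (leq_maxr _ _); rewrite !lt_min => /and3P[k1 k2 k3].
  have [k hk] := floor_sample x n.
  have p0 : 0 < (2 ^+ n : R) by rewrite exprn_gt0.
  have ek : k%:~R = 2 ^+ n * (2 ^- n * k%:~R) :> R by rewrite mulVKf // gt_eqF.
  set y := 2 ^- n * k%:~R in hk ek.
  have yx : `|y| <= `|y - x| + `|x| by rewrite -{1}(subrK x y) ler_normD.
  have xy : `|x| <= `|y - x| + `|y| by rewrite distrC -{1}(subrK y x) ler_normD.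
  have := h1 n (leq_maxl _ _) k; rewrite -/y ek normrM (gtr0_norm p0) ler_pM2l //.
  rewrite (iter_subdivision_zbnd (n := n) wM) ?mxE ?mul0r ?sub0r ?normcN ?cderivn0; last first.
    by apply: big; rewrite ek normrM (gtr0_norm p0) ltr_pM2l //; lra.
  move=> h3; have h4 : `|y| <= K by rewrite /K; lra.
  have h7 := h3 h4; have h5 : `|y - x| < d by lra.
  have h6 := hd y h5; have -> : E x = (E y) - (E y - E x) by ring.
  by apply: le_trans (normcD _ _) _; rewrite normcN; lra.
split => // l.
have lm : (l <= m)%N by have := ltn_ord l; lia.
have sl := csupp_cderivn sE cE lm.
move=> e e0; have [n0 hn] := conv L l L0 e e0; exists n0 => n nn k.
have [le|lt] := leP `|k%:~R| (2 ^+ n * L); first exact: hn.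
rewrite (iter_subdivision_zbnd (n := n) wM) ?(big n) // mxE mul0r sub0r normcN sl ?Normc.normc0 ?ltW //.
by rewrite normrM gtr0_norm ?invr_gt0 ?exprn_gt0 // mulrC ltr_pdivlMr ?exprn_gt0 // mulrC.
Qed.

End HermiteLimits.

(** * The matching filter of a convergent scheme *)

Section HermiteFilter.
Variable R : realType.
Local Notation C := R[i].
Variables (r m : nat) (a : int -> 'M[C]_r) (N : nat).
Hypotheses (r0 : (0 < r)%N) (rm : (r - 1 <= m)%N) (aN : zbnd N a).

(** The Hermite condition in moments: the l-th derivative of (i xi)^l at 0 is i^l l!, that of the
    symbol is (-i)^l times the moment, and the quotient is (-1)^l l!. *)
Definition hermite_moments (v : int -> 'rV[C]_r) := forall l : 'I_r,
  (forall p, (p < l)%N -> mom 'X^p v 0 l = 0) /\ mom 'X^l v 0 l = (-1) ^+ l * (l`!)%:R.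

Lemma real_complex_pow2 n : (2 ^- n)%:C = 2 ^- n :> C.
Proof. by rewrite -[LHS]/(real_complex R _) fmorphV rmorphXn /= (rmorph_nat (real_complex R)). Qed.

Lemma real_complex_grid n (k : int) : (2 ^- n * k%:~R)%:C = 2 ^- n * k%:~R :> C.
Proof. by rewrite -[LHS]/(real_complex R _) rmorphM /= real_complex_pow2 (rmorph_int (real_complex R)). Qed.

Lemma mono_derivn (l p : nat) : cderivn p (fun xi : R => (0 +i* xi) ^+ l : C) 0 =
  if p == l then (0 +i* 1) ^+ l * (l`!)%:R else 0.
Proof.
pose q : {poly C} := ((0 +i* 1) ^+ l) *: 'X^l.
have e0 x : (derivn 0 q).[x%:C] = (0 +i* x) ^+ l.
  rewrite /= hornerZ hornerXn -exprMn; congr (_ ^+ _).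
  by apply: cReIm_eq; rewrite ?cReM ?cImM /=; ring.
have -> : (fun xi : R => (0 +i* xi) ^+ l : C) = (fun x => (derivn 0 q).[x%:C]).
  by apply/funext => x; rewrite e0.
rewrite (@derivs_all_cderivn R (fun n x => (derivn n q).[x%:C])); last by move=> k; exact: derivs_poly.
rewrite rmorph0 /q derivnZ hornerZ derivnXn hornerMn hornerXn expr0n subn_eq0.
have [->|pl] := eqVneq p l; first by rewrite leqnn ffactnn.
have [lp|lp] := leqP l p; last by rewrite mul0rn mulr0.
by rewrite ffact_small ?mulr0n ?mulr0 //; lia.
Qed.

Lemma hermite_filterP M (v : int -> 'rV[C]_r) : zbnd M v ->
  (forall l : 'I_r, ceqO l.+1 (fun xi => symbol v xi 0 l) (fun xi => (0 +i* xi) ^+ l)) <->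
  hermite_moments v.
Proof.
move=> vM.
have key (p l : nat) : (0 +i* 1 : C) ^+ l * (l`!)%:R = (0 -i* 1) ^+ l * ((-1) ^+ l * (l`!)%:R).
  rewrite mulrA -exprMn; congr (_ ^+ _ * _).
  by apply: cReIm_eq; rewrite ?cReM ?cImM /=; ring.
split=> [h l|h l p].
  split=> [p pl|].
    have := h l p (ltnW pl); rewrite (symbol_derivn vM) mono_derivn ltn_eqF // => /eqP.
    by rewrite mulf_eq0 (negbTE (mI_neq0 _ _)) /= => /eqP.
  have := h l l (leqnn _); rewrite (symbol_derivn vM) mono_derivn eqxx (key 0%N).
  by apply: mulfI; exact: mI_neq0.
have [h1 h2] := h l.
rewrite ltnS leq_eqVlt (symbol_derivn vM) mono_derivn => /orP[/eqP ->|pl].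
  by rewrite eqxx h2 (key 0%N).
by rewrite ltn_eqF // h1 // mulr0.
Qed.

(** Repeated integration by parts: the derivative of x^(l+1) E^(l) integrates to 0, which
    contributes a factor -(l+1) at each step. *)
Lemma integral_monomial_deriv (L : R) (E : R -> C) : 0 < L -> csupp L E -> cont_diff m E ->
  forall l, (l <= m)%N ->
  cRintegral (fun x => x%:C ^+ l * cderivn l E x) = (-1) ^+ l * (l`!)%:R * cRintegral E.
Proof.
move=> L0 sE cE.
have sl := csupp_cderivn sE cE.
have mc (p : nat) : ccontinuous (fun x : R => x%:C ^+ p : C).
  by apply: smooth_continuous; exact: smooth_mono.
elim=> [|l IH] lm.
  by rewrite expr0 mul1r mul1r cderivn0; congr cRintegral; apply/funext => x; rewrite expr0 mul1r.
pose F x := x%:C ^+ l.+1 * cderivn l E x.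
pose f1 x := x%:C ^+ l.+1 * cderivn l.+1 E x.
pose f2 x := l.+1%:R * (x%:C ^+ l * cderivn l E x).
have dF x : is_cderive F x (f1 x + f2 x).
  have h1 : is_cderive (fun y : R => y%:C ^+ l.+1 : C) x (l.+1%:R * x%:C ^+ l).
    refine (@is_cderive_eq R (fun y => ('X^(l.+1) : {poly C}).[y%:C]) (fun y : R => y%:C ^+ l.+1 : C) x _ _ (is_cderive_poly _ x) _ _) => [y|]; first by rewrite hornerXn.
    by rewrite derivXn hornerMn hornerXn mulr_natl.
  have h2 := cont_diff_derivs cE lm x.
  apply: (@is_cderive_eq R _ _ x _ _ (is_cderiveM h1 h2)) => [//|].
  by rewrite /f1 /f2; ring.
have c1 : ccontinuous f1 by apply: ccontinuousM (mc _) _; exact: cE.2.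
have c2' : ccontinuous (fun x => x%:C ^+ l * cderivn l E x).
  by apply: ccontinuousM (mc _) _; apply: cE.2; exact: ltnW.
have c2 : ccontinuous f2 by exact: ccontinuousZ.
have s1 : csupp L f1 by move=> x Lx; rewrite /f1 (sl _ lm) ?mulr0.
have s2' : csupp L (fun x => x%:C ^+ l * cderivn l E x) by move=> x Lx; rewrite (sl _ (ltnW lm)) ?mulr0.
have s2 : csupp L f2 by move=> x Lx; rewrite /f2 s2' ?mulr0.
have sF : csupp L F by move=> x Lx; rewrite /F (sl _ (ltnW lm)) ?mulr0.
have := cRintegral_deriv L0 (ccontinuousD c1 c2) sF dF.
move=> /(_ _)-h; have : csupp L (fun x => f1 x + f2 x) by move=> x Lx; rewrite s1 ?s2 ?addr0.
move=> /h; rewrite (cRintegralD L0) // /f2 (cRintegralZ _ L0) // (IH (ltnW lm)) => /eqP.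
rewrite addr_eq0 => /eqP ->; rewrite factS natrM exprS; ring.
Qed.

Section Filter.
Variables (M : nat) (v : int -> 'rV[C]_r).
Hypotheses (vM : zbnd M v) (hv : matched a r v) (conv : hermite_convergent m a).

Lemma filter_limit : exists E : R -> C, [/\ cont_diff m E, csupp (M + N + 1)%N%:R E &
  forall (l : 'I_r) p, (p < r)%N -> exists2 x : nat -> unit -> R, unif0 x &
    forall n, Normc.normc (2 ^+ (l * n) * (2 ^- n ^+ p * mom 'X^p v 0 l)
       - cRintegral (fun x => x%:C ^+ p * cderivn l E x)) <= x n tt].
Proof.
have [E [cE sE hE]] := hermite_limit r0 rm aN conv vM; exists E; split => // l p pr.
have L0 : (0 < M + N + 1)%N by rewrite addn1.
have lm : (l <= m)%N by have := ltn_ord l; lia.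
have cf : ccontinuous (cderivn l E) by exact: cE.2.
have := riemann_samples L0 cf (csupp_cderivn sE cE lm) (smooth_continuous (smooth_mono R p)) _ (hE l).
set X := (X in _ -> unif0 X); move=> h.
have bn n : zbnd ((M + N) * 2 ^ n) (iter n (subdivision a) v) by exact: iter_subdivision_zbnd.
exists X => [|n].
  apply: h => n; apply: (@zbnd_widen _ ((M + N) * 2 ^ n)); first by rewrite leq_mul2r leq_addr orbT.
  by move=> k /bn ->; rewrite mxE mul0r.
rewrite /X le_eqVlt; apply/orP; left; apply/eqP; congr (Normc.normc (_ - _)).
have e := @mom_iter R r a N aN r M v n 'X^p vM hv; rewrite size_polyXn in e; have {}e := e pr.
have e2 : mom 'X^p v = 2 ^- n *: mom 'X^p (iter n (subdivision a) v).
  by rewrite e scalerA mulVf ?scale1r // expf_neq0 // pnatr_eq0.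
rewrite e2 mxE /mom (zsum_entry (M := (M + N) * 2 ^ n)); last exact: zbndZ.
have b3 : zbnd ((M + N) * 2 ^ n) (fun k : int => ('X^p : {poly C}).[k%:~R] * iter n (subdivision a) v k 0 l).
  by move=> k /bn ->; rewrite mxE mulr0.
rewrite (@zsumE _ ((M + N) * 2 ^ n)); last by move=> k /bn ->; rewrite !mxE mulr0.
rewrite [RHS](@zsumE _ ((M + N) * 2 ^ n)); last by move=> k /bn ->; rewrite !mxE mul0r !mulr0.
rewrite !mulr_sumr; apply: eq_bigr => k _; rewrite !mxE hornerXn.
rewrite real_complex_grid real_complex_pow2 exprMn.
by ring.
Qed.

Lemma hermite_convergent_moments :
  (exists l : 'I_r, symbol v 0 0 l = 1 /\ forall j : 'I_r, (j < l)%N -> symbol v 0 0 j = 0) ->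
  hermite_moments v.
Proof.
have s0 : symbol v 0 = mom 'X^0 v by rewrite (symbol_0 vM) expr0.
rewrite s0; move=> [l0 [h1 h2]].
have [E [cE sE hE]] := filter_limit.
pose U p l := mom 'X^p v 0 l; pose I p l := cRintegral (fun x => x%:C ^+ p * cderivn l E x).
have Ult p (l : 'I_r) : (p < l)%N -> U p l = 0.
  move=> pl; have [x x0 hx] := hE l p (ltn_trans pl (ltn_ord l)).
  apply: (@unif0_eq0 _ _ (fun n t => Normc.normc (I p l) * 2 ^- n + x n t)).
    by apply: unif0D x0; apply: unif0Z; [exact: normc_ge0 | exact: unif0_pow].
  move=> n; have p1 : 1 <= (2 ^+ n : R) by rewrite exprn_ege1 // ler1n.
  have p0 : 0 < (2 ^+ n : R) by lra.
  have ed : (2 ^+ (l * n) * (2 ^- n ^+ p) : C) = (2 ^+ n) ^+ (l - p).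
    by rewrite mulnC exprM exprB ?(ltnW pl) ?unitfE ?expf_neq0 ?pnatr_eq0 // exprVn.
  have := hx n; rewrite mulrA ed -/(U p l) -/(I p l) => h.
  have h3 : Normc.normc ((2 ^+ n) ^+ (l - p) * U p l) <= Normc.normc (I p l) + x n tt.
    rewrite -[X in Normc.normc X](subrK (I p l)) addrC; apply: le_trans (normcD _ _) _.
    by rewrite lerD2l.
  rewrite Normc.normcM normcX normcX normc_nat in h3.
  have dl : (0 < l - p)%N by rewrite subn_gt0.
  have h4 : 2 ^+ n * Normc.normc (U p l) <= Normc.normc (I p l) + x n tt.
    apply: le_trans h3; rewrite ler_wpM2r ?normc_ge0 //.
    exact: ler_eXnr.
  have x1 : 0 <= x n tt by apply: le_trans (hx n); exact: normc_ge0.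
  apply: (@le_trans _ _ (2 ^- n * (Normc.normc (I p l) + x n tt))).
    by rewrite ler_pdivlMl.
  rewrite mulrDr mulrC lerD2l -[leRHS]mul1r ler_wpM2r // invf_le1 //.
have Ueq (l : 'I_r) : U l l = I l l.
  have [x x0 hx] := hE l l (ltn_ord l); apply/eqP; rewrite -subr_eq0; apply/eqP.
  apply: (unif0_eq0 x0) => n; have := hx n.
  by rewrite mulrA exprVn -exprM mulnC divff ?mul1r // expf_neq0 // pnatr_eq0.
have L0 : 0 < (M + N + 1)%N%:R :> R by rewrite ltr0n addn1.
have Ieq (l : 'I_r) : I l l = (-1) ^+ l * (l`!)%:R * cRintegral E.
  by apply: (integral_monomial_deriv L0) => //; have := ltn_ord l; lia.
(* All entries of the symbol at 0 of positive index vanish, being moments of order 0 < l; so the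
   first nonzero entry is the entry 0, and its normalization gives E the integral 1. *)
have l00 : l0 = Ordinal r0.
  apply/val_inj => /=; case: (posnP l0) => // l0p.
  by move/eqP: h1; rewrite -/(U 0%N l0) (Ult 0%N l0 l0p) eq_sym oner_eq0.
have E1 : cRintegral E = 1.
  by have := Ueq (Ordinal r0); rewrite Ieq /= !mul1r => <-; rewrite -h1 l00.
by move=> l; split=> [p pl|]; [exact: (Ult p l pl) | rewrite -/(U l l) Ueq Ieq E1 mulr1].
Qed.

End Filter.
End HermiteFilter.

(** * Refinable functions *)

Section Refinable.
Variable R : realType.
Local Notation C := R[i].
Variables (r m : nat) (a : int -> 'M[C]_r) (N : nat).
Hypothesis aN : zbnd N a.
Local Notation A := (A a).

(* The equation fourier phi (2 xi) = symbol a xi *m fourier phi xi, read pointwise. *)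
Definition refinable (eta : 'I_r -> R -> C) := forall i x,
  eta i x = 2 * \sum_(k <- zr N) \sum_j a k i j * eta j (2 * x - k%:~R).

Definition jet (eta : 'I_r -> R -> C) (n : nat) (x : R) : 'cV[C]_r := \col_i cderivn n (eta i) x.

Section Eta.
Variables (L : R) (eta : 'I_r -> R -> C).
Hypotheses (L0 : 0 < L) (eta_diff : forall i, cont_diff m (eta i)) (eta_supp : forall i, csupp L (eta i))
  (eta_ref : refinable eta).

Lemma refinable_cderivn n i x : (n <= m)%N ->
  cderivn n (eta i) x = 2 ^+ n.+1 * \sum_(k <- zr N) \sum_j a k i j * cderivn n (eta j) (2 * x - k%:~R).
Proof.
move=> nm; pose D p y : C := 2 * \sum_(k <- zr N) \sum_j a k i j * (2%:C ^+ p * cderivn p (eta j) (2 * y + - k%:~R)).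
have dD : derivs m D.
  apply: (@derivsZ R m 2 (fun p y => \sum_(k <- zr N) \sum_j a k i j * (2%:C ^+ p * cderivn p (eta j) (2 * y + - k%:~R)))).
  apply: (@derivs_sum R m int (zr N) (fun k p y => \sum_j a k i j * (2%:C ^+ p * cderivn p (eta j) (2 * y + - k%:~R)))) => k.
  apply: (@derivs_sum R m 'I_r _ (fun j p y => a k i j * (2%:C ^+ p * cderivn p (eta j) (2 * y + - k%:~R)))) => j.
  apply: (@derivsZ R m (a k i j) (fun p y => (2%:C ^+ p * cderivn p (eta j) (2 * y + - k%:~R)))).
  exact: (derivs_aff 2 (- k%:~R) (cont_diff_derivs (eta_diff j))).
have -> : eta i = D 0%N.
  apply/funext => y; rewrite eta_ref /D; congr (_ * _).
  apply: eq_bigr => k _; apply: eq_bigr => j _.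
  by rewrite cderivn0 expr0 mul1r.
rewrite (derivs_cderivn dD nm) /D exprS -mulrA; congr (_ * _); rewrite mulr_sumr.
apply: eq_bigr => k _; rewrite mulr_sumr; apply: eq_bigr => j _.
have -> : 2%:C ^+ n = 2 ^+ n :> C by congr (_ ^+ _); rewrite -[LHS]/(real_complex R _) rmorph_nat.
by rewrite mulrCA.
Qed.

Lemma jet_zbnd n x : (n <= m)%N -> exists M, zbnd M (fun k : int => jet eta n (x + k%:~R)).
Proof.
move=> nm; exists (Num.bound (L + `|x|)) => k lt; apply/matrixP => i j; rewrite !mxE.
apply: (csupp_cderivn (eta_supp i) (eta_diff i) nm).
have h : L + `|x| < (Num.bound (L + `|x|))%:R by apply: archi_boundP; rewrite addr_ge0 // ltW.
have h2 : (Num.bound (L + `|x|))%:R <= `|k%:~R| :> R.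
  by rewrite -intr_norm -abszE -[_%:~R]/(`|k|%N%:R : R) ler_nat ltnW.
have := lerB_normD (k%:~R) x; rewrite [k%:~R + x]addrC; lra.
Qed.

Lemma jet_half n x (p : int) : (n <= m)%N ->
  jet eta n ((x + p%:~R) / 2) = 2 ^+ n *: convolution (A 1) (fun k : int => jet eta n (x + k%:~R)) p.
Proof.
move=> nm; rewrite convolutionC (@zsumE _ N); last first.
  by move=> k lt; rewrite (A_1 aN) aN // scaler0 mul0mx.
apply/matrixP => i j; rewrite !mxE (refinable_cderivn i _ nm) exprSr -mulrA; congr (_ * _).
rewrite mulr_sumr summxE; apply: eq_bigr => k _; rewrite (A_1 aN) !mxE mulr_sumr; apply: eq_bigr => t _.
rewrite !mxE -mulrA; congr (_ * (_ * cderivn n (eta t) _)).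
by rewrite rmorphB /=; field.
Qed.

(** The refinement equation, iterated, computes the values at 2^(-j) (x + p) by j steps of the
    cascade from the integer translates of x. *)
Lemma jet_iter n j x (p : int) : (n <= m)%N ->
  jet eta n (2 ^- j * (x + p%:~R)) =
  2 ^+ (n * j) *: convolution (A j) (fun k : int => jet eta n (x + k%:~R)) p.
Proof.
move=> nm; elim: j x p => [|j IH] x p.
  rewrite muln0 expr0 scale1r invr1 mul1r convolutionC (@zsum1 _ 0) => [|k /negbTE k0].
    by rewrite /A /= /dirac_mx eqxx mul1mx subr0.
  by rewrite /A /= /dirac_mx k0 mul0mx.
have [M uM] := jet_zbnd x nm.
(* The induction hypothesis is used with the base point (x + p) / 2 and position 0; the step peeled
   off is a transition operator on the coset of p. *)
have -> : 2 ^- j.+1 * (x + p%:~R) = 2 ^- j * ((x + p%:~R) / 2 + 0%:~R) :> R.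
  by rewrite exprS; field; rewrite expf_neq0.
rewrite IH.
have -> : (fun k : int => jet eta n ((x + p%:~R) / 2 + k%:~R)) =
    (fun k => 2 ^+ n *: Tm a 1 p (fun k => jet eta n (x + k%:~R)) k).
  apply/funext => k; rewrite /Tm -jet_half //; congr (jet _ _ _).
  by rewrite rmorphD rmorphM /=; field.
have h := convolution_A_add aN (fun k : int => jet eta n (x + k%:~R)) j 1 0 p; rewrite mulr0 add0r addn1 in h.
rewrite h mulnSr exprD -scalerA; congr (_ *: _).
rewrite !convolutionE; have b : zbnd (N * 2 ^ 1 + M + `|p|) (Tm a 1 p (fun k => jet eta n (x + k%:~R))).
  move=> k lt; rewrite /Tm (convolution_zbnd uM (A_zbnd' aN (n := 1))) //.
  by have := two_le 1 k; lia.
transitivity (\zsum_(k) 2 ^+ n *: (A j (0 - k) *m Tm a 1 p (fun k0 : int => jet eta n (x + k0%:~R)) k)).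
  by apply: eq_zsum => k; rewrite scaleMr.
by rewrite -(zsumZ (M := N * 2 ^ 1 + M + `|p|)) // => k /b ->; rewrite mulmx0.
Qed.

End Eta.
End Refinable.

(** * Refinement of integrals *)

Section IntegralRefinement.
Variable R : realType.
Local Notation C := R[i].
Variables (r : nat) (a : int -> 'M[C]_r) (N : nat).

Lemma integral_refinement (L0 : R) (eta : 'I_r -> R -> C) : 0 < L0 ->
  (forall i, ccontinuous (eta i)) -> (forall i, csupp L0 (eta i)) ->
  forall i (f : R -> C), ccontinuous f ->
  cRintegral (fun x => (2 * \sum_(k <- zr N) \sum_j a k i j * eta j (2 * x - k%:~R)) * f x) =
  \sum_(k <- zr N) \sum_j a k i j * cRintegral (fun x => eta j x * f ((x + k%:~R) / 2)).
Proof.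
move=> L00 eta_cont eta_supp i f cf.
pose G (k : int) j x := eta j x * f (2^-1 * x + k%:~R / 2).
have cG k j : ccontinuous (G k j).
  by apply: ccontinuousM; [exact: eta_cont | exact: ccontinuous_aff].
have sG k j : csupp L0 (G k j) by move=> x Lx; rewrite /G eta_supp ?mul0r.
pose L : R := L0 + N%:R.
have L1 : 0 < L by rewrite /L ltr_wpDr ?ler0n.
have sG2 k j : (`|k| <= N)%N -> csupp L (fun x => G k j (2 * x + - k%:~R)).
  move=> kN x Lx; apply: sG.
  have h1 : `|k%:~R| <= N%:R :> R by rewrite -intr_norm -abszE -[_%:~R]/(`|k|%N%:R : R) ler_nat.
  have := lerB_normD (2 * x) (- k%:~R); rewrite normrN normrM ger0_norm //.
  have : 0 <= N%:R :> R by []. move: Lx; rewrite /L; lra.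
(* Integrals of sums require one support bound for all indices, so the translates beyond the range
   of the mask are replaced by 0. *)
pose H k j : R -> C := if (`|k| <= N)%N then (fun x => a k i j * (2 * G k j (2 * x + - k%:~R))) else (fun=> 0).
have cH k j : ccontinuous (H k j).
  rewrite /H; case: ifP => _; last exact: ccontinuous_cst.
  by apply: ccontinuousZ; apply: ccontinuousZ; apply: ccontinuous_aff.
have sH k j : csupp L (H k j).
  by rewrite /H; case: ifP => kN x Lx //; rewrite sG2 // !mulr0.
have -> : (fun x => (2 * \sum_(k <- zr N) \sum_j a k i j * eta j (2 * x - k%:~R)) * f x) = (fun x => \sum_(k <- zr N) \sum_j H k j x).
  apply/funext => x; rewrite mulrAC mulr_sumr; rewrite !big_seq; apply: eq_bigr => k.
  rewrite mem_zr => kN; rewrite mulr_sumr; apply: eq_bigr => j _; rewrite /H kN /G.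
  have -> : 2^-1 * (2 * x + - k%:~R) + k%:~R / 2 = x by field.
  by ring.
rewrite (cRintegral_sum _ L1); last 2 first.
  - by move=> k; exact: ccontinuous_sum.
  - by move=> k x Lx; rewrite big1 // => j _; exact: sH.
rewrite !big_seq; apply: eq_bigr => k; rewrite mem_zr => kN.
rewrite (cRintegral_sum _ L1) //; apply: eq_bigr => j _.
rewrite /H kN (cRintegralZ _ L1); last 2 first.
  - by apply: ccontinuousZ; apply: ccontinuous_aff.
  - by move=> x Lx; rewrite sG2 // mulr0.
rewrite (cRintegralZ 2 L1 (ccontinuous_aff 2 (- k%:~R) (cG k j)) (sG2 k j kN)).
rewrite (cRintegral_aff (- k%:~R) L00 _ (cG k j) (sG k j)) // -[(2^-1)%:C]/(real_complex R _) fmorphV (rmorph_nat (real_complex R)) mulVKf ?pnatr_eq0 //.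
congr (_ * cRintegral _); apply/funext => x; rewrite /G; congr (_ * f _).
by rewrite mulrDl [x / 2]mulrC.
Qed.

End IntegralRefinement.

(** * Limit functions of delta data *)

Section LimitFunctions.
Variable R : realType.
Local Notation C := R[i].
Variables (r m : nat) (a : int -> 'M[C]_r) (N : nat).
Hypotheses (r0 : (0 < r)%N) (rm : (r - 1 <= m)%N) (aN : zbnd N a) (conv : hermite_convergent m a).
Local Notation A := (A a).
Local Notation o := (Ordinal r0).

Lemma limit_functions : exists eta : 'I_r -> R -> C,
  [/\ forall i, cont_diff m (eta i), forall i, csupp (N + 1)%N%:R (eta i) &
   forall i l : 'I_r, unif0 (fun n k =>
      Normc.normc (A n k i l * 2 ^+ (l * n) - cderivn l (eta i) (2 ^- n * k%:~R)))].
Proof.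
have H i : exists E : R -> C, [/\ cont_diff m E, csupp (N + 1)%N%:R E &
    forall l : 'I_r, unif0 (fun n k =>
      Normc.normc (A n k i l * 2 ^+ (l * n) - cderivn l E (2 ^- n * k%:~R)))].
  pose w (k : int) : 'rV[C]_r := if k == 0 then delta_mx 0 i else 0.
  have wM : zbnd 0 w by move=> k; rewrite absz_gt0 /w => /negbTE ->.
  have [E [h1 h2 h3]] := hermite_limit r0 rm aN conv wM; exists E; split => // l.
  apply: unif0_le (h3 l) => n k.
  rewrite (iter_subdivision aN) (@zsum1 _ 0) => [|j /negbTE j0]; last by rewrite /w j0 mul0mx.
  by rewrite mulr0 subr0 /w eqxx -rowE mxE.
have [eta h] := boolp.choice H.
by exists eta; split=> [i|i|i l]; have [] := h i.
Qed.

Section Eta.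
Variable eta : 'I_r -> R -> C.
Hypotheses (eta_diff : forall i, cont_diff m (eta i)) (eta_supp : forall i, csupp (N + 1)%N%:R (eta i))
 (eta_lim : forall i l : 'I_r, unif0 (fun n k =>
      Normc.normc (A n k i l * 2 ^+ (l * n) - cderivn l (eta i) (2 ^- n * k%:~R)))).

Lemma eta_cont i : ccontinuous (eta i).
Proof. by have := (eta_diff i).2 0%N (leq0n _); rewrite cderivn0. Qed.

(** Let p(n) 2^(-n) tend to x. Then [A n.+1] at p(n+1) approximates eta(x), while (p(n+1) - 2^n k)
    2^(-n) tends to 2 x - k; the recursion for [A n.+1] passes to the limit term by term. *)
Lemma eta_refinable : refinable a N eta.
Proof.
move=> i x; apply/eqP; rewrite -subr_eq0; apply/eqP.
have lim j : unif0 (fun n k => Normc.normc (A n k j o - eta j (2 ^- n * k%:~R))).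
  apply: unif0_le (eta_lim j o) => n k.
  by rewrite mul0n expr0 mulr1 cderivn0.
have [p hp] := boolp.choice (floor_sample x).
pose X n (_ : unit) := Normc.normc (A n (p n) i o - eta i x).
have X0 : unif0 X by apply: (@grid_sample _ _ (fun n k => A n k i o) x 1) => [||//|n]; rewrite ?mul1r //; exact: eta_cont.
pose Y k j n (_ : unit) := Normc.normc (A n (p n.+1 - 2 ^+ n * k) j o - eta j (2 * x - k%:~R)).
have Y0 k j : unif0 (Y k j).
  apply: (@grid_sample _ _ (fun n k => A n k j o) (2 * x - k%:~R) 1 (fun n => p n.+1 - 2 ^+ n * k)) => [||//|n]; [exact: eta_cont | exact: ler01 |].
  rewrite mul1r; have := hp n.+1.
  have e2 : (2 ^+ n : R) != 0 by rewrite expf_neq0.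
  have -> : 2 ^- n * (p n.+1 - 2 ^+ n * k)%:~R - (2 * x - k%:~R) = 2 * (2 ^- n.+1 * (p n.+1)%:~R - x) :> R.
    by rewrite rmorphB rmorphM /= rmorphXn /= exprS; field.
  have -> : 2 ^- n = 2 * 2 ^- n.+1 :> R by rewrite exprS; field.
  by rewrite normrM ger0_norm // ler_pM2l.
apply: (@unif0_eq0 _ _ (fun n t => X n.+1 t + \sum_(k <- zr N) \sum_j Normc.normc (2 * a k i j) * Y k j n t)).
  apply: unif0D; first by have := unif0_shift 1 X0; under eq_fun do rewrite addn1.
  apply: unif0_sum => k; apply: unif0_sum => j; apply: unif0Z; [exact: normc_ge0 | exact: Y0].
move=> n; set S := 2 * _.
have -> : eta i x - S = (A n.+1 (p n.+1) i o - S) - (A n.+1 (p n.+1) i o - eta i x) by ring.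
apply: le_trans (normcD _ _) _; rewrite normcN addrC lerD2l /S mulr_sumr.
rewrite -[n.+1]add1n (A_add aN) add1n.
rewrite (@zsumE _ N); last by move=> k kN; rewrite (A_1 aN) aN // scaler0 mul0mx.
rewrite summxE -sumrB; apply: le_trans (normc_sum _ _ _) _; apply: ler_sum => k _.
rewrite mxE mulr_sumr -sumrB; apply: le_trans (normc_sum _ _ _) _; apply: ler_sum => j _.
by rewrite (A_1 aN) mxE mulrA -mulrBr Normc.normcM.
Qed.

(** Being fixed by the symbol of a at 0, m0 is multiplied by 2^n by that of [A n]. So the normalized
    column sums of row i, weighted by m0, equal its i-th entry for all n; in the limit only the
    first column survives, as the integral of eta_i times the first entry 1. *)
Lemma eta_mean (m0 : 'cV[C]_r) : symbol a 0 *m m0 = m0 -> m0 o 0 = 1 ->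
  forall i, cRintegral (eta i) = m0 i 0.
Proof.
move=> am m01 i.
have L0 : (0 < N + 1)%N by rewrite addn1.
pose Z l n := \sum_(k <- zr ((N + 1) * 2 ^ n)) 2 ^- n * A n k i l.
have bA n : zbnd ((N + 1) * 2 ^ n) (A n).
  by apply: (zbnd_widen _ (A_zbnd' aN (n := n))); rewrite leq_mul2r leq_addr orbT.
have mean n : \sum_l Z l n * m0 l 0 = m0 i 0.
  have e : symbol (A n) 0 *m m0 = 2 ^+ n *: m0.
    elim: n => [|n IH].
      rewrite expr0 scale1r symbolE (@zsum1 _ 0) => [|k /negbTE k0].
        by rewrite mul0r oppr0 expi0 scale1r /A /= /dirac_mx eqxx mul1mx.
      by rewrite /A /= /dirac_mx k0 scaler0.
    rewrite (symbol_subdivision (a := a) (v := A n) 0 aN (bA n)) mulr0 scaleMl -mulmxA am IH.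
    by rewrite scalerA -exprS.
  have -> : m0 i 0 = (2 ^- n *: (symbol (A n) 0 *m m0)) i 0.
    by rewrite e scalerA mulVf ?scale1r // expf_neq0 // pnatr_eq0.
  rewrite mxE mxE mulr_sumr; apply: eq_bigr => l _.
  rewrite [in RHS]mulrA (symbol_0 (bA n)) /mom (@zsumE _ ((N + 1) * 2 ^ n)); last exact: zbndZ.
  rewrite summxE mulr_sumr /Z; congr (_ * _).
  by apply: eq_bigr => k _; rewrite mxE hornerC mul1r.
have Zlim (l : 'I_r) : exists x : nat -> unit -> R, unif0 x /\
    forall n, Normc.normc (Z l n - (if l == o then cRintegral (eta i) else 0)) <= x n tt.
  have lm : (l <= m)%N by have := ltn_ord l; lia.
  have cf : ccontinuous (cderivn l (eta i)) by exact: (eta_diff i).2.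
  have := riemann_samples L0 cf (csupp_cderivn (eta_supp i) (eta_diff i) lm) (ccontinuous_cst 1) _ (eta_lim i l).
  set X := (X in _ -> unif0 X); move=> h.
  have X0 : unif0 X by apply: h => n k /bA ->; rewrite mxE mul0r.
  set I := cRintegral (fun x => 1 * cderivn l (eta i) x) in X h X0.
  have eX n : X n tt = Normc.normc (2 ^+ (l * n) * Z l n - I).
    rewrite /X; congr (Normc.normc (_ - _)).
    rewrite (@zsumE _ ((N + 1) * 2 ^ n)); last by move=> k /bA ->; rewrite mxE mul0r !mulr0.
    by rewrite mulr_sumr; apply: eq_bigr => k _; rewrite real_complex_pow2; ring.
  have [lo|lo] := eqVneq l o.
    exists X; split => // n; rewrite eX lo mul0n expr0 mul1r /I lo cderivn0.
    by have -> : (fun x => 1 * eta i x) = eta i by apply/funext => x; rewrite mul1r.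
  exists (fun n t => Normc.normc I * 2 ^- n + X n t); split.
    by apply: unif0D X0; apply: unif0Z; [exact: normc_ge0 | exact: unif0_pow].
  move=> n; rewrite subr0.
  have l1 : (0 < l)%N by rewrite lt0n; apply: contraNneq lo => l0; apply/eqP/val_inj.
  have p1 : 1 <= (2 ^+ n : R) by rewrite exprn_ege1 // ler1n.
  have p0 : 0 < (2 ^+ n : R) by lra.
  have x1 : 0 <= X n tt by exact: normc_ge0.
  have h3 : Normc.normc (2 ^+ (l * n) * Z l n) <= Normc.normc I + X n tt.
    rewrite -[X in Normc.normc X](subrK I) addrC; apply: le_trans (normcD _ _) _.
    by rewrite lerD2l eX.
  rewrite Normc.normcM [(l * n)%N]mulnC exprM normcX normcX normc_nat in h3.
  have h4 : 2 ^+ n * Normc.normc (Z l n) <= Normc.normc I + X n tt.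
    apply: le_trans h3; rewrite ler_wpM2r ?normc_ge0 //; exact: ler_eXnr.
  apply: (@le_trans _ _ (2 ^- n * (Normc.normc I + X n tt))).
    by rewrite ler_pdivlMl.
  by rewrite mulrDr mulrC lerD2l -[leRHS]mul1r ler_wpM2r // invf_le1.
have [x hx] := boolp.choice Zlim.
apply/eqP; rewrite -subr_eq0; apply/eqP.
apply: (@unif0_eq0 _ _ (fun n t => \sum_l Normc.normc (m0 l 0) * x l n t)).
  by apply: unif0_sum => l; apply: unif0Z; [exact: normc_ge0 | have [] := hx l].
move=> n; have e : cRintegral (eta i) = \sum_l (if l == o then cRintegral (eta i) else 0) * m0 l 0.
  rewrite (bigD1 o) // eqxx m01 mulr1 big1; first exact: (esym (addr0 _)).
  by move=> l /negbTE ->; rewrite mul0r.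
rewrite [X in X - _]e -(mean n) -sumrB; apply: le_trans (normc_sum _ _ _) _; apply: ler_sum => l _.
rewrite -mulrBl Normc.normcM mulrC ler_wpM2l ?normc_ge0 // normcB.
by have [_] := hx l; apply.
Qed.

Lemma integral_refinable i (f : R -> C) : ccontinuous f ->
  cRintegral (fun x => eta i x * f x) =
  \sum_(k <- zr N) \sum_j a k i j * cRintegral (fun x => eta j x * f ((x + k%:~R) / 2)).
Proof.
move=> cf; have L0 : 0 < (N + 1)%N%:R :> R by rewrite ltr0n addn1.
rewrite -(integral_refinement a N L0 eta_cont eta_supp i cf); congr cRintegral; apply/funext => x.
by rewrite (eta_refinable i x).
Qed.

End Eta.
End LimitFunctions.

(** * Identification of the limit functions with phi *)

Section Represented.
Variable R : realType.
Local Notation C := R[i].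
Variables (r m : nat) (a : int -> 'M[C]_r) (N : nat).
Hypotheses (r0 : (0 < r)%N) (rm : (r - 1 <= m)%N) (aN : zbnd N a) (conv : hermite_convergent m a)
  (eig2 : forall k : nat, (0 < k)%N -> ~~ eigenvalue (symbol a 0) (2 ^+ k)).

(** Both sides are values of compactly supported distributions with the same Fourier transform, so
    their difference has vanishing moments. *)
Lemma distr_refinement (phi : 'I_r -> cs_distribution R) :
  (forall xi : R, fourier phi (2 * xi) = symbol a xi *m fourier phi xi) ->
  forall i p, phi i (fun x => x%:C ^+ p) =
  \sum_(k <- zr N) \sum_j a k i j * phi j (fun x => ((2^-1 * x + k%:~R / 2)%:C) ^+ p).
Proof.
move=> ref i p.
pose Q (k : int) j f := a k i j * phi j (fun x : R => f (2^-1 * x + k%:~R / 2) : C).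
pose D f := phi i f - \sum_(k <- zr N) \sum_j Q k j f.
have dD : distr D.
  apply: (distrB (distr_cs (phi i))); apply: distr_sum => k; apply: distr_sum => j.
  exact: (distr_scale (a k i j) (distr_aff 2^-1 (k%:~R / 2) (distr_cs (phi j)))).
apply/eqP; rewrite -subr_eq0; apply/eqP; apply: (distr_fourier dD) => xi.
have e j t : phi j (fun x => expi (- (x * t))) = fourier phi t j 0 by rewrite mxE.
rewrite /D e; have -> : xi = 2 * (xi / 2) by field.
rewrite ref mxE; apply/eqP; rewrite subr_eq0; apply/eqP.
rewrite symbolE (@zsumE _ N); last exact: zbndZ.
under eq_bigr do rewrite summxE mulr_suml.
rewrite exchange_big; apply: eq_bigr => k _; apply: eq_bigr => j _.
rewrite /Q !mxE mulrAC mulrC; congr (_ * _).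
rewrite -(distrZ (distr_cs (phi j))); last first.
  by have := smooth_expi (- (xi / 2)); congr smooth; apply/funext => x; congr expi; ring.
congr (phi j _); apply/funext => x; rewrite mulrC -expiD; congr expi; by field.
Qed.

Lemma phi_eta (phi : 'I_r -> cs_distribution R) (eta : 'I_r -> R -> C) :
  (forall xi : R, fourier phi (2 * xi) = symbol a xi *m fourier phi xi) ->
  fourier phi 0 (Ordinal r0) 0 = 1 ->
  (forall i, cont_diff m (eta i)) -> (forall i, csupp (N + 1)%N%:R (eta i)) ->
  (forall i l : 'I_r, unif0 (fun n k =>
      Normc.normc (A a n k i l * 2 ^+ (l * n) - cderivn l (eta i) (2 ^- n * k%:~R)))) ->
  forall i f, smooth f -> phi i f = cRintegral (fun x => eta i x * f x).
Proof.
move=> ref norm eta_diff eta_supp eta_lim.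
pose D i f := phi i f - cRintegral (fun x => eta i x * f x).
have dD i : distr (D i).
  apply: (distrB (distr_cs (phi i))); apply: (@distr_integral _ (N + 1)%N%:R).
  - by rewrite ler1n addn1.
  - exact: eta_cont.
  - exact: eta_supp.
have mc p : ccontinuous (fun x : R => x%:C ^+ p : C) by apply: smooth_continuous; exact: smooth_mono.
have rec i p : D i (fun x => x%:C ^+ p) =
    \sum_(k <- zr N) \sum_j a k i j * D j (fun x => ((2^-1 * x + k%:~R / 2)%:C) ^+ p).
  rewrite /D (distr_refinement ref).
  rewrite (integral_refinable r0 aN eta_diff eta_supp eta_lim _ (mc p)) -sumrB.
  apply: eq_bigr => k _; rewrite -sumrB; apply: eq_bigr => j _; rewrite mulrBr; congr (_ - _ * cRintegral _).
  by apply/funext => x; congr (_ * _%:C ^+ _); field.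
have D0 p : forall i, D i (fun x => x%:C ^+ p) = 0.
  have [n] := ubnP p; elim: n p => // n IH p; rewrite ltnS => pn.
  have [p0|p0] := posnP p.
    move=> i; rewrite p0 /D; apply/eqP; rewrite subr_eq0; apply/eqP.
    have e1 j : phi j (fun x => x%:C ^+ 0) = fourier phi 0 j 0.
      by rewrite mxE; congr (phi j _); apply/funext => x; rewrite mulr0 oppr0 expi0 expr0.
    have -> : (fun x => eta i x * x%:C ^+ 0) = eta i by apply/funext => x; rewrite mulr1.
    rewrite e1 (eta_mean rm aN eta_diff eta_supp eta_lim _ norm) //.
    by have := ref 0; rewrite mulr0 => <-.
  pose d : 'cV[C]_r := \col_i D i (fun x => x%:C ^+ p).
  (* In the binomial expansion the lower moments vanish by induction, which leaves the leading
     term. *)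
  have hd k j : D j (fun x => ((2^-1 * x + k%:~R / 2)%:C) ^+ p) = 2 ^- p * d j 0.
    pose c q : C := (2 ^- 1) ^+ (p - q) * ((k%:~R / 2) ^+ q) *+ 'C(p, q).
    have -> : (fun x : R => ((2^-1 * x + k%:~R / 2)%:C) ^+ p) = (fun x => \sum_(q < p.+1) c q * x%:C ^+ (p - q)).
      apply/funext => x.
      have -> : (2^-1 * x + k%:~R / 2)%:C = 2 ^- 1 * x%:C + k%:~R / 2 :> C.
        rewrite -[LHS]/(real_complex R _) rmorphD !rmorphM /= fmorphV (rmorph_nat (real_complex R)).
        by rewrite (rmorph_int (real_complex R)).
      rewrite exprDn; apply: eq_bigr => q _; rewrite exprMn /c [RHS]mulrnAl; congr (_ *+ _).
      by ring.
    rewrite (distr_lsum (dD j)); last by move=> q; apply: smoothZ; exact: smooth_mono.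
    rewrite big_ord_recl (distrZ (dD j)); last exact: smooth_mono.
    rewrite big1 ?addr0 => [|q _]; last first.
      rewrite (distrZ (dD j)); last exact: smooth_mono.
      by rewrite IH ?mulr0 // lift0; move: p0 pn; clear; lia.
    by rewrite /c subn0 expr0 mulr1 bin0 mulr1n mxE expr1 exprVn.
  have fix_d : symbol a 0 *m d = 2 ^+ p *: d.
    have e : d = 2 ^- p *: (symbol a 0 *m d).
      apply/matrixP => i z; rewrite ord1 mxE rec mxE mxE mulr_sumr symbolE (@zsumE _ N); last exact: zbndZ.
      under [RHS]eq_bigr do rewrite summxE mulr_suml mulr_sumr.
      rewrite [RHS]exchange_big; apply: eq_bigr => k _; apply: eq_bigr => j _.
      rewrite hd mulr0 oppr0 expi0 scale1r; by ring.
    by rewrite {2}e scalerA mulfV ?scale1r // expf_neq0 // pnatr_eq0.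
  suff d0 : d = 0 by move=> i; have := congr1 (fun d : 'cV[C]_r => d i 0) d0; rewrite !mxE.
  (* [eigenvalue] speaks of row vectors, but its failure makes the matrix minus 2^p invertible,
     hence injective on columns as well. *)
  have := eig2 p0; rewrite /eigenvalue negbK /eigenspace kermx_eq0 row_free_unit => u.
  rewrite -(mulKmx u d) mulmxBl fix_d mul_scalar_mx subrr mulmx0 //.
move=> i f sf; apply/eqP; rewrite -subr_eq0; apply/eqP.
exact: (distr_moments (dD i) (fun p => D0 p i) sf).
Qed.

End Represented.

(** * Smoothness exponents of functions *)

Section Smoothness.
Variable R : realType.
Local Notation C := R[i].
Local Notation mu := (@lebesgue_measure R).

Lemma aeS (P Q : R -> Prop) : (forall x, P x -> Q x) ->
  {ae mu, forall x, P x} -> {ae mu, forall x, Q x}.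
Proof. by move=> PQ; apply: negligibleS => x /= nQ /PQ. Qed.

Lemma aeI (P Q : R -> Prop) : {ae mu, forall x, P x} -> {ae mu, forall x, Q x} ->
  {ae mu, forall x, P x /\ Q x}.
Proof.
move=> hP hQ; have := negligibleU hP hQ; apply: negligibleS => x /= nPQ.
by apply: contrapT => /not_orP[/contrapT p /contrapT q]; exact: nPQ.
Qed.

Lemma Linfty_normP (f : R -> C) (B : R) :
  (Linfty_norm f <= B%:E)%E <-> {ae mu, forall x, Normc.normc (f x) <= B}.
Proof.
have mu0 : (0 < mu [set: R])%E.
  apply: (@lt_le_trans _ _ (mu `]0, 1[%classic)).
    by rewrite lebesgue_measure_itv /= lte_fin ltr01 sube0 lte_fin ltr01.
  by apply: le_measure; rewrite ?inE //; exact: measurable_itv.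
rewrite /Linfty_norm unlock mu0; split=> [/ess_sup_inf.ess_supP|h].
  by apply: aeS => x; rewrite /= lee_fin ger0_norm ?normc_ge0.
have h2 : {ae mu, forall x, ((abse \o (fun y => (Normc.normc (f y))%:E)) x <= B%:E)%E}.
  by apply: aeS h => x; rewrite /= lee_fin ger0_norm ?normc_ge0.
exact/ess_sup_inf.ess_supP.
Qed.

Lemma continuous_Linfty (B : R) (f : R -> C) : ccontinuous f -> (forall x, Normc.normc (f x) <= B) ->
  in_Linfty f.
Proof.
move=> [c1 c2] hB; split; [exact: measurable_realfun.continuous_measurable_fun | exact: measurable_realfun.continuous_measurable_fun |].
by apply: (@le_lt_trans _ _ B%:E); [apply/Linfty_normP; exact: aeW | exact: ltry].
Qed.

Lemma bounded_derive_AC (B : R) (f f' : R -> C) : 0 <= B -> (forall x, is_cderive f x (f' x)) ->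
  (forall x, Normc.normc (f' x) <= B) -> absolutely_continuous f.
Proof.
move=> B0 df hB e e0; have B1 : 0 < 2 * B + 1 by lra.
exists (e / (2 * B + 1)); first exact: divr_gt0.
move=> n x y xy _ lt; apply: (@le_lt_trans _ _ ((2 * B) * \sum_i (y i - x i))).
  rewrite mulr_sumr; apply: ler_sum => i _.
  rewrite -[y i - x i]ger0_norm ?subr_ge0 //; apply: (normc_increment df) => z _; exact: hB.
move: lt; rewrite ltr_pdivlMr // mulrC; have : 0 <= \sum_i (y i - x i).
  by apply: sumr_ge0 => i _; rewrite subr_ge0.
by nra.
Qed.

Lemma sobolev_cont_diff (L : R) (m : nat) (f : R -> C) : 0 <= L -> cont_diff m f -> csupp L f ->
  sobolev_derivs m f (fun j => cderivn j f).
Proof.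
move=> L0 df sf; have dd := cont_diff_derivs df.
have bd j : (j <= m)%N -> exists2 B, 0 <= B & forall s, Normc.normc (cderivn j f s) <= B.
  by move=> jm; apply: (csupp_bounded L0 (csupp_cderivn sf df jm)); exact: df.2.
split=> [|j jm|j jm|j jm].
- by apply: aeW => x; rewrite cderivn0.
- have [B B0 hB] := bd j jm; apply: (continuous_Linfty (B := B)) hB; exact: df.2.
- have [B B0 hB] := bd j.+1 jm; exact: (bounded_derive_AC B0 (dd j jm) hB).
- by apply: aeW => x; exact: (is_cderive_derivable (dd j jm x)).
Qed.

Lemma sm_fun_gt (L B tau : R) (m : nat) (f : R -> C) : 0 <= L -> cont_diff m f -> csupp L f ->
  0 < tau < 1 -> 0 < B ->
  (forall x y, Normc.normc (cderivn m f x - cderivn m f y) <= B * `|x - y| `^ tau) ->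
  (m%:R%:E < sm_fun f)%E.
Proof.
move=> L0 df sf /andP[t0 t1] B0 hB; apply: (@lt_le_trans _ _ (m%:R + tau)%:E).
  by rewrite lte_fin ltrDl.
apply: ereal_sup_ubound; exists m, tau, (fun j => cderivn j f); split => //.
- by rewrite (ltW t0).
- exact: sobolev_cont_diff sf.
exists B => // t; apply/Linfty_normP; apply: aeW => x.
by apply: le_trans (hB _ _) _; rewrite subKr.
Qed.

(** With tau defined by 2^(-tau) = theta, the bound B theta^n at scale 2^(-n) is a Hoelder bound;
    theta >= 3/4 > 1/2 gives tau < 1. At distances above 1 the global bound on f is used. *)
Lemma geometric_holder (T B theta : R) (f : R -> C) : 3 / 4 <= theta < 1 -> 0 < B ->
  (forall x, Normc.normc (f x) <= T) ->
  (forall n x y, `|x - y| <= 2 ^- n -> Normc.normc (f x - f y) <= B * theta ^+ n) ->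
  exists tau B' : R, [/\ 0 < tau < 1, 0 < B' & forall x y, Normc.normc (f x - f y) <= B' * `|x - y| `^ tau].
Proof.
move=> /andP[th1 th2] B0 hT hf; have th0 : 0 < theta by lra.
have T0 : 0 <= T by apply: le_trans (hT 0); exact: normc_ge0.
pose tau : R := - ln theta / ln (2 : R).
have l2 := ln2_gt0 R.
have t0 : 0 < tau.
  by rewrite divr_gt0 // oppr_gt0 -ln1 ltr_ln ?posrE.
have t1 : tau < 1.
  rewrite ltr_pdivrMr // mul1r ltrNl -lnV ?posrE // ltr_ln ?posrE ?invr_gt0 //; lra.
have th : (2 ^-1) `^ tau = theta.
  rewrite /powR invr_eq0 pnatr_eq0 /= lnV ?posrE //.
  have -> : tau * - ln 2 = ln theta by rewrite /tau; field; rewrite gt_eqF.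
  by rewrite lnK ?posrE.
have thn n : theta ^+ n = (2 ^- n) `^ tau.
  rewrite -th -powR_mulrn ?powR_ge0 // -powRrM mulrC powRrM powR_mulrn ?invr_ge0 //.
  by rewrite exprVn.
exists tau, (2 `^ tau * B + 2 * T); split; rewrite ?t0 //.
  by rewrite ltr_wpDr ?mulr_ge0 // mulr_gt0 // powR_gt0.
move=> x y; set h : R := `|x - y|.
have h0 : 0 <= h by exact: normr_ge0.
have big : Normc.normc (f x - f y) <= 2 * T.
  by apply: le_trans (normcD _ _) _; rewrite normcN; have := hT x; have := hT y; lra.
have p0 := powR_ge0 h tau.
have [hh|hh] := leP h 1; last first.
  have h1 : 1 <= h `^ tau.
    have e1 : (1 : R) `^ tau = 1 by rewrite powR1.
    by rewrite -[X in X <= _]e1; apply: ge0_ler_powR; rewrite ?nnegrE ?(ltW t0) // ltW.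
  have q0 : 0 <= 2 `^ tau * B * h `^ tau by rewrite !mulr_ge0 ?powR_ge0 ?(ltW B0).
  have q1 : 0 <= T * (h `^ tau - 1) by rewrite mulr_ge0 // subr_ge0.
  by move: big q0 q1; lra.
have [e0|hn0] := eqVneq h 0.
  have -> : x = y by apply/eqP; rewrite -subr_eq0 -normr_eq0 -/h e0.
  by rewrite subrr Normc.normc0 mulr_ge0 // addr_ge0 ?mulr_ge0 ?powR_ge0 // ltW.
have hp : 0 < h by rewrite lt_def hn0.
have ex : exists n, 2 ^- n.+1 < h.
  by have [n0 hn] := pow2_small hp; exists n0; apply: hn.
case: (ex_minnP ex) => n ltn minn.
have le : h <= 2 ^- n.
  case: n ltn minn => [|n] ltn minn; first by rewrite expr0 invr1.
  by rewrite leNgt; apply/negP => /minn; rewrite ltnn.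
apply: le_trans (hf n x y le) _; rewrite thn.
apply: (@le_trans _ _ (B * (2 `^ tau * h `^ tau))).
  rewrite ler_wpM2l ?(ltW B0) // -powRM //.
  apply: ge0_ler_powR; rewrite ?nnegrE ?(ltW t0) ?invr_ge0 ?exprn_ge0 ?mulr_ge0 //.
  have -> : 2 ^- n = 2 * 2 ^- n.+1 :> R by rewrite exprS; field; rewrite expf_neq0.
  by rewrite ler_wpM2l // ltW.
by rewrite mulrA [B * _]mulrC ler_wpM2r // lerDl mulr_ge0.
Qed.

End Smoothness.

(** * Hoelder continuity of the top derivatives *)

Section HolderRefinable.
Variable R : realType.
Local Notation C := R[i].
Variables (r m : nat) (a : int -> 'M[C]_r) (N : nat).
Hypothesis aN : zbnd N a.
Variable eta : 'I_r -> R -> C.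
Hypotheses (eta_diff : forall i, cont_diff m (eta i)) (eta_supp : forall i, csupp (N + 1)%N%:R (eta i))
  (eta_ref : refinable a N eta).

Lemma jet_mnorm x : mnorm (jet eta m x) = \sum_i Normc.normc (cderivn m (eta i) x).
Proof. by rewrite /mnorm exchange_big big_ord1; apply: eq_bigr => i _; rewrite mxE. Qed.

(* The differences of integer translates of the top derivative tend to 0 under the
   rescaled cascade, by uniform continuity, hence exponentially fast. *)
Lemma refinable_holder : forall i, exists tau B : R, [/\ 0 < tau < 1, 0 < B &
  forall x y, Normc.normc (cderivn m (eta i) x - cderivn m (eta i) y) <= B * `|x - y| `^ tau].
Proof.
have L0 : 0 < (N + 1)%N%:R :> R by rewrite ltr0n addn1.
have sm i := csupp_cderivn (eta_supp i) (eta_diff i) (leqnn m).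
have cm i : ccontinuous (cderivn m (eta i)) by exact: (eta_diff i).2.
have [T T0 hT] : exists2 T : R, 0 < T & forall x, mnorm (jet eta m x) <= T.
  have [b hb] := boolp.choice (fun i => let: ex_intro2 B B0 h := csupp_bounded (ltW L0) (sm i) (cm i) in
    ex_intro (fun B => forall s, Normc.normc (cderivn m (eta i) s) <= B) B h).
  exists (\sum_i `|b i| + 1); first by rewrite ltr_wpDl // sumr_ge0.
  move=> x; rewrite jet_mnorm; apply: ler_wpDr => //; apply: ler_sum => i _.
  by apply: le_trans (hb i x) (ler_norm _).
(* Large enough for the window of [exponential_decay], and for the translates by k of points of
   absolute value at most 3 to leave the support N + 1 once |k| > M. *)
pose M := (2 * N + 8)%N.
pose u (s t : R) (k : int) := jet eta m (s + k%:~R) - jet eta m (t + k%:~R).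
have c0 : 0 < (2 ^+ m : R) by rewrite exprn_gt0.
have MN : (2 * N + 4 <= M)%N by rewrite /M; lia.
have [B [theta [B0 hth dec]]] := exponential_decay aN c0 MN.
have jz (x : R) (k : int) : `|x| <= 3 -> (M < `|k|)%N -> jet eta m (x + k%:~R) = 0.
  move=> x3 kM; apply/matrixP => i j; rewrite !mxE; apply: sm.
  have h1 : M%:R < `|k%:~R| :> R by rewrite -intr_norm -abszE -[_%:~R]/(`|k|%N%:R : R) ltr_nat.
  have := lerB_normD (k%:~R) x; rewrite [k%:~R + x]addrC; move: h1.
  have -> : M%:R = 2 * N%:R + 8 :> R by rewrite /M natrD natrM.
  have -> : (N + 1)%N%:R = N%:R + 1 :> R by rewrite natrD.
  have : 0 <= N%:R :> R by [].
  by move: x3; lra.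
have uM s t : `|s| <= 3 -> `|t| <= 3 -> zbnd M (u s t) by move=> s3 t3 k kM; rewrite /u !jz // subrr.
have conv s t n p : `|s| <= 3 -> `|t| <= 3 -> (2 ^+ m) ^+ n * mnorm (convolution (A a n) (u s t) p) =
    mnorm (jet eta m (2 ^- n * (s + p%:~R)) - jet eta m (2 ^- n * (t + p%:~R))).
  move=> s3 t3; rewrite !(jet_iter aN L0 eta_diff eta_supp eta_ref _ _ _ (leqnn m)) -scalerBr mnormZ.
  rewrite normcX normc_nat exprM; congr (_ * mnorm _); rewrite !convolutionE.
  have bz x : `|x| <= 3 -> zbnd M (fun k : int => A a n (p - k) *m jet eta m (x + k%:~R)).
    by move=> x3 k kM; rewrite jz // mulmx0.
  rewrite (zsumE (@bz s s3)) (zsumE (@bz t t3)) -sumrB (zsumE (M := M)); last first.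
    by move=> k kM; rewrite uM // mulmx0.
  by apply: eq_bigr => k _; rewrite mulmxBr.
have van s t : `|s| <= 3 -> `|t| <= 3 -> vanishes a (2 ^+ m) (u s t).
  move=> s3 t3 e e0; have e1 : 0 < e / (r%:R + 1) by rewrite divr_gt0 // ltr_wpDl.
  have [d hd] := boolp.choice (fun i => let: ex_intro2 d d0 h := csupp_unif (ltW L0) (sm i) (cm i) e1 in
    ex_intro (fun d : R => 0 < d /\ forall s t, `|s - t| < d -> Normc.normc (cderivn m (eta i) s - cderivn m (eta i) t) <= e / (r%:R + 1)) d (conj d0 h)).
  pose d0 := \big[Num.min/1]_i d i.
  have d0p : 0 < d0 by apply: (big_ind (fun x : R => 0 < x)) => // [x y x0 y0|i _]; [rewrite lt_min x0 | have [] := hd i].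
  have d0l i : d0 <= d i by rewrite /d0 (bigD1 i) //= ge_min lexx.
  have d6 : 0 < d0 / 6 by rewrite divr_gt0.
  have [n0 hn] := pow2_small d6; exists n0 => n nn p.
  rewrite conv // /mnorm exchange_big big_ord1 /=.
  apply: (@le_trans _ _ (\sum_(i < r) e / (r%:R + 1))).
    apply: ler_sum => i _; rewrite !mxE; apply: (hd i).2; apply: lt_le_trans (d0l i).
    rewrite -mulrBr opprD addrACA subrr addr0 normrM gtr0_norm ?invr_gt0 ?exprn_gt0 //.
    have h6 : `|s - t| <= 6 by apply: le_trans (ler_normB _ _) _; lra.
    have p0 : 0 < (2 ^- n : R) by rewrite invr_gt0 exprn_gt0.
    apply: (@le_lt_trans _ _ (2 ^- n * 6)); first by rewrite ler_wpM2l // ltW.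
    by rewrite -ltr_pdivlMr //; exact: hn.
  rewrite sumr_const card_ord -[leLHS]mulr_natl mulrCA -[leRHS]mulr1 ler_wpM2l ?(ltW e0) //.
  by rewrite ler_pdivrMr ?ltr_wpDl // mul1r lerDl.
have Z0 s t : `|s| <= 3 -> `|t| <= 3 -> znorm M (u s t) <= (2 * M).+1%:R * (2 * T).
  move=> s3 t3; rewrite /znorm; apply: (@le_trans _ _ (\sum_(k <- zr M) (2 * T))).
    apply: ler_sum => k _; apply: le_trans (mnormB _ _) _.
    by have := hT (s + k%:~R); have := hT (t + k%:~R); lra.
  by rewrite big_const_seq count_predT size_zr iter_addr_0 -[leLHS]mulr_natl.
pose B1 := B * ((2 * M).+1%:R * (2 * T)) + 1.
have th0 : 0 <= theta by move: hth; lra.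
have B10 : 0 < B1 by rewrite ltr_wpDl // !mulr_ge0 // ltW.
have key n x y : `|x - y| <= 2 ^- n -> mnorm (jet eta m x - jet eta m y) <= B1 * theta ^+ n.
  (* At scale 2^(-n), x and y have the same integer part p up to offsets s and t bounded by 1 and 2,
     so one cascade position p serves for both. *)
  move=> xy; have [p hp] := floor_sample x n.
  have p0 : 0 < (2 ^+ n : R) by rewrite exprn_gt0.
  pose s := 2 ^+ n * x - p%:~R; pose t := 2 ^+ n * y - p%:~R.
  have es : x = 2 ^- n * (s + p%:~R) by rewrite /s subrK mulKf // gt_eqF.
  have et : y = 2 ^- n * (t + p%:~R) by rewrite /t subrK mulKf // gt_eqF.
  have s1 : `|s| <= 1.
    have -> : s = - (2 ^+ n * (2 ^- n * p%:~R - x)) by rewrite mulrBr mulVKf ?gt_eqF // opprB.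
    by rewrite normrN normrM gtr0_norm // mulrC -ler_pdivlMr // mul1r.
  have t1 : `|s - t| <= 1.
    have -> : s - t = 2 ^+ n * (x - y) by rewrite /s /t; ring.
    by rewrite normrM gtr0_norm // mulrC -ler_pdivlMr // mul1r.
  have s3 : `|s| <= 3 by lra.
  have t3 : `|t| <= 3.
    have -> : t = s - (s - t) by ring.
    by apply: le_trans (ler_normB _ _) _; lra.
  rewrite es et -conv //; apply: le_trans (dec _ (uM _ _ s3 t3) (van _ _ s3 t3) n p) _.
  rewrite mulrAC ler_wpM2r ?exprn_ge0 // /B1; apply: ler_wpDr => //.
  by rewrite ler_wpM2l // Z0.
move=> i.
have le1 x y : Normc.normc (cderivn m (eta i) x - cderivn m (eta i) y) <= mnorm (jet eta m x - jet eta m y).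
  by have := normc_le_mnorm (jet eta m x - jet eta m y) i 0; rewrite !mxE.
apply: (@geometric_holder R T B1 theta) => // [x|n x y xy].
  by have := normc_le_mnorm (jet eta m x) i 0; rewrite !mxE => le; apply: le_trans le (hT x).
exact: le_trans (le1 x y) (key n x y xy).
Qed.

End HolderRefinable.

(** * Smoothness of the mask of a convergent scheme *)

Lemma int_parity (k : int) : exists j e : int, k = 2 * j + e /\ (e = 0 \/ e = 1).
Proof.
exists (k %/ 2)%Z, (k %% 2)%Z; split; first by rewrite {1}(divz_eq k 2) mulrC.
by have := modz_ge0 k (isT : (2 : int) != 0); have := ltz_pmod k (isT : (0 : int) < 2); lia.
Qed.

Section MaskSmoothness.
Variable R : realType.
Local Notation C := R[i].
Variables (r m : nat) (a : int -> 'M[C]_r) (N : nat).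
Hypotheses (r0 : (0 < r)%N) (rm : (r - 1 <= m)%N) (aN : zbnd N a).
Local Notation A := (A a).
Local Notation o := (Ordinal r0).

(** One rate for all supports, as rho demands. Above the window 2 N + 4 the transition operators for
    e = 0 and e = 1 shorten the support and together cover all positions; each such step costs a
    factor 1 / theta in the constant. *)
Lemma vanishes_decay : exists2 theta : R, 0 < theta < 1 & forall M (u : int -> 'cV[C]_r),
  zbnd M u -> vanishes a 1 u -> decays a theta u.
Proof.
have MN : (2 * N + 4 <= 2 * N + 4)%N by [].
have [B [theta [B0 /andP[th1 th2] dec]]] := exponential_decay aN (@ltr01 R) MN.
have th0 : 0 < theta by lra.
exists theta; first by rewrite th0.
move=> M; have [n] := ubnP M; elim: n M => // n IH M; rewrite ltnS => Mn u uM vu.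
have [le|lt] := leqP M (2 * N + 4).
  have uM' := zbnd_widen le uM.
  exists (B * znorm (2 * N + 4) u); first by rewrite mulr_ge0 // znorm_ge0.
  by move=> p j; have := dec u uM' vu p j; rewrite expr1n mul1r mulrAC.
have [b0 b00 hb0] := convolution_bound_unif aN 0.
have sub e : (`|e| <= 2 ^ 1)%N -> decays a theta (Tm a 1 e u).
  move=> e2; apply: (IH (N + 1 + (M + 1) %/ 2)%N); first by move: lt Mn; clear; lia.
    exact: (zbnd_Tm aN).
  exact: (vanishes_Tm aN ltr01 _ _ uM).
have [B1 B10 h1] := sub 0 isT; have [B2 B20 h2] := sub 1 isT.
pose K := b0 * znorm M u + B1 / theta + B2 / theta.
have z0 : 0 <= b0 * znorm M u by rewrite mulr_ge0 // znorm_ge0.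
have k1 : 0 <= B1 / theta by rewrite divr_ge0 // ltW.
have k2 : 0 <= B2 / theta by rewrite divr_ge0 // ltW.
exists K => [|[|p] j]; first by rewrite !addr_ge0.
  rewrite expr0 mulr1; apply: le_trans (hb0 M u j uM) _; rewrite /K; lra.
have tp : 0 <= theta ^+ p.+1 by rewrite exprn_ge0 // ltW.
have [q [e [-> e01]]] := int_parity j.
have h := convolution_A_add aN u p 1 q e; rewrite addn1 expr1 in h; rewrite h.
case: e01 => ->.
  apply: le_trans (h1 p q) _; apply: (@le_trans _ _ (B1 / theta * theta ^+ p.+1)).
    by rewrite exprS mulrA divfK ?gt_eqF.
  by rewrite ler_wpM2r // /K; lra.
apply: le_trans (h2 p q) _; apply: (@le_trans _ _ (B2 / theta * theta ^+ p.+1)).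
  by rewrite exprS mulrA divfK ?gt_eqF.
by rewrite ler_wpM2r // /K; lra.
Qed.

Variable eta : 'I_r -> R -> C.
Hypotheses (eta_diff : forall i, cont_diff m (eta i)) (eta_supp : forall i, csupp (N + 1)%N%:R (eta i))
 (eta_lim : forall i l : 'I_r, unif0 (fun n k =>
      Normc.normc (A n k i l * 2 ^+ (l * n) - cderivn l (eta i) (2 ^- n * k%:~R)))).

Let L0 : 0 < (N + 1)%N%:R :> R. Proof. by rewrite ltr0n addn1. Qed.

(** For l > 0 the Hermite scaling 2^(l n) forces the column to 0; for the first column a bounded
    shift k is harmless by uniform continuity of eta_i. *)
Lemma cascade_columns M k i l : (`|k| <= M)%N -> unif0 (fun n (j : int) =>
  Normc.normc (A n (j - k) i l - (if l == o then eta i (2 ^- n * j%:~R) else 0))).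
Proof.
move=> kM; have lm : (l <= m)%N by have := ltn_ord l; move: rm; clear; lia.
have lim := unif0_comp (fun n (j : int) => j - k) (eta_lim i l).
have [lo|lo] := eqVneq l o; last first.
  have [T T0 hT] := csupp_bounded (ltW L0) (csupp_cderivn (eta_supp i) (eta_diff i) lm) ((eta_diff i).2 l lm).
  have h2 : unif0 (fun n (j : int) => T * 2 ^- n).
    have := unif0_comp (fun n (j : int) => tt) (unif0Z T0 (@unif0_pow R)); exact.
  apply: unif0_le (unif0D lim h2) => n j; rewrite subr0.
  have l1 : (0 < l)%N by rewrite lt0n; apply: contraNneq lo => l0; apply/eqP/val_inj.
  have p1 : 1 <= (2 ^+ n : R) by rewrite exprn_ege1 // ler1n.
  have p0 : 0 < (2 ^+ n : R) by lra.
  set x := Normc.normc (_ - _); have x1 : 0 <= x by exact: normc_ge0.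
  have h3 : Normc.normc (A n (j - k) i l * 2 ^+ (l * n)) <= T + x.
    rewrite -[X in Normc.normc X](subrK (cderivn l (eta i) (2 ^- n * (j - k)%:~R))) addrC.
    by apply: le_trans (normcD _ _) _; rewrite lerD2r.
  rewrite Normc.normcM [(l * n)%N]mulnC exprM [X in _ * X]normcX normcX normc_nat in h3.
  have h4 : Normc.normc (A n (j - k) i l) * 2 ^+ n <= T + x.
    apply: le_trans h3; rewrite ler_wpM2l ?normc_ge0 //; exact: ler_eXnr.
  apply: (@le_trans _ _ ((T + x) / 2 ^+ n)); first by rewrite ler_pdivlMr.
  by rewrite mulrDl addrC lerD2r -[leRHS]mulr1 ler_wpM2l // invf_le1.
have ce : ccontinuous (eta i) by have := (eta_diff i).2 0%N (leq0n _); rewrite cderivn0.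
have h2 : unif0 (fun n (j : int) => Normc.normc (eta i (2 ^- n * (j - k)%:~R) - eta i (2 ^- n * j%:~R))).
  move=> e e0; have [d d0 hd] := csupp_unif (ltW L0) (eta_supp i) ce e0.
  have d1 : 0 < d / (M%:R + 1) by rewrite divr_gt0 // ltr_wpDl.
  have [n0 hn] := pow2_small d1; exists n0 => n nn j; apply: hd.
  have p0 : 0 < (2 ^- n : R) by rewrite invr_gt0 exprn_gt0.
  have hk : `|k%:~R| <= M%:R :> R by rewrite -intr_norm -abszE -[_%:~R]/(`|k|%N%:R : R) ler_nat.
  have -> : 2 ^- n * (j - k)%:~R - 2 ^- n * j%:~R = - (2 ^- n * k%:~R) :> R by rewrite rmorphB /=; ring.
  rewrite normrN normrM gtr0_norm //.
  have := hn n nn; rewrite ltr_pdivlMr ?ltr_wpDl //; apply: le_lt_trans.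
  by rewrite ler_wpM2l ?(ltW p0) //; lra.
apply: unif0_le (unif0D lim h2) => n j; rewrite lo mul0n expr0 mulr1 cderivn0.
have -> : A n (j - k) i o - eta i (2 ^- n * j%:~R) =
  (A n (j - k) i o - eta i (2 ^- n * (j - k)%:~R)) + (eta i (2 ^- n * (j - k)%:~R) - eta i (2 ^- n * j%:~R)) by ring.
exact: normcD.
Qed.

(* Asymptotically, the cascade sees a sequence u only through the first entry of
   its symbol at 0. *)
Lemma cascade_limit M (u : int -> 'cV[C]_r) : zbnd M u -> unif0 (fun n (j : int) =>
  \sum_i Normc.normc (convolution (A n) u j i 0 - eta i (2 ^- n * j%:~R) * mom 1 u o 0)).
Proof.
move=> uM.
have H : unif0 (fun n (j : int) => \sum_i \sum_(k <- zr M) \sum_l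
    Normc.normc (u k l 0) * (if (`|k| <= M)%N then Normc.normc (A n (j - k) i l - (if l == o then eta i (2 ^- n * j%:~R) else 0)) else 0)).
  apply: unif0_sum => i; apply: unif0_sum => k; apply: unif0_sum => l; apply: unif0Z; first exact: normc_ge0.
  by have [kM|kM] := boolP (`|k| <= M)%N; [exact: cascade_columns kM | exact: unif0_zero].
apply: unif0_le H => n j; apply: ler_sum => i _.
rewrite convolutionE (@zsumE _ M); last by move=> k kM; rewrite uM // mulmx0.
rewrite /mom (@zsumE _ M); last exact: zbndZ.
rewrite !summxE mulr_sumr -sumrB; apply: le_trans (normc_sum _ _ _) _; rewrite !big_seq; apply: ler_sum => k.
rewrite mem_zr => kM; rewrite kM hornerC scale1r.
have -> : eta i (2 ^- n * j%:~R) * u k o 0 = \sum_l (if l == o then eta i (2 ^- n * j%:~R) else 0) * u k l 0.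
  rewrite (bigD1 o) // eqxx big1; first exact: (esym (addr0 _)).
  by move=> l /negbTE ->; rewrite mul0r.
rewrite mxE -sumrB; apply: le_trans (normc_sum _ _ _) _; apply: ler_sum => l _.
by rewrite -mulrBl Normc.normcM mulrC.
Qed.

Lemma mnorm_cV (x : 'cV[C]_r) : mnorm x = \sum_i Normc.normc (x i 0).
Proof. by rewrite /mnorm exchange_big big_ord1. Qed.

Lemma cascade_vanishes M (u : int -> 'cV[C]_r) : zbnd M u -> mom 1 u o 0 = 0 -> vanishes a 1 u.
Proof.
move=> uM u0 e e0; have [n0 h] := cascade_limit uM e0; exists n0 => n nn j.
rewrite expr1n mul1r mnorm_cV; apply: le_trans (h n nn j).
by apply: ler_sum => i _; rewrite u0 mulr0 subr0.
Qed.

Variable m0 : 'cV[C]_r.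
Hypotheses (am0 : symbol a 0 *m m0 = m0) (m01 : m0 o 0 = 1).

(** The cascade of u tends to eta times the first entry of its mass; if it tends to 0, that entry is
    0 because the first component of eta has integral 1. *)
Lemma vanishes_cascade M (u : int -> 'cV[C]_r) : zbnd M u -> vanishes a 1 u -> mom 1 u o 0 = 0.
Proof.
move=> uM vu.
have ce : ccontinuous (eta o) by have := (eta_diff o).2 0%N (leq0n _); rewrite cderivn0.
have z x : eta o x * mom 1 u o 0 = 0.
  have [p hp] := boolp.choice (floor_sample x).
  have h1 : unif0 (fun n (_ : int) => Normc.normc (mom 1 u o 0) * Normc.normc (eta o (2 ^- n * (p n)%:~R) - eta o x)).
    have h : unif0 (fun n (j : int) => Normc.normc (eta o (2 ^- n * j%:~R) - eta o (2 ^- n * j%:~R))).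
      by apply: unif0_le (@unif0_zero R int) => n j; rewrite subrr Normc.normc0.
    have g : unif0 (fun n (_ : unit) => Normc.normc (eta o (2 ^- n * (p n)%:~R) - eta o x)).
      by apply: (@grid_sample _ _ (fun n k => eta o (2 ^- n * k%:~R)) x 1) => // n; rewrite mul1r.
    exact: (unif0_comp (fun n (_ : int) => tt) (unif0Z (normc_ge0 _) g)).
  have h2 := unif0_comp (fun n (_ : int) => p n) (cascade_limit uM).
  have h3 := unif0_comp (fun n (_ : int) => p n) (vu : unif0 _).
  apply: (unif0_eq0 (unif0_comp (fun n (_ : unit) => 0 : int) (unif0D h1 (unif0D h2 h3)))) => n.
  set w := convolution (A n) u (p n).
  have -> : eta o x * mom 1 u o 0 = - (mom 1 u o 0 * (eta o (2 ^- n * (p n)%:~R) - eta o x)) +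
    (- (w o 0 - eta o (2 ^- n * (p n)%:~R) * mom 1 u o 0) + w o 0) by ring.
  apply: le_trans (normcD _ _) _; apply: lerD; first by rewrite normcN Normc.normcM.
  apply: le_trans (normcD _ _) _; apply: lerD.
    by rewrite normcN (bigD1 o) //= lerDl sumr_ge0 // => i _; exact: normc_ge0.
  by rewrite expr1n mul1r; exact: normc_le_mnorm.
have E : cRintegral (eta o) = 1 by rewrite (eta_mean rm aN eta_diff eta_supp eta_lim am0 m01).
have := cRintegralZ (mom 1 u o 0) L0 ce (eta_supp o); rewrite E mulr1 => <-.
rewrite -[RHS](cRintegral_0 R); congr cRintegral; apply/funext => x.
by rewrite mulrC z.
Qed.

Lemma convolution_delta (b : int -> 'M[C]_r) (w : 'cV[C]_r) k0 j :
  convolution b (fun k => if k == k0 then w else 0) j = b (j - k0) *m w.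
Proof.
rewrite convolutionE (@zsum1 _ k0) ?eqxx // => k /negbTE ->; by rewrite mulmx0.
Qed.

Lemma zbnd_delta (w : 'cV[C]_r) (k0 : int) : zbnd `|k0| (fun k : int => if k == k0 then w else 0).
Proof. by move=> k; case: eqP => // ->; rewrite ltnn. Qed.

Lemma mom_delta s q (w : 'M[C]_(s, q)) (f : {poly C}) (k0 : int) :
  mom f (fun k : int => if k == k0 then w else 0) = f.[k0%:~R] *: w.
Proof. by rewrite /mom (@zsum1 _ k0) ?eqxx // => k /negbTE ->; rewrite scaler0. Qed.

Let s e (l : 'I_r) := \zsum_(j) A 1 (2 ^+ 1 * j + e) o l.

Let szb e l : zbnd (2 * N + `|e|) (fun j : int => A 1 (2 ^+ 1 * j + e) o l).
Proof.
move=> j lt; rewrite (A_zbnd' aN (n := 1)) ?mxE //.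
by rewrite expr1 expn1; move: lt; clear; lia.
Qed.

(** Having zero first mass is equivalent to a vanishing cascade, hence invariant under the
    transition operators. A delta in another column gives [s e l = 0]; the difference of adjacent
    deltas in the first column makes [s e o] independent of e; the eigenvector m0 fixes the common
    value to 1. *)
Lemma coset_row e l : s e l = (l == o)%:R.
Proof.
have T0 M (u : int -> 'cV[C]_r) e' : zbnd M u -> mom 1 u o 0 = 0 -> mom 1 (Tm a 1 e' u) o 0 = 0.
  move=> uM u0; have bT : zbnd (N * 2 ^ 1 + M + `|e'|) (Tm a 1 e' u).
    move=> k lt; rewrite /Tm (convolution_zbnd uM (A_zbnd' aN (n := 1))) //.
    by rewrite expr1 expn1; move: lt; rewrite expn1; clear; lia.
  apply: (vanishes_cascade bT); apply: (vanishes_Tm aN ltr01 _ _ uM).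
  exact: (cascade_vanishes uM u0).
have sT e' l' : mom 1 (Tm a 1 e' (fun k => if k == 0 then delta_mx l' 0 else 0 : 'cV[C]_r)) o 0 = s e' l'.
  have b1 : zbnd (2 * N + `|e'|) (fun j : int => col l' (A 1 (2 ^+ 1 * j + e'))).
    move=> j lt; rewrite (A_zbnd' aN (n := 1)); first by apply/matrixP => x y; rewrite !mxE.
    by rewrite expr1 expn1; move: lt; clear; lia.
  have -> : Tm a 1 e' (fun k => if k == 0 then delta_mx l' 0 else 0 : 'cV[C]_r) = (fun j : int => col l' (A 1 (2 ^+ 1 * j + e'))).
    by apply/funext => j; rewrite /Tm convolution_delta subr0 colE.
  rewrite /mom (zsumE (M := 2 * N + `|e'|)); last exact: zbndZ.
  rewrite /s (zsumE (@szb e' l')) summxE; apply: eq_bigr => j _.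
  by rewrite hornerC scale1r mxE.
have off e' l' : l' != o -> s e' l' = 0.
  move=> lo; rewrite -sT; apply: (T0 0%N); first exact: (@zbnd_delta _ 0).
  by rewrite mom_delta hornerC scale1r mxE eq_sym (negbTE lo).
have shift e' : s e' o = s (e' - 1) o.
  pose u0 (k : int) : 'cV[C]_r := if k == 0 then delta_mx o 0 else 0.
  pose u1 (k : int) : 'cV[C]_r := if k == 1 then delta_mx o 0 else 0.
  have z0 : zbnd 1 u0 by apply: zbnd_widen (@zbnd_delta _ 0).
  have z1 : zbnd 1 u1 by exact: (@zbnd_delta _ 1).
  have zn : zbnd 1 (fun k => -1 *: u1 k) by move=> k /z1 ->; rewrite scaler0.
  have zu : zbnd 1 (fun k => u0 k + -1 *: u1 k) by move=> k lt; rewrite z0 ?zn ?addr0.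
  have e0 : mom 1 (fun k => u0 k + -1 *: u1 k) o 0 = 0.
    rewrite (momDr _ z0 zn) (momZr _ _ z1) !mom_delta !hornerC scale1r !mxE eqxx.
    by rewrite mulr1 subrr.
  have := T0 1%N _ e' zu e0.
  have -> : Tm a 1 e' (fun k => u0 k + -1 *: u1 k) = (fun j => Tm a 1 e' u0 j + -1 *: Tm a 1 (e' - 1) u0 j).
    apply/funext => j; rewrite /Tm.
    have -> : convolution (A 1) u0 (2 ^+ 1 * j + (e' - 1)) = convolution (A 1) u1 (2 ^+ 1 * j + e').
      by rewrite !convolution_delta subr0 addrA.
    exact: convolution_scale z0 z1.
  have bT x : zbnd (N * 2 ^ 1 + 1 + `|x|) (Tm a 1 x u0).
    move=> k lt; rewrite /Tm (convolution_zbnd z0 (A_zbnd' aN (n := 1))) //.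
    by rewrite expr1 expn1; move: lt; rewrite expn1; clear; lia.
  have bT' : zbnd (N * 2 ^ 1 + 1 + (`|e'| + 1)) (Tm a 1 e' u0) by apply: zbnd_widen (bT _); lia.
  have bT2 : zbnd (N * 2 ^ 1 + 1 + (`|e'| + 1)) (Tm a 1 (e' - 1) u0) by apply: zbnd_widen (bT _); lia.
  have bT3 : zbnd (N * 2 ^ 1 + 1 + (`|e'| + 1)) (fun j => -1 *: Tm a 1 (e' - 1) u0 j).
    by move=> k /bT2 ->; rewrite scaler0.
  have ent (X Y : 'cV[C]_r) : (X + -1 *: Y) o 0 = X o 0 - Y o 0 by rewrite scaleN1r !mxE.
  have sT0 x : mom 1 (Tm a 1 x u0) o 0 = s x o by exact: sT.
  have -> := momDr 1 bT' bT3.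
  rewrite (momZr _ _ bT2).
  rewrite ent.
  move=> /eqP; rewrite subr_eq0 => /eqP h.
  by rewrite -!sT0.
have sum01 l' : s 0 l' + s 1 l' = 2 * symbol a 0 o l'.
  pose F k := A 1 k o l'.
  have bF : zbnd N F by move=> k kN; rewrite /F (A_1 aN) aN // scaler0 mxE.
  have -> : s 0 l' = \zsum_(j) F (2 * j) by apply: eq_zsum => j; rewrite addr0 expr1.
  rewrite -(zsum_parity bF) (zsumE bF) symbolE (zsumE (M := N)); last exact: zbndZ.
  rewrite summxE mulr_sumr; apply: eq_bigr => k _.
  by rewrite /F (A_1 aN) mulr0 oppr0 expi0 scale1r mxE.
have [lo|lo] := eqVneq l o; last exact: off.
have s01 : s 1 o = s 0 o by rewrite shift subrr.
have s1 : s 0 o = 1.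
  have := congr1 (fun x : 'cV[C]_r => x o 0) am0; rewrite mxE m01 (bigD1 o) // big1; last first.
    move=> l' lo'; have := sum01 l'; rewrite !off // addr0 => /esym/eqP.
    by rewrite mulf_eq0 pnatr_eq0 /= => /eqP ->; rewrite mul0r.
  have e2 : s 0 o = symbol a 0 o o.
    have h2 : (2 : C) != 0 by rewrite pnatr_eq0.
    by apply: (mulfI h2); rewrite -(sum01 o) s01 mulr_natl mulr2n.
  by rewrite e2 m01 mulr1; apply: etrans; exact: (esym (addr0 _)).
rewrite lo; have [j [e' [-> e01]]] := int_parity e.
have -> : s (2 * j + e') o = s e' o.
  rewrite /s [RHS](zsum_shift j); apply: eq_zsum => k.
  by have -> : 2 ^+ 1 * (k + j) + e' = 2 ^+ 1 * k + (2 * j + e') by rewrite expr1; ring.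
by case: e01 => ->; rewrite ?s01 s1.
Qed.

(** By [coset_row] the first unit row, placed at 0, keeps its mass on every coset. This makes [sr a]
    positive, so that membership in the vanishing space does constrain the mass. *)
Lemma sum_rules_1 : sum_rules 1 a (fun k => if k == 0 then delta_mx 0 o else 0).
Proof.
set v := fun k : int => _.
have vM : zbnd 0 v by move=> k; rewrite absz_gt0 /v => /negbTE ->.
apply/(sum_rulesP aN 1 vM); split.
  rewrite (symbol_0 vM) mom_delta hornerC scale1r => /matrixP/(_ 0 o)/eqP.
  by rewrite !mxE !eqxx oner_eq0.
move=> e f szf; rewrite (size1_polyC szf) mom_delta !hornerC.
have e1 (i : int) : subdivision a v (2 * i + e) = row o (A 1 (2 ^+ 1 * i + e)).
  rewrite (subdivisionE aN) (@zsum1 _ 0) => [|k /negbTE k0]; last by rewrite /v k0 mul0mx scaler0.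
  by rewrite /v eqxx mulr0 subr0 (A_1 aN) -rowE linearZ expr1.
have b1 : zbnd (2 * N + `|e|) (fun i : int => f`_0 *: row o (A 1 (2 ^+ 1 * i + e))).
  move=> j lt; rewrite (A_zbnd' aN (n := 1)); first by apply/matrixP => x y; rewrite !mxE mulr0.
  by rewrite expr1 expn1; move: lt; clear; lia.
transitivity (\zsum_(i) f`_0 *: row o (A 1 (2 ^+ 1 * i + e))).
  by apply: eq_zsum => i; rewrite hornerC e1.
rewrite (zsumE b1); apply/matrixP => x l; rewrite ord1 summxE !mxE eqxx /= -(coset_row e l) /s (zsumE (@szb e l)).
by rewrite mulr_sumr; apply: eq_bigr => j _; rewrite mxE [row _ _ _ _]mxE.
Qed.

Lemma sr_gt0 : (0 < sr a)%N.
Proof. by have [_ h] := sr_spec r0 aN; apply: h; eexists; exact: sum_rules_1. Qed.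

(** The symbol of v at 0 is a left eigenvector, so 2^n times it is its product with the symbol of
    [A n] at 0. In a column l other than the first, the O(2^n) summands of the latter tend to 0
    uniformly; dividing by 2^n leaves 0. *)
Lemma filter_first M (v : int -> 'rV[C]_r) : zbnd M v -> sum_ruled a 1 v ->
  forall l, l != o -> symbol v 0 0 l = 0.
Proof.
move=> vM hv l lo.
have hm := sum_ruled_matched aN vM hv.
have e1 n : 2 ^+ n *: symbol v 0 = symbol v 0 *m symbol (A n) 0.
  elim: n => [|n IH].
    have -> : symbol (A 0) 0 = 1%:M.
      rewrite symbolE (@zsum1 _ 0) => [|k /negbTE k0]; last by rewrite /A /= /dirac_mx k0 scaler0.
      by rewrite mul0r oppr0 expi0 scale1r /A /= /dirac_mx eqxx.
    by rewrite expr0 scale1r mulmx1.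
  rewrite (symbol_subdivision (a := a) (v := A n) 0 aN (A_zbnd' aN (n := n))) mulr0 scaleMr mulmxA -IH.
  rewrite scaleMl scalerA -exprS.
  have sM := zbnd_subdivision aN vM.
  have := hm 1; rewrite size_poly1 => /(_ (leqnn _)); rewrite -(symbol_0 sM) -(symbol_0 vM).
  rewrite (symbol_subdivision 0 aN vM) mulr0 => /(scalerI _) -> //; by rewrite pnatr_eq0.
pose u (k : int) : 'cV[C]_r := if k == 0 then delta_mx l 0 else 0.
have van : vanishes a 1 u.
  apply: (@cascade_vanishes 0); first exact: (@zbnd_delta _ 0).
  by rewrite mom_delta hornerC scale1r mxE eq_sym (negbTE lo).
pose V := \sum_i Normc.normc (symbol v 0 0 i).
have V0 : 0 <= V by apply: sumr_ge0 => i _; exact: normc_ge0.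
have K0 : 0 <= V * (2 * N%:R + 1) by rewrite mulr_ge0 // addr_ge0 // mulr_ge0.
apply/Normc.eq0_normc/le_anti; rewrite normc_ge0 andbT; apply/ler_addgt0Pl => e e0; rewrite addr0.
have e2 : 0 < e / (V * (2 * N%:R + 1) + 1) by rewrite divr_gt0 // ltr_wpDl.
have [n hn] := van _ e2; have {}hn := hn n (leqnn n).
have p0 : 0 < (2 ^+ n : R) by rewrite exprn_gt0.
have p1 : 1 <= (2 ^+ n : R) by rewrite exprn_ege1 // ler1n.
have hA k i : Normc.normc (A n k i l) <= e / (V * (2 * N%:R + 1) + 1).
  apply: le_trans (hn k); rewrite expr1n mul1r convolution_delta subr0 -colE.
  by have := normc_le_mnorm (col l (A n k)) i 0; rewrite mxE.
have : Normc.normc (2 ^+ n * symbol v 0 0 l) <= V * ((2 * (N * 2 ^ n)).+1%:R * (e / (V * (2 * N%:R + 1) + 1))).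
  have := congr1 (fun x : 'rV[C]_r => x 0 l) (e1 n); rewrite mxE => ->; rewrite mxE /V mulr_suml.
  apply: le_trans (normc_sum _ _ _) _; apply: ler_sum => i _.
  rewrite Normc.normcM ler_wpM2l ?normc_ge0 // symbolE (zsumE (M := (N * 2 ^ n)%N)); last first.
    by apply: zbndZ; exact: A_zbnd'.
  rewrite summxE; apply: le_trans (normc_sum _ _ _) _.
  apply: (@le_trans _ _ (\sum_(k <- zr (N * 2 ^ n)) e / (V * (2 * N%:R + 1) + 1))).
    by apply: ler_sum => k _; rewrite mulr0 oppr0 expi0 scale1r.
  by rewrite big_const_seq count_predT size_zr iter_addr_0 -[leLHS]mulr_natl.
rewrite Normc.normcM normcX normc_nat -ler_pdivlMl // => h; apply: le_trans h _.
have -> : (2 * (N * 2 ^ n)).+1%:R = 2 * N%:R * 2 ^+ n + 1 :> R by rewrite -addn1 natrD !natrM natrX mulrA.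
set K := V * (2 * N%:R + 1) in K0 e2 *.
have -> : 2 ^- n * (V * ((2 * N%:R * 2 ^+ n + 1) * (e / (K + 1)))) = (V * (2 * N%:R + 2 ^- n)) * (e / (K + 1)).
  by field; rewrite !gt_eqF //; lra.
apply: (@le_trans _ _ (K * (e / (K + 1)))).
  by rewrite ler_wpM2r ?(ltW e2) // /K ler_wpM2l // lerD2l invf_le1.
by rewrite mulrCA -[leRHS]mulr1 ler_wpM2l ?(ltW e0) // ler_pdivrMr ?mul1r; lra.
Qed.

Lemma hermite_mask_smoothness : (0 < sm_mask a)%E.
Proof.
have [theta th dec] := vanishes_decay.
apply: sm_mask_gt0; apply: (rho_lt1 r0 th) => u [uf uv].
have [M uM] := fsuppP uf.
have hs := sr_filter_spec r0 aN; set v := sr_filter a in hs uv.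
have [Mv vM] : exists Mv, zbnd Mv v by case: hs => [[vf _ _] _]; exact: fsuppP.
have [v0 hv] := (sum_rulesP aN (sr a) vM).1 hs.
have hv1 : sum_ruled a 1 v by move=> e f szf; apply: hv; exact: leq_trans szf sr_gt0.
have off := filter_first vM hv1.
apply: (dec M _ uM); apply: (cascade_vanishes uM).
(* The zeroth-order part of the vanishing condition; by [filter_first] only the first entries
   contribute to it, so u has zero first mass. *)
have := uv 0 0 0%N sr_gt0; rewrite !cderivn0 mxE mxE (bigD1 o) // big1 => [|l lo]; last first.
  by rewrite off // mul0r.
rewrite (symbol_0 uM) => h.
have {}h : symbol v 0 0 o * mom 1 u o 0 = 0 by apply: etrans h; exact: (esym (addr0 _)).
move/eqP: h; rewrite mulf_eq0 => /orP[/eqP v00|/eqP//].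
case: v0; apply/rowP => l; rewrite [RHS]mxE.
by have [->|lo] := eqVneq l o; [exact: v00 | exact: off].
Qed.

End MaskSmoothness.

(** * Absolute continuity and Sobolev representatives *)

Section AbsoluteContinuity.
Variable R : realType.
Local Notation C := R[i].
Local Notation mu := (@lebesgue_measure R).

Lemma is_derive_eps (f : R -> R) (x d : R) : is_derive x 1 f d <->
  forall e : R, 0 < e -> exists2 t : R, 0 < t & forall y, `|y - x| < t ->
    `|f y - f x - (y - x) * d| <= e * `|y - x|.
Proof.
split=> [[h1 h2] e e0|H].
  have c : (fun h : R => h^-1 *: ((f \o shift x) (h *: (1 : R)) - f x)) h @[h --> 0^'] --> d.
    by rewrite -h2; exact: h1.
  move/cvgrPdist_le: c => /(_ e e0) /nbhs_ballP [t /= t0 ht]; exists t => // y yt.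
  have [->|yx] := eqVneq y x; first by rewrite !subrr mul0r subrr normr0 mulr0.
  have y0 : y - x != 0 by rewrite subr_eq0.
  have := ht (y - x); rewrite /ball /= sub0r normrN => /(_ yt y0).
  rewrite /shift /= /GRing.scale /= mulr1 subrK => h.
  have -> : f y - f x - (y - x) * d = - ((d - (y - x)^-1 * (f y - f x)) * (y - x)).
    by field.
  by rewrite normrN normrM ler_wpM2r.
have c : (fun h : R => h^-1 *: ((f \o shift x) (h *: (1 : R)) - f x)) h @[h --> 0^'] --> d.
  apply/cvgrPdist_le => e e0; have [t t0 ht] := H e e0.
  apply/nbhs_ballP; exists t => //= h; rewrite /ball /= sub0r normrN => hlt h0.
  rewrite /shift /= /GRing.scale /= mulr1.
  have := ht (h + x); rewrite addrK => /(_ hlt) => k.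
  have -> : d - h^-1 * (f (h + x) - f x) = - ((f (h + x) - f x - h * d) / h) by field.
  by rewrite normrN normrM normfV ler_pdivrMr ?normr_gt0.
by apply: DeriveDef; [apply/cvg_ex; exists d | apply/cvg_lim].
Qed.

Lemma is_cderive_eps (f : R -> C) (x : R) (d : C) : is_cderive f x d <->
  forall e : R, 0 < e -> exists2 t : R, 0 < t & forall y, `|y - x| < t ->
    Normc.normc (f y - f x - (y - x)%:C * d) <= e * `|y - x|.
Proof.
have eRe y : complex.Re (f y - f x - (y - x)%:C * d) = re_fun f y - re_fun f x - (y - x) * complex.Re d.
  by rewrite !cReB cReM /= mul0r subr0.
have eIm y : complex.Im (f y - f x - (y - x)%:C * d) = im_fun f y - im_fun f x - (y - x) * complex.Im d.
  by rewrite !cImB cImM /= mul0r addr0.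
split=> [[/is_derive_eps h1 /is_derive_eps h2] e e0|H].
  have e2 : 0 < e / 2 by lra.
  have [t1 t10 k1] := h1 _ e2; have [t2 t20 k2] := h2 _ e2.
  exists (Num.min t1 t2) => [|y]; first by rewrite lt_min t10.
  rewrite lt_min => /andP[y1 y2]; apply: le_trans (normc_ReIm _) _.
  by rewrite eRe eIm; have := k1 y y1; have := k2 y y2; lra.
split; apply/is_derive_eps => e e0; have [t t0 h] := H e e0; exists t => // y yt.
  by rewrite -eRe; apply: le_trans (Re_normc _) (h y yt).
by rewrite -eIm; apply: le_trans (Im_normc _) (h y yt).
Qed.

Lemma AC_sub (f g : R -> C) : absolutely_continuous f -> absolutely_continuous g ->
  absolutely_continuous (fun x => f x - g x).
Proof.
move=> hf hg e e0; have e2 : 0 < e / 2 by lra.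
have [d1 d10 h1] := hf _ e2; have [d2 d20 h2] := hg _ e2.
exists (Num.min d1 d2) => [|n x y xy tr]; first by rewrite lt_min d10.
rewrite lt_min => /andP[/(h1 n x y xy tr) k1 /(h2 n x y xy tr) k2].
apply: (@le_lt_trans _ _ (\sum_i Normc.normc (f (y i) - f (x i)) + \sum_i Normc.normc (g (y i) - g (x i)))); last lra.
rewrite -big_split; apply: ler_sum => i _.
have -> : f (y i) - g (y i) - (f (x i) - g (x i)) = (f (y i) - f (x i)) - (g (y i) - g (x i)) by ring.
by apply: le_trans (normcD _ _) _; rewrite normcN.
Qed.

Lemma AC_shift (t : R) (f : R -> C) : absolutely_continuous f -> absolutely_continuous (fun x => f (x - t)).
Proof.
move=> hf e e0; have [d d0 h] := hf e e0; exists d => // n x y xy tr lt.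
apply: (h n (fun i => x i - t) (fun i => y i - t)) => [i||]; first by rewrite lerD2r.
  apply/trivIsetP => i j _ _ ij; apply/seteqP; split=> // z [] /=; rewrite !in_itv /= => /andP[z1 z2] /andP[z3 z4].
  have /trivIsetP/(_ i j I I ij)/seteqP[/(_ (z + t))] := tr.
  by move=> + _; apply; split; rewrite /= in_itv /=; apply/andP; split; lra.
by under eq_bigr do rewrite opprB addrA subrK.
Qed.

Section MeanValue.
Variables (h : R -> C) (a b B : R) (U : set R) (e : R).
Hypotheses (ab : a <= b) (B0 : 0 <= B) (e0 : 0 < e) (oU : open U) (fU : (mu U < +oo)%E)
  (hB : forall x, a <= x <= b -> ~ U x -> exists2 d, is_cderive h x d & Normc.normc d <= B).

Let len x y := fine (mu (U `&` `]x, y])).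

Let mUi x y : measurable (U `&` `]x, y] : set (measurableTypeR R)).
Proof. by apply: measurableI; [exact: measurable_realfun.open_measurable | exact: measurable_itv]. Qed.

Let mfin x y : mu (U `&` `]x, y]) \is a fin_num.
Proof.
rewrite ge0_fin_numE ?measure_ge0 //; apply: le_lt_trans fU; apply: le_measure; rewrite ?inE; [exact: mUi | exact: measurable_realfun.open_measurable | exact: subIsetl].
Qed.

(** The increment of h obeys the derivative bound up to its increments over disjoint intervals whose
    total length is charged to U. Near a point of U the whole interval is charged; near any other
    point none is. Both the lengths and the bounds are additive, as [cousin] needs. *)
Let P x y := exists n (xs ys : 'I_n -> R), [/\ forall i, x <= xs i /\ xs i <= ys i /\ ys i <= y,
  trivIset setT (fun i => `]xs i, ys i[%classic), \sum_i (ys i - xs i) <= len x y &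
  Normc.normc (h y - h x) <= (B + e) * (y - x) + \sum_i Normc.normc (h (ys i) - h (xs i))].

Let P_add x y z : x <= y <= z -> P x y -> P y z -> P x z.
Proof.
move=> /andP[xy yz] [n [xs [ys [h1 h2 h3 h4]]]] [n' [xs' [ys' [k1 k2 k3 k4]]]].
pose f (u : 'I_n -> R) (v : 'I_n' -> R) (i : 'I_(n + n')) := match fintype.split i with inl j => u j | inr j => v j end.
have fl u v i : f u v (lshift n' i) = u i by rewrite /f -[lshift n' i]/(unsplit (inl i)) unsplitK.
have fr u v i : f u v (rshift n i) = v i by rewrite /f -[rshift n i]/(unsplit (inr i)) unsplitK.
exists (n + n')%N, (f xs xs'), (f ys ys'); split.
- move=> i; case: (split_ordP i) => j ->; rewrite ?fl ?fr.
    by have [? [? ?]] := h1 j; repeat split => //; lra.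
  by have [? [? ?]] := k1 j; repeat split => //; lra.
- apply/trivIsetP => i j _ _; case: (split_ordP i) => i' ->; case: (split_ordP j) => j' -> ne; rewrite ?fl ?fr.
  + by move/trivIsetP: h2; apply => //; apply: contraNneq ne => ->.
  + apply/seteqP; split=> // w [] /=; rewrite !in_itv /= => /andP[w1 w2] /andP[w3 w4].
    by have [? [? ?]] := h1 i'; have [? [? ?]] := k1 j'; lra.
  + apply/seteqP; split=> // w [] /=; rewrite !in_itv /= => /andP[w1 w2] /andP[w3 w4].
    by have [? [? ?]] := k1 i'; have [? [? ?]] := h1 j'; lra.
  + by move/trivIsetP: k2; apply => //; apply: contraNneq ne => ->.
- rewrite big_split_ord /=; under eq_bigr do rewrite !fl; under [X in _ + X]eq_bigr do rewrite !fr.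
  have -> : len x z = len x y + len y z.
    rewrite /len -fineD // -measureU //.
      congr (fine (mu _)); rewrite -setIUr; congr (_ `&` _); apply/seteqP; split=> w /=; rewrite !in_itv /=.
        by move=> /andP[w1 w2]; case: (leP w y) => wy; [left; rewrite w1 | right].
      by case=> /andP[w1 w2]; apply/andP; split; lra.
    apply/seteqP; split=> // w [[_ v1] [_ v2]]; move: v1 v2; rewrite /= !in_itv /= => /andP[w1 w2] /andP[w3 w4]; lra.
  exact: lerD.
rewrite big_split_ord /=; under eq_bigr do rewrite !fl; under [X in _ + (_ + X)]eq_bigr do rewrite !fr.
have -> : h z - h x = (h z - h y) + (h y - h x) by ring.
apply: le_trans (normcD _ _) _; move: h4 k4; lra.
Qed.

Let P_loc t : a <= t <= b -> exists2 d : R, 0 < d &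
  forall x y, a <= x -> x <= t <= y -> y <= b -> t - d < x -> y < t + d -> P x y.
Proof.
move=> tab; have [Ut|nU] := pselect (U t).
  have /nbhs_ballP[d /= d0 hd] : nbhs t U by apply: open_nbhs_nbhs.
  exists d => // x y ax /andP[xt ty] yb dx yd; have xy : x <= y by lra.
  exists 1%N, (fun=> x), (fun=> y); split=> //.
  - by move=> i j _ _ _; rewrite !ord1.
  - rewrite big_ord1 /len; have -> : U `&` `]x, y]%classic = `]x, y]%classic.
      apply/seteqP; split=> w; first by case.
      move=> wi; split=> //; apply: hd; rewrite /ball /=; move: wi; rewrite /= in_itv /= => /andP[w1 w2].
      by rewrite ltr_norml; apply/andP; split; lra.
    rewrite lebesgue_measure_itv /= lte_fin; case: ltP => //= yx.
    by lra.
  - have yx0 : 0 <= y - x by rewrite subr_ge0.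
    have := mulr_ge0 (addr_ge0 B0 (ltW e0)) yx0.
    by rewrite big_ord1; lra.
have [d dd dB] := hB tab nU; have [s s0 hs] := (is_cderive_eps h t d).1 dd e e0.
exists s => // x y ax /andP[xt ty] yb dx yd.
exists 0%N, (fun=> 0), (fun=> 0); rewrite !big_ord0; split.
- by case.
- by case.
- by rewrite /len fine_ge0.
have inc z : `|z - t| < s -> Normc.normc (h z - h t) <= (B + e) * `|z - t|.
  move=> zt; have -> : h z - h t = (h z - h t - (z - t)%:C * d) + (z - t)%:C * d by ring.
  apply: le_trans (normcD _ _) _; have := hs z zt; rewrite Normc.normcM normc_real.
  have : `|z - t| * Normc.normc d <= `|z - t| * B by rewrite ler_wpM2l.
  by lra.
have i1 : `|y - t| = y - t by rewrite ger0_norm ?subr_ge0.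
have i2 : `|x - t| = t - x by rewrite distrC ger0_norm ?subr_ge0.
have := inc y; have := inc x; rewrite i1 i2 => k1 k2.
have {}k1 := k1 ltac:(lra); have {}k2 := k2 ltac:(lra).
have -> : h y - h x = (h y - h t) - (h x - h t) by ring.
by apply: le_trans (normcD _ _) _; rewrite normcN; lra.
Qed.

Lemma AC_cover (d : R) : (mu U < d%:E)%E ->
  (forall n (x y : 'I_n -> R), (forall i, x i <= y i) -> trivIset setT (fun i => `]x i, y i[%classic) ->
     \sum_i (y i - x i) < d -> \sum_i Normc.normc (h (y i) - h (x i)) < e) ->
  Normc.normc (h b - h a) <= (B + e) * (b - a) + e.
Proof.
move=> Ud hd; have [n [xs [ys [h1 h2 h3 h4]]]] := cousin ab P_add P_loc.
apply: le_trans h4 _; rewrite lerD2l; apply/ltW/hd => //.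
  by move=> i; have [_ []] := h1 i.
apply: (le_lt_trans h3); rewrite /len -lte_fin fineK //; apply: le_lt_trans Ud.
by apply: le_measure; rewrite ?inE; [exact: mUi | exact: measurable_realfun.open_measurable | exact: subIsetl].
Qed.

End MeanValue.

(** Outer regularity covers the exceptional null set by an open set of measure below the modulus of
    absolute continuity for e; [AC_cover] then bounds the charged increments by e. *)
Lemma AC_mean_value (h : R -> C) (a b B : R) : a <= b -> 0 <= B -> absolutely_continuous h ->
  {ae mu, forall x, a <= x <= b -> exists2 d, is_cderive h x d & Normc.normc d <= B} ->
  Normc.normc (h b - h a) <= B * (b - a).
Proof.
move=> ab B0 ac [N [mN N0 hN]].
have key (e : R) : 0 < e -> Normc.normc (h b - h a) <= (B + e) * (b - a) + e.
  move=> e0; have [d d0 hd] := ac e e0.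
  have Nfin : (mu N < +oo)%E by rewrite N0 ltry.
  have [U [oU NU UN]] := lebesgue_regularity_outer mN Nfin d0.
  have mU : measurable (U : set (measurableTypeR R)) by exact: measurable_realfun.open_measurable.
  have Ud : (mu U < d%:E)%E.
    apply: le_lt_trans UN; rewrite -[X in (mu X <= _)%E](setDUK NU) setUC.
    by rewrite -[leRHS]adde0 -N0; apply: measureU2 => //; exact: measurableD.
  apply: (@AC_cover h a b B U e ab B0 e0 oU _ _ d Ud hd).
    exact: lt_le_trans Ud (leey _).
  move=> x xab nU; apply: contrapT => nx; apply: nU; apply: NU; apply: hN => /= hx.
  by apply: nx; exact: hx.
apply/ler_addgt0Pl => e e0; have k0 : 0 < b - a + 1 by lra.
have := key (e / (b - a + 1)) (divr_gt0 e0 k0).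
have -> : (B + e / (b - a + 1)) * (b - a) + e / (b - a + 1) = e + B * (b - a) by field; rewrite gt_eqF.
by [].
Qed.

(** Subtract the linear function of slope d(x): near x the a.e. derivative of the difference is
    small by continuity of d, and the mean value inequality gives differentiability at x itself. *)
Lemma AC_C1 (h d : R -> C) : absolutely_continuous h -> ccontinuous d ->
  {ae mu, forall x, is_cderive h x (d x)} -> forall x, is_cderive h x (d x).
Proof.
move=> ac cd hd x; apply/is_cderive_eps => e e0.
have [t t0 ht] := ccont_eps cd x e0; exists t => // y yx.
pose k z := h z - z%:C * d x.
have dl z : is_cderive (fun z : R => z%:C * d x) z (d x).
  apply: (is_cderive_eq (is_cderiveZ (d x) (is_cderive_id z))) => [w|]; first by rewrite mulrC.
  by rewrite mulr1.
have ack : absolutely_continuous k.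
  apply: AC_sub => //; apply: (bounded_derive_AC (normc_ge0 (d x)) dl) => z; exact: lexx.
have dk (p q : R) : (forall z, p <= z <= q -> `|z - x| < t) ->
    {ae mu, forall z, p <= z <= q -> exists2 d, is_cderive k z d & Normc.normc d <= e}.
  move=> hpq; apply: aeS hd => z hz /hpq zt; exists (d z - d x); last by apply: ltW; exact: ht.
  apply: (is_cderive_eq (is_cderiveD hz (is_cderiveZ (-1) (dl z)))) => [w|]; first by rewrite mulN1r.
  by rewrite mulN1r.
have -> : h y - h x - (y - x)%:C * d x = k y - k x.
  by rewrite /k -[(y - x)%:C]/(real_complex R _) rmorphB /=; ring.
have [xy|yx'] := leP x y.
  rewrite [`|y - x|]ger0_norm ?subr_ge0 //; apply: AC_mean_value => //; first exact: ltW.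
  apply: dk => z /andP[z1 z2]; apply: le_lt_trans yx; rewrite !ger0_norm ?subr_ge0 //; lra.
rewrite normcB distrC [`|x - y|]ger0_norm ?subr_ge0 ?(ltW yx') //; apply: AC_mean_value => //; try exact: ltW.
apply: dk => z /andP[z1 z2]; apply: le_lt_trans yx; rewrite !ler0_norm ?subr_le0 //; lra.
Qed.

Lemma AC_cont (f : R -> C) : absolutely_continuous f -> ccontinuous f.
Proof.
move=> hf; apply: eps_ccont => x e e0; have [d d0 h] := hf e e0.
have key u v : u <= v -> v - u < d -> Normc.normc (f v - f u) < e.
  move=> uv lt; have := h 1%N (fun=> u) (fun=> v); rewrite !big_ord1; apply => //.
  by move=> i j _ _ _; rewrite !ord1.
exists d => // y; have [xy|yx] := leP x y.
  by rewrite ger0_norm ?subr_ge0 //; exact: key.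
by rewrite ltr0_norm ?subr_lt0 // opprB normcB; apply: key; exact: ltW.
Qed.

Lemma lipschitz_AC (B : R) (f : R -> C) : 0 <= B ->
  (forall x y, x <= y -> Normc.normc (f y - f x) <= B * (y - x)) -> absolutely_continuous f.
Proof.
move=> B0 hB e e0; have B1 : 0 < B + 1 by lra.
exists (e / (B + 1)); first exact: divr_gt0.
move=> n x y xy _ lt; apply: (@le_lt_trans _ _ (B * \sum_i (y i - x i))).
  by rewrite mulr_sumr; apply: ler_sum => i _; exact: hB.
move: lt; rewrite ltr_pdivlMr // mulrC; have : 0 <= \sum_i (y i - x i).
  by apply: sumr_ge0 => i _; rewrite subr_ge0.
by nra.
Qed.

(** Null sets are translation invariant: the pushforward of Lebesgue measure agrees with it on
    half-open intervals, hence everywhere. *)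
Lemma ae_shift (t : R) (P : R -> Prop) : {ae mu, forall x, P x} -> {ae mu, forall x, P (x - t)}.
Proof.
move=> [N [mN N0 hN]].
have mf0 : measurable_fun setT (fun x : R => x - t).
  by apply: measurable_realfun.continuous_measurable_fun => x; apply: cvgB; [exact: cvg_id | exact: cvg_cst].
have mf : @measurable_fun _ _ (measurableTypeR R) (measurableTypeR R) setT (fun x : R => x - t) by exact: mf0.
exists ((fun x => x - t) @^-1` N); split.
- by rewrite -[X in measurable X]setTI; exact: mf.
- pose F : {mfun measurableTypeR R >-> measurableTypeR R} := @mfun_Sub _ _ (measurableTypeR R) (measurableTypeR R) _ (mem_set mf).
  have := @lebesgue_measure_unique R (pushforward mu F) _ N mN.
  move=> /(_ mf) h; rewrite -N0 h // => X [[p q] _ <-] /=.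
  rewrite -[RHS]/(mu ((fun x : R => x - t) @^-1` `]p, q]%classic)).
  have -> : (fun x : R => x - t) @^-1` `]p, q]%classic = `]p + t, q + t]%classic.
    by apply/seteqP; split=> w /=; rewrite !in_itv /= => /andP[w1 w2]; apply/andP; split; lra.
  rewrite !lebesgue_measure_itv /= !lte_fin ltrD2r; case: ifP => // _.
  by rewrite -!EFinB; congr _%:E; ring.
- by move=> x /= nP; apply: hN => /= /nP.
Qed.

Lemma ae_dense (P : R -> Prop) : {ae mu, forall x, P x} -> forall x e : R, 0 < e -> exists2 y, P y & `|y - x| < e.
Proof.
move=> [N [mN N0 hN]] x e e0; apply: contrapT => no.
have sub : `]x - e, x + e[%classic `<=` N.
  move=> y; rewrite /= in_itv /= => /andP[y1 y2]; apply: hN => /= Py; apply: no; exists y => //.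
  by rewrite ltr_norml; apply/andP; split; lra.
pose I : set R := `]x - e, x + e[%classic.
have : (mu I <= mu N)%E by apply: le_measure; rewrite ?inE //; exact: measurable_itv.
rewrite N0 /I lebesgue_measure_itv /= lte_fin ifT; last lra.
by rewrite -EFinB lee_fin; lra.
Qed.

End AbsoluteContinuity.

(** * Continuous representatives and C^m regularity *)

Section Representatives.
Variable R : realType.
Local Notation C := R[i].
Local Notation mu := (@lebesgue_measure R).

(* An a.e. bound on the increments of a derivative holds between any two points of
   differentiability, by the mean value inequality for z |-> G z - G (z - t). *)
Lemma ae_modulus (g : R -> C) (w : R -> R) (G : nat -> R -> C) :
  (forall K, absolutely_continuous (G K)) ->
  (forall K, {ae mu, forall x, `|x| < K%:R -> is_cderive (G K) x (g x)}) ->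
  (forall t, 0 <= w t) ->
  (forall t, {ae mu, forall x, Normc.normc (g x - g (x - t)) <= w t}) ->
  exists2 E : R -> Prop, {ae mu, forall x, E x} &
    forall x y, E x -> E y -> Normc.normc (g x - g y) <= w (x - y).
Proof.
move=> acG dG w0 hw; exists (fun x => forall K, `|x| < K%:R -> is_cderive (G K) x (g x)).
  exact: ae_foralln.
move=> x y Ex Ey; pose t := x - y.
pose K := Num.bound (`|x| + `|y| + 2).
have hK : `|x| + `|y| + 2 < K%:R by apply: archi_boundP; rewrite !addr_ge0.
have x0 := normr_ge0 x; have y0 := normr_ge0 y.
pose k z := G K z - G K (z - t).
have ack : absolutely_continuous k by apply: AC_sub => //; exact: AC_shift.
have dk z d d' : is_cderive (G K) z d -> is_cderive (G K) (z - t) d' -> is_cderive k z (d - d').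
  move=> h h'; have h2 : is_cderive (fun y => G K (1 * y + - t)) z (1%:C * d') by apply: is_cderive_aff; rewrite mul1r.
  apply: (@is_cderive_eq _ _ _ _ _ _ (is_cderiveD h (is_cderiveZ (-1) h2))) => [u|].
    by rewrite mul1r mulN1r.
  by rewrite mul1r mulN1r.
have dx : is_cderive k x (g x - g y).
  apply: dk; first by apply: Ex; lra.
  by rewrite /t subKr; apply: Ey; lra.
have inc s : 0 <= s <= 1 -> Normc.normc (k (x + s) - k x) <= w t * s.
  move=> /andP[s0 s1]; have -> : w t * s = w t * (x + s - x) by ring.
  apply: (AC_mean_value _ (w0 t) ack); first by rewrite lerDl.
  apply: aeS (aeI (hw t) (aeI (dG K) (ae_shift t (dG K)))) => z [h1 [h2 h3]] /andP[z1 z2].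
  exists (g z - g (z - t)) => //; apply: dk; [apply: h2 | apply: h3].
    have h := ler_normD x (z - x); rewrite addrC subrK [`|z - x|]ger0_norm ?subr_ge0 // in h; lra.
  have e : z - t = y + (z - x) by rewrite /t; ring.
  have h := ler_normD y (z - x); rewrite -e [`|z - x|]ger0_norm ?subr_ge0 // in h; lra.
apply/ler_addgt0Pl => e e0; have [d d0 hd] := (is_cderive_eps k x (g x - g y)).1 dx e e0.
pose s := Num.min 1 (d / 2).
have s0 : 0 < s by rewrite lt_min ltr01 divr_gt0.
have s1 : s <= 1 by rewrite ge_min lexx.
have sd : s < d by rewrite gt_min; apply/orP; right; lra.
have := hd (x + s); rewrite addrAC subrr add0r gtr0_norm // => /(_ sd) h1.
have h2 := inc s; rewrite (ltW s0) s1 in h2; have {}h2 := h2 isT.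
have h3 : Normc.normc (s%:C * (g x - g y)) <= e * s + w t * s.
  have -> : s%:C * (g x - g y) = - (k (x + s) - k x - s%:C * (g x - g y)) + (k (x + s) - k x) by ring.
  by apply: le_trans (normcD _ _) _; rewrite normcN; lra.
by move: h3; rewrite Normc.normcM normc_real gtr0_norm // -mulrDl mulrC ler_pM2r.
Qed.

(* Extension by the lower limit along the dense set E. *)
Lemma continuous_extension (g : R -> R) (w : R -> R) (E : R -> Prop) :
  (forall e : R, 0 < e -> exists2 d : R, 0 < d & forall t, `|t| < d -> w t <= e) ->
  (forall x y, E x -> E y -> `|g x - g y| <= w (x - y)) ->
  (forall x e : R, 0 < e -> exists2 y, E y & `|y - x| < e) ->
  exists2 h : R -> R, continuous h & forall x, E x -> h x = g x.
Proof.
move=> hw hg dense.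
pose S x := [set s | exists2 d : R, 0 < d & forall y, E y -> `|y - x| < d -> s <= g y].
pose h x := sup (S x).
have key x (e : R) : 0 < e -> exists2 d : R, 0 < d & forall y, E y -> `|y - x| < d -> `|h x - g y| <= e.
  move=> e0; have [d d0 hd] := hw e e0; exists (d / 2); first lra.
  move=> y Ey yx.
  have near y' : E y' -> `|y' - x| < d / 2 -> `|g y' - g y| <= e.
    move=> Ey' y'x; apply: le_trans (hg _ _ Ey' Ey) _; apply: hd.
    have -> : y' - y = (y' - x) - (y - x) by ring.
    by apply: le_lt_trans (ler_normB _ _) _; lra.
  have in_S : S x (g y - e).
    exists (d / 2) => [|y' Ey' y'x]; first lra.
    by have := near y' Ey' y'x; rewrite ler_norml; lra.
  have ub : ubound (S x) (g y + e).
    move=> s [d' d'0 hs]; have dd : 0 < Num.min (d / 2) d' by rewrite lt_min d'0 andbT; lra.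
    have [y' Ey' ] := dense x _ dd; rewrite lt_min => /andP[k1 k2].
    by have := hs y' Ey' k2; have := near y' Ey' k1; rewrite ler_norml; lra.
  have h1 : h x <= g y + e by apply: ge_sup => //; exists (g y - e).
  have h2 : g y - e <= h x by apply: ub_le_sup => //; exists (g y + e).
  by rewrite ler_norml; lra.
exists h => [x|x Ex].
  apply/cont_eps => e e0; have e3 : 0 < e / 3 by lra.
  have [d d0 hd] := key x _ e3; exists (d / 2) => [|y yx]; first lra.
  have [d' d'0 hd'] := key y _ e3.
  have dd : 0 < Num.min (d / 2) d' by rewrite lt_min d'0 andbT; lra.
  have [z Ez] := dense y _ dd; rewrite lt_min => /andP[k1 k2].
  have k3 : `|z - x| < d.
    have -> : z - x = (z - y) + (y - x) by ring.
    by apply: le_lt_trans (ler_normD _ _) _; lra.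
  have := hd z Ez k3; have := hd' z Ez k2.
  by rewrite !ler_norml ltr_norml; lra.
apply/eqP; rewrite -subr_eq0 -normr_eq0; apply/eqP/le_anti; rewrite normr_ge0 andbT.
apply/ler_addgt0Pl => e e0; rewrite addr0; have [d d0 hd] := key x e e0.
by apply: hd => //; rewrite subrr normr0.
Qed.

Lemma ccontinuous_extension (g : R -> C) (w : R -> R) (E : R -> Prop) :
  (forall e : R, 0 < e -> exists2 d : R, 0 < d & forall t, `|t| < d -> w t <= e) ->
  (forall x y, E x -> E y -> Normc.normc (g x - g y) <= w (x - y)) ->
  (forall x e : R, 0 < e -> exists2 y, E y & `|y - x| < e) ->
  exists2 h : R -> C, ccontinuous h & forall x, E x -> h x = g x.
Proof.
move=> hw hg dense.
have [|h1 c1 e1] := @continuous_extension (re_fun g) w E hw _ dense.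
  by move=> x y Ex Ey; rewrite /re_fun -cReB; apply: le_trans (Re_normc _) (hg x y Ex Ey).
have [|h2 c2 e2] := @continuous_extension (im_fun g) w E hw _ dense.
  by move=> x y Ex Ey; rewrite /im_fun -cImB; apply: le_trans (Im_normc _) (hg x y Ex Ey).
exists (fun x => h1 x +i* h2 x); first by split.
by move=> x Ex; apply: cReIm_eq => /=; [exact: e1 | exact: e2].
Qed.

(** Clipping to [-B, B] makes the bound hold everywhere, and cutting off outside [-K, K] makes the
    function integrable over R; on ]-K, K[ it still agrees a.e. with [gr], so Lebesgue
    differentiation applies. *)
Lemma real_bounded_primitive (gr : R -> R) (B : R) (K : nat) : 0 <= B -> measurable_fun setT gr ->
  {ae mu, forall x, `|gr x| <= B} ->
  exists F : R -> R, (forall x y, x <= y -> `|F y - F x| <= B * (y - x)) /\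
    {ae mu, forall x, `|x| < K%:R -> is_derive (x : R) (1 : R) F (gr x)}.
Proof.
move=> B0 mg hB.
pose q x := Num.max (- B) (Num.min B (gr x)).
have qB x : - B <= q x <= B.
  by rewrite /q le_max lexx /= ge_max ge_min lexx andbT; lra.
have mq : measurable_fun setT q.
  by apply: measurable_realfun.measurable_maxr => //; apply: measurable_realfun.measurable_minr.
pose I : set (measurableTypeR R) := `[- K%:R, K%:R]%classic.
have mI : measurable I by exact: measurable_itv.
have bint (A : set (measurableTypeR R)) (f : R -> R) : measurable A -> (mu A < +oo)%E -> measurable_fun A f ->
    (forall x, - B <= f x <= B) -> mu.-integrable A (EFin \o f).
  move=> mA fA mf hf; apply: measurable_bounded_integrable => //.
  exists B; split; first exact: num_real.
  by move=> M BM x _ /=; apply: le_trans (ltW BM); rewrite ler_norml.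
have fI : (mu I < +oo)%E by rewrite /I lebesgue_measure_itv /=; case: ifP => _; rewrite ltry.
have iq : mu.-integrable I (EFin \o q) by apply: bint => //; exact: measurable_funS mq.
pose p := q \_ I.
have pB x : - B <= p x <= B by rewrite /p patchE; case: ifP => _; [exact: qB | rewrite oppr_le0 B0].
have ip : mu.-integrable setT (EFin \o p).
  by have := iq; move/(integrable_mkcond _ mI); rewrite restrict_EFin.
have mp : measurable_fun setT p by have /integrableP[/measurable_realfun.measurable_EFinP ? _] := ip.
pose F x := Rintegral mu `]-oo, x]%classic p.
exists F; split=> [x y xy|].
  have mu1 : measurable (`]-oo, x]%classic : set (measurableTypeR R)) by exact: measurable_itv.
  have mu2 : measurable (`]x, y]%classic : set (measurableTypeR R)) by exact: measurable_itv.
  have i2 : mu.-integrable `]x, y] (EFin \o p) by apply: integrableS ip.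
  have -> : F y - F x = Rintegral mu `]x, y]%classic p.
    have U : `]-oo, y]%classic = `]-oo, x]%classic `|` `]x, y]%classic :> set R.
      apply/seteqP; split=> w /=; rewrite !in_itv /=.
        by move=> wy; case: (leP w x) => wx; [left | right].
      by case=> [wx|/andP[_ //]]; exact: le_trans wx xy.
    rewrite /F U Rintegral_setU //; first by rewrite addrAC subrr add0r.
      by apply: integrableS ip => //; exact: measurableU.
    by apply/disj_setPLR => w /=; rewrite !in_itv /= => wx /andP[xw _]; lra.
  have muxy : mu `]x, y]%classic = (y - x)%:E.
    rewrite lebesgue_measure_itv /= lte_fin; case: ltP => //= yx.
    by congr _%:E; lra.
  have fi : (mu `]x, y]%classic < +oo)%E by rewrite muxy ltry.
  have em c : Rintegral mu `]x, y]%classic (cst c) = c * (y - x).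
    have e : fine (mu `]x, y]%classic) = y - x by rewrite muxy.
    by rewrite -e; exact: Rintegral_cst.
  have ic c : - B <= c <= B -> mu.-integrable `]x, y]%classic (EFin \o cst c).
    by move=> cB; apply: bint.
  rewrite ler_norml -mulNr -!em; apply/andP; split; apply: le_Rintegral => //; try (apply: ic; lra).
    by move=> w _; have /andP[] := pB w.
  by move=> w _; have /andP[] := pB w.
have lp : locally_integrable [set: R] p by exact: integrable_locally.
have := @FTC1Ny R p _ lp => /(_ _)-h.
have {}h : {ae mu, forall x, derivable F x 1 /\ derive1 F x = p x}.
  by apply: h => y; apply: integrableS ip.
apply: aeS (aeI h hB) => x [[h1 h2] h3] xK; apply: DeriveDef => //.
rewrite -derive1E h2 /p patchE ifT; last by rewrite inE /I /= in_itv /= -ler_norml ltW.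
by rewrite /q min_r ?max_r //; move: h3; rewrite ler_norml; lra.
Qed.

Lemma bounded_primitive (g : R -> C) (K : nat) : in_Linfty g ->
  exists2 G, absolutely_continuous G & {ae mu, forall x, `|x| < K%:R -> is_cderive G x (g x)}.
Proof.
move=> [m1 m2 fin].
have [B B0 hB] : exists2 B : R, 0 <= B & {ae mu, forall x, Normc.normc (g x) <= B}.
  have h0 : (0 <= Linfty_norm g)%E by exact: Lnorm_ge0.
  have ff : Linfty_norm g \is a fin_num by rewrite ge0_fin_numE.
  exists (fine (Linfty_norm g)); first exact: fine_ge0.
  by apply/Linfty_normP; rewrite fineK.
have [|F1 [l1 d1]] := @real_bounded_primitive (re_fun g) B K B0 m1.
  by apply: aeS hB => x; apply: le_trans; exact: Re_normc.
have [|F2 [l2 d2]] := @real_bounded_primitive (im_fun g) B K B0 m2.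
  by apply: aeS hB => x; apply: le_trans; exact: Im_normc.
exists (fun x => F1 x +i* F2 x).
  apply: (@lipschitz_AC _ (2 * B)); first by rewrite mulr_ge0.
  move=> x y xy; apply: le_trans (normc_ReIm _) _ => /=.
  by have := l1 x y xy; have := l2 x y xy; lra.
by apply: aeS (aeI d1 d2) => x [h1 h2] xK; split; [exact: h1 | exact: h2].
Qed.

Lemma powR_modulus (B tau : R) : 0 <= B -> 0 < tau -> forall e : R, 0 < e ->
  exists2 d : R, 0 < d & forall t : R, `|t| < d -> B * `|t| `^ tau <= e.
Proof.
move=> B0 t0 e e0; have B1 : 0 < B + 1 by lra.
have q0 : 0 < e / (B + 1) by rewrite divr_gt0.
exists ((e / (B + 1)) `^ tau^-1); first exact: powR_gt0.
move=> t ht; apply: (@le_trans _ _ (B * (e / (B + 1)))); last first.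
  by rewrite mulrCA -[leRHS]mulr1 ler_wpM2l ?(ltW e0) // ler_pdivrMr ?mul1r; lra.
rewrite ler_wpM2l //; have -> : e / (B + 1) = ((e / (B + 1)) `^ tau^-1) `^ tau.
  by rewrite -powRrM mulVf ?gt_eqF // powRr1 // ltW.
by apply: ge0_ler_powR; rewrite ?nnegrE ?powR_ge0 // ?(ltW t0) // ltW.
Qed.

(** If n > m, the given derivatives up to order m are absolutely continuous, so [AC_C1] upgrades the
    a.e. relations among them. If n = m, then tau > 0, and the top derivative agrees a.e. with a
    continuous function by its Hoelder modulus. *)
Lemma sm_fun_cont_diff (m : nat) (f : R -> C) : (m%:R%:E < sm_fun f)%E ->
  exists2 F, cont_diff m F & {ae mu, forall x, f x = F x}.
Proof.
move=> /ereal_sup_gt[_ [n [tau [g [/andP[t0 t1] [fg gL gAC gD] [B B0 hB] ->]]]]].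
rewrite lte_fin => lt.
have dae j : (j < n)%N -> {ae mu, forall x, is_cderive (g j) x (g j.+1 x)}.
  move=> jn; apply: aeS (gD j jn) => x [h1 <-]; exact: is_cderiveP.
have mn : (m <= n)%N.
  rewrite leqNgt; apply/negP => nm; have : (n.+1%:R : R) <= m%:R by rewrite ler_nat.
  by rewrite -addn1 natrD; lra.
have [lmn|] := ltnP m n.
  have D : derivs m g.
    move=> j jm; apply: AC_C1; [exact/gAC/(ltn_trans jm) | | exact/dae/(ltn_trans jm)].
    by apply: AC_cont; apply: gAC; exact: leq_ltn_trans jm lmn.
  exists (g 0%N) => //; apply: derivs_cont_diff D _; apply: AC_cont; exact: gAC.
move=> nm; have {nm mn} nm : n = m by apply/eqP; rewrite eqn_leq nm mn.
rewrite nm in lt fg gL gAC gD hB dae; have tp : 0 < tau by lra.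
(* Absolutely continuous primitives of the top derivative: the derivative of order m - 1 if m > 0,
   and otherwise a local primitive of the bounded function itself. *)
have [G acG dG] : exists2 G : nat -> R -> C, (forall K, absolutely_continuous (G K)) &
    (forall K, {ae mu, forall x, `|x| < K%:R -> is_cderive (G K) x (g m x)}).
  case: (m) gL gAC dae => [|p] gL gAC dae.
    have H K := bounded_primitive K (gL 0%N isT).
    have [G hG] := boolp.choice (fun K => let: ex_intro2 G h1 h2 := H K in
      ex_intro (fun G => absolutely_continuous G /\ {ae mu, forall x, `|x| < K%:R -> is_cderive G x (g 0%N x)}) G (conj h1 h2)).
    by exists G => K; have [] := hG K.
  exists (fun=> g p) => K; first exact: gAC.
  by apply: aeS (dae p (ltnSn p)) => x h _.
have w0 (t : R) : 0 <= B * `|t| `^ tau by rewrite mulr_ge0 ?powR_ge0 // ltW.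
have hw t : {ae mu, forall x, Normc.normc (g m x - g m (x - t)) <= B * `|t| `^ tau} by apply/Linfty_normP; exact: hB.
have [E aeE hE] := ae_modulus acG dG w0 hw.
have [h ch eh] := ccontinuous_extension (powR_modulus (ltW B0) tp) hE (ae_dense aeE).
pose D j := if (j < m)%N then g j else h.
have aeD j : (j <= m)%N -> {ae mu, forall x, g j x = D j x}.
  move=> jm; rewrite /D; case: ltnP => [_|mj]; first exact: aeW.
  have -> : j = m by apply/eqP; rewrite eqn_leq jm.
  by apply: aeS aeE => x /eh ->.
have cD j : (j <= m)%N -> ccontinuous (D j).
  by move=> jm; rewrite /D; case: ltnP => [lt'|_] //; apply: AC_cont; exact: gAC.
have dD : derivs m D.
  move=> j jm; have -> : D j = g j by rewrite /D jm.
  apply: AC_C1; [exact: gAC | exact: cD |].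
  by apply: aeS (aeI (dae j jm) (aeD j.+1 jm)) => x [k1 k2]; rewrite -k2.
exists (D 0%N); first by apply: derivs_cont_diff dD _; exact: cD.
by apply: aeS (aeI fg (aeD 0%N (leq0n m))) => x [-> <-].
Qed.

End Representatives.

(** * Distributions represented by functions *)

Section TestFunctions.
Variable R : realType.
Local Notation C := R[i].

(** Repeated differentiability as a chain of existence statements: closure under products is then an
    induction that needs no Leibniz formula. *)
Fixpoint diff_class (m : nat) (f : R -> C) : Prop :=
  if m is p.+1 then exists2 f' : R -> C, (forall x, is_cderive f x (f' x)) & diff_class p f' else True.

Lemma diff_class_pred m f : diff_class m.+1 f -> diff_class m f.
Proof. by elim: m f => // m IH f [f' h1 h2]; exists f' => //; exact: IH. Qed.

Lemma diff_classD m f g : diff_class m f -> diff_class m g -> diff_class m (fun x => f x + g x).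
Proof.
elim: m f g => // m IH f g [f' f1 f2] [g' g1 g2].
by exists (fun x => f' x + g' x) => [x|]; [exact: is_cderiveD | exact: IH].
Qed.

Lemma diff_classZ m c f : diff_class m f -> diff_class m (fun x => c * f x).
Proof.
elim: m f => // m IH f [f' f1 f2].
by exists (fun x => c * f' x) => [x|]; [exact: is_cderiveZ | exact: IH].
Qed.

Lemma diff_classM m f g : diff_class m f -> diff_class m g -> diff_class m (fun x => f x * g x).
Proof.
elim: m f g => // m IH f g hf hg; have [f' f1 f2] := hf; have [g' g1 g2] := hg.
exists (fun x => f x * g' x + f' x * g x) => [x|]; first exact: is_cderiveM.
by apply: diff_classD; apply: IH => //; exact: diff_class_pred.
Qed.

Lemma diff_class_cderivn k m f : diff_class (k + m) f -> diff_class m (cderivn k f).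
Proof.
elim: k m => [|k IH] m h; first by rewrite cderivn0.
have {h} : diff_class (k + m.+1) f by rewrite addnS.
move=> /IH [f' h1 h2]; rewrite cderivnS; have -> // : cderivn 1 (cderivn k f) = f'.
by apply/funext => x; exact: (is_cderive_derivable (h1 x)).2.
Qed.

Lemma diff_class_smooth f : (forall m, diff_class m f) <-> smooth f.
Proof.
split=> [h|h m].
  rewrite -[f]cderivn0; apply: (@derivs_smooth R (fun n => cderivn n f)) => m n _ x.
  have := h (n + 1)%N; move=> /diff_class_cderivn [f' h1 _]; rewrite cderivnS.
  by rewrite (is_cderive_derivable (h1 x)).2; exact: h1.
suff H k : diff_class m (cderivn k f) by have := H 0%N; rewrite cderivn0.
elim: m k => // m IH k; exists (cderivn k.+1 f) => [x|]; last exact: IH.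
exact: (smooth_derivs h (ltnSn k)).
Qed.

Lemma smoothM f g : smooth f -> smooth g -> smooth (fun x : R => f x * g x).
Proof.
by move=> /diff_class_smooth hf /diff_class_smooth hg; apply/diff_class_smooth => m; exact: diff_classM.
Qed.

Lemma smooth_primitive (F f : R -> C) : (forall x, is_cderive F x (f x)) -> smooth f -> smooth F.
Proof.
move=> h /diff_class_smooth hf; apply/diff_class_smooth => -[|m] //.
by exists f.
Qed.

(** The functions x^(-k) exp(-1/x), extended by 0. All k are considered at once because derivatives
    stay in their span. *)
Definition flat (k : nat) (x : R) : C := if 0 < x then (x^-1 ^+ k * expR (- x^-1))%:C else 0.

(** From exp(u) >= u^(k+2) / (k+2)! with u = 1/x. The quadratic bound makes the derivative at 0
    vanish. *)
Lemma flat_bound k (x : R) : 0 < x -> x^-1 ^+ k * expR (- x^-1) <= (k.+2)`!%:R * x ^+ 2.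
Proof.
move=> x0; have u0 : 0 < x^-1 by rewrite invr_gt0.
have h : x^-1 ^+ k.+2 <= (k.+2)`!%:R * expR (x^-1).
  have := expR_ge1Dxn k.+1 (ltW u0); have f0 : 0 < (k.+2)`!%:R :> R by rewrite ltr0n fact_gt0.
  move=> h; rewrite mulrC -ler_pdivrMr //; lra.
rewrite expRN ler_pdivrMr ?expR_gt0 //.
have -> : x^-1 ^+ k = x^-1 ^+ k.+2 * x ^+ 2.
  by rewrite -addn2 exprD -mulrA -exprMn mulVf ?gt_eqF // expr1n mulr1.
by rewrite [leRHS]mulrAC ler_wpM2r // exprn_ge0 // ltW.
Qed.

Lemma flat_derive k x : is_cderive (flat k) x (flat k.+2 x - k%:R * flat k.+1 x).
Proof.
have [x0|x0] := ltP 0 x; last first.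
  have -> : flat k.+2 x - k%:R * flat k.+1 x = 0 by rewrite /flat !ltNge x0 /= mulr0 subrr.
  have fx : flat k x = 0 by rewrite /flat ltNge x0.
  apply/is_cderive_eps => e e0; have f0 : 0 < (k.+2)`!%:R :> R by rewrite ltr0n fact_gt0.
  exists (e / (k.+2)`!%:R); first exact: divr_gt0.
  move=> y yx; rewrite fx subr0 mulr0 subr0 /flat; have [y0|y0] := ltP 0 y; last first.
    by rewrite Normc.normc0 mulr_ge0 // ltW.
  rewrite normc_real ger0_norm; last by rewrite mulr_ge0 ?expR_ge0 // exprn_ge0 // invr_ge0 ltW.
  apply: le_trans (flat_bound k y0) _.
  have yy : y <= `|y - x| by rewrite ger0_norm ?subr_ge0; lra.
  rewrite expr2 mulrA; apply: (@le_trans _ _ (e * y)); last by rewrite ler_wpM2l // ltW.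
  rewrite ler_wpM2r ?(ltW y0) // mulrC -ler_pdivlMr //; apply: le_trans yy (ltW yx).
have near : \forall y \near x, 0 < y by exact: lt_nbhsr.
have ne : x != 0 by rewrite gt_eqF.
have v : is_derive x 1 (fun y : R => y^-1) (- x ^- 2).
  have := @is_deriveV R id x 1 1 ne (is_derive_id x 1); by rewrite /GRing.scale /= mulr1.
have ex : is_derive x 1 (fun y : R => expR (- y^-1)) (expR (- x^-1) * x ^- 2).
  have := @is_derive1_comp R expR (fun y => - y^-1) x _ _ (is_derive_expR _) (is_deriveN v).
  by rewrite opprK.
have pw : is_derive x 1 (fun y : R => y^-1 ^+ k) (k%:R * x^-1 ^+ k.-1 * - x ^- 2).
  apply: (is_derive_eqf (is_deriveX k v)) => [y|//].
  by elim: k => [|k IH]; rewrite ?expr0 // !exprS -IH.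
have m := is_deriveM pw ex.
split.
  have m' : is_derive x 1 (fun y : R => y^-1 ^+ k * expR (- y^-1)) (complex.Re (flat k.+2 x - k%:R * flat k.+1 x)).
    apply: (is_derive_eqf m) => //.
    rewrite /flat x0 cReB cReM /= /GRing.scale /=.
    have -> : complex.Re (k%:R : C) = k%:R by rewrite -(rmorph_nat (real_complex R)).
    have -> : complex.Im (k%:R : C) = 0 by rewrite -(rmorph_nat (real_complex R)).
    by case: (k) => [|p]; rewrite /= ?exprS; field.
  apply: (near_eq_is_derive _ m').
  by apply: filterS near => y y0; rewrite /re_fun /flat y0.
have m' : is_derive x 1 (fun y : R => 0) (complex.Im (flat k.+2 x - k%:R * flat k.+1 x)).
  apply: (is_derive_eqf (is_derive_cst (0 : R) x 1)) => //.
  rewrite /flat x0 cImB cImM /=.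
  have -> : complex.Im (k%:R : C) = 0 by rewrite -(rmorph_nat (real_complex R)).
  by rewrite mulr0 mul0r addr0 subrr.
apply: (near_eq_is_derive _ m').
by apply: filterS near => y y0; rewrite /im_fun /flat y0.
Qed.

Lemma smooth_flat k : smooth (flat k).
Proof.
apply/diff_class_smooth => m; elim: m k => // m IH k.
exists (fun x => flat k.+2 x + - k%:R * flat k.+1 x) => [x|].
  by rewrite mulNr; exact: flat_derive.
by apply: diff_classD => //; exact: diff_classZ.
Qed.

Lemma bump (x0 d : R) : 0 < d -> exists g : R -> C, [/\ smooth g,
  forall x, d <= `|x - x0| -> g x = 0, forall x, complex.Im (g x) = 0 /\ 0 <= complex.Re (g x) &
  forall x, `|x - x0| < d -> 0 < complex.Re (g x)].
Proof.
move=> d0; exists (fun x => flat 0 (1 * x + (d - x0)) * flat 0 (-1 * x + (x0 + d))).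
have fr y : flat 0 y = (if 0 < y then expR (- y^-1) else 0)%:C.
  by rewrite /flat; case: ifP; rewrite ?expr0 ?mul1r.
have f0 y : 0 <= (if 0 < y then expR (- y^-1) else 0 : R) by case: ifP => // _; exact: expR_ge0.
split.
- by apply: smoothM; apply: smooth_aff; exact: smooth_flat.
- move=> x; rewrite ler_normr => /orP[h|h].
    by rewrite /flat [X in _ * X](_ : _ = 0) ?mulr0 // ifF //; apply/negbTE; rewrite -leNgt; lra.
  by rewrite /flat [X in X * _](_ : _ = 0) ?mul0r // ifF //; apply/negbTE; rewrite -leNgt; lra.
- move=> x; rewrite !fr cImM cReM /= !mulr0 mul0r subr0 addr0; split=> //; exact: mulr_ge0.
- move=> x; rewrite ltr_norml => /andP[h1 h2]; rewrite !fr cReM /= mulr0 subr0.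
  by rewrite !ifT ?mulr_gt0 ?expR_gt0 //; lra.
Qed.

Lemma derive_ge0_mono (G f : R -> R) (x y : R) : x <= y -> (forall z : R, is_derive z 1 G (f z)) ->
  (forall z, 0 <= f z) -> G x <= G y.
Proof.
move=> xy dG f0; have [c _ e] := mean_value xy dG.
by rewrite -subr_ge0 e mulr_ge0 // subr_ge0.
Qed.

(** A primitive of a bump is a smooth step from one constant to another; the difference of two
    translates, divided by the height S of the step, is 1 in between and 0 far away. *)
Lemma cutoff (A : R) : 0 < A -> exists (chi : R -> C) (L : R), [/\ smooth chi,
  forall x, `|x| <= A -> chi x = 1, csupp L chi & A <= L].
Proof.
move=> A0; have [g [sg g0 gr gp]] := bump 0 ltr01.
have cg := smooth_continuous sg.
have s1 : csupp 1 g by move=> x x1; apply: g0; rewrite subr0 ltW.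
have [G dG] := cprimitive_ex ltr01 cg s1.
pose S := G 1 - G (-1).
have Gr (x : R) : 1 <= x -> G x = G 1.
  move=> x1; apply: (primitive_const dG) => z /andP[]; rewrite min_r // => h _.
  by apply: g0; rewrite subr0 ger0_norm; lra.
have Gl (x : R) : x <= -1 -> G x = G (-1).
  move=> x1; apply: (primitive_const dG) => z /andP[_]; rewrite max_r // => h.
  by apply: g0; rewrite subr0 ler0_norm; lra.
have S0 : S != 0.
  have dr (x : R) : is_derive x 1 (re_fun G) (complex.Re (g x)) by have [] := dG x.
  have gr0 x : 0 <= complex.Re (g x) by have [] := gr x.
  have h1 : re_fun G (-1) <= re_fun G (- 2^-1) by apply: (derive_ge0_mono _ dr gr0); lra.
  have h2 : re_fun G (2^-1) <= re_fun G 1 by apply: (derive_ge0_mono _ dr gr0); lra.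
  have hh : - 2^-1 <= 2^-1 :> R by lra.
  have [c /andP[c1 c2] ec] := mean_value hh dr.
  have pc : 0 < complex.Re (g c) by apply: gp; rewrite subr0 ltr_norml; apply/andP; split; lra.
  have h3 : re_fun G (- 2^-1) < re_fun G (2^-1).
    by rewrite -subr_gt0 ec mulr_gt0 //; lra.
  apply/eqP => /(congr1 (@complex.Re R)); rewrite /S cReB /= => h.
  by move: h h1 h2 h3; rewrite /re_fun; lra.
have sG : smooth G by exact: smooth_primitive dG sg.
exists (fun x => S^-1 * (G (1 * x + (A + 1)) + -1 * G (1 * x + - (A + 1)))), (A + 2); split.
- apply: smoothZ; apply: smoothD; first exact: smooth_aff.
  by apply: smoothZ; exact: smooth_aff.
- move=> x; rewrite ler_norml => /andP[x1 x2].
  have -> : G (1 * x + (A + 1)) = G 1 by apply: Gr; lra.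
  have -> : G (1 * x + - (A + 1)) = G (-1) by apply: Gl; lra.
  by rewrite mulN1r mulVf.
- move=> x; rewrite ltr_normr => /orP[h|h].
    have -> : G (1 * x + (A + 1)) = G 1 by apply: Gr; lra.
    have -> : G (1 * x + - (A + 1)) = G 1 by apply: Gr; lra.
    by rewrite mulN1r subrr mulr0.
  have -> : G (1 * x + (A + 1)) = G (-1) by apply: Gl; lra.
  have -> : G (1 * x + - (A + 1)) = G (-1) by apply: Gl; lra.
  by rewrite mulN1r subrr mulr0.
- lra.
Qed.

(** Multiplied by the conjugate of its value at x0, H has positive real part near x0 if that value
    is nonzero; testing against a small bump then gives a nonzero integral. *)
Lemma dubois_reymond (H : R -> C) (x0 d0 : R) : ccontinuous H -> 0 < d0 ->
  (forall g, smooth g -> (forall x, d0 <= `|x - x0| -> g x = 0) -> cRintegral (fun x => H x * g x) = 0) ->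
  H x0 = 0.
Proof.
move=> cH d00 hH; apply/eqP; apply: contraT => Hx0.
pose c : C := complex.Re (H x0) +i* - complex.Im (H x0).
pose H1 x := complex.Re (c * H x).
have H1x : 0 < H1 x0.
  rewrite /H1 cReM /= mulNr opprK lt_def addr_ge0 ?sqr_ge0 -?expr2 ?sqr_ge0 // andbT.
  apply: contraNneq Hx0 => /eqP; rewrite paddr_eq0 ?sqr_ge0 // !sqrf_eq0 => /andP[/eqP h1 /eqP h2].
  by apply/eqP/cReIm_eq.
have cH1 : ccontinuous (fun x => c * H x) by exact: ccontinuousZ.
have [d d1 hd] := ccont_eps cH1 x0 H1x.
pose s := Num.min d d0.
have s0 : 0 < s by rewrite lt_min d1.
have sd : s <= d by rewrite ge_min lexx.
have sd0 : s <= d0 by rewrite ge_min lexx orbT.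
have pos x : `|x - x0| < s -> 0 < H1 x.
  move=> xs; have := hd x (lt_le_trans xs sd); move=> h.
  have := le_lt_trans (Re_normc _) h; rewrite cReB -/(H1 x) -/(H1 x0) ltr_norml; lra.
have [g [sg g0 gr gp]] := bump x0 s0.
pose L := `|x0| + s.
have L0 : 0 < L by rewrite ltr_wpDl.
have sgL : csupp L g.
  move=> x Lx; apply: g0; have := lerB_dist x x0; rewrite /L in Lx; lra.
pose f x := c * (H x * g x).
have cf : ccontinuous f by apply: ccontinuousZ; apply: ccontinuousM => //; exact: smooth_continuous.
have sf : csupp L f by move=> x /sgL h; rewrite /f h !mulr0.
have [G dG] := cprimitive_ex L0 cf sf.
have I0 : G L - G (- L) = 0.
  rewrite -(cRintegral_primitive L0 cf sf dG) (cRintegralZ _ L0).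
  - by rewrite hH ?mulr0 // => x hx; apply: g0; exact: le_trans sd0 hx.
  - by apply: ccontinuousM => //; exact: smooth_continuous.
  - by move=> x /sgL ->; rewrite mulr0.
have ef x : complex.Re (f x) = H1 x * complex.Re (g x).
  by rewrite /f mulrA cReM; have [-> _] := gr x; rewrite mulr0 subr0.
have f0 x : 0 <= complex.Re (f x).
  rewrite ef; have [h|h] := ltP `|x - x0| s; first by rewrite mulr_ge0 ?(ltW (pos x h)) //; have [] := gr x.
  by rewrite g0 // mulr0.
have dr (x : R) : is_derive x 1 (re_fun G) (complex.Re (f x)) by have [] := dG x.
have xL := ler_norm x0; have xL2 := ler_norm (- x0); rewrite normrN in xL2.
have h1 : re_fun G (- L) <= re_fun G (x0 - s / 2) by apply: (derive_ge0_mono _ dr f0); rewrite /L; lra.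
have h2 : re_fun G (x0 + s / 2) <= re_fun G L by apply: (derive_ge0_mono _ dr f0); rewrite /L; lra.
have ss : x0 - s / 2 <= x0 + s / 2 by lra.
have [z /andP[z1 z2] ez] := mean_value ss dr.
have zs : `|z - x0| < s by rewrite ltr_norml; apply/andP; split; lra.
have h3 : re_fun G (x0 - s / 2) < re_fun G (x0 + s / 2).
  by rewrite -subr_gt0 ez mulr_gt0 ?ef ?mulr_gt0 ?pos ?gp //; lra.
move/(congr1 (@complex.Re R)): I0; rewrite cReB /= => h.
by move: h h1 h2 h3; rewrite /re_fun; lra.
Qed.

End TestFunctions.

(** * Support and test functions of a represented distribution *)

Section RepresentedDistribution.
Variable R : realType.
Local Notation C := R[i].
Local Notation mu := (@lebesgue_measure R).

Lemma cderivn_locally0 m (f : R -> C) (x d : R) : cont_diff m f -> 0 < d -> (forall y, `|y - x| < d -> f y = 0) ->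
  forall n y, (n <= m)%N -> `|y - x| < d -> cderivn n f y = 0.
Proof.
move=> sf d0 f0; elim=> [|n IH] y nm yx; first by rewrite cderivn0 f0.
apply: (is_cderive_unique (cont_diff_derivs sf nm y)).
apply/is_cderive_eps => e e0; exists (d - `|y - x|); first by rewrite subr_gt0.
move=> z zy; rewrite (IH y (ltnW nm) yx) (IH z (ltnW nm)) ?subrr ?mulr0 ?subrr ?Normc.normc0 ?mulr_ge0 // ?(ltW e0) //.
have -> : z - x = (z - y) + (y - x) by ring.
by apply: le_lt_trans (ler_normD _ _) _; lra.
Qed.

Lemma ae_cRintegral (f F g : R -> C) : in_Linfty f -> ccontinuous F -> ccontinuous g ->
  {ae mu, forall x, f x = F x} -> cRintegral (fun x => f x * g x) = cRintegral (fun x => F x * g x).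
Proof.
move=> [m1 m2 _] [c1 c2] [g1 g2] fF.
have n1 := measurable_realfun.continuous_measurable_fun c1.
have n2 := measurable_realfun.continuous_measurable_fun c2.
have k1 := measurable_realfun.continuous_measurable_fun g1.
have k2 := measurable_realfun.continuous_measurable_fun g2.
have mre (u : R -> C) : measurable_fun setT (re_fun u) -> measurable_fun setT (im_fun u) ->
    measurable_fun setT (re_fun (fun x => u x * g x)) /\ measurable_fun setT (im_fun (fun x => u x * g x)).
  move=> u1 u2; split.
    have -> : re_fun (fun x => u x * g x) = (fun x => re_fun u x * re_fun g x - im_fun u x * im_fun g x).
      by apply/funext => x; rewrite /re_fun cReM.
    by apply: measurable_realfun.measurable_funB; exact: measurable_realfun.measurable_funM.
  have -> : im_fun (fun x => u x * g x) = (fun x => re_fun u x * im_fun g x + im_fun u x * re_fun g x).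
    by apply/funext => x; rewrite /im_fun cImM.
  by apply: measurable_realfun.measurable_funD; exact: measurable_realfun.measurable_funM.
have [a1 a2] := mre f m1 m2; have [b1 b2] := mre F n1 n2.
congr (_ +i* _); rewrite /Rintegral; congr fine; apply: ae_eq_integral => //.
- exact/measurable_realfun.measurable_EFinP.
- exact/measurable_realfun.measurable_EFinP.
- by apply: aeS fF => x e _; rewrite /re_fun e.
- exact/measurable_realfun.measurable_EFinP.
- exact/measurable_realfun.measurable_EFinP.
- by apply: aeS fF => x e _; rewrite /im_fun e.
Qed.

(** The distribution sees only jets on [-K, K], so it kills functions vanishing on a neighbourhood
    of it, and F vanishes beyond K + 1. A cutoff then extends the representation from compactly
    supported test functions to all smooth ones. *)
Lemma represented_continuous (phi : cs_distribution R) (f F : R -> C) : in_Linfty f -> represented_by phi f ->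
  ccontinuous F -> {ae mu, forall x, f x = F x} ->
  exists2 L : R, 0 < L & csupp L F /\ forall g, smooth g -> phi g = cRintegral (fun x => F x * g x).
Proof.
move=> fi hf cF fF; have [lin [B [K [P [B0 K1 hB]]]]] := distr_cs phi.
have test g : smooth g -> (exists K, csupp K g) -> phi g = cRintegral (fun x => F x * g x).
  by move=> sg [K' sK]; rewrite (hf g sg) ?(ae_cRintegral fi cF (smooth_continuous sg) fF) //; exists K'.
have far g : smooth g -> (forall x, `|x| < K + 1 -> g x = 0) -> phi g = 0.
  move=> sg g0; apply/Normc.eq0_normc/le_anti; rewrite normc_ge0 andbT -(mulr0 B).
  apply: (hB g sg 0) => j x _ xK; rewrite (@cderivn_locally0 j g x 1 (sg j) ltr01 _ j x) ?Normc.normc0 ?subrr ?normr0 //.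
  move=> y yx; apply: g0; have -> : y = (y - x) + x by ring.
  by apply: le_lt_trans (ler_normD _ _) _; lra.
have sF : csupp (K + 1) F.
  move=> x Kx; have d0 : 0 < `|x| - (K + 1) by rewrite subr_gt0.
  apply: (dubois_reymond cF d0) => g sg g0; rewrite -test //.
    apply: far => // y yK; apply: g0; have := lerB_dist x y; rewrite distrC; lra.
  exists (`|x| + (`|x| - (K + 1))) => y yL; apply: g0; have := lerB_dist y x; lra.
have K0 : 0 < K + 1 by lra.
exists (K + 1) => //; split=> // g sg.
have K2 : 0 < K + 2 by lra.
have [chi [L [schi chi1 supp_chi _]]] := cutoff K2.
have s1 : smooth (fun x => chi x * g x) by exact: smoothM.
have s2 : smooth (fun x => -1 * (chi x * g x) + g x) by apply: smoothD => //; exact: smoothZ.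
have e : phi (fun x => 1 * (chi x * g x) + (-1 * (chi x * g x) + g x)) = phi (fun x => chi x * g x).
  rewrite (pairing_linear phi 1 s1 s2) mul1r (far _ s2) ?addr0 // => x xK.
  by rewrite chi1 ?mul1r ?mulN1r ?addNr //; lra.
have -> : phi g = phi (fun x => chi x * g x).
  by rewrite -e; congr (phi _); apply/funext => x; ring.
rewrite test //; last by exists L => x /supp_chi ->; rewrite mul0r.
congr cRintegral; apply/funext => x; have [xK|Kx] := leP `|x| (K + 1).
  by rewrite chi1 ?mul1r //; lra.
by rewrite sF // !mul0r.
Qed.

End RepresentedDistribution.

(** * Refinement equation of the representatives *)

Section RepresentedRefinable.
Variable R : realType.
Local Notation C := R[i].
Variables (r m : nat) (a : int -> 'M[C]_r) (N : nat).
Hypothesis aN : zbnd N a.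
Variables (phi : 'I_r -> cs_distribution R).
Hypothesis phi_ref : forall xi : R, fourier phi (2 * xi) = symbol a xi *m fourier phi xi.

Lemma phi_refinement i f : smooth f ->
  phi i f = \sum_(k <- zr N) \sum_j a k i j * phi j (fun x => f (2^-1 * x + k%:~R / 2)).
Proof.
move=> sf; pose D f := phi i f - \sum_(k <- zr N) \sum_j a k i j * phi j (fun x => f (2^-1 * x + k%:~R / 2)).
have dD : distr D.
  apply: (distrB (distr_cs (phi i))); apply: distr_sum => k; apply: distr_sum => j.
  exact: (distr_scale (a k i j) (distr_aff 2^-1 (k%:~R / 2) (distr_cs (phi j)))).
apply/eqP; rewrite -subr_eq0; apply/eqP; apply: (distr_moments dD _ sf) => p.
by rewrite /D (distr_refinement aN phi_ref) subrr.
Qed.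

(** The refinement equation holds against every test function, by that of phi and a change of
    variables; both sides being continuous, it holds pointwise. *)
Lemma represented_refinable (F : 'I_r -> R -> C) (L : R) : 0 < L ->
  (forall i, ccontinuous (F i)) -> (forall i, csupp L (F i)) ->
  (forall i g, smooth g -> phi i g = cRintegral (fun x => F i x * g x)) -> refinable a N F.
Proof.
move=> L0 cF sF hF i x.
pose G x := 2 * \sum_(k <- zr N) \sum_j a k i j * F j (2 * x - k%:~R).
have cG : ccontinuous G.
  apply: ccontinuousZ; apply: ccontinuous_sum => k; apply: ccontinuous_sum => j.
  by apply: ccontinuousZ; apply: (ccontinuous_aff 2 (- k%:~R)).
have cH : ccontinuous (fun x => F i x + -1 * G x) by apply: ccontinuousD => //; exact: ccontinuousZ.
suff : F i x + -1 * G x = 0 by move/eqP; rewrite mulN1r subr_eq0 => /eqP.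
apply: (dubois_reymond cH ltr01) => g sg g0.
have cg := smooth_continuous sg.
pose L' := L + `|x| + 1.
have L'0 : 0 < L' by rewrite /L'; have := normr_ge0 x; lra.
have sg' : csupp L' g by move=> y yL; apply: g0; have := lerB_dist y x; rewrite /L' in yL; lra.
have s1 : csupp L' (fun x => F i x * g x) by move=> y yL; rewrite sg' ?mulr0.
have s2 : csupp L' (fun x => G x * g x) by move=> y yL; rewrite sg' ?mulr0.
have c1 : ccontinuous (fun x => F i x * g x) by exact: ccontinuousM.
have c2 : ccontinuous (fun x => G x * g x) by exact: ccontinuousM.
have -> : (fun x => (F i x + -1 * G x) * g x) = (fun x => F i x * g x + -1 * (G x * g x)).
  by apply/funext => y; ring.
rewrite (cRintegralD L'0 c1 (ccontinuousZ (-1) c2) s1); last by move=> y /s2 ->; rewrite mulr0.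
rewrite (cRintegralZ (-1) L'0 c2 s2) -hF // (phi_refinement i sg).
rewrite /G (integral_refinement a N L0 cF sF i cg) mulN1r -sumrB big1 // => k _.
rewrite -sumrB big1 // => j _; rewrite -mulrBr hF; last exact: smooth_aff.
rewrite [X in _ * (X - _)](_ : _ = cRintegral (fun x => F j x * g ((x + k%:~R) / 2))) ?subrr ?mulr0 //.
by congr cRintegral; apply/funext => y; congr (_ * g _); field.
Qed.

Lemma sm_gt_limit : sm_gt phi m -> exists (F : 'I_r -> R -> C) (L : R), [/\ 0 < L,
  forall i, cont_diff m (F i), forall i, csupp L (F i), refinable a N F &
  forall i, cRintegral (F i) = fourier phi 0 i 0].
Proof.
move=> [f [hf lt]].
have lti i : (m%:R%:E < sm_fun (f i))%E.
  by apply: lt_le_trans lt _; rewrite (bigD1 i) //= ge_min lexx.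
have H i : exists F : R -> C, cont_diff m F /\ exists2 L : R, 0 < L & csupp L F /\
    forall g, smooth g -> phi i g = cRintegral (fun x => F x * g x).
  have [F cF fF] := sm_fun_cont_diff (lti i); have [fi fr] := hf i; exists F; split => //.
  apply: (represented_continuous fi fr _ fF); by have := cF.2 0%N (leq0n _); rewrite cderivn0.
have [F hF] := boolp.choice H.
have [Ls hLs] := boolp.choice (fun i => let: ex_intro2 L h1 h2 := (hF i).2 in
  ex_intro (fun L : R => 0 < L /\ csupp L (F i)) L (conj h1 h2.1)).
pose L := 1 + \sum_i Ls i.
have LsL i : Ls i <= L.
  rewrite /L (bigD1 i) //= addrCA lerDl addr_ge0 // sumr_ge0 // => j _; by have [/ltW] := hLs j.
have L0 : 0 < L by rewrite ltr_wpDr // sumr_ge0 // => j _; have [/ltW] := hLs j.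
have sF i : csupp L (F i) by apply: csupp_widen (LsL i) _; have [] := hLs i.
have rF i g : smooth g -> phi i g = cRintegral (fun x => F i x * g x).
  by have [_ [_ _ [_ h]]] := hF i; exact: h.
have cF i : ccontinuous (F i) by have := (hF i).1.2 0%N (leq0n _); rewrite cderivn0.
exists F, L; split => //; first by move=> i; have [] := hF i.
  exact: (represented_refinable L0 cF sF rF).
move=> i; rewrite mxE rF; last first.
  by have := smooth_cst (1 : C); congr smooth; apply/funext => x; rewrite mulr0 oppr0 expi0.
by congr cRintegral; apply/funext => x; rewrite mulr0 oppr0 expi0 mulr1.
Qed.

End RepresentedRefinable.

(** * Decay of vanishing sequences *)

Section Pairing.
Variable R : realType.
Local Notation C := R[i].
Variables (r : nat) (a : int -> 'M[C]_r) (N : nat).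
Hypothesis aN : zbnd N a.
Local Notation A := (A a).
Variables (k Mv : nat) (v : int -> 'rV[C]_r).
Hypotheses (vM : zbnd Mv v) (v0 : symbol v 0 <> 0) (hv : sum_ruled a k v).

Definition pairing_value (f : {poly C}) (u : int -> 'cV[C]_r) : C := pairmom f v u 0 0.
Local Notation P := pairing_value.

Lemma pairing_sum M (u : int -> 'cV[C]_r) f : zbnd M u ->
  P f u = \sum_(i <- zr M) (mom (f \Po ('X + (i%:~R)%:P)) v *m u i) 0 0.
Proof.
move=> uM; rewrite /P (pairmomE f vM uM) (zsumE (M := M)) ?summxE // => i iM.
by rewrite uM // mulmx0.
Qed.

Lemma pairing_scale M (u w : int -> 'cV[C]_r) c f : zbnd M u -> zbnd M w ->
  P f (fun k => u k + c *: w k) = P f u + c * P f w.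
Proof.
move=> uM wM; rewrite !(pairing_sum f (M := M)) //; last by move=> i iM; rewrite uM // wM // scaler0 addr0.
rewrite mulr_sumr -big_split; apply: eq_bigr => i _.
have ent (X Y : 'M[C]_1) : (X + c *: Y) 0 0 = X 0 0 + c * Y 0 0 by rewrite !mxE.
by rewrite mulmxDr scaleMr ent.
Qed.

Lemma pairing_zbnd M (u : int -> 'cV[C]_r) : zbnd M u -> zbnd (Mv + M) (convolution v u).
Proof. by move=> uM; exact: (convolution_zbnd uM vM). Qed.

Lemma pairingD M (u : int -> 'cV[C]_r) f g : zbnd M u -> P (f + g) u = P f u + P g u.
Proof. by move=> uM; rewrite /P /pairmom (momD f g (pairing_zbnd uM)) mxE. Qed.

Lemma pairingZ M (u : int -> 'cV[C]_r) c f : zbnd M u -> P (c *: f) u = c * P f u.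
Proof. by move=> uM; rewrite /P /pairmom (momZ c f (pairing_zbnd uM)) mxE. Qed.

Lemma pairing0 (u : int -> 'cV[C]_r) : P 0 u = 0.
Proof. by rewrite /P /pairmom mom0 mxE. Qed.

Lemma pairing_shift (t : int) f (u : int -> 'cV[C]_r) : P f (fun k => u (k + t)) = P (f \Po ('X + (- t%:~R)%:P)) u.
Proof.
rewrite /P /pairmom /mom [in RHS](zsum_shift t); congr ((_ : 'M[C]_1) 0 0); apply: eq_zsum => s.
rewrite horner_comp hornerD hornerX hornerC rmorphD /= addrK; congr (_ *: _).
rewrite !convolutionE [RHS](zsum_shift t); apply: eq_zsum => q.
by congr (v _ *m _); ring.
Qed.

Definition vanishing_order (j : nat) (u : int -> 'cV[C]_r) :=
  forall f : {poly C}, (size f <= j)%N -> P f u = 0.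

Lemma vanishing_orderP M j (u : int -> 'cV[C]_r) : zbnd M u -> (forall p, (p < j)%N -> P 'X^p u = 0) -> vanishing_order j u.
Proof.
move=> uM h f szf.
have zM : zbnd (Mv + M) (fun _ : int => 0 : 'M[C]_1) by [].
have := @mom_monom R (Mv + M) 1 1 j (convolution v u) (fun=> 0) (pairing_zbnd uM) zM.
rewrite /P /pairmom => -> //; first by rewrite mom_0 mxE.
move=> p pj; rewrite mom_0; apply/matrixP => x y; rewrite !ord1 [RHS]mxE; exact: h.
Qed.

Lemma vanishing_spaceP M (u : int -> 'cV[C]_r) : zbnd M u -> vanishing_order k u -> vanishing_space v k u.
Proof.
move=> uM hu; split; first exact: fsupp_zbnd uM.
have -> : (fun xi => symbol v xi *m symbol u xi) = symbol (convolution v u).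
  by apply/funext => x; rewrite (symbol_convolution _ vM uM).
rewrite -(symbol0 R 1 1); apply/(mxeqO_mom k (pairing_zbnd uM) (fun _ _ => erefl)) => f szf.
by rewrite mom_0; apply/matrixP => x y; rewrite !ord1 [RHS]mxE; exact: hu.
Qed.

Lemma pairing_delta f (y : 'cV[C]_r) (k0 : int) :
  P f (fun k => if k == k0 then y else 0) = (mom (f \Po ('X + (k0%:~R)%:P)) v *m y) 0 0.
Proof.
rewrite /P (pairmomE f vM (@zbnd_delta _ _ y k0)) (@zsum1 _ k0) ?eqxx // => i /negbTE ->.
by rewrite mulmx0.
Qed.

Lemma polyX_shift (p : nat) (c : C) : exists2 g : {poly C}, (size g <= p)%N &
  'X^p \Po ('X + c%:P) = 'X^p + g.
Proof.
rewrite comp_Xn_poly; elim: p => [|p [g szg IH]].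
  by exists 0; rewrite ?size_poly0 // !expr0 addr0.
exists (g * 'X + c *: ('X^p + g)).
  apply: leq_trans (size_polyD _ _) _; rewrite geq_max; apply/andP; split.
    by apply: leq_trans (size_polyMleq _ _) _; rewrite size_polyX addn2.
  apply: leq_trans (size_scale_leq _ _) _; apply: leq_trans (size_polyD _ _) _.
  by rewrite size_polyXn geq_max leqnn leqW.
by rewrite exprSr IH exprSr -mul_polyC; ring.
Qed.

Lemma polyX_shift2 (p : nat) (c : C) : exists2 g : {poly C}, (size g <= p)%N &
  'X^(p.+1) \Po ('X + c%:P) = 'X^(p.+1) + (p.+1%:R * c) *: 'X^p + g.
Proof.
rewrite comp_Xn_poly; elim: p => [|p [g szg IH]].
  by exists 0; rewrite ?size_poly0 // !expr1 expr0 mul1r addr0 alg_polyC.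
exists (g * 'X + c *: ((p.+1%:R * c) *: 'X^p + g)).
  apply: leq_trans (size_polyD _ _) _; rewrite geq_max; apply/andP; split.
    by apply: leq_trans (size_polyMleq _ _) _; rewrite size_polyX addn2.
  apply: leq_trans (size_scale_leq _ _) _; apply: leq_trans (size_polyD _ _) _.
  by rewrite geq_max (leq_trans (size_scale_leq _ _)) ?size_polyXn // leqW.
rewrite exprSr IH -[in RHS](natr1 p.+1) -!mul_polyC !exprS !polyCM !polyCD ?polyC1; ring.
Qed.

Lemma polyX_affine (p : nat) (s c : C) : s != 0 -> exists2 g : {poly C}, (size g <= p)%N &
  'X^p \Po (s *: 'X + c%:P) = s ^+ p *: 'X^p + g.
Proof.
move=> s0; have [g szg e] := polyX_shift p (c / s).
exists (s ^+ p *: g); first exact: leq_trans (size_scale_leq _ _) szg.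
have -> : s *: 'X + c%:P = s *: ('X + (c / s)%:P).
  by rewrite scalerDr -[X in _ = _ + X]mul_polyC -polyCM mulrCA divff ?mulr1.
by move: e; rewrite !comp_Xn_poly exprZn => ->; rewrite scalerDr.
Qed.

Section Decay.
Variable theta : R.
Hypotheses (th0 : 0 < theta)
  (dec : forall M (u : int -> 'cV[C]_r), zbnd M u -> vanishing_order k u -> decays a theta u).

Lemma decays_le (t t' : R) (u : int -> 'cV[C]_r) : 0 <= t <= t' -> decays a t u -> decays a t' u.
Proof.
move=> /andP[t0 tt] [B B0 h]; exists B => // n j; apply: le_trans (h n j) _.
by rewrite ler_wpM2l // lerXn2r // ?nnegrE //; exact: le_trans tt.
Qed.

Lemma Tm_zbnd M e (u : int -> 'cV[C]_r) : zbnd M u -> zbnd (N * 2 ^ 1 + M + `|e|) (Tm a 1 e u).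
Proof.
move=> uM q lt; rewrite /Tm (convolution_zbnd uM (A_zbnd' aN (n := 1))) //.
by rewrite expr1 expn1; move: lt; rewrite expn1; clear; lia.
Qed.

(* Tm 1 e u - 2^-j u vanishes to one more order than u. *)
Lemma vanishing_decays (t : R) j : (j <= k)%N -> theta <= t -> 2 ^- j < t ->
  forall M (u : int -> 'cV[C]_r), zbnd M u -> vanishing_order j u -> decays a t u.
Proof.
move=> jk tht.
have tpos : (0 < t)%R.
  by apply: lt_le_trans tht.
have [ i ] := ubnP (k - j); elim: i j jk => // i IH j jk; rewrite ltnS => ki jt M u uM uj.
have [e|jk'] := eqVneq j k.
  by apply: decays_le (dec uM _); [rewrite (ltW th0) | rewrite -e].
have {jk'} jk' : (j < k)%N by rewrite ltn_neqAle jk'.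
pose z e q := Tm a 1 e u q + - 2 ^- j *: u q.
have zz e : exists2 M', zbnd M' (z e) & decays a t (z e).
  pose M' := (N * 2 ^ 1 + M + `|e|)%N.
  have b1 : zbnd M' (Tm a 1 e u) by exact: Tm_zbnd.
  have b2 : zbnd M' u by apply: zbnd_widen uM; rewrite /M'; clear; lia.
  have bz : zbnd M' (z e) by move=> q lt; rewrite /z b1 // b2 // scaler0 addr0.
  exists M' => //; apply: (IH j.+1 jk' _ _ M' _ bz).
  - by move: ki jk'; clear; lia.
  - apply: le_lt_trans jt; rewrite lef_pV2 ?posrE ?exprn_gt0 //.
    by rewrite ler_weXn2l // ler1n.
  apply: (vanishing_orderP bz) => p; rewrite ltnS => pj.
  rewrite /z (pairing_scale _ _ b1 b2).
  have -> : P 'X^p (Tm a 1 e u) = P ('X^p \Po (2^-1 *: 'X + (- e%:~R / 2)%:P)) u.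
    rewrite /P (pairmom_T aN e vM uM hv) // size_polyXn; exact: leq_ltn_trans pj jk'.
  have h2 : (2^-1 : C) != 0 by rewrite invr_eq0 pnatr_eq0.
  have [g szg ->] := polyX_affine p (- e%:~R / 2) h2; rewrite exprVn.
  rewrite (pairingD _ _ uM) (pairingZ _ _ uM) (uj g) ?(leq_trans szg pj) // addr0 mulNr.
  move: pj; rewrite leq_eqVlt => /orP[/eqP ->|pj]; first by rewrite subrr.
  by rewrite (uj 'X^p) ?size_polyXn // !mulr0 subrr.
have [M0 zM0 [B0 B00 h0]] := zz 0; have [M1 zM1 [B1 B10 h1]] := zz 1.
have [b0 b00 hb0] := convolution_bound_unif aN 0.
(* The second term solves the recursion: one step replaces K by B0 + B1 + 2^(-j) K, which must not
   exceed t K. The first term covers n = 0. *)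
pose K := b0 * znorm M u + (B0 + B1) / (t - 2 ^- j).
have d0 : 0 < t - 2 ^- j by rewrite subr_gt0.
have z0 : 0 <= b0 * znorm M u by rewrite mulr_ge0 // znorm_ge0.
have K1 : (B0 + B1) / (t - 2 ^- j) <= K by rewrite lerDr.
have KB : B0 + B1 <= K * (t - 2 ^- j) by rewrite -ler_pdivrMr.
have K2 := divr_ge0 (addr_ge0 B00 B10) (ltW d0).
have K0 : 0 <= K by exact: le_trans K2 K1.
exists K => //; elim=> [|n IHn] q.
  rewrite expr0 mulr1; apply: le_trans (hb0 M u q uM) _.
  by rewrite lerDl.
have [q' [e [-> e01]]] := int_parity q.
have h := convolution_A_add aN u n 1 q' e; rewrite addn1 expr1 in h; rewrite h.
have hz : mnorm (convolution (A n) (z e) q') <= (B0 + B1) * t ^+ n.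
  have tn : 0 <= t ^+ n by rewrite exprn_ge0 // ltW.
  case: e01 => ->; [apply: le_trans (h0 n q') _ | apply: le_trans (h1 n q') _]; rewrite ler_wpM2r //; lra.
have split_conv : convolution (A n) (fun q => convolution (A 1) u (2 * q + e)) q' =
    convolution (A n) (z e) q' + 2 ^- j *: convolution (A n) u q'.
  pose M' := (N * 2 ^ 1 + M + `|e|)%N.
  have b1 : zbnd M' (fun q => convolution (A 1) u (2 * q + e)).
    by move=> s lt; have := Tm_zbnd uM lt; rewrite /Tm expr1.
  have b2 : zbnd M' u by apply: zbnd_widen uM; rewrite /M'; clear; lia.
  rewrite /z /Tm expr1 (convolution_scale _ _ _ b1 b2) -addrA scaleNr addNr addr0 //.
rewrite split_conv; apply: le_trans (mnormD _ _) _; rewrite mnormZ.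
have -> : Normc.normc (2 ^- j : C) = 2 ^- j by rewrite -real_complex_pow2 normc_real gtr0_norm // invr_gt0 exprn_gt0.
have p0 : 0 < (2 ^- j : R) by rewrite invr_gt0 exprn_gt0.
apply: (@le_trans _ _ ((B0 + B1) * t ^+ n + 2 ^- j * (K * t ^+ n))).
  by apply: lerD hz _; rewrite ler_wpM2l // ltW.
have -> : (B0 + B1) * t ^+ n + 2 ^- j * (K * t ^+ n) = (B0 + B1 + 2 ^- j * K) * t ^+ n by ring.
rewrite exprS mulrA ler_wpM2r ?exprn_ge0 ?(ltW tpos) //; move: KB; rewrite mulrBr; lra.
Qed.

(** A backward difference raises the order of vanishing by one and multiplies the first nonzero
    pairing by j + 1 up to sign, hence the factor c; it also annihilates the mass. *)
Lemma vanishing_ladder j : exists (M : nat) (w : int -> 'cV[C]_r), [/\ zbnd M w, vanishing_order j w,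
  P 'X^j w = 1 & (0 < j)%N -> mom 1 w = 0].
Proof.
elim: j => [|j [M [w [wM wj w1 wm]]]].
  have [l hl] : exists l, symbol v 0 0 l != 0.
    apply: contrapT => /forallNP h; apply: v0; apply/rowP => l; rewrite [RHS]mxE.
    by apply/eqP; apply: contrapT => /negP; exact: h.
  exists 0%N, (fun k => if k == 0 then (symbol v 0 0 l)^-1 *: delta_mx l 0 else 0); split=> //.
  - exact: (@zbnd_delta _ _ _ 0).
  - by move=> f; rewrite leqn0 size_poly_eq0 => /eqP ->; exact: pairing0.
  - rewrite pairing_delta expr0 comp_polyC -(symbol_0 vM) scaleMr -colE mxE [col _ _ _ _]mxE.
    by rewrite mulVf.
pose w' q := w (q - 1).
have b' : zbnd M.+1 w' by move=> q lt; rewrite /w' wM //; move: lt; clear; lia.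
have b : zbnd M.+1 w by apply: zbnd_widen wM.
have b2 : zbnd M.+1 (fun q => w q + -1 *: w' q) by move=> q lt; rewrite b // b' // scaler0 addr0.
have j0 : (j.+1%:R : C) != 0 by rewrite pnatr_eq0.
pose c : C := - (j.+1%:R)^-1.
have key f : P f (fun q => w q + -1 *: w' q) = P (f - (f \Po ('X + 1%:P))) w.
  rewrite (pairing_scale _ _ b b') (pairing_shift (-1)) mulN1r rmorphN1 opprK.
  by rewrite -[X in P (f + X)]scaleN1r (pairingD _ _ wM) (pairingZ _ _ wM) mulN1r.
pose W q := c *: (w q + -1 *: w' q).
have bW : zbnd M.+1 W by move=> q lt; rewrite /W b2 // scaler0.
have PW f : P f W = c * P (f - (f \Po ('X + 1%:P))) w.
  have z0 : zbnd M.+1 (fun _ : int => 0 : 'cV[C]_r) by [].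
  have -> : W = (fun q => 0 + c *: (w q + -1 *: w' q)) by apply/funext => q; rewrite add0r.
  rewrite (pairing_scale _ _ z0 b2) key (pairing_sum f z0) big1 ?add0r // => i _.
  by rewrite mulmx0 mxE.
exists M.+1, W; split => //.
- apply: (vanishing_orderP bW) => p; rewrite ltnS => pj; rewrite PW.
  have [g szg ->] := polyX_shift p 1.
  by rewrite opprD addrA subrr add0r wj ?mulr0 // size_polyN; exact: leq_trans szg pj.
- rewrite PW; have [g szg ->] := polyX_shift2 j 1.
  have -> : 'X^(j.+1) - ('X^(j.+1) + (j.+1%:R * 1) *: 'X^j + g) = - j.+1%:R *: 'X^j + -1 *: g :> {poly C}.
    by rewrite mulr1 scaleNr scaleN1r; ring.
  rewrite (pairingD _ _ wM) !(pairingZ _ _ wM) w1 (wj g) // mulr0 addr0 mulr1 /c mulrNN.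
  by rewrite mulVf.
- move=> _; apply/colP => i.
  have mw : mom 1 w' = mom 1 w.
    by rewrite /mom [RHS](zsum_shift (-1)); apply: eq_zsum => q; rewrite !hornerC.
  have bn : zbnd M.+1 (fun q => -1 *: w' q) by move=> q lt; rewrite b' // scaler0.
  by rewrite /W (momZr _ _ b2) (momDr _ b bn) (momZr _ _ b') mw scaleN1r subrr scaler0.
Qed.

(** A delta of value y vanishes to order 1, since v^(0) y = 0. Higher orders are reached by
    subtracting elements of [vanishing_ladder], which have mass 0 and so leave the mass y
    unchanged. *)
Lemma vanishing_sequence (y : 'cV[C]_r) j : (0 < j)%N -> symbol v 0 *m y = 0 ->
  exists (M : nat) (u : int -> 'cV[C]_r), [/\ zbnd M u, vanishing_order j u & mom 1 u = y].
Proof.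
move=> + vy; elim: j => // -[|j] IH _.
  exists 0%N, (fun k => if k == 0 then y else 0); split.
  - exact: (@zbnd_delta _ _ _ 0).
  - move=> f szf; rewrite pairing_delta (size1_polyC szf) comp_polyC.
    have -> : mom (f`_0)%:P v = f`_0 *: symbol v 0.
      by rewrite (symbol_0 vM) -(momZ _ _ vM) alg_polyC.
    by rewrite scaleMl vy scaler0 mxE.
  - by rewrite mom_delta hornerC scale1r.
have [M [u [uM uj uy]]] := IH isT; have [M' [w [wM wj w1 w0]]] := vanishing_ladder j.+1.
pose M2 := maxn M M'.
have b1 : zbnd M2 u by apply: zbnd_widen uM; exact: leq_maxl.
have b2 : zbnd M2 w by apply: zbnd_widen wM; exact: leq_maxr.
pose c := P 'X^(j.+1) u.
have b3 : zbnd M2 (fun q => - c *: w q) by move=> q lt; rewrite b2 // scaler0.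
exists M2, (fun q => u q + - c *: w q); split.
- by move=> q lt; rewrite b1 // b3 // addr0.
- apply: (@vanishing_orderP M2); first by move=> q lt; rewrite b1 // b3 // addr0.
  move=> p; rewrite ltnS leq_eqVlt (pairing_scale _ _ b1 b2) => /orP[/eqP ->|pj].
    by rewrite w1 mulr1 subrr.
  by rewrite uj ?size_polyXn // wj ?size_polyXn // mulr0 addr0.
- by rewrite (momDr _ b1 b3) (momZr _ _ b2) w0 // scaler0 addr0.
Qed.

(** Take u vanishing to order k with mass y. Applied to the mass of [A n] convolved with u, d gives
    (2 2^(-p))^n d y, while the decay bounds it by O(2^n theta^n); as theta < 2^(-p), d y = 0. So d
    is determined by v^(0) up to a scalar. *)
Lemma left_eigenvector_span p (d : 'rV[C]_r) (y : 'cV[C]_r) : (0 < k)%N -> theta < 2 ^- p ->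
  d *m symbol a 0 = 2 ^- p *: d -> symbol v 0 *m y = 0 -> (d *m y) 0 0 = 0.
Proof.
move=> k0 thp da vy; have [M [u [uM uk uy]]] := vanishing_sequence k0 vy.
have [B B0 hB] := dec uM uk.
have e n : (2 * 2 ^- p) ^+ n *: d = d *m symbol (A n) 0.
  elim: n => [|n IH].
    have -> : symbol (A 0) 0 = 1%:M.
      rewrite symbolE (@zsum1 _ 0) => [|q /negbTE q0]; last by rewrite /A /= /dirac_mx q0 scaler0.
      by rewrite mul0r oppr0 expi0 scale1r /A /= /dirac_mx eqxx.
    by rewrite expr0 scale1r mulmx1.
  rewrite (symbol_subdivision (a := a) (v := A n) 0 aN (A_zbnd' aN (n := n))) mulr0 scaleMr mulmxA -IH.
  by rewrite scaleMl da !scalerA exprS; congr (_ *: _); ring.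
pose t := theta * 2 ^+ p.
have t01 : 0 <= t < 1.
  rewrite /t mulr_ge0 ?(ltW th0) ?exprn_ge0 //= -ltr_pdivlMr ?exprn_gt0 // mul1r //.
pose K := mnorm d * ((2 * (N + M)).+1%:R * B).
have K0 : 0 <= K by rewrite !mulr_ge0 // mnorm_ge0.
have key n : Normc.normc ((d *m y) 0 0) <= K * t ^+ n.
  have p0 : 0 < (2 ^+ n : R) by rewrite exprn_gt0.
  have q0 : 0 < (2 ^- p : R) by rewrite invr_gt0 exprn_gt0.
  have h1 : (2 * 2 ^- p) ^+ n * (d *m y) 0 0 = (d *m mom 1 (convolution (A n) u)) 0 0.
    have bc := convolution_zbnd uM (A_zbnd' aN (n := n)).
    rewrite -(symbol_0 bc) (symbol_convolution _ (A_zbnd' aN (n := n)) uM) mulmxA -e scaleMl [RHS]mxE.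
    by rewrite (symbol_0 uM) uy.
  have h2 : mnorm (mom 1 (convolution (A n) u)) <= (2 * (N * 2 ^ n + M)).+1%:R * (B * theta ^+ n).
    rewrite /mom (zsumE (M := (N * 2 ^ n + M)%N)); last first.
      by apply: zbndZ; exact: (convolution_zbnd uM (A_zbnd' aN (n := n))).
    apply: le_trans (mnorm_sum _ _ _) _.
    apply: (@le_trans _ _ (\sum_(q <- zr (N * 2 ^ n + M)) (B * theta ^+ n))).
      by apply: ler_sum => q _; rewrite hornerC scale1r.
    by rewrite big_const_seq count_predT size_zr iter_addr_0 -[leLHS]mulr_natl.
  have h3 : Normc.normc ((2 * 2 ^- p) ^+ n * (d *m y) 0 0) <= mnorm d * ((2 * (N * 2 ^ n + M)).+1%:R * (B * theta ^+ n)).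
    rewrite h1; apply: le_trans (normc_le_mnorm _ _ _) _; apply: le_trans (mnormM _ _) _.
    by rewrite ler_wpM2l ?mnorm_ge0.
  have h4 : ((2 * (N * 2 ^ n + M)).+1%:R : R) <= (2 * (N + M)).+1%:R * 2 ^+ n.
    rewrite -natrX -natrM ler_nat; have := expn_gt0 2 n; move: (2 ^ n)%N => w; rewrite /= => w0; clear -w0; nia.
  rewrite Normc.normcM normcX in h3.
  have e2 : Normc.normc (2 * 2 ^- p : C) = 2 * 2 ^- p.
    by rewrite Normc.normcM normc_nat -real_complex_pow2 normc_real gtr0_norm.
  rewrite e2 exprMn -mulrA -ler_pdivlMl // in h3; rewrite -ler_pdivlMl ?exprn_gt0 // in h3.
  apply: le_trans h3 _.
  have -> : (2 ^- p ^+ n)^-1 * ((2 ^+ n)^-1 * (mnorm d * ((2 * (N * 2 ^ n + M)).+1%:R * (B * theta ^+ n)))) =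
     (mnorm d * B * t ^+ n * (2 ^+ n)^-1) * (2 * (N * 2 ^ n + M)).+1%:R.
    by rewrite /t exprMn exprVn invrK; ring.
  have -> : K * t ^+ n = (mnorm d * B * t ^+ n * (2 ^+ n)^-1) * ((2 * (N + M)).+1%:R * 2 ^+ n).
    by rewrite /K; field; rewrite gt_eqF.
  rewrite ler_wpM2l // !mulr_ge0 ?mnorm_ge0 ?invr_ge0 ?exprn_ge0 //; by case/andP: t01.
apply/Normc.eq0_normc/le_anti; rewrite normc_ge0 andbT; apply/ler_addgt0Pl => e' e0; rewrite addr0.
have e1 : 0 < e' / (K + 1) by rewrite divr_gt0 // ltr_wpDl.
have [n hn] := geom_small t01 e1; apply: le_trans (key n) _.
apply: (@le_trans _ _ (K * (e' / (K + 1)))); first by rewrite ler_wpM2l // hn.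
by rewrite mulrCA -[leRHS]mulr1 ler_wpM2l ?(ltW e0) // ler_pdivrMr ?mul1r; lra.
Qed.

End Decay.
End Pairing.

(** * Polynomial reproduction *)

Section Reproduction.
Variable R : realType.
Local Notation C := R[i].
Variables (r m : nat) (a : int -> 'M[C]_r) (N : nat).
Hypothesis aN : zbnd N a.
Variables (k Mv : nat) (v : int -> 'rV[C]_r).
Hypotheses (vM : zbnd Mv v) (hv : sum_ruled a k v).
Variables (F : 'I_r -> R -> C) (L : R).
Hypotheses (L0 : 0 < L) (F_diff : forall i, cont_diff m (F i)) (F_supp : forall i, csupp L (F i))
  (F_ref : refinable a N F).
Local Notation P := (pairing_value v).

Let rep (f : {poly C}) (x : R) := P f (fun q => jet F 0 (x + q%:~R)).

Let c := \sum_l symbol v 0 0 l * cRintegral (F l).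

Let M := Num.bound (L + 1).

Let F_cont i n : (n <= m)%N -> ccontinuous (cderivn n (F i)).
Proof. exact: (F_diff i).2. Qed.

Let jet_far n x (q : int) : (n <= m)%N -> `|x| <= 1 -> (M < `|q|)%N -> jet F n (x + q%:~R) = 0.
Proof.
move=> nm x1 qM; apply/matrixP => i j; rewrite !mxE; apply: (csupp_cderivn (F_supp i) (F_diff i) nm).
have h : L + 1 < M%:R by apply: archi_boundP; rewrite addr_ge0 // ltW.
have h1 : M%:R < `|q%:~R| :> R by rewrite -intr_norm -abszE -[_%:~R]/(`|q|%N%:R : R) ltr_nat.
by have := lerB_normD (q%:~R) x; rewrite [q%:~R + x]addrC; lra.
Qed.

Let jets_zbnd x : exists M', zbnd M' (fun q : int => jet F 0 (x + q%:~R)).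
Proof. exact: (jet_zbnd L0 F_diff F_supp x (leq0n m)). Qed.

(** For |x| <= 1 the translates entering [rep] lie in a fixed finite range, so the sum can be
    differentiated termwise; the factors 1 keep the shape of [derivs_aff]. *)
Let rep_local (f : {poly C}) n (x : R) := \sum_(i <- zr M) \sum_t mom (f \Po ('X + (i%:~R)%:P)) v 0 t * (1%:C ^+ n * cderivn n (F t) (1 * x + i%:~R)).

Let rep_localE (f : {poly C}) n (x : R) : (n <= m)%N -> `|x| <= 1 -> P f (fun q => jet F n (x + q%:~R)) = rep_local f n x.
Proof.
move=> nm x1; rewrite (pairing_sum vM f (M := M)); last by move=> q; exact: jet_far.
apply: eq_bigr => i _; rewrite mxE; apply: eq_bigr => t _.
by rewrite mxE mul1r expr1n mul1r.
Qed.

Let derivs_local (f : {poly C}) : derivs m (rep_local f).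
Proof.
apply: (@derivs_sum R m int (zr M) (fun i n x => \sum_t mom (f \Po ('X + (i%:~R)%:P)) v 0 t * (1%:C ^+ n * cderivn n (F t) (1 * x + i%:~R)))) => i.
apply: (@derivs_sum R m 'I_r _ (fun t n x => mom (f \Po ('X + (i%:~R)%:P)) v 0 t * (1%:C ^+ n * cderivn n (F t) (1 * x + i%:~R)))) => t.
apply: (@derivsZ R m _ (fun n x => (1%:C ^+ n * cderivn n (F t) (1 * x + i%:~R)))).
exact: (derivs_aff 1 (i%:~R) (cont_diff_derivs (F_diff t))).
Qed.

Let local_cont (f : {poly C}) n : (n <= m)%N -> ccontinuous (rep_local f n).
Proof.
move=> nm; apply: ccontinuous_sum => i; apply: ccontinuous_sum => t; apply: ccontinuousZ; apply: ccontinuousZ.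
by apply: (ccontinuous_aff 1); exact: F_cont.
Qed.

Let repD (f g : {poly C}) (x : R) : rep (f + g) x = rep f x + rep g x.
Proof. by have [M' h] := jets_zbnd x; exact: (pairingD vM _ _ h). Qed.

Let repZ (d : C) (f : {poly C}) (x : R) : rep (d *: f) x = d * rep f x.
Proof. by have [M' h] := jets_zbnd x; exact: (pairingZ vM _ _ h). Qed.

Let rep_shift (f : {poly C}) (x : R) : rep f (x + 1) = rep (f \Po ('X + (-1)%:P)) x.
Proof.
rewrite /rep -[in RHS](rmorphN1 (intr : int -> C)) -(pairing_shift v 1 f (fun q : int => jet F 0 (x + q%:~R))).
by congr (P f _); apply/funext => q; rewrite rmorphD /= addrA addrAC.
Qed.

Let rep_half (f : {poly C}) (x : R) : (size f <= k)%N -> rep f (x / 2) = rep (f \Po (2^-1 *: 'X + (- 0%:~R / 2)%:P)) x.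
Proof.
move=> szf; have [M' h] := jets_zbnd x.
rewrite /rep -[RHS]/((pairmom _ _ _) 0 0) -(pairmom_T aN 0 vM h hv szf) -[RHS]/(P f _).
congr (P f _); apply/funext => q; rewrite /Tm -[RHS]scale1r -(expr0 (2 : C)).
rewrite -(jet_half aN F_diff F_ref x _ (leq0n m)); congr (jet F 0 _).
by rewrite addr0 expr1 rmorphM /=; field.
Qed.

Let s x := \sum_l symbol v 0 0 l * F l x.

Let s_cont : ccontinuous s.
Proof.
apply: ccontinuous_sum => l; apply: ccontinuousZ.
by have := F_cont l (leq0n m); rewrite cderivn0.
Qed.

Let s_supp : csupp L s.
Proof. by move=> x Lx; rewrite /s big1 // => l _; rewrite F_supp ?mulr0. Qed.

Let s_int : cRintegral s = c.
Proof.
have cF l : ccontinuous (F l) by have := F_cont l (leq0n m); rewrite cderivn0.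
rewrite /s (cRintegral_sum _ L0) => [|l|l x Lx]; last by rewrite F_supp ?mulr0.
  by apply: eq_bigr => l _; rewrite (cRintegralZ _ L0).
exact: ccontinuousZ.
Qed.

Let rep1 x : rep 1 x = \zsum_(q) s (x + q%:~R).
Proof.
have [M' h] := jets_zbnd x; rewrite /rep (pairing_sum vM 1 h) (zsumE (M := M')).
  apply: eq_bigr => i _; rewrite -polyC1 comp_polyC polyC1 -(symbol_0 vM) mxE.
  by apply: eq_bigr => l _; rewrite mxE cderivn0.
move=> q /h /colP e; rewrite /s big1 // => l _.
by have := e l; rewrite !mxE cderivn0 => ->; rewrite mulr0.
Qed.

Let s_zbnd n x : exists M', zbnd M' (fun q : int => s (x + 2 ^- n * q%:~R)).
Proof.
exists (Num.bound ((L + `|x|) * 2 ^+ n)) => q lt; apply: s_supp.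
have p0 : 0 < (2 ^+ n : R) by rewrite exprn_gt0.
have h : (L + `|x|) * 2 ^+ n < (Num.bound ((L + `|x|) * 2 ^+ n))%:R.
  by apply: archi_boundP; rewrite mulr_ge0 ?addr_ge0 // ltW.
have h1 : (Num.bound ((L + `|x|) * 2 ^+ n))%:R < `|q%:~R| :> R.
  by rewrite -intr_norm -abszE -[X in _ < X]/(`|q|%N%:R : R) ltr_nat.
have h2 : L + `|x| < `|2 ^- n * q%:~R|.
  rewrite normrM gtr0_norm ?invr_gt0 // mulrC ltr_pdivlMr //; exact: lt_trans h h1.
by have := lerB_normD (2 ^- n * q%:~R) x; rewrite [2 ^- n * q%:~R + x]addrC; lra.
Qed.

(** If all sums of s over translates of Z are equal, splitting by parity shows that those over
    2^(-n) Z are 2^n times as large; the Riemann sums of s are then constant, and their limit is the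
    integral c. *)
Let periodization_const : (forall x, rep 1 x = rep 1 0) -> rep 1 0 = c.
Proof.
move=> const; set kappa := rep 1 0.
have key n : forall x, \zsum_(q) s (x + 2 ^- n * q%:~R) = 2 ^+ n * kappa.
  elim: n => [|n IH] x.
    rewrite expr0 mul1r /kappa -(const x) rep1; apply: eq_zsum => q.
    by rewrite invr1 mul1r.
  have [M' h] := s_zbnd n.+1 x; rewrite (zsum_parity h).
  have e2 (q : R) : 2 ^- n.+1 * (2 * q) = 2 ^- n * q by rewrite exprS; field; rewrite expf_neq0.
  have -> : \zsum_(j) s (x + 2 ^- n.+1 * (2 * j)%:~R) = 2 ^+ n * kappa.
    by rewrite -(IH x); apply: eq_zsum => q; rewrite rmorphM /= e2.
  have -> : \zsum_(j) s (x + 2 ^- n.+1 * (2 * j + 1)%:~R) = 2 ^+ n * kappa.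
    rewrite -(IH (x + 2 ^- n.+1)); apply: eq_zsum => q.
    by rewrite rmorphD rmorphM /= mulrDr e2 mulr1; congr s; ring.
  by rewrite exprS; ring.
apply/eqP; rewrite -subr_eq0; apply/eqP/Normc.eq0_normc/le_anti; rewrite normc_ge0 andbT.
apply/ler_addgt0Pl => e e0; rewrite addr0; have [n0 hn] := riemann L0 s_cont s_supp e0.
have := hn n0 (leqnn _); rewrite s_int.
have [M' h] := s_zbnd n0 0.
have -> // : \zsum_(q) ((2 ^- n0)%:C * s (2 ^- n0 * q%:~R)) = kappa.
transitivity (2 ^- n0 * \zsum_(q) s (0 + 2 ^- n0 * q%:~R)).
  rewrite (zsumE h) (zsumE (M := M')); last by move=> q /h; rewrite add0r => ->; rewrite mulr0.
  by rewrite mulr_sumr; apply: eq_bigr => q _; rewrite real_complex_pow2 add0r.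
by rewrite key mulKf // expf_neq0 // pnatr_eq0.
Qed.

Lemma size_lead_split (p : nat) (f : {poly C}) : (size f <= p.+1)%N ->
  exists2 g : {poly C}, (size g <= p)%N & f = f`_p *: 'X^p + g.
Proof.
move=> szf; exists (\poly_(i < p) f`_i); first exact: size_poly.
apply/polyP => i; rewrite coefD coefZ coefXn coef_poly; case: (ltngtP i p) => ip.
- by rewrite mulr0 add0r.
- by rewrite mulr0 addr0 nth_default //; exact: leq_trans szf ip.
- by rewrite ip mulr1 addr0.
Qed.

(* The deviation from polynomial reproduction is periodic, homogeneous and bounded. *)
Let reproduction p : (p <= k)%N -> forall (f : {poly C}) (x : R), (size f <= p)%N -> rep f x = c * f.[(- x)%:C].
Proof.
elim: p => [|p IH] pk f x.
  rewrite leqn0 size_poly_eq0 => /eqP ->; rewrite /rep horner0 mulr0; exact: pairing0.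
have {}IH := IH (ltnW pk).
pose h x := rep 'X^p x - c * ((- x)%:C) ^+ p.
suff h0 : forall y, h y = 0.
  move=> szf; have [g szg ->] := size_lead_split szf.
  rewrite repD repZ (IH g) // hornerD hornerZ hornerXn.
  by have /eqP := h0 x; rewrite subr_eq0 => /eqP ->; ring.
have per y : h (y + 1) = h y.
  rewrite /h rep_shift; have [g szg e] := polyX_shift p (-1 : C).
  have := congr1 (fun q : {poly C} => q.[(- y)%:C]) e; rewrite /= horner_comp hornerD hornerD !hornerXn hornerX hornerC => e2.
  rewrite e repD (IH g _ szg).
  have -> : (- (y + 1))%:C = (- y)%:C + -1 :> C.
    by rewrite opprD -[LHS]/(real_complex R _) rmorphD rmorphN1.
  by rewrite e2; ring.
have half y : h (y / 2) = 2 ^- p * h y.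
  have h2 : (2^-1 : C) != 0 by rewrite invr_eq0 pnatr_eq0.
  rewrite /h rep_half ?size_polyXn //; have [g szg e] := polyX_affine p (- 0%:~R / 2) h2.
  have := congr1 (fun q : {poly C} => q.[(- y)%:C]) e.
  rewrite /= horner_comp !hornerD !hornerZ !hornerXn hornerX hornerC => e2.
  rewrite e repD repZ (IH g _ szg) exprVn.
  have -> : (- (y / 2))%:C = 2^-1 * (- y)%:C + - 0%:~R / 2 :> C.
    rewrite mulr0z oppr0 mul0r addr0 -[LHS]/(real_complex R _) -mulNr mulrC rmorphM /= fmorphV.
    by rewrite (rmorph_nat (real_complex R)).
  by rewrite e2 exprVn; ring.
have perz (z : int) y : h (y + z%:~R) = h y.
  elim/int_rec: z => [|n IHn|n IHn]; first by rewrite mulr0z addr0.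
    by rewrite -addn1 PoszD rmorphD /= addrA per.
  rewrite -[RHS]IHn -(per (y + (- n.+1%:Z)%:~R)); congr h.
  by rewrite -addn1 PoszD opprD rmorphD rmorphN1 -addrA subrK.
have hc : ccontinuous (fun y => rep_local 'X^p 0 y + - c * ('X^p).[(-1 * y + 0)%:C]).
  apply: ccontinuousD; first exact: local_cont.
  apply: ccontinuousZ; apply: (ccontinuous_aff (-1) 0 (f := fun y => ('X^p).[y%:C])).
  by apply: smooth_continuous; exact: smooth_poly.
have hE y : `|y| <= 1 -> h y = rep_local 'X^p 0 y + - c * ('X^p).[(-1 * y + 0)%:C].
  by move=> y1; rewrite /h /rep rep_localE // hornerXn mulN1r addr0 mulNr.
have iter n y : h y = 2 ^- p ^+ n * h (2 ^+ n * y).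
  elim: n => [|n IHn]; first by rewrite !expr0 !mul1r.
  rewrite IHn exprSr -mulrA; congr (_ * _); rewrite -half; congr h.
  by rewrite exprS; field.
(* For p > 0, homogeneity and boundedness, which follows from periodicity, force h = 0. For p = 0,
   homogeneity only says h(x/2) = h(x): continuity at 0 makes h constant, and the constant is found
   from the integral. *)
move=> y; have [p0|p0] := posnP p; last first.
  have [T T0 hT] := bounded_segment (ler01 : 0 <= 1 :> R) hc.
  have bd z : Normc.normc (h z) <= T.
    rewrite -(subrK (Num.floor z)%:~R z) perz.
    have h1 := floor_le z; have h2 := floorD1_gt z; rewrite rmorphD /= in h2.
    by rewrite hE ?hT ?ger0_norm //; lra.
  apply: (@unif0_eq0 _ _ (fun n _ => T * 2 ^- n)); first exact: unif0Z (@unif0_pow R).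
  move=> n; rewrite (iter n) Normc.normcM mulrC.
  have -> : Normc.normc (2 ^- p ^+ n : C) = 2 ^- p ^+ n.
    by rewrite normcX -real_complex_pow2 normc_real gtr0_norm // invr_gt0 exprn_gt0.
  apply: ler_pM => //; rewrite ?normc_ge0 ?exprn_ge0 ?invr_ge0 ?exprn_ge0 //.
  rewrite exprVn lef_pV2 ?posrE ?exprn_gt0 // lerXn2r ?nnegrE ?exprn_ge0 //.
  by rewrite -{1}(expr1 2) ler_weXn2l // ler1n.
have const z : h z = h 0.
  apply/eqP; rewrite -subr_eq0; apply/eqP/Normc.eq0_normc/le_anti; rewrite normc_ge0 andbT.
  apply/ler_addgt0Pl => e e0; rewrite addr0; have [d d0 hd] := ccont_eps hc 0 e0.
  have dm : 0 < Num.min 1 d / (`|z| + 1) by rewrite divr_gt0 ?lt_min ?ltr01 ?d0 // ltr_wpDl.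
  have [n hn] := pow2_small dm; have {}hn := hn n (leqnn n).
  have p1 : 0 < (2 ^- n : R) by rewrite invr_gt0 exprn_gt0.
  have zn : `|2 ^- n * z| < Num.min 1 d.
    rewrite normrM gtr0_norm //; move: hn; rewrite ltr_pdivlMr ?ltr_wpDl // mulrDr mulr1; lra.
  move: zn; rewrite lt_min => /andP[z1 z2].
  have -> : h z = h (2 ^- n * z).
    by rewrite (iter n (2 ^- n * z)) p0 expr0 invr1 expr1n mul1r mulVKf // expf_neq0.
  rewrite (hE _ (ltW z1)) hE ?normr0 //; apply: ltW; apply: hd; by rewrite subr0.
rewrite const /h p0 !expr0 mulr1; apply/eqP; rewrite subr_eq0; apply/eqP.
apply: periodization_const => z.
by have := const z; rewrite /h p0 !expr0 !mulr1 => /(congr1 (+%R^~ c)); rewrite !subrK.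
Qed.

(** The reproduction identity holds near 0 and is differentiated l times there; the sign comes from
    the argument -x of f. *)
Lemma jet_reproduction l (f : {poly C}) : (l <= m)%N -> (size f <= k)%N ->
  P f (fun q => jet F l (0 + q%:~R)) = c * ((-1) ^+ l * (derivn l f).[0]).
Proof.
move=> lm szf; pose H n x := rep_local f n x + - c * ((-1)%:C ^+ n * (derivn n f).[(-1 * x + 0)%:C]).
have dH : derivs m H.
  apply: derivsD; first exact: derivs_local.
  apply: (@derivsZ R m (- c) (fun n x => ((-1)%:C ^+ n * (derivn n f).[(-1 * x + 0)%:C]))).
  exact: (derivs_aff (-1) 0 (@derivs_poly R m f)).
have cH : ccontinuous (H m).
  apply: ccontinuousD; first exact: local_cont.
  apply: ccontinuousZ; apply: ccontinuousZ.
  apply: (ccontinuous_aff (-1) 0 (f := fun y => (derivn m f).[y%:C])).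
  by apply: smooth_continuous; exact: smooth_poly.
have H0 y : `|y - 0| < 1 -> H 0%N y = 0.
  rewrite subr0 => y1; rewrite /H -rep_localE ?(ltW y1) // -/(rep f y) (reproduction (leqnn k)) //.
  by rewrite expr0 mul1r mulN1r addr0 mulNr subrr.
have := cderivn_locally0 (derivs_cont_diff dH cH) ltr01 H0 lm (y := 0).
rewrite (derivs_cderivn dH lm) subrr normr0 => /(_ ltr01) /eqP.
rewrite /H -rep_localE ?normr0 // addr_eq0 => /eqP ->.
rewrite mulr0 addr0 -mulNr opprK rmorph0; congr (_ * (_ ^+ _ * _)).
by rewrite -[LHS]/(real_complex R _) rmorphN1.
Qed.

End Reproduction.

(** * Convergence of smooth schemes *)

Section FilterMoments.
Variable R : realType.
Local Notation C := R[i].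
Variables (r : nat) (a : int -> 'M[C]_r) (N : nat).
Hypotheses (r0 : (0 < r)%N) (aN : zbnd N a).
Local Notation A := (A a).

Lemma matched_mom k M (w : int -> 'rV[C]_r) (f : {poly C}) : zbnd M w -> matched a k w -> (size f <= k)%N ->
  mom f w = \sum_(i <- zr N) mom (f \Po (2 *: 'X + (i%:~R)%:P)) w *m a i.
Proof.
move=> wM hw szf; have h2 : (2 : C) != 0 by rewrite pnatr_eq0.
apply: (scalerI h2); rewrite -(hw f szf) (mom_subdivision aN f wM) (zsumE (M := N)) //.
by move=> i lt; rewrite aN // mulmx0.
Qed.

Lemma symbol0_sum : symbol a 0 = \sum_(i <- zr N) a i.
Proof.
rewrite (symbol_0 aN) /mom (zsumE (M := N)); last exact: zbndZ.
by apply: eq_bigr => i _; rewrite hornerC scale1r.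
Qed.

Variables (k Mv : nat) (v : int -> 'rV[C]_r).
Hypotheses (vM : zbnd Mv v) (v0 : symbol v 0 <> 0) (hv : sum_ruled a k v).
Variable theta : R.
Hypotheses (th0 : 0 < theta) (thr : theta < 2 ^- (r - 1))
  (dec : forall M (u : int -> 'cV[C]_r), zbnd M u -> vanishing_order v k u -> decays a theta u).
Variables (Mu : nat) (ups : int -> 'rV[C]_r).
Hypotheses (uM : zbnd Mu ups) (hu : matched a r ups).
Variable m0 : 'cV[C]_r.
Hypotheses (am0 : symbol a 0 *m m0 = m0) (um0 : symbol ups 0 *m m0 = 1%:M).

Let c := (symbol v 0 *m m0) 0 0.

Let th_lt p : (p < r)%N -> theta < 2 ^- p.
Proof.
move=> pr; apply: (lt_le_trans thr); rewrite lef_pV2 ?posrE ?exprn_gt0 //.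
by rewrite ler_weXn2l ?ler1n //; move: pr; clear; lia.
Qed.

Let span p (d : 'rV[C]_r) (y : 'cV[C]_r) : (0 < k)%N -> (p < r)%N ->
  d *m symbol a 0 = 2 ^- p *: d -> symbol v 0 *m y = 0 -> (d *m y) 0 0 = 0.
Proof. by move=> k0 pr; exact: (left_eigenvector_span aN vM v0 th0 dec k0 (th_lt pr)). Qed.

(** If c = 0, then m0 lies in the kernel of v^(0), and the left eigenvector ups^(0) for the
    eigenvalue 1 would kill m0, against the normalization. *)
Lemma filter_mass_neq0 : (0 < k)%N -> c != 0.
Proof.
move=> k0; apply/eqP => c0.
have ua : symbol ups 0 *m symbol a 0 = 2 ^- 0 *: symbol ups 0.
  rewrite invr1 scale1r (symbol_0 uM) symbol0_sum mulmx_sumr.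
  rewrite [RHS](@matched_mom r Mu) ?size_poly1 //.
  by apply: eq_bigr => i _; rewrite -polyC1 comp_polyC.
have vm : symbol v 0 *m m0 = 0 by apply/matrixP => i j; rewrite !ord1 [RHS]mxE.
have := span k0 r0 ua vm; rewrite um0 mxE eqxx => /eqP.
by rewrite oner_eq0.
Qed.

(* 1, 1/2, ..., 2^(1-r) are simple left eigenvalues of symbol a 0 as far as the
   decay rate theta can tell, and the moments solve the same eigenvalue recursion. *)
Lemma filter_moments p : (p < k)%N -> (p < r)%N -> mom 'X^p v = c *: mom 'X^p ups.
Proof.
have [ n ] := ubnP p; elim: n p => // n IH p; rewrite ltnS => pn pk pr.
have k0 : (0 < k)%N by apply: leq_ltn_trans pk.
have cn := filter_mass_neq0 k0.
have low (g : {poly C}) : (size g <= p)%N -> mom g v = c *: mom g ups.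
  move=> szg; have zb : zbnd Mu (fun q => c *: ups q) by move=> q lt; rewrite uM // scaler0.
  rewrite -(momZr _ _ uM).
  have b1 : zbnd (maxn Mv Mu) v by apply: zbnd_widen vM; exact: leq_maxl.
  have b2 : zbnd (maxn Mv Mu) (fun q => c *: ups q) by apply: zbnd_widen zb; exact: leq_maxr.
  apply: (mom_monom b1 b2 _ szg) => s sp; rewrite (momZr _ _ uM).
  by apply: IH; [exact: leq_trans sp pn | exact: ltn_trans sp pk | exact: ltn_trans sp pr].
pose d := mom 'X^p v - c *: mom 'X^p ups.
have h2 : (2 : C) != 0 by rewrite pnatr_eq0.
have step (i : int) : mom ('X^p \Po (2 *: 'X + (i%:~R)%:P)) v - c *: mom ('X^p \Po (2 *: 'X + (i%:~R)%:P)) ups =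
    2 ^+ p *: d.
  have [g szg ->] := polyX_affine p (i%:~R : C) h2.
  rewrite (momD _ _ vM) (momD _ _ uM) (momZ _ _ vM) (momZ _ _ uM) (low g szg) /d.
  rewrite scalerDr scalerBr opprD addrACA subrr addr0; congr (_ - _).
  by rewrite !scalerA mulrC.
have da : d *m symbol a 0 = 2 ^- p *: d.
  have p2 : (2 ^+ p : C) != 0 by rewrite expf_neq0.
  apply: (scalerI p2); rewrite scalerA divff // scale1r -scaleMl symbol0_sum mulmx_sumr.
  transitivity (mom 'X^p v - c *: mom 'X^p ups); last by [].
  rewrite (@matched_mom k Mv v) ?size_polyXn //; last exact: (sum_ruled_matched aN vM hv).
  rewrite (@matched_mom r Mu ups) ?size_polyXn // scaler_sumr -sumrB.
  by apply: eq_bigr => i _; rewrite -(step i) mulmxBl scaleMl.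
have dm : (d *m m0) 0 0 = 0.
  have [p0|p0] := posnP p.
    have e0 : 'X^p = 1 :> {poly C} by rewrite p0 expr0.
    have ent (X Y : 'M[C]_1) : (X - c *: Y) 0 0 = X 0 0 - c * Y 0 0 by rewrite !mxE.
    rewrite /d e0 -(symbol_0 vM) -(symbol_0 uM) mulmxBl scaleMl ent um0 -/c.
    by rewrite [X in _ - _ * X]mxE eqxx mulr1 subrr.
  have ent (X : 'M[C]_1) (s : C) : (s *: X) 0 0 = s * X 0 0 by rewrite !mxE.
  have e : (d *m m0) 0 0 = 2 ^- p * (d *m m0) 0 0 by rewrite -ent -scaleMl -da -mulmxA am0.
  have ne : (1 - 2 ^- p : C) != 0.
    rewrite subr_eq0 -real_complex_pow2; apply/eqP => /(congr1 (@complex.Re R)) /= e1.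
    have : (2 ^- p : R) < 1 by rewrite invf_lt1 ?exprn_gt0 // exprn_egt1 // ?ltr1n // -lt0n.
    by rewrite -e1 ltxx.
  by apply: (mulfI ne); rewrite mulr0 mulrBl mul1r -e subrr.
have d0 : d = 0.
  apply/rowP => i; rewrite [RHS]mxE.
  have ent (X Y : 'M[C]_1) (s t : C) : (s *: X - t *: Y) 0 0 = s * X 0 0 - t * Y 0 0 by rewrite !mxE.
  (* The i-th unit column corrected by m0 so as to lie in the kernel of v^(0); as d m0 = 0, pairing
     d with it isolates c times the i-th entry of d. *)
  pose y : 'cV[C]_r := c *: delta_mx i 0 - (symbol v 0 0 i) *: m0.
  have vy : symbol v 0 *m y = 0.
    apply/matrixP => s t; rewrite !ord1 [RHS]mxE /y mulmxBr !scaleMr -colE.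
    by rewrite ent -/c [col _ _ _ _]mxE mulrC subrr.
  have := span k0 pr da vy; rewrite /y mulmxBr !scaleMr -colE.
  rewrite ent dm mulr0 subr0 [col _ _ _ _]mxE => /eqP.
  by rewrite mulf_eq0 (negbTE cn) => /eqP.
by move: d0 => /eqP; rewrite subr_eq0 => /eqP.
Qed.

Hypothesis ups_mom : hermite_moments ups.
Variables (m : nat) (F : 'I_r -> R -> C) (L : R).
Hypotheses (rm : (r - 1 <= m)%N) (L0 : 0 < L) (F_diff : forall i, cont_diff m (F i))
  (F_supp : forall i, csupp L (F i)) (F_ref : refinable a N F)
  (F_int : forall i, cRintegral (F i) = m0 i 0).

Let dev (l : 'I_r) (q : int) : 'cV[C]_r := jet F l (0 + q%:~R) + -1 *: (if q == 0 then delta_mx l 0 else 0).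

Let lm (l : 'I_r) : (l <= m)%N.
Proof. by have := ltn_ord l; move: rm; clear; lia. Qed.

Let dev_zbnd (l : 'I_r) : exists2 M, zbnd M (dev l) & zbnd M (fun q : int => jet F l (0 + q%:~R)).
Proof.
have [M hM] := jet_zbnd L0 F_diff F_supp 0 (lm l); exists M => // q lt.
rewrite /dev hM // add0r (@zbnd_delta _ _ _ 0) ?scaler0 //.
exact: leq_ltn_trans (leq0n _) lt.
Qed.

Let dev_vanishing (l : 'I_r) (p : nat) : (p <= l)%N -> (p < k)%N -> pairing_value v 'X^p (dev l) = 0.
Proof.
move=> pl pk; have [M hM] := jet_zbnd L0 F_diff F_supp 0 (lm l).
have dM : zbnd M (fun q : int => if q == 0 then delta_mx l 0 else 0 : 'cV[C]_r).
  by move=> q lt; rewrite (@zbnd_delta _ _ _ 0) //; exact: leq_ltn_trans (leq0n _) lt.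
rewrite /dev (pairing_scale vM _ _ hM dM).
rewrite (jet_reproduction aN vM hv L0 F_diff F_supp F_ref (lm l)) ?size_polyXn //.
have -> : \sum_l0 symbol v 0 0 l0 * cRintegral (F l0) = c.
  by rewrite /c mxE; apply: eq_bigr => i _; rewrite F_int.
rewrite (pairing_delta vM) mulr0z addr0 comp_polyXr -colE [col _ _ _ _]mxE.
have pr : (p < r)%N by apply: leq_ltn_trans pl (ltn_ord l).
have ent (X : 'rV[C]_r) (s : C) : (s *: X) 0 l = s * X 0 l by rewrite !mxE.
rewrite filter_moments // ent; have [h1 h2] := ups_mom l.
move: pl; rewrite leq_eqVlt => /orP[/eqP e|pl].
  by rewrite e h2 derivnXn subnn ffactnn expr0 hornerMn hornerC; ring.
by rewrite h1 // derivnXn ffact_small // mulr0n horner0 !mulr0 addr0.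
Qed.

(** If k <= l, all k orders vanish and the rate is theta. Otherwise the l + 1 vanishing orders allow
    any rate at least theta and above 2^(-(l+1)); 3/4 2^(-l) is such a threshold still below
    2^(-l). *)
Let dev_decays (l : 'I_r) : exists2 t : R, 0 <= t < 2 ^- l & decays a t (dev l).
Proof.
have [M hM _] := dev_zbnd l; have lr := ltn_ord l.
have p0 : 0 < (2 ^- l : R) by rewrite invr_gt0 exprn_gt0.
have [kl|lk] := leqP k l.
  exists theta; first by rewrite (ltW th0) th_lt.
  apply: (dec hM); apply: (vanishing_orderP vM hM) => p pk.
  by apply: dev_vanishing => //; exact: ltnW (leq_trans pk kl).
exists (Num.max theta (3 / 4 * 2 ^- l)).
  rewrite gt_max th_lt // le_max (ltW th0) /=; lra.
apply: (vanishing_decays aN vM hv th0 dec lk _ _ hM).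
- by rewrite le_max lexx.
- by rewrite lt_max; apply/orP; right; rewrite exprS invfM; lra.
apply: (vanishing_orderP vM hM) => p; rewrite ltnS => pl; apply: dev_vanishing => //.
exact: leq_ltn_trans pl lk.
Qed.

(** By [jet_iter] the cascade of the integer jets is exactly 2^(-l n) times the samples of F^(l),
    while that of the delta is a column of [A n]. The error is thus 2^(l n) times the cascade of
    [dev l], which is O((2^l t)^n). *)
Lemma fundamental_convergence (i l : 'I_r) : unif0 (fun n (p : int) =>
  Normc.normc (A n p i l * 2 ^+ (l * n) - cderivn l (F i) (2 ^- n * p%:~R))).
Proof.
have [t /andP[t0 t1] [B B0 hB]] := dev_decays l.
have p0 : 0 < (2 ^+ l : R) by rewrite exprn_gt0.
have t01 : 0 <= 2 ^+ l * t < 1.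
  by rewrite mulr_ge0 ?(ltW p0) //= -ltr_pdivlMl // mulr1.
apply: (@unif0_le _ _ _ (fun n (_ : int) => B * (2 ^+ l * t) ^+ n)); last first.
  apply: unif0Z => // e e0; have [n0 hn] := geom_small t01 e0.
  by exists n0 => n nn _; exact: hn.
move=> n p; have [M hM jM] := dev_zbnd l.
have dM : zbnd M (fun q : int => if q == 0 then delta_mx l 0 else 0 : 'cV[C]_r).
  by move=> q lt; rewrite (@zbnd_delta _ _ _ 0) //; exact: leq_ltn_trans (leq0n _) lt.
have e1 : convolution (A n) (dev l) p =
    convolution (A n) (fun q : int => jet F l (0 + q%:~R)) p - A n p *m delta_mx l 0.
  by rewrite (convolution_scale _ _ _ jM dM) convolution_delta subr0 scaleN1r.
have := jet_iter aN L0 F_diff F_supp F_ref n 0 p (lm l); rewrite add0r => /colP/(_ i).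
have ent (X : 'cV[C]_r) (s : C) : (s *: X) i 0 = s * X i 0 by rewrite !mxE.
have ent2 (X Y : 'cV[C]_r) : (X - Y) i 0 = X i 0 - Y i 0 by rewrite !mxE.
rewrite [LHS]mxE ent => ->.
have -> : A n p i l = (A n p *m (delta_mx l 0 : 'cV[C]_r)) i 0 by rewrite -colE [RHS]mxE.
have -> : forall x y : C, x * 2 ^+ (l * n) - 2 ^+ (l * n) * y = - (2 ^+ (l * n) * (y - x)) by move=> x y; ring.
rewrite normcN Normc.normcM -ent2 -e1.
have -> : Normc.normc (2 ^+ (l * n) : C) = 2 ^+ l ^+ n by rewrite normcX normc_nat exprM.
rewrite exprMn mulrCA ler_wpM2l ?exprn_ge0 ?(ltW p0) //.
by apply: le_trans (normc_le_mnorm _ _ _) (hB n p).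
Qed.

End FilterMoments.

(** * From delta data to arbitrary data *)

Section HermiteConvergence.
Variable R : realType.
Local Notation C := R[i].
Variables (r m : nat) (a : int -> 'M[C]_r) (N : nat).
Hypotheses (r0 : (0 < r)%N) (rm : (r - 1 <= m)%N) (aN : zbnd N a).
Variables (F : 'I_r -> R -> C) (L : R).
Hypotheses (L0 : 0 < L) (F_diff : forall i, cont_diff m (F i)) (F_supp : forall i, csupp L (F i)).
Hypothesis F_lim : forall i l : 'I_r, unif0 (fun n (p : int) =>
  Normc.normc (A a n p i l * 2 ^+ (l * n) - cderivn l (F i) (2 ^- n * p%:~R))).

Lemma ereal_sup_cvg0 (T : Type) (D : nat -> set T) (x : nat -> T -> R) :
  (forall n, D n !=set0) -> (forall n t, 0 <= x n t) ->
  (forall e : R, 0 < e -> exists n0, forall n, (n0 <= n)%N -> forall t, D n t -> x n t <= e) ->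
  (fun n => ereal_sup [set (x n t)%:E | t in D n]) @ \oo --> 0%E.
Proof.
move=> D0 x0 h.
have ge0 n : (0 <= ereal_sup [set (x n t)%:E | t in D n])%E.
  have [t Dt] := D0 n; apply: (@le_trans _ _ (x n t)%:E); first by rewrite lee_fin.
  by apply: ereal_sup_ubound; exists t.
have le e n : (forall t, D n t -> x n t <= e) -> (ereal_sup [set (x n t)%:E | t in D n] <= e%:E)%E.
  by move=> he; apply: ub_ereal_sup => _ [t Dt <-]; rewrite lee_fin; exact: he.
have fin e n : (forall t, D n t -> x n t <= e) -> ereal_sup [set (x n t)%:E | t in D n] \is a fin_num.
  by move=> /le he; rewrite ge0_fin_numE //; exact: le_lt_trans he (ltry _).
apply/fine_cvgP; split.
  have [n0 hn] := h 1 ltr01; exists n0 => // n /= nn; exact: fin (hn n nn).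
apply/cvgrPdist_le => e e0; have [n0 hn] := h e e0; exists n0 => // n /= nn.
rewrite sub0r normrN ger0_norm ?fine_ge0 //.
by rewrite -lee_fin fineK ?le ?(fin e) //; exact: hn.
Qed.

Variable w0 : int -> 'rV[C]_r.

(** The limit for the data w0 and its derivatives. The sum has infinitely many nonzero coefficients
    in general, but on |x| <= K it is the finite sum [local n K], from which regularity is
    inherited. *)
Let D n x := \zsum_(q) \sum_i w0 q 0 i * (1%:C ^+ n * cderivn n (F i) (1 * x + - q%:~R)).

Let bnd (K : R) := Num.bound (K + L).

Let far n (x K : R) i (q : int) : (n <= m)%N -> `|x| <= K -> (bnd K < `|q|)%N -> cderivn n (F i) (1 * x + - q%:~R) = 0.
Proof.
move=> nm xK lt; apply: (csupp_cderivn (F_supp i) (F_diff i) nm); rewrite mul1r.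
have K0 : 0 <= K by exact: le_trans xK.
have h1 : K + L < (bnd K)%:R by apply: archi_boundP; rewrite addr_ge0 // ltW.
have h2 : (bnd K)%:R < `|q%:~R| :> R.
  by rewrite -intr_norm -abszE -[X in _ < X]/(`|q|%N%:R : R) ltr_nat.
by have := lerB_dist (q%:~R : R) x; rewrite distrC; lra.
Qed.

Let local n K x := \sum_(q <- zr (bnd K)) \sum_i w0 q 0 i * (1%:C ^+ n * cderivn n (F i) (1 * x + - q%:~R)).

Let D_local n (x K : R) : (n <= m)%N -> `|x| <= K -> D n x = local n K x.
Proof.
move=> nm xK; rewrite /D (zsumE (M := bnd K)) // => q lt.
by rewrite big1 // => i _; rewrite (far i nm xK lt) !mulr0.
Qed.

Let local_derivs K : derivs m (fun n => local n K).
Proof.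
apply: (@derivs_sum R m int (zr (bnd K)) (fun q n x => \sum_i w0 q 0 i * (1%:C ^+ n * cderivn n (F i) (1 * x + - q%:~R)))) => q.
apply: (@derivs_sum R m 'I_r _ (fun i n x => w0 q 0 i * (1%:C ^+ n * cderivn n (F i) (1 * x + - q%:~R)))) => i.
apply: (@derivsZ R m (w0 q 0 i) (fun n x => (1%:C ^+ n * cderivn n (F i) (1 * x + - q%:~R)))).
exact: (derivs_aff 1 (- q%:~R) (cont_diff_derivs (F_diff i))).
Qed.

Let local_cont n K : (n <= m)%N -> ccontinuous (local n K).
Proof.
move=> nm; apply: ccontinuous_sum => q; apply: ccontinuous_sum => i; apply: ccontinuousZ; apply: ccontinuousZ.
by apply: (ccontinuous_aff 1); exact: (F_diff i).2.
Qed.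

Let near_le (x y : R) : `|y - x| < 1 -> `|y| <= `|x| + 1.
Proof. by move=> h; have := ler_normD (y - x) x; rewrite subrK; lra. Qed.

Let D_derivs : derivs m D.
Proof.
move=> n nm x; apply/is_cderive_eps => e e0; pose K := `|x| + 1.
have [t t0 ht] := (is_cderive_eps _ _ _).1 (local_derivs K nm x) e e0.
exists (Num.min t 1); first by rewrite lt_min t0 ltr01.
move=> y; rewrite lt_min => /andP[/ht h1 /near_le h2].
by rewrite !(@D_local _ _ K) ?lerDl // ltnW.
Qed.

Let D_cont : ccontinuous (D m).
Proof.
apply: eps_ccont => x e e0; pose K := `|x| + 1.
have [t t0 ht] := ccont_eps (@local_cont m K (leqnn m)) x e0.
exists (Num.min t 1); first by rewrite lt_min t0 ltr01.
move=> y; rewrite lt_min => /andP[/ht h1 /near_le h2].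
by rewrite !(@D_local _ _ K) ?lerDl.
Qed.

Let limit_error (K : R) (l : 'I_r) : 0 < K -> forall e : R, 0 < e -> exists n0, forall n, (n0 <= n)%N ->
  forall p : int, `|p%:~R| <= 2 ^+ n * K ->
  Normc.normc (iter n (subdivision a) w0 p 0 l * 2 ^+ (l * n) - cderivn l (D 0) (2 ^- n * p%:~R)) <= e.
Proof.
move=> K0; have lm : (l <= m)%N by have := ltn_ord l; move: rm; clear; lia.
(* For |q| > M and positions in 2^n [-K, K], both the translate of F and the translate of [A n]
   vanish. *)
pose M := maxn (bnd K) (Num.bound (K + N%:R)).
pose err n (p : int) := \sum_(q <- zr M) \sum_i Normc.normc (w0 q 0 i) *
  Normc.normc (A a n (p - 2 ^+ n * q) i l * 2 ^+ (l * n) - cderivn l (F i) (2 ^- n * (p - 2 ^+ n * q)%:~R)).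
have lim : unif0 err.
  apply: (@unif0_sum R int int (zr M) (fun q n p => \sum_i Normc.normc (w0 q 0 i) *
    Normc.normc (A a n (p - 2 ^+ n * q) i l * 2 ^+ (l * n) - cderivn l (F i) (2 ^- n * (p - 2 ^+ n * q)%:~R)))) => q.
  apply: (@unif0_sum R int 'I_r _ (fun i n p => Normc.normc (w0 q 0 i) *
    Normc.normc (A a n (p - 2 ^+ n * q) i l * 2 ^+ (l * n) - cderivn l (F i) (2 ^- n * (p - 2 ^+ n * q)%:~R)))) => i.
  apply: unif0Z; first exact: normc_ge0.
  exact: (unif0_comp (fun n (p : int) => p - 2 ^+ n * q) (F_lim i l)).
move=> e e0; have [n0 hn] := lim e e0; exists n0 => n nn p pK; apply: le_trans (hn n nn p).
have p0 : 0 < (2 ^+ n : R) by rewrite exprn_gt0.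
have xK : `|2 ^- n * p%:~R| <= K by rewrite normrM gtr0_norm ?invr_gt0 // ler_pdivrMl.
rewrite (derivs_cderivn D_derivs lm).
have -> : D l (2 ^- n * p%:~R) = \sum_(q <- zr M) \sum_i w0 q 0 i * cderivn l (F i) (2 ^- n * (p - 2 ^+ n * q)%:~R).
  rewrite /D (zsumE (M := M)) => [|q lt].
    apply: eq_bigr => q _; apply: eq_bigr => i _; rewrite expr1n mul1r; congr (_ * cderivn l (F i) _).
    by rewrite mul1r rmorphB rmorphM rmorphXn /= mulrBr mulKf // gt_eqF.
  rewrite big1 // => i _; rewrite (far i lm xK) ?mulr0 //; apply: leq_ltn_trans lt; exact: leq_maxl.
have -> : iter n (subdivision a) w0 p 0 l = \sum_(q <- zr M) \sum_i w0 q 0 i * A a n (p - 2 ^+ n * q) i l.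
  rewrite (iter_subdivision aN) (zsumE (M := M)) => [|q lt].
    by rewrite summxE; apply: eq_bigr => q _; rewrite mxE.
  rewrite (A_zbnd' aN) ?mulmx0 // -(ltr_nat R) natrM natrX.
  have lt2 : (Num.bound (K + N%:R) < `|q|)%N by apply: leq_ltn_trans lt; exact: leq_maxr.
  have h1 : K + N%:R < (Num.bound (K + N%:R))%:R by apply: archi_boundP; rewrite addr_ge0 // ltW.
  have h2 : (Num.bound (K + N%:R))%:R < `|q%:~R| :> R.
    by rewrite -intr_norm -abszE -[X in _ < X]/(`|q|%N%:R : R) ltr_nat.
  have -> : (`|(p - 2 ^+ n * q)%R|%N)%:R = `|p%:~R - 2 ^+ n * q%:~R| :> R.
    by rewrite -[LHS]/((`|(p - 2 ^+ n * q)%R|%N : int)%:~R) abszE intr_norm rmorphB rmorphM rmorphXn.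
  have h3 := lerB_dist (2 ^+ n * q%:~R : R) (p%:~R); rewrite distrC in h3; apply: lt_le_trans h3.
  rewrite normrM (gtr0_norm p0) mulrC.
  have h4 : 2 ^+ n * (K + N%:R) < 2 ^+ n * `|q%:~R| by rewrite ltr_pM2l //; exact: lt_trans h2.
  by move: h4 pK; rewrite mulrDr; lra.
rewrite mulr_suml -sumrB; apply: le_trans (normc_sum _ _ _) _; apply: ler_sum => q _.
rewrite mulr_suml -sumrB; apply: le_trans (normc_sum _ _ _) _; apply: ler_sum => i _.
by rewrite -mulrA -mulrBr Normc.normcM.
Qed.

Lemma fundamental_hermite_convergence : exists eta : R -> C, cont_diff m eta /\
  forall K : R, 0 < K -> forall l : 'I_r,
    (fun n : nat => ereal_sup [set (Normc.normc (iter n (subdivision a) w0 k 0 l * 2 ^+ (l * n)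
                                - cderivn l eta (2 ^- n * k%:~R)))%:E
                   | k in [set k : int | `|k%:~R| <= 2 ^+ n * K]]) @ \oo --> 0%E.
Proof.
exists (D 0); split; first exact: derivs_cont_diff D_derivs D_cont.
move=> K K0 l; apply: ereal_sup_cvg0.
- by move=> n; exists 0; rewrite /= normr0 mulr_ge0 // ?exprn_ge0 // ltW.
- by move=> n t; exact: normc_ge0.
exact: limit_error.
Qed.

End HermiteConvergence.

Theorem theorem9 (R : realType) (r m : nat) (r_gt0 : (0 < r)%N)
    (r_le_m : (r - 1 <= m)%N)
    (a : int -> 'M[R[i]]_r) (a_fin : finitely_supported a)
    (eig1 : simple_eigenvalue (symbol a 0) 1)
    (eig2 : forall k : nat, (0 < k)%N -> ~~ eigenvalue (symbol a 0) (2 ^+ k))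
    (ups : int -> 'rV[R[i]]_r) (ups_mf : matching_filter r a ups)
    (ups_first : exists l : 'I_r, symbol ups 0 0 l = 1 /\
       forall j : 'I_r, (j < l)%N -> symbol ups 0 0 j = 0)
    (phi : 'I_r -> cs_distribution R)
    (phi_ref : forall xi : R,
       fourier phi (2 * xi) = symbol a xi *m fourier phi xi)
    (phi_norm : symbol ups 0 *m fourier phi 0 = 1%:M) :
  (hermite_convergent m a ->
     [/\ (0 < sm_mask a)%E,
         sm_gt phi m &
         forall l : 'I_r, ceqO l.+1 (fun xi => symbol ups xi 0 l)
                                    (fun xi => (0 +i* xi) ^+ l)])
  /\
  (((r - 1)%:R%:E < sm_mask a)%E ->
   sm_gt phi m ->
   (forall l : 'I_r, ceqO l.+1 (fun xi => symbol ups xi 0 l)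
                               (fun xi => (0 +i* xi) ^+ l)) ->
   hermite_convergent m a).
Proof.
have [N aN] := fsuppP a_fin; have [ups_fin _ ups_match] := ups_mf.
have [Mu uM] := fsuppP ups_fin; have hu := (matchedP aN r uM).1 ups_match.
have am0 : symbol a 0 *m fourier phi 0 = fourier phi 0 by rewrite -phi_ref mulr0.
split=> [conv|smooth_mask smooth_phi ups_hermite].
  have hm := hermite_convergent_moments r_gt0 r_le_m aN uM hu conv ups_first.
  pose o := Ordinal r_gt0.
  have m01 : fourier phi 0 o 0 = 1.
    (* The moments of order 0 in [hermite_moments]; the normalization of phi then says that the
       first entry of its transform at 0 is 1. *)
    have u0 : symbol ups 0 = delta_mx 0 o.
      apply/rowP => l; rewrite (symbol_0 uM) -(expr0 'X) [RHS]mxE eqxx /=.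
      have [h1 h2] := hm l; have [e|ne] := eqVneq l o; first by rewrite e in h1 h2 *; rewrite h2 expr0 mul1r.
      by rewrite h1 // lt0n; apply: contra ne => /eqP e; apply/eqP/val_inj.
    by have := congr1 (fun M : 'M[R[i]]_(1, 1) => M 0 0) phi_norm; rewrite /= u0 -rowE [LHS]mxE [RHS]mxE eqxx.
  have [eta [eta_diff eta_supp eta_lim]] := limit_functions r_gt0 r_le_m aN conv.
  have eta_ref := eta_refinable r_gt0 aN eta_diff eta_lim.
  have N0 : 0 <= (N + 1)%N%:R :> R by [].
  have eta_cont i : ccontinuous (eta i) by have := (eta_diff i).2 0%N (leq0n m); rewrite cderivn0.
  split; last exact/(hermite_filterP r_gt0 r_le_m uM).
    exact: (hermite_mask_smoothness r_le_m aN eta_diff eta_supp eta_lim am0 m01).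
  exists eta; split=> [l|].
    have [B _ hB] := csupp_bounded N0 (@eta_supp l) (eta_cont l).
    split; first exact: continuous_Linfty (eta_cont l) hB.
    move=> g gs _; exact: (phi_eta r_le_m aN eig2 phi_ref m01 eta_diff eta_supp eta_lim l gs).
  elim/big_ind: _ => [|x y hx hy|l _]; first exact: ltry.
    by rewrite lt_min hx hy.
  have [tau [B [tau01 B0 hB]]] := refinable_holder aN eta_diff eta_supp eta_ref l.
  exact: (sm_fun_gt N0 (eta_diff l) (@eta_supp l) tau01 B0 hB).
have hm := (hermite_filterP r_gt0 r_le_m uM).1 ups_hermite.
have [[v_fin _ _] _] := sr_filter_spec r_gt0 aN.
have [Mv vM] := fsuppP v_fin.
have [v0 hv] := (sum_rulesP aN (sr a) vM).1 (sr_filter_spec r_gt0 aN).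
have p0 : 0 < (2 ^- (r - 1) : R) by rewrite invr_gt0 exprn_gt0.
have [theta /andP[th0 thr] hdec] := rho_decays r_gt0 aN p0 (sm_mask_rho smooth_mask).
have [F [L [L0 F_diff F_supp F_ref F_int]]] := sm_gt_limit aN phi_ref smooth_phi.
have F_lim := fundamental_convergence r_gt0 aN vM v0 hv th0 thr
  (fun M u bu hu => hdec u (vanishing_spaceP vM bu hu)) uM hu am0 phi_norm hm r_le_m L0 F_diff F_supp F_ref F_int.
move=> w0; exact: (fundamental_hermite_convergence r_le_m aN L0 F_diff F_supp F_lim w0).
Qed.
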